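(* Let $m\ge 2$ be an integer, let $1\le p\le\infty$, and define $q$ by $\frac1q:=\frac m2+\frac1p$ (with $\frac1\infty=0$). Let $\Omega\subset\mathbb{R}^2$ be a compact polygonal domain and let $f\in C^m(\Omega)$. Then there exists a sequence $(\mathcal{T}_N)_{N\ge N_0}$ of conforming triangulations of $\Omega$, with $\#(\mathcal{T}_N)=N$, such that $$\limsup_{N\to\infty} N^{\frac m2}\, e_{m,\mathcal{T}_N}(f)_p\le \left\|K_{m,p}\left(\frac{d^mf}{m!}\right)\right\|_{L^q(\Omega)}.$$
   Context: $\mathbb{H}_m$ denotes the space of real homogeneous polynomials of degree $m$ in $(x,y)$ (including $0$) and $\mathbb{P}_{m-1}$ the space of real polynomials in $(x,y)$ of total degree at most $m-1$. For a triangle $T$ (closed, nondegenerate, of area $|T|$), $I_{m,T}:C^0(T)\to\mathbb{P}_{m-1}$ is the Lagrange interpolation operator: $I_{m,T}v(\gamma)=v(\gamma)$ for all points $\gamma\in T$ whose barycentric coordinates all belong to $\{0,\frac1{m-1},\frac2{m-1},\dots,1\}$. Local error: $e_{m,T}(v)_p:=\|v-I_{m,T}v\|_{L^p(T)}$. A conforming triangulation $\mathcal{T}$ of $\Omega$ is a finite set of triangles with union $\Omega$ and pairwise disjoint interiors, such that two distinct triangles intersect in the empty set, a common vertex or a common full edge. $\#(\mathcal{T})$ is its number of triangles. Global error: $e_{m,\mathcal{T}}(v)_p:=\left(\sum_{T\in\mathcal{T}}e_{m,T}(v)_p^p\right)^{1/p}$ if $p<\infty$, and $\max_{T\in\mathcal{T}}e_{m,T}(v)_\infty$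 if $p=\infty$. Shape function: for $\pi\in\mathbb{H}_m$, $K_{m,p}(\pi):=\inf_{|T|=1}e_{m,T}(\pi)_p$, the infimum being over all triangles $T\subset\mathbb{R}^2$ of area $1$. At each $z\in\Omega$, $\frac{d^mf(z)}{m!}$ is identified with the polynomial $\sum_{k+l=m}\frac{\partial^mf}{\partial x^k\partial y^l}(z)\frac{x^k}{k!}\frac{y^l}{l!}\in\mathbb{H}_m$. $f\in C^m(\Omega)$ means that $f$ and its derivatives up to order $m$ are continuous up to the boundary of $\Omega$. For $0<q<\infty$, $\|g\|_{L^q(\Omega)}:=\left(\int_\Omega|g|^q\right)^{1/q}$ (possibly $q<1$). *)

(* Defs.v *)
From HB Require Import structures.
From mathcomp Require Import all_boot all_order all_algebra finmap.
From mathcomp Require Import all_classical all_reals all_analysis.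
Set Implicit Arguments.
Unset Strict Implicit.
Unset Printing Implicit Defensive.
Import Order.TTheory GRing.Theory Num.Theory numFieldNormedType.Exports.
Local Open Scope classical_set_scope.
Local Open Scope ring_scope.

Section plane.
Context {R : realType}.

Definition leb2 :
    {measure set (measurableTypeR R * measurableTypeR R) -> \bar R} :=
  (@lebesgue_measure R \x @lebesgue_measure R)%E.

(* ||g||_{L^p(D)}; any p in \bar R, including finite 0 < p < 1. *)
Definition normLp (p : \bar R) (D : set (R * R)) (g : R * R -> \bar R) :
  \bar R := Lnorm leb2 p (g \_ D).

Definition segment (a b : R * R) : set (R * R) :=
  [set (1 - t) *: a + t *: b | t in `[0, 1]%classic].

(* Connectedness of the interior is not required. *)
Definition polygonal_domain (Omega : set (R * R)) : Prop :=
  [/\ compact Omega, Omega !=set0, closure (Omega°) = Omega &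
      exists s : seq ((R * R) * (R * R)),
        Omega `\` Omega° = \bigcup_(ab in [set` s]) segment ab.1 ab.2].

End plane.

Definition nondegenerate (R : realType) (v : 3.-tuple (R * R)) : bool :=
  let a := tnth v (inord 0) in
  let b := tnth v (inord 1) in
  let c := tnth v (inord 2) in
  (b.1 - a.1) * (c.2 - a.2) - (c.1 - a.1) * (b.2 - a.2) != 0.

(* A triangle is carried by its list of vertices: the six orderings of the
   same three points are different inhabitants with the same [tri]. *)
Record triangle (R : realType) := Triangle {
  vertices : 3.-tuple (R * R);
  _ : nondegenerate vertices }.

HB.instance Definition _ (R : realType) := [isSub for @vertices R].
HB.instance Definition _ (R : realType) := [Choice of triangle R by <:].

Section interpolation.
Context {R : realType}.
Implicit Types (T : triangle R) (m : nat) (p : \bar R) (v : R * R -> R).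

Definition vtx T (i : 'I_3) : R * R := tnth (vertices T) i.

Definition bary T (l : 'I_3 -> R) : R * R := \sum_i l i *: vtx T i.

Definition tri T : set (R * R) :=
  [set bary T l | l in [set l | (forall i, 0 <= l i) /\ \sum_i l i = 1]].

Definition nodes m T : set (R * R) :=
  [set bary T l | l in [set l | \sum_i l i = 1 /\
     forall i, exists2 j : nat, (j <= m.-1)%N & l i = j%:R / m.-1%:R]].

(* Polynomial functions in (x, y) of total degree at most d. *)
Definition polys (d : nat) : set (R * R -> R) :=
  [set P | exists c : nat -> nat -> R, forall z,
     P z = \sum_(k < d.+1) \sum_(l < d.+1 | (k + l <= d)%N)
             c k l * z.1 ^+ k * z.2 ^+ l].

(* [I_{m,T} v]; the default value [cst 0] is never used when [2 <= m], the
   interpolating polynomial then existing and being unique. *)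
Definition interp m T v : R * R -> R :=
  xget (cst 0) [set P | polys m.-1 P /\ forall z, nodes m T z -> P z = v z].

Definition err_loc m p T v : \bar R :=
  normLp p (tri T) (fun z => (v z - interp m T v z)%:E).

Definition err_glob m p (TT : {fset triangle R}) v : \bar R :=
  (match p with
   | r%:E => (\sum_(T <- TT) err_loc m p T v `^ r) `^ (r^-1)
   | _ => \big[maxe/0]_(T <- TT) err_loc m p T v
   end)%E.

(* Meant for [v] a homogeneous polynomial function of degree [m]. *)
Definition shape_fun m p v : \bar R :=
  ereal_inf [set err_loc m p T v | T in [set T | leb2 (tri T) = 1%E]].

Definition is_vertex T (z : R * R) : Prop := exists i, z = vtx T i.

Definition is_edge T (E : set (R * R)) : Prop :=
  exists i j, i != j /\ E = segment (vtx T i) (vtx T j).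

(* Disjointness of the interiors excludes two orderings of the same triangle,
   so that the cardinal of [TT] is the number of triangles. *)
Definition conforming (Omega : set (R * R)) (TT : {fset triangle R}) : Prop :=
  \bigcup_(T in [set` TT]) tri T = Omega /\
  forall T T', T \in TT -> T' \in TT -> T != T' ->
    (tri T)° `&` (tri T')° = set0 /\
    [\/ tri T `&` tri T' = set0,
        exists z, [/\ is_vertex T z, is_vertex T' z &
                      tri T `&` tri T' = [set z]] |
        is_edge T (tri T `&` tri T') /\ is_edge T' (tri T `&` tri T')].

End interpolation.

Section derivatives.
Context {R : realType}.
Implicit Types (Omega : set (R * R)) (f h : R * R -> R).

(* [false] stands for the variable x and [true] for y; the head of [w] is the
   last derivative taken. *)
Definition axis (b : bool) : R * R := if b then (0, 1) else (1, 0).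

Definition partials (w : seq bool) f : R * R -> R :=
  foldr (fun b h => fun z => 'D_(axis b) h z) f w.

(* [f] is a total function, but only its values on [Omega] matter: the partial
   derivatives are taken in the interior and extended to the boundary. *)
Definition Cm (m : nat) Omega f : Prop :=
  {within Omega, continuous f} /\
  forall w : seq bool, (size w <= m)%N ->
    ((size w < m)%N -> forall b z, Omega° z ->
       derivable (partials w f) z (axis b)) /\
    exists g : R * R -> R, {within Omega, continuous g} /\
      forall z, Omega° z -> g z = partials w f z.

(* Value at [z] of the continuous extension to [Omega] of [h] restricted to
   the interior. *)
Definition extend Omega h (z : R * R) : R :=
  lim (h x @[x --> within Omega° (nbhs z)]).

(* d^m f(z) / m! as a function of (x, y). *)
Definition dmf (m : nat) Omega f (z : R * R) : R * R -> R := fun xy =>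
  \sum_(k < m.+1)
    extend Omega (partials (nseq k false ++ nseq (m - k) true) f) z *
      (xy.1 ^+ k / k`!%:R) * (xy.2 ^+ (m - k) / (m - k)`!%:R).

End derivatives.

(* Main.v *)
(* Write [alpha = m + 2/p = 2/q].  Scaling a triangle by [l] scales the error of a
   homogeneous polynomial of degree [m] by [l^alpha], since interpolation
   commutes with affine maps and polynomials of degree below [m] are reproduced.
   Hence if [P] is a (nonconforming) partition of [Omega] into triangles [Q] on
   which [d^m f / m!] is nearly constant, cutting each [Q] into about [n_Q^2]
   copies of itself, with [n_Q] proportional to [e_Q^(q/2)], yields
   [N = tau^2 sum e_Q^q] triangles and an error [N^(-m/2) (sum e_Q^q)^(1/q)].

   Partition with [sum e_Q^q] close to the integral of [K^q]: on a small macro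
   triangle freeze the Taylor coefficients, choose a triangle [T] of area 1 and
   bounded diameter nearly optimal for them, and fill the macro triangle with
   copies of [T] at a small scale; the pieces along its boundary have negligible
   total weight.  The bound on the diameter is removed by dominated convergence.

   Conformity: in each [Q] the uniform tiles fill a slightly smaller homothetic
   copy of [Q], and the strip along each side is triangulated so as to join the
   tiles to a prescribed finite set of points of that side, which contains a fine
   regular subdivision and every vertex lying there on account of the
   neighbours.  The strips contain about [sum n_Q] triangles, negligible against
   [sum n_Q^2].  For [p = oo] their flat triangles must have small error: they
   are nearly parallel to a side of [Q], and degenerate interpolation along a
   segment of length [1/n] of that side is no worse than on a tile.  Adding
   points on a free part of the boundary adjusts the cardinality to be exactly
   [N]. *)
Require Import Defs.
From HB Require Import structures.
From mathcomp Require Import all_boot all_order all_algebra finmap.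
From mathcomp Require Import all_classical all_reals all_analysis.
From mathcomp Require Import ring lra zify.
From mathcomp Require Import measurable_realfun ess_sup_inf.
Set Implicit Arguments.
Unset Strict Implicit.
Unset Printing Implicit Defensive.
Import Order.TTheory GRing.Theory Num.Theory numFieldNormedType.Exports.
Local Open Scope classical_set_scope.
Local Open Scope ring_scope.

(** * Polynomials and Lagrange interpolation *)

Section polynomials.
Context {R : realType}.
Implicit Types (d : nat) (P Q : R * R -> R).

(** The costs of order [tau = sqrt(N / S')] are then absorbed by the gap between [S'] and the sum of
    the weights, however bad the constants are. A slack [sg] added to every [e_Q] does two jobs: it
    makes the weights positive, so that their powers can be inverted, and it pays for the strips.
    Its own cost is controlled because [m >= 2] forces [q <= 1], so that [q]-th powers are
    subadditive.

    Disjoint interiors are encoded by separating lines, a condition on vertices that survives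
    subdivision and affine maps without topology. It also confines the intersection of two triangles
    to a line, and conformity then reduces to a statement on vertices: one that lies in another
    triangle must be a vertex of it.

    Since [f] has derivatives only in the interior of [Omega], Taylor expansions are made in open
    triangles and carried to the closed ones by continuity. *)

Lemma polys_ext d P Q : P =1 Q -> polys d P -> polys d Q.
Proof. by move=> PQ [c Pc]; exists c => z; rewrite -PQ. Qed.

Lemma polys0 d : polys d (fun _ : R * R => 0).
Proof.
exists (fun _ _ => 0) => z; rewrite big1// => k _; rewrite big1// => l _.
by rewrite !mul0r.
Qed.

Lemma polysD d P Q : polys d P -> polys d Q -> polys d (fun z => P z + Q z).
Proof.
move=> [c Pc] [c' Qc]; exists (fun k l => c k l + c' k l) => z.
rewrite Pc Qc -big_split; apply: eq_bigr => k _; rewrite -big_split.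
by apply: eq_bigr => l _ /=; rewrite !mulrDl.
Qed.

Lemma polysZ d a P : polys d P -> polys d (fun z => a * P z).
Proof.
move=> [c Pc]; exists (fun k l => a * c k l) => z.
rewrite Pc mulr_sumr; apply: eq_bigr => k _; rewrite mulr_sumr.
by apply: eq_bigr => l _; rewrite !mulrA.
Qed.

Lemma polysB d P Q : polys d P -> polys d Q -> polys d (fun z => P z - Q z).
Proof.
move=> dP /(polysZ (-1)) dQ; apply: polys_ext (polysD dP dQ) => z.
by rewrite mulN1r.
Qed.

Lemma polys_sum d (I : Type) (r : seq I) (p : pred I) (F : I -> R * R -> R) :
  (forall i, p i -> polys d (F i)) -> polys d (fun z => \sum_(i <- r | p i) F i z).
Proof.
move=> dF; elim: r => [|i r IH].
  by apply: polys_ext (polys0 d) => z; rewrite big_nil.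
case pi : (p i).
  by apply: polys_ext (polysD (dF _ pi) IH) => z; rewrite big_cons pi.
by apply: polys_ext IH => z; rewrite big_cons pi.
Qed.

Lemma polys_mono d k l : (k + l <= d)%N ->
  polys d (fun z : R * R => z.1 ^+ k * z.2 ^+ l).
Proof.
move=> kld; exists (fun k' l' => ((k' == k) && (l' == l))%:R) => z.
have kd : (k < d.+1)%N by rewrite ltnS (leq_trans _ kld) ?leq_addr.
have ld : (l < d.+1)%N by rewrite ltnS (leq_trans _ kld) ?leq_addl.
rewrite (bigD1 (Ordinal kd))//= [X in _ + X]big1 ?addr0; last first.
  move=> i /eqP ik; rewrite big1// => j _.
  by case: eqP => [e|_]; rewrite ?mul0r//; case: ik; apply: val_inj.
rewrite (bigD1 (Ordinal ld))//= big1 ?addr0 ?eqxx ?mul1r// => i /andP[_ /eqP il].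
by case: (eqVneq (i : nat) l) => [e|_]; rewrite ?andbF ?mul0r//;
  case: il; apply: val_inj.
Qed.

Lemma polys_le d d' P : (d <= d')%N -> polys d P -> polys d' P.
Proof.
move=> dd' [c Pc]; apply: (@polys_ext _ (fun z => \sum_(k < d.+1)
  \sum_(l < d.+1 | (k + l <= d)%N) c k l * (z.1 ^+ k * z.2 ^+ l))).
  move=> z; rewrite Pc; apply: eq_bigr => k _; apply: eq_bigr => l _.
  by rewrite mulrA.
apply: polys_sum => k _; apply: polys_sum => l kl; apply: polysZ.
exact/polys_mono/(leq_trans kl).
Qed.

Lemma polysM d d' P Q : polys d P -> polys d' Q ->
  polys (d + d') (fun z => P z * Q z).
Proof.
move=> [c Pc] [c' Qc]; apply: (@polys_ext _ (fun z => \sum_(k < d.+1)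
  \sum_(l < d.+1 | (k + l <= d)%N) \sum_(k' < d'.+1)
  \sum_(l' < d'.+1 | (k' + l' <= d')%N) (c k l * c' k' l') *
     (z.1 ^+ (k + k') * z.2 ^+ (l + l')))).
  move=> z; rewrite Pc Qc mulr_suml; apply: eq_bigr => k _.
  rewrite mulr_suml; apply: eq_bigr => l _.
  rewrite mulr_sumr; apply: eq_bigr => k' _.
  rewrite mulr_sumr; apply: eq_bigr => l' _.
  by rewrite !exprD; ring.
apply: polys_sum => k _; apply: polys_sum => l kl.
apply: polys_sum => k' _; apply: polys_sum => l' kl'; apply: polysZ.
by apply: polys_mono; rewrite addnACA leq_add.
Qed.

Lemma polys_cst d a : polys d (fun _ : R * R => a).
Proof.
apply: (@polys_ext _ (fun z => a * (z.1 ^+ 0 * z.2 ^+ 0))).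
  by move=> z; rewrite !expr0 !mulr1.
exact/polysZ/polys_mono.
Qed.

Lemma polys_aff a b c : polys 1 (fun z : R * R => a + b * z.1 + c * z.2).
Proof.
apply: polysD; first apply: polysD; first exact: polys_cst.
  apply: polysZ; apply: polys_ext (@polys_mono 1 1 0 isT) => z;
    by rewrite expr0 mulr1 expr1.
apply: polysZ; apply: polys_ext (@polys_mono 1 0 1 isT) => z;
  by rewrite expr0 mul1r expr1.
Qed.

Lemma polys_prod (I : Type) (r : seq I) (D : I -> nat) (F : I -> R * R -> R) :
  (forall i, polys (D i) (F i)) ->
  polys (\sum_(i <- r) D i) (fun z => \prod_(i <- r) F i z).
Proof.
move=> dF; elim: r => [|i r IH].
  by apply: polys_ext (polys_cst _ 1) => z; rewrite big_nil.
rewrite big_cons; apply: polys_ext (polysM (dF i) IH) => z.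
by rewrite big_cons.
Qed.

Lemma polysX d P n : polys d P -> polys (n * d) (fun z => P z ^+ n).
Proof.
move=> dP; elim: n => [|n IH].
  by apply: polys_ext (polys_cst _ 1) => z; rewrite expr0.
by rewrite mulSn; apply: polys_ext (polysM dP IH) => z; rewrite exprS.
Qed.

Lemma polys_comp d P g : polys d P ->
  polys 1 (fun z => (g z).1) -> polys 1 (fun z => (g z).2) ->
  polys d (fun z : R * R => P (g z)).
Proof.
move=> [c Pc] g1 g2; apply: (@polys_ext _ (fun z => \sum_(k < d.+1)
  \sum_(l < d.+1 | (k + l <= d)%N) c k l * ((g z).1 ^+ k * (g z).2 ^+ l))).
  move=> z; rewrite Pc; apply: eq_bigr => k _; apply: eq_bigr => l _.
  by rewrite mulrA.
apply: polys_sum => k _; apply: polys_sum => l kl; apply: polysZ.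
apply: polys_le kl _; apply: polysM.
  by have := polysX k g1; rewrite muln1.
by have := polysX l g2; rewrite muln1.
Qed.

Lemma univariate_roots d (c : nat -> R) :
  (forall j, (j <= d)%N -> \sum_(l < d.+1) c l * j%:R ^+ l = 0) ->
  forall y, \sum_(l < d.+1) c l * y ^+ l = 0.
Proof.
move=> c0; pose p := \poly_(l < d.+1) c l.
have pE y : p.[y] = \sum_(l < d.+1) c l * y ^+ l by rewrite horner_poly.
suff p0 : p = 0 by move=> y; rewrite -pE p0 horner0.
apply: (@roots_geq_poly_eq0 _ _ [seq j%:R | j <- iota 0 d.+1]).
- apply/allP => _ /mapP[j + ->]; rewrite mem_iota add0n ltnS => /andP[_ jd].
  by rewrite /root pE c0.
- by rewrite map_inj_uniq ?iota_uniq//; apply: mulrIn; rewrite oner_eq0.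
- by rewrite size_map size_iota size_poly.
Qed.

(* Peeling off the column [x = 0]: there the polynomial is univariate with
   [d + 1] roots, and what remains is [x] times a polynomial of lower degree. *)
Lemma polys_lattice_eq0 d P : polys d P ->
  (forall i j, (i + j <= d)%N -> P (i%:R, j%:R) = 0) -> forall z, P z = 0.
Proof.
elim: d P => [|d IH] P [c Pc] P0 z.
  have PE w : P w = c 0%N 0%N.
    by rewrite Pc big_ord1 big_mkcond big_ord1 /= !expr0 !mulr1.
  by rewrite PE -(PE (0%:R, 0%:R)) P0.
pose Q z := \sum_(k < d.+1) \sum_(l < d.+2 | (k + l <= d)%N)
  c k.+1 l * (z.1 ^+ k * z.2 ^+ l).
have dQ : polys d Q.
  apply: polys_sum => k _; apply: polys_sum => l kl.
  exact/polysZ/polys_mono.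
have PE w : P w = \sum_(l < d.+2) c 0 l * w.2 ^+ l + w.1 * Q w.
  rewrite Pc big_ord_recl; congr (_ + _).
    rewrite big_mkcond; apply: eq_bigr => l _ /=.
    by rewrite add0n -ltnS ltn_ord expr0 mulr1.
  rewrite mulr_sumr; apply: eq_bigr => k _; rewrite mulr_sumr.
  apply: eq_big => [l|l _]; first by rewrite /= /bump/= add1n addSn ltnS.
  by rewrite /= /bump/= add1n exprS; ring.
have col0 y : \sum_(l < d.+2) c 0 l * y ^+ l = 0.
  apply: univariate_roots => j jd.
  by have := P0 0 j; rewrite add0n => /(_ jd); rewrite PE /= mul0r addr0.
have PxQ w : P w = w.1 * Q w by rewrite PE col0 add0r.
(* At lattice points with positive abscissa the factor [x] can be cancelled; the shift by one brings
   these points back to the lattice of degree [d]. *)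
suff Q0 w : Q (w.1 + 1, w.2) = 0.
  have := Q0 (z.1 - 1, z.2); rewrite /= subrK => Q0z.
  by rewrite PxQ (surjective_pairing z) Q0z mulr0.
apply: (IH (fun w => Q (w.1 + 1, w.2))) => [|i j ijd].
  apply: (polys_comp (g := fun w => (w.1 + 1, w.2)) dQ).
    by apply: polys_ext (polys_aff 1 1 0) => v /=; ring.
  by apply: polys_ext (polys_aff 0 0 1) => v /=; ring.
have := P0 i.+1 j; rewrite addSn ltnS => /(_ ijd); rewrite PxQ /= => /eqP.
by rewrite mulf_eq0 pnatr_eq0 /= -natr1 => /eqP.
Qed.


(** Rescaling by [d] turns the nodes into the integer points of [polys_lattice_eq0], applied to the
    difference. *)
Lemma polys_uniq d P Q : polys d P -> polys d Q ->
  (forall i j, (i + j <= d)%N ->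
     P (i%:R / d%:R, j%:R / d%:R) = Q (i%:R / d%:R, j%:R / d%:R)) ->
  (0 < d)%N -> forall z, P z = Q z.
Proof.
move=> dP dQ PQ d0 z; have d0' : d%:R != 0 :> R by rewrite pnatr_eq0 -lt0n.
pose F (w : R * R) := P (w.1 / d%:R, w.2 / d%:R) - Q (w.1 / d%:R, w.2 / d%:R).
have F0 w : F w = 0.
  apply: (@polys_lattice_eq0 d) => [|i j ij]; last by rewrite /F PQ ?subrr.
  apply: (polys_comp (P := fun w => P w - Q w)
    (g := fun w => (w.1 / d%:R, w.2 / d%:R))); first exact: polysB.
    by apply: polys_ext (polys_aff 0 d%:R^-1 0) => v /=; ring.
  by apply: polys_ext (polys_aff 0 0 d%:R^-1) => v /=; ring.
have := F0 (z.1 * d%:R, z.2 * d%:R); rewrite /F /= !mulfK//.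
by rewrite -surjective_pairing => /eqP; rewrite subr_eq0 => /eqP.
Qed.

End polynomials.

Lemma norm_sum_ord_le (R : numDomainType) n (p : pred 'I_n) (F : 'I_n -> R) a :
  0 <= a -> (forall i, p i -> `|F i| <= a) -> `|\sum_(i < n | p i) F i| <= n%:R * a.
Proof.
move=> a0 Fa; rewrite (le_trans (ler_norm_sum _ _ _))//.
rewrite (@le_trans _ _ (\sum_(i < n) a))//; last first.
  by rewrite sumr_const card_ord mulr_natl.
by rewrite big_mkcond; apply: ler_sum => i _; case: ifPn => // /Fa.
Qed.

Section lagrange.
Context {R : realType}.
Variable d : nat.
Implicit Types (v : R * R -> R).

(** The binomial coefficient of [d x] over [i]: it vanishes at [0, 1/d, ..., (i-1)/d] and is 1 at
    [i/d]. The Lagrange basis function [lag i j] multiplies three of them, one for each barycentric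
    coordinate. *)
Definition newton (x : R) (i : nat) : R :=
  \prod_(0 <= k < i) ((d%:R * x - k%:R) / (i - k)%:R).

Definition lag (i j : nat) (z : R * R) : R :=
  newton z.1 i * newton z.2 j * newton (1 - z.1 - z.2) (d - i - j).

(* The interpolant on the reference triangle, where the nodes are
   [(i / d, j / d)] with [i + j <= d]. *)
Definition lagrange v (z : R * R) : R :=
  \sum_(i < d.+1) \sum_(j < d.+1 | (i + j <= d)%N)
    lag i j z * v (i%:R / d%:R, j%:R / d%:R).

Lemma polys_newton (g : R * R -> R) i : polys 1 g ->
  polys i (fun z => newton (g z) i).
Proof.
move=> g1; rewrite -[X in polys X _](_ : \sum_(0 <= k < i) 1 = i)%N; last first.
  by rewrite sum_nat_const_nat subn0 muln1.
apply: (@polys_prod _ _ _ (fun _ => 1%N)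
  (fun k z => (d%:R * g z - k%:R) / (i - k)%:R)) => k.
apply: polys_ext (polysZ (i - k)%:R^-1
  (polysB (polysZ d%:R g1) (polys_cst 1 k%:R))) => z /=.
by rewrite mulrC.
Qed.

Lemma polys_lag i j : (i + j <= d)%N -> polys d (lag i j).
Proof.
move=> ijd; rewrite -[X in polys X _](_ : i + j + (d - i - j) = d)%N; last first.
  by rewrite -subnDA subnKC.
apply: polysM; first apply: polysM.
- by apply: polys_newton; apply: polys_ext (polys_aff 0 1 0) => z /=; ring.
- by apply: polys_newton; apply: polys_ext (polys_aff 0 0 1) => z /=; ring.
- by apply: polys_newton; apply: polys_ext (polys_aff 1 (-1) (-1)) => z /=; ring.
Qed.

Lemma polys_lagrange v : polys d (lagrange v).
Proof.
apply: polys_sum => i _; apply: polys_sum => j ij.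
apply: polys_ext (polysZ (v (i%:R / d%:R, j%:R / d%:R)) (polys_lag ij)) => z.
by rewrite mulrC.
Qed.

Hypothesis d0 : (0 < d)%N.
Let dR0 : d%:R != 0 :> R. Proof. by rewrite pnatr_eq0 -lt0n. Qed.

Lemma newton_lt i j : (j < i)%N -> newton (j%:R / d%:R) i = 0.
Proof.
move=> ji; rewrite /newton (bigD1_seq j) ?mem_index_iota ?iota_uniq//=.
by rewrite mulrCA divff// mulr1 subrr !mul0r.
Qed.

Lemma newton_eq i : newton (i%:R / d%:R) i = 1.
Proof.
rewrite /newton big_nat_cond big1// => k /andP[/andP[_ ki] _].
by rewrite mulrCA divff// mulr1 -natrB 1?ltnW// divff// pnatr_eq0 subn_eq0 -ltnNge.
Qed.

(** The three barycentric numerators of a node add up to [d]. If two nodes differ, one numerator of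
    the second is smaller than that of the first, and the corresponding factor vanishes. *)
Lemma lag_node i j i' j' : (i + j <= d)%N -> (i' + j' <= d)%N ->
  lag i j (i'%:R / d%:R, j'%:R / d%:R) = ((i == i') && (j == j'))%:R.
Proof.
move=> ijd ijd'; rewrite /lag /=.
have -> : 1 - i'%:R / d%:R - j'%:R / d%:R = (d - i' - j')%:R / d%:R :> R.
  by rewrite -subnDA natrB// natrD !mulrBl mulrDl divff// opprD addrA.
have [ii'|] := ltnP i' i.
  by rewrite newton_lt// !mul0r gtn_eqF.
have [jj'|] := ltnP j' j.
  by rewrite (newton_lt jj') mulr0 mul0r andbC gtn_eqF.
have [h _ _|] := ltnP (d - i' - j') (d - i - j).
  rewrite (newton_lt h) mulr0; case: eqP => [e|//]; case: eqP => [e'|//].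
  by rewrite e e' ltnn in h.
move=> h1 h2 h3; have [-> ->] : i = i' /\ j = j'.
  by split; lia.
by rewrite !newton_eq !eqxx !mulr1.
Qed.

Lemma lagrange_node v i j : (i + j <= d)%N ->
  lagrange v (i%:R / d%:R, j%:R / d%:R) = v (i%:R / d%:R, j%:R / d%:R).
Proof.
move=> ijd; have id : (i < d.+1)%N by rewrite ltnS (leq_trans _ ijd) ?leq_addr.
have jd : (j < d.+1)%N by rewrite ltnS (leq_trans _ ijd) ?leq_addl.
rewrite /lagrange (bigD1 (Ordinal id))//= [X in _ + X]big1 ?addr0; last first.
  move=> i' ii'; rewrite big1// => j' ij'; rewrite lag_node//.
  by rewrite (_ : (i' == i :> nat) = false) ?mul0r//; apply: negbTE.
rewrite (bigD1 (Ordinal jd))//= big1 ?addr0; last first.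
  move=> j' /andP[ij' jj']; rewrite lag_node//.
  by rewrite (_ : (j' == j :> nat) = false) ?andbF ?mul0r//; apply: negbTE.
by rewrite lag_node// !eqxx mul1r.
Qed.

Lemma lagrange_id P : polys d P -> lagrange P =1 P.
Proof.
move=> dP; apply: (@polys_uniq _ d) => // [|i j ij]; first exact: polys_lagrange.
by rewrite lagrange_node.
Qed.

Lemma eq_lagrange v w : (forall i j, (i + j <= d)%N ->
    v (i%:R / d%:R, j%:R / d%:R) = w (i%:R / d%:R, j%:R / d%:R)) ->
  lagrange v =1 lagrange w.
Proof.
by move=> vw z; apply: eq_bigr => i _; apply: eq_bigr => j ij; rewrite vw.
Qed.

Lemma lagrangeB v w z : lagrange (fun x => v x - w x) z = lagrange v z - lagrange w z.
Proof.
rewrite /lagrange -sumrB; apply: eq_bigr => i _; rewrite -sumrB.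
by apply: eq_bigr => j _; rewrite mulrBr.
Qed.

Lemma lagrangeD v w z : lagrange (fun x => v x + w x) z = lagrange v z + lagrange w z.
Proof.
rewrite /lagrange -big_split; apply: eq_bigr => i _; rewrite -big_split.
by apply: eq_bigr => j _ /=; rewrite mulrDr.
Qed.

Lemma lagrangeZ a v z : lagrange (fun x => a * v x) z = a * lagrange v z.
Proof.
rewrite /lagrange mulr_sumr; apply: eq_bigr => i _; rewrite mulr_sumr.
by apply: eq_bigr => j _; rewrite mulrCA.
Qed.

Definition reft : set (R * R) := [set z | [/\ 0 <= z.1, 0 <= z.2 & z.1 + z.2 <= 1]].

Lemma reft_node i j : (i + j <= d)%N -> reft (i%:R / d%:R, j%:R / d%:R).
Proof.
move=> ijd; split; rewrite /= ?divr_ge0// -mulrDl -natrD.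
by rewrite ler_pdivrMr ?ltr0n// mul1r ler_nat.
Qed.

Lemma newton_le x i : 0 <= x <= 1 -> (i <= d)%N -> `|newton x i| <= d%:R ^+ i.
Proof.
move=> /andP[x0 x1] id; rewrite /newton normr_prod.
rewrite -[X in _ ^+ X]subn0 -prodr_const_nat.
rewrite big_nat_cond [leRHS]big_nat_cond; apply: ler_prod => k /andP[/andP[_ ki] _].
rewrite normr_ge0 normrM normfV [X in _ / X]ger0_norm//.
have ik : 1 <= (i - k)%:R :> R by rewrite ler1n subn_gt0.
rewrite ler_pdivrMr ?(lt_le_trans _ ik)//.
have kd : k%:R <= d%:R :> R by rewrite ler_nat (leq_trans (ltnW ki)).
have dx : 0 <= d%:R * x <= d%:R.
  by rewrite mulr_ge0//= ler_piMr.
have k0 : 0 <= k%:R :> R by [].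
rewrite (@le_trans _ _ d%:R)// ?ler_peMr// ler_norml; lra.
Qed.

(** A crude bound for the Lebesgue constant: at most [(d+1)^2] basis functions, each a product of
    [d] factors bounded by [d]. *)
Definition Lam : R := d.+1%:R * (d.+1%:R * d%:R ^+ d).

Lemma Lam_ge0 : 0 <= Lam. Proof. by rewrite !mulr_ge0// exprn_ge0. Qed.

Lemma lagrange_le v c z : 0 <= c -> reft z -> (forall w, reft w -> `|v w| <= c) ->
  `|lagrange v z| <= Lam * c.
Proof.
move=> c0 [z1 z2 z12] vc.
rewrite /Lam -!mulrA; apply: norm_sum_ord_le => [|i _].
  by rewrite !mulr_ge0// exprn_ge0.
apply: norm_sum_ord_le => [|j ijd]; first by rewrite mulr_ge0// exprn_ge0.
rewrite normrM ler_pM//; last exact/vc/reft_node.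
rewrite /lag !normrM -[X in _ ^+ X](_ : i + j + (d - i - j) = d)%N; last first.
  by rewrite -subnDA subnKC.
have id : (i <= d)%N by rewrite -ltnS.
have jd : (j <= d)%N by rewrite -ltnS.
rewrite !exprD !ler_pM// ?mulr_ge0//.
- by apply: newton_le => //; apply/andP; split; lra.
- by apply: newton_le => //; apply/andP; split; lra.
- by apply: newton_le => //; [apply/andP; split; lra|rewrite -subnDA leq_subr].
Qed.

End lagrange.


(** * Triangles as triples of points *)

Notation triple R := ((R * R) * (R * R) * (R * R))%type.

Section triples.
Context {R : realType}.
Implicit Types (t : triple R) (z w : R * R).

Lemma scaleE (a b : R) : a *: b = a * b.
Proof. by []. Qed.

Lemma pair_ext z w : z.1 = w.1 -> z.2 = w.2 -> z = w.
Proof. by case: z w => [? ?] [? ?] /= -> ->. Qed.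

(** Computations are made on bare triples of points, which may be degenerate; the type [triangle] is
    reached through [mkT]. [pt t] is the affine parametrization of [t] over the reference triangle
    [reft]. *)
Definition pt t z : R * R :=
  ((1 - z.1 - z.2) * t.1.1.1 + z.1 * t.1.2.1 + z.2 * t.2.1,
   (1 - z.1 - z.2) * t.1.1.2 + z.1 * t.1.2.2 + z.2 * t.2.2).

Definition det t : R := (t.1.2.1 - t.1.1.1) * (t.2.2 - t.1.1.2) -
  (t.2.1 - t.1.1.1) * (t.1.2.2 - t.1.1.2).

Definition hull t : set (R * R) := pt t @` reft.

(** Cramer's rule for the inverse of [pt t]. *)
Definition co1 t w : R := det (t.1.1, w, t.2) / det t.
Definition co2 t w : R := det (t.1.1, t.1.2, w) / det t.
Definition co t w : R * R := (co1 t w, co2 t w).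

Lemma ptK t : det t != 0 -> cancel (pt t) (co t).
Proof.
by move=> t0 z; apply: pair_ext; rewrite /co /co1 /co2 /=;
  apply: (mulIf t0); rewrite divfK// /det/=; ring.
Qed.

Lemma coK t : det t != 0 -> cancel (co t) (pt t).
Proof.
move=> t0 w; rewrite /pt /co /co1 /co2 /=.
have := divfK t0 (det (t.1.1, w, t.2)); have := divfK t0 (det (t.1.1, t.1.2, w)).
move: (_ / _) (_ / _) => u v vE uE.
have E a b c : ((1 - u - v) * a + u * b + v * c) * det t =
    (det t - u * det t - v * det t) * a + u * det t * b + v * det t * c by ring.
by apply: pair_ext; apply: (mulIf t0); rewrite /= E vE uE /det /=; ring.
Qed.

Lemma co1_pt t z : det t != 0 -> co1 t (pt t z) = z.1.
Proof. by move=> /ptK/(_ z) {2}<-. Qed.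

Lemma co2_pt t z : det t != 0 -> co2 t (pt t z) = z.2.
Proof. by move=> /ptK/(_ z) {2}<-. Qed.

Lemma hullP t w : det t != 0 -> hull t w <-> reft (co t w).
Proof.
move=> t0; split=> [[z zr <-]|cr]; first by rewrite ptK.
by exists (co t w) => //; rewrite coK.
Qed.

Lemma polys_co1 t : polys 1 (co1 t).
Proof.
rewrite /co1 /co2 /det /=.
pose a := (t.2.2 - t.1.1.2) / det t; pose b := (t.2.1 - t.1.1.1) / det t.
apply: polys_ext (polys_aff (b * t.1.1.2 - a * t.1.1.1) a (- b)) => w.
by rewrite /a /b /det; ring.
Qed.

Lemma polys_co2 t : polys 1 (co2 t).
Proof.
rewrite /co1 /co2 /det /=.
pose a := (t.1.2.1 - t.1.1.1) / det t; pose b := (t.1.2.2 - t.1.1.2) / det t.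
apply: polys_ext (polys_aff (b * t.1.1.1 - a * t.1.1.2) (- b) a) => w.
by rewrite /a /b /det; ring.
Qed.

Lemma polys_pt1 t : polys 1 (fun z => (pt t z).1).
Proof.
apply: polys_ext (polys_aff t.1.1.1 (t.1.2.1 - t.1.1.1) (t.2.1 - t.1.1.1)) => z.
by rewrite /pt /=; ring.
Qed.

Lemma polys_pt2 t : polys 1 (fun z => (pt t z).2).
Proof.
apply: polys_ext (polys_aff t.1.1.2 (t.1.2.2 - t.1.1.2) (t.2.2 - t.1.1.2)) => z.
by rewrite /pt /=; ring.
Qed.

Definition tup t : 3.-tuple (R * R) := [tuple t.1.1; t.1.2; t.2].

Lemma nondegenerate_tup t : Defs.nondegenerate (tup t) = (det t != 0).
Proof.
by rewrite /Defs.nondegenerate !(tnth_nth (0, 0)) !inordK.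
Qed.

Lemma nondegenerate_std :
  Defs.nondegenerate (tup ((0, 0), (1, 0), (0, 1)) : 3.-tuple (R * R)).
Proof. by rewrite nondegenerate_tup /det /= !subr0 mulr1 mul0r subr0 oner_eq0. Qed.

(** A degenerate triple is sent to the reference triangle, which makes the map total. *)
Definition mkT t : triangle R := insubd (Triangle nondegenerate_std) (tup t).

Lemma vertices_mkT t : det t != 0 -> vertices (mkT t) = tup t.
Proof.
by move=> t0; have := @val_insubd _ _ (triangle R) (Triangle nondegenerate_std)
  (tup t); rewrite nondegenerate_tup t0.
Qed.

Lemma mkT_surj (T : triangle R) : exists t, det t != 0 /\ T = mkT t.
Proof.
case: T => v nv.
exists (tnth v (inord 0), tnth v (inord 1), tnth v (inord 2)).
have vE : v = tup (tnth v (inord 0), tnth v (inord 1), tnth v (inord 2)).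
  apply: eq_from_tnth => i; rewrite [RHS](tnth_nth (0, 0)).
  case: i => -[|[|[|//]]] Hi; congr tnth; apply: val_inj; rewrite /= inordK//.
split; first by rewrite -nondegenerate_tup -vE.
apply: val_inj; rewrite /= vertices_mkT// -nondegenerate_tup -vE//.
Qed.

Lemma big_ord3 (V : nmodType) (F : 'I_3 -> V) :
  \sum_i F i = F ord0 + F (inord 1) + F (inord 2).
Proof.
rewrite !big_ord_recl big_ord0 addr0 addrA.
by congr (_ + F _ + F _); apply: val_inj; rewrite /= inordK.
Qed.

Lemma vtx_mkT t : det t != 0 -> [/\ vtx (mkT t) ord0 = t.1.1,
  vtx (mkT t) (inord 1) = t.1.2 & vtx (mkT t) (inord 2) = t.2].
Proof.
by move=> t0; rewrite /vtx vertices_mkT// !(tnth_nth (0, 0)) !inordK.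
Qed.

Lemma bary_mkT t (l : 'I_3 -> R) : det t != 0 -> \sum_i l i = 1 ->
  bary (mkT t) l = pt t (l (inord 1), l (inord 2)).
Proof.
move=> t0; rewrite big_ord3 => l1; rewrite /bary big_ord3.
have [-> -> ->] := vtx_mkT t0.
have -> : l ord0 = 1 - l (inord 1) - l (inord 2) by rewrite -l1; ring.
by apply: pair_ext.
Qed.

Definition bcoord z (i : 'I_3) : R :=
  if i == ord0 then 1 - z.1 - z.2 else if i == inord 1 then z.1 else z.2.

Lemma bcoordE z : [/\ bcoord z ord0 = 1 - z.1 - z.2, bcoord z (inord 1) = z.1,
  bcoord z (inord 2) = z.2 & \sum_i bcoord z i = 1].
Proof.
have E1 : (inord 1 == ord0 :> 'I_3) = false.
  by apply/eqP => /(congr1 val); rewrite /= inordK.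
have E2 : (inord 2 == ord0 :> 'I_3) = false.
  by apply/eqP => /(congr1 val); rewrite /= inordK.
have E3 : (inord 2 == inord 1 :> 'I_3) = false.
  by apply/eqP => /(congr1 val); rewrite /= !inordK.
rewrite big_ord3 /bcoord !eqxx E1 E2 E3; split=> //; ring.
Qed.

Lemma tri_mkT t : det t != 0 -> tri (mkT t) = hull t.
Proof.
move=> t0; apply/seteqP; split=> [_ [l [l0 l1] <-]|_ [z [z1 z2 z12] <-]].
  rewrite bary_mkT//; exists (l (inord 1), l (inord 2)) => //; split=> //=.
  by rewrite -l1 big_ord3 -addrA lerDr.
have [b0 b1 b2 bs] := bcoordE z; exists (bcoord z); last first.
  by rewrite bary_mkT// b1 b2 -surjective_pairing.
split=> // i; rewrite /bcoord; case: ifP => _; first by lra.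
by case: ifP.
Qed.

End triples.

Section interpolation_triple.
Context {R : realType} (m : nat) (m2 : (2 <= m)%N).
Implicit Types (t : triple R) (v : R * R -> R).

Let d0 : (0 < m.-1)%N. Proof. by case: m m2 => [|[]]. Qed.
Let dR0 : m.-1%:R != 0 :> R. Proof. by rewrite pnatr_eq0 -lt0n. Qed.

Lemma nodes_mkT t : det t != 0 -> forall w, nodes m (mkT t) w <->
  exists i j, (i + j <= m.-1)%N /\ w = pt t (i%:R / m.-1%:R, j%:R / m.-1%:R).
Proof.
move=> t0 w; split=> [[l [l1 lq] <-]|[i [j [ij ->]]]].
  have [i0 i0m l0E] := lq ord0; have [i im liE] := lq (inord 1).
  have [j jm ljE] := lq (inord 2); exists i, j; split; last first.
    by rewrite bary_mkT// liE ljE.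
  have : m.-1%:R = i0%:R + i%:R + j%:R :> R.
    by rewrite -[LHS]mulr1 -l1 big_ord3 l0E liE ljE; field.
  by move=> /eqP; rewrite -!natrD eqr_nat => /eqP ->; rewrite -addnA leq_addl.
have [b0 b1 b2 bs] := bcoordE (i%:R / m.-1%:R : R, j%:R / m.-1%:R).
exists (bcoord (i%:R / m.-1%:R, j%:R / m.-1%:R)); last by rewrite bary_mkT// b1 b2.
split=> // k; rewrite /bcoord /=; case: ifP => _.
  exists (m.-1 - i - j)%N; first by rewrite -subnDA leq_subr.
  by rewrite -subnDA natrB// natrD; field.
case: ifP => _; first by exists i => //; rewrite (leq_trans _ ij) ?leq_addr.
by exists j => //; rewrite (leq_trans _ ij) ?leq_addl.
Qed.

(** Pulled back to the reference triangle, a polynomial selected by [interp] agrees with the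
    Lagrange formula at the nodes, hence everywhere. The default branch of [xget] is excluded by
    exhibiting the Lagrange formula, transported by [co t], as a solution. *)
Lemma interp_mkT t v z : det t != 0 ->
  interp m (mkT t) v (pt t z) = lagrange m.-1 (v \o pt t) z.
Proof.
move=> t0; rewrite /interp; case: xgetP => [P PE [dP Pn]|/(_
    (fun w => lagrange m.-1 (v \o pt t) (co t w)))]; last first.
  case; split; first by apply: (polys_comp (g := co t)) (polys_co1 t) (polys_co2 t);
    exact: polys_lagrange.
  move=> w /nodes_mkT[]// i [j [ij ->]].
  by rewrite ptK// lagrange_node.
rewrite -[LHS]/((P \o pt t) z).
apply: (@polys_uniq _ m.-1) => //.
- by apply: polys_comp (polys_pt1 t) (polys_pt2 t).
- exact: polys_lagrange.
- move=> i j ij; rewrite lagrange_node//=; apply: Pn.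
  by apply/nodes_mkT => //; exists i, j.
Qed.

Lemma interp_polys t P : det t != 0 -> polys m.-1 P -> interp m (mkT t) P =1 P.
Proof.
move=> t0 dP w; rewrite -(coK t0 w) interp_mkT// lagrange_id//.
by apply: polys_comp (polys_pt1 t) (polys_pt2 t).
Qed.

Lemma polys_interp t v : det t != 0 -> polys m.-1 (interp m (mkT t) v).
Proof.
move=> t0; apply: (@polys_ext _ _ (fun w => lagrange m.-1 (v \o pt t) (co t w))).
  by move=> w; rewrite -{2}(coK t0 w) interp_mkT.
by apply: (polys_comp (g := co t)) (polys_co1 t) (polys_co2 t); exact: polys_lagrange.
Qed.

Lemma interpB t v w x : det t != 0 ->
  interp m (mkT t) (fun z => v z - w z) x =
  interp m (mkT t) v x - interp m (mkT t) w x.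
Proof. by move=> t0; rewrite -(coK t0 x) !interp_mkT// -lagrangeB. Qed.

Lemma eq_interp t v w : det t != 0 -> v =1 w ->
  interp m (mkT t) v =1 interp m (mkT t) w.
Proof.
move=> t0 vw x; rewrite -(coK t0 x) !interp_mkT//.
by apply: eq_lagrange => i j ij /=; rewrite vw.
Qed.

Lemma interp_le t v c x : det t != 0 -> 0 <= c -> hull t x ->
  (forall w, hull t w -> `|v w| <= c) ->
  `|interp m (mkT t) v x| <= Lam m.-1 * c.
Proof.
move=> t0 c0 [z zr <-] vc; rewrite interp_mkT//; apply: lagrange_le => // w wr.
by apply: vc; exists w.
Qed.

End interpolation_triple.

(** * Homogeneous polynomials *)

Section homogeneous.
Context {R : realType}.
Implicit Types (z : R * R) (c : nat -> R).

Definition hom m c z : R := \sum_(k < m.+1) c k * z.1 ^+ k * z.2 ^+ (m - k).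

Definition cnorm m c : R := \sum_(k < m.+1) `|c k|.

Lemma cnorm_ge0 m c : 0 <= cnorm m c.
Proof. exact: sumr_ge0. Qed.

Lemma hom_polys m c : polys m (hom m c).
Proof.
apply: (@polys_ext _ _ (fun z => \sum_(k < m.+1) c k * (z.1 ^+ k * z.2 ^+ (m - k)))).
  by move=> z; apply: eq_bigr => k _; rewrite mulrA.
apply: polys_sum => k _; apply: polysZ; apply: polys_mono.
by rewrite subnKC// -ltnS.
Qed.

Lemma homB m c c' z : hom m (fun k => c k - c' k) z = hom m c z - hom m c' z.
Proof. by rewrite /hom -sumrB; apply: eq_bigr => k _; rewrite !mulrBl. Qed.

Lemma homZ m c (l : R) z : hom m c (l *: z) = l ^+ m * hom m c z.
Proof.
rewrite /hom mulr_sumr; apply: eq_bigr => -[k /=]; rewrite ltnS => /subnKC mE _.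
move: (m - k)%N mE => n <-; rewrite exprD.
by rewrite -[l *: z.1]/(l * _) -[l *: z.2]/(l * _) !exprMn; ring.
Qed.

Lemma hom_le m c z r : `|z.1| <= r -> `|z.2| <= r ->
  `|hom m c z| <= cnorm m c * r ^+ m.
Proof.
move=> z1 z2; rewrite /cnorm mulr_suml (le_trans (ler_norm_sum _ _ _))//.
apply: ler_sum => -[k /=]; rewrite ltnS => /subnKC mE _.
move: (m - k)%N mE => n <-; rewrite exprD mulrA !normrM !normrX !ler_pM ?mulr_ge0 ?exprn_ge0//.
  by rewrite lerXn2r ?nnegrE// (le_trans _ z1).
by rewrite lerXn2r ?nnegrE// (le_trans _ z1).
Qed.

Lemma exprB_le (x x' r e : R) k : `|x| <= r -> `|x'| <= r -> `|x - x'| <= e ->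
  1 <= r -> `|x ^+ k - x' ^+ k| <= k%:R * r ^+ k * e.
Proof.
move=> xr xr' xe r1; have r0 : 0 <= r by rewrite (le_trans _ r1).
have e0 : 0 <= e by rewrite (le_trans _ xe).
elim: k => [|k IH]; first by rewrite !expr0 subrr normr0 !mul0r.
rewrite !exprS.
have -> : x * x ^+ k - x' * x' ^+ k = x * (x ^+ k - x' ^+ k) + (x - x') * x' ^+ k.
  by ring.
rewrite (le_trans (ler_normD _ _))// !normrM.
have -> : k.+1%:R * (r * r ^+ k) * e = r * (k%:R * r ^+ k * e) + e * (r * r ^+ k).
  by rewrite -natr1; ring.
apply: lerD; first by rewrite ler_pM.
rewrite ler_pM// normrX (@le_trans _ _ (r ^+ k))//.
  by rewrite lerXn2r ?nnegrE.
by rewrite ler_peMl// exprn_ge0.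
Qed.

Lemma hom_lip m c z z' r e : `|z.1| <= r -> `|z.2| <= r ->
  `|z'.1| <= r -> `|z'.2| <= r -> `|z.1 - z'.1| <= e -> `|z.2 - z'.2| <= e ->
  1 <= r -> `|hom m c z - hom m c z'| <= cnorm m c * (m%:R * r ^+ m * e).
Proof.
move=> z1 z2 z1' z2' e1 e2 r1; have r0 : 0 <= r by rewrite (le_trans _ r1).
rewrite /hom -sumrB /cnorm mulr_suml (le_trans (ler_norm_sum _ _ _))//.
apply: ler_sum => -[k /=]; rewrite ltnS => /subnKC mE _.
move: (m - k)%N mE => n <-; rewrite -!mulrA -mulrBr normrM ler_wpM2l//.
have -> : z.1 ^+ k * z.2 ^+ n - z'.1 ^+ k * z'.2 ^+ n =
  z.1 ^+ k * (z.2 ^+ n - z'.2 ^+ n) +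
  (z.1 ^+ k - z'.1 ^+ k) * z'.2 ^+ n by ring.
rewrite (le_trans (ler_normD _ _))// !normrM.
have -> : (k + n)%:R * (r ^+ (k + n) * e) = r ^+ k * (n%:R * r ^+ n * e) +
   k%:R * r ^+ k * e * r ^+ n.
  by rewrite natrD exprD; ring.
apply: lerD; apply: ler_pM => //; rewrite ?normrX.
- by rewrite lerXn2r ?nnegrE.
- exact: exprB_le.
- exact: exprB_le.
- by rewrite lerXn2r ?nnegrE.
Qed.

(** Degree strictly below [n], with only the zero function for [n = 0]. This convention makes the
    degree counts of products and powers uniform. *)
Definition spolys n (F : R * R -> R) : Prop :=
  if n is n'.+1 then polys n' F else forall z, F z = 0.

Lemma spolys_ext n F G : F =1 G -> spolys n F -> spolys n G.
Proof.
by case: n => [|n] FG; [move=> F0 z; rewrite -FG|exact: polys_ext].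
Qed.

Lemma spolysD n F G : spolys n F -> spolys n G -> spolys n (fun z => F z + G z).
Proof.
case: n => [|n] /=; last exact: polysD.
by move=> F0 G0 z; rewrite F0 G0 addr0.
Qed.

Lemma spolysM n k F G : polys n F -> spolys k G -> spolys (n + k) (fun z => F z * G z).
Proof.
case: k => [|k] /= dF; last by rewrite addnS /=; exact: polysM.
move=> G0; apply: (@spolys_ext _ (fun=> 0)) => [z|]; first by rewrite G0 mulr0.
by case: (n + 0)%N => [|?] //=; exact: polys0.
Qed.

Lemma spolys_sum d (I : Type) (r : seq I) (F : I -> R * R -> R) :
  (forall i, spolys d (F i)) -> spolys d (fun z => \sum_(i <- r) F i z).
Proof.
case: d => [|d] dF /=; last by apply: polys_sum => i _; exact: dF.
by move=> z; rewrite big1// => i _; exact: dF.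
Qed.

Lemma spolys_expB (g h : R * R -> R) a k : polys 1 g -> polys 1 h ->
  (forall z, g z = a + h z) -> spolys k (fun z => g z ^+ k - h z ^+ k).
Proof.
move=> g1 h1 gh; elim: k => [z|k IH]; first by rewrite !expr0 subrr.
apply: (@spolys_ext _ (fun z => g z * (g z ^+ k - h z ^+ k) + a * h z ^+ k)).
  by move=> z; rewrite !exprS gh; ring.
apply: spolysD; first by have := spolysM g1 IH; rewrite add1n.
by apply: polysZ; have := polysX k h1; rewrite muln1.
Qed.

(** [(b + l z)^k - (l z)^k] has degree below [k], so a translation alters a form of degree [m] only
    by terms that interpolation reproduces. The interpolation error of a form is therefore
    translation invariant. *)
Lemma hom_shift m c (b : R * R) (l : R) : (0 < m)%N -> exists P, polys m.-1 P /\
  forall z, hom m c (b + l *: z) = l ^+ m * hom m c z + P z.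
Proof.
move=> m0; exists (fun z => hom m c (b + l *: z) - l ^+ m * hom m c z).
split; last by move=> z; ring.
suff : spolys m (fun z => hom m c (b + l *: z) - l ^+ m * hom m c z) by case: (m) m0.
apply: (@spolys_ext _ (fun z => \sum_(k < m.+1) (c k *
  ((b.1 + l * z.1) ^+ k * ((b.2 + l * z.2) ^+ (m - k) - (l * z.2) ^+ (m - k)) +
   (l * z.2) ^+ (m - k) * ((b.1 + l * z.1) ^+ k - (l * z.1) ^+ k))))).
  by move=> z; rewrite -homZ /hom -sumrB; apply: eq_bigr => k _;
    rewrite /= -!/(_ * _); ring.
apply: spolys_sum => k; have km : (k <= m)%N by rewrite -ltnS.
have p1 : polys 1 (fun z : R * R => b.1 + l * z.1).
  by apply: polys_ext (polys_aff b.1 l 0) => z; ring.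
have p2 : polys 1 (fun z : R * R => b.2 + l * z.2).
  by apply: polys_ext (polys_aff b.2 0 l) => z; ring.
have p3 : polys 1 (fun z : R * R => l * z.1).
  by apply: polys_ext (polys_aff 0 l 0) => z; ring.
have p4 : polys 1 (fun z : R * R => l * z.2).
  by apply: polys_ext (polys_aff 0 0 l) => z; ring.
rewrite -[m in spolys m]add0n; apply: spolysM; first exact: polys_cst.
apply: spolysD.
  rewrite -[X in spolys X](subnKC km); apply: spolysM.
    by have := polysX k p1; rewrite muln1.
  exact: spolys_expB p2 p4 _.
rewrite -[X in spolys X](subnK km); apply: spolysM.
  by have := polysX (m - k) p4; rewrite muln1.
exact: spolys_expB p1 p3 _.
Qed.

End homogeneous.

(** * Pointwise interpolation errors *)

Section pointwise_error.
Context {R : realType} (m : nat) (m2 : (2 <= m)%N).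
Implicit Types (t : triple R) (v : R * R -> R) (c : nat -> R) (b : R * R).

Let m0 : (0 < m)%N. Proof. by case: m m2. Qed.
Let d0 : (0 < m.-1)%N. Proof. by case: m m2 => [|[]]. Qed.

Definition eI t v z : R := v z - interp m (mkT t) v z.

(** A homothety when [l] is nonzero. The ratio may be negative: in a grid, the tiles turned upside
    down are copies with negative ratio. *)
Definition tmap b (l : R) t : triple R :=
  ((b + l *: t.1.1, b + l *: t.1.2), b + l *: t.2).

Lemma pt_tmap b l t z : pt (tmap b l t) z = b + l *: pt t z.
Proof.
by apply: pair_ext; rewrite /pt /tmap /= !scaleE; ring.
Qed.

Lemma det_tmap b l t : det (tmap b l t) = l ^+ 2 * det t.
Proof.
by rewrite /det /tmap /= !scaleE; ring.
Qed.

Lemma det_tmap_neq0 b l t : l != 0 -> det t != 0 -> det (tmap b l t) != 0.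
Proof. by move=> l0 t0; rewrite det_tmap mulf_neq0// expf_neq0. Qed.

Lemma hull_tmap b l t z : hull t z -> hull (tmap b l t) (b + l *: z).
Proof. by move=> [x xr <-]; exists x => //; rewrite pt_tmap. Qed.

Lemma eI_tmap b l t c z : l != 0 -> det t != 0 ->
  eI (tmap b l t) (hom m c) (b + l *: z) = l ^+ m * eI t (hom m c) z.
Proof.
move=> l0 t0; have t0' := det_tmap_neq0 b l0 t0.
have [P [dP PE]] := hom_shift c b l m0.
rewrite /eI -(coK t0 z) -pt_tmap !interp_mkT// pt_tmap PE mulrBr.
have E : hom m c \o pt (tmap b l t) =1
    fun y => l ^+ m * (hom m c \o pt t) y + (P \o pt t) y.
  by move=> y; rewrite /= pt_tmap PE.
have -> x : lagrange m.-1 (hom m c \o pt (tmap b l t)) x =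
    l ^+ m * lagrange m.-1 (hom m c \o pt t) x + P (pt t x).
  rewrite (@eq_lagrange _ _ _ (fun y => l ^+ m * (hom m c \o pt t) y + (P \o pt t) y));
    last by move=> i j _; rewrite E.
  rewrite lagrangeD lagrangeZ; congr (_ + _).
  by rewrite (lagrange_id d0)//; apply: polys_comp (polys_pt1 t) (polys_pt2 t).
by ring.
Qed.

(** Interpolation reproduces [P], so [v - w] and [v - w - P] have the same error, and the latter is
    bounded by [1 +] the Lebesgue constant times its size. *)
Lemma eI_approx t v w P k z : det t != 0 -> polys m.-1 P -> 0 <= k ->
  (forall x, hull t x -> `|v x - w x - P x| <= k) -> hull t z ->
  `|eI t v z - eI t w z| <= (1 + Lam m.-1) * k.
Proof.
move=> t0 dP k0 vw tz.
have -> : eI t v z - eI t w z = (v z - w z - P z) -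
    interp m (mkT t) (fun x => v x - w x - P x) z.
  by rewrite /eI !interpB// (interp_polys m2 t0 dP); ring.
rewrite (le_trans (ler_normB _ _))// mulrDl mul1r lerD//; first exact: vw.
exact: interp_le.
Qed.

Definition diam_le t (D : R) : Prop := forall z w, hull t z -> hull t w ->
  `|z.1 - w.1| <= D /\ `|z.2 - w.2| <= D.

Lemma hullv t : [/\ hull t t.1.1, hull t t.1.2 & hull t t.2].
Proof.
split; [exists (0, 0)|exists (1, 0)|exists (0, 1)];
  by [split; rewrite /= ?addr0 ?add0r|apply: pair_ext; rewrite /pt /=; ring].
Qed.

Lemma diam_ge0 t D : diam_le t D -> 0 <= D.
Proof.
have [h _ _] := hullv t.
by move=> /(_ _ _ h h)[+ _]; rewrite subrr normr0.
Qed.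

Lemma diam_le_tmap t D b l : diam_le t D -> diam_le (tmap b l t) (`|l| * D).
Proof.
move=> tD z w [x xr <-] [y yr <-]; rewrite !pt_tmap /=.
have [h1 h2] : _ /\ _ := tD (pt t x) (pt t y) (ex_intro2 _ _ x xr erefl) (ex_intro2 _ _ y yr erefl).
split.
  rewrite [X in `|X|](_ : _ = l * ((pt t x).1 - (pt t y).1)).
    by rewrite normrM ler_wpM2l.
  by rewrite /pt /= !scaleE; ring.
rewrite [X in `|X|](_ : _ = l * ((pt t x).2 - (pt t y).2)).
  by rewrite normrM ler_wpM2l.
by rewrite /pt /= !scaleE; ring.
Qed.

Lemma diam_le_sub t t' D : hull t `<=` hull t' -> diam_le t' D -> diam_le t D.
Proof. by move=> tt' tD z w /tt' tz /tt' tw; exact: tD. Qed.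

(** Seen from a vertex of [t], the form has size [D^m] up to a polynomial of lower degree, which
    does not contribute to the error. *)
Lemma eI_hom_le t c D z : det t != 0 -> diam_le t D -> hull t z ->
  `|eI t (hom m c) z| <= (1 + Lam m.-1) * (cnorm m c * D ^+ m).
Proof.
move=> t0 tD tz; have [P [dP PE]] := hom_shift c (t.1.1) 1 m0.
have D0 := diam_ge0 tD.
have -> : eI t (hom m c) z = eI t (hom m c) z - eI t (fun=> 0) z.
  by rewrite [X in _ - X]/eI (interp_polys m2 t0 (polys0 _)) !subr0.
apply: (@eI_approx _ _ _ (fun x => P (x - t.1.1))) => //.
- apply: polys_comp dP _ _.
    by apply: polys_ext (polys_aff (- t.1.1.1) 1 0) => w /=; ring.
  by apply: polys_ext (polys_aff (- t.1.1.2) 0 1) => w /=; ring.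
- by rewrite mulr_ge0 ?cnorm_ge0// exprn_ge0.
- move=> x tx; have := PE (x - t.1.1); rewrite scale1r subrKC expr1n mul1r => ->.
  have [ta _ _] := hullv t; have [h1 h2] := tD _ _ tx ta.
  by rewrite subr0 addrK; apply: hom_le.
Qed.

(* The error on a triangle two of whose vertices nearly coincide is close to
   the error of the degenerate triangle, which is one-dimensional: it is seen
   along an edge of [Q]. *)
Lemma eI_flat t (Q : triple R) c (nu sg k r S : R) :
  det t != 0 -> det Q != 0 -> 0 < nu -> 0 <= sg <= 1 -> 0 <= k <= 1 -> 1 <= r ->
  let e := Q.1.2 - Q.1.1 in
  `|e.1| <= r -> `|e.2| <= r ->
  `|t.1.2.1 - t.1.1.1 - nu * sg * e.1| <= nu * k ->
  `|t.1.2.2 - t.1.1.2 - nu * sg * e.2| <= nu * k ->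
  `|t.2.1 - t.1.1.1 - nu * sg * e.1| <= nu * k ->
  `|t.2.2 - t.1.1.2 - nu * sg * e.2| <= nu * k ->
  (forall z, hull Q z -> `|eI Q (hom m c) z| <= S) ->
  forall z, hull t z -> `|eI t (hom m c) z| <=
    nu ^+ m * (S + (1 + Lam m.-1) * (cnorm m c * (m%:R * (r + 1) ^+ m * k))).
Proof.
move=> t0 Q0 nu0 /andP[sg0 sg1] /andP[k0 k1] r1 e er1 er2 h1 h2 h3 h4 QS.
have nu0' : nu != 0 by rewrite gt_eqF.
have S0 : 0 <= S by have [h _ _] := hullv Q; rewrite (le_trans _ (QS _ h)).
(* Rescaling by [1 / nu] sends the first vertex to the origin and the two others within [k] of
   [sg *: e]. *)
pose T := tmap (- (nu^-1 *: t.1.1)) nu^-1 t.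
have T0 : det T != 0 by rewrite det_tmap_neq0// invr_neq0.
have tT z : eI t (hom m c) z = nu ^+ m *
    eI T (hom m c) (- (nu^-1 *: t.1.1) + nu^-1 *: z).
  by rewrite eI_tmap ?invr_neq0// mulrA -exprMn divff// expr1n mul1r.
move=> z tz; rewrite tT normrM ger0_norm ?exprn_ge0 ?(ltW nu0)//.
rewrite ler_wpM2l ?exprn_ge0 ?(ltW nu0)//.
have : hull T (- (nu^-1 *: t.1.1) + nu^-1 *: z) by exact: hull_tmap.
move: (_ + _) => {tz}z [x [x1 x2 x12] <-].
(* The limit case: if both free vertices of [T] were [sg *: e], the parametrization would only see
   [y.1 + y.2], and the form would become a function of one variable along the side [e] of [Q]. *)
pose F (y : R * R) := hom m c ((y.1 + y.2) *: (sg *: e)).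
have T11 : T.1.1 = 0.
  by rewrite /T /tmap /= addrC subrr.
have ub (a b : R) : `|a - b - nu * sg * e.1| <= nu * k ->
    `|nu^-1 * a - nu^-1 * b - sg * e.1| <= k.
  move=> H; rewrite -(ler_pM2l nu0) -{1}(gtr0_norm nu0) -normrM.
  by rewrite [X in `|X|](_ : _ = a - b - nu * sg * e.1)//; field.
have ub2 (a b : R) : `|a - b - nu * sg * e.2| <= nu * k ->
    `|nu^-1 * a - nu^-1 * b - sg * e.2| <= k.
  move=> H; rewrite -(ler_pM2l nu0) -{1}(gtr0_norm nu0) -normrM.
  by rewrite [X in `|X|](_ : _ = a - b - nu * sg * e.2)//; field.
have T1 : [/\ `|T.1.2.1 - sg * e.1| <= k, `|T.1.2.2 - sg * e.2| <= k,
    `|T.2.1 - sg * e.1| <= k & `|T.2.2 - sg * e.2| <= k].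
  rewrite /T /tmap /= !scaleE.
  by rewrite ![- (nu^-1 * _) + _]addrC; split; [exact: ub|exact: ub2|exact: ub|exact: ub2].
have ser1 : `|sg * e.1| <= r.
  by rewrite normrM (ger0_norm sg0) (@le_trans _ _ `|e.1|)// ler_piMl.
have ser2 : `|sg * e.2| <= r.
  by rewrite normrM (ger0_norm sg0) (@le_trans _ _ `|e.2|)// ler_piMl.
have aux (a b A B w : R) : 0 <= a -> 0 <= b -> a + b <= 1 -> `|A - w| <= k ->
    `|B - w| <= k -> `|w| <= r ->
    [/\ `|a * A + b * B - (a + b) * w| <= k, `|(a + b) * w| <= r + 1 &
        `|a * A + b * B| <= r + 1].
  move=> a0 b0 ab Aw Bw wr.
  have h : `|a * A + b * B - (a + b) * w| <= k.
    have -> : a * A + b * B - (a + b) * w = a * (A - w) + b * (B - w) by ring.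
    rewrite (le_trans (ler_normD _ _))// !normrM (ger0_norm a0) (ger0_norm b0).
    by rewrite (@le_trans _ _ (a * k + b * k)) ?lerD ?ler_wpM2l// -mulrDl ler_piMl.
  have h' : `|(a + b) * w| <= r.
    by rewrite normrM ger0_norm ?addr_ge0// (@le_trans _ _ `|w|)// ler_piMl.
  split=> //; first by rewrite (le_trans h')// lerDl.
  rewrite -(subrK ((a + b) * w) (a * A + b * B)) (le_trans (ler_normD _ _))//.
  by rewrite addrC lerD// (le_trans h).
have FT y : reft y -> `|hom m c (pt T y) - F y| <=
    cnorm m c * (m%:R * (r + 1) ^+ m * k).
  move=> [y1 y2 y12]; have [a1 a2 a3 a4] := T1.
  have [u1 u2 u3] := aux _ _ _ _ _ y1 y2 y12 a1 a3 ser1.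
  have [w1 w2 w3] := aux _ _ _ _ _ y1 y2 y12 a2 a4 ser2.
  rewrite /F /pt T11 !mulr0 !add0r.
  by apply: hom_lip => //; rewrite (le_trans r1)// lerDl.
have C0 : 0 <= cnorm m c * (m%:R * (r + 1) ^+ m * k).
  by rewrite mulr_ge0 ?cnorm_ge0// mulr_ge0// mulr_ge0// exprn_ge0// addr_ge0// (le_trans _ r1).
have FQ : F x - lagrange m.-1 F x =
    sg ^+ m * eI Q (hom m c) (pt Q (x.1 + x.2, 0)).
  pose G (y : R * R) := hom m c (y.1 *: e + y.2 *: (Q.2 - Q.1.1)).
  have FG y : F y = sg ^+ m * G (y.1 + y.2, 0).
    by rewrite /F /G /= scale0r addr0 -homZ; congr hom; rewrite !scalerA mulrC.
  have [P [dP PE]] := hom_shift c Q.1.1 1 m0.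
  have ptQ y : pt Q y = Q.1.1 + 1 *: (y.1 *: e + y.2 *: (Q.2 - Q.1.1)).
    by apply: pair_ext; rewrite /pt /e /= !scaleE; ring.
  rewrite /eI interp_mkT//.
  have -> : lagrange m.-1 (hom m c \o pt Q) (x.1 + x.2, 0) =
      lagrange m.-1 G (x.1 + x.2, 0) + P ((x.1 + x.2) *: e).
    rewrite (@eq_lagrange _ _ _ (fun y => G y + P (y.1 *: e + y.2 *: (Q.2 - Q.1.1)))).
      rewrite lagrangeD; congr (_ + _); rewrite (lagrange_id d0)/= ?scale0r ?addr0//.
      apply: polys_comp dP _ _.
        by apply: polys_ext (polys_aff 0 e.1 (Q.2 - Q.1.1).1) => w /=;
          rewrite !scaleE; ring.
      by apply: polys_ext (polys_aff 0 e.2 (Q.2 - Q.1.1).2) => w /=;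
          rewrite !scaleE; ring.
    by move=> i j _; rewrite /= ptQ PE expr1n mul1r.
  rewrite ptQ PE expr1n mul1r -/(G (x.1 + x.2, 0)) /= scale0r addr0.
  (* The sum of the coordinates of a node is again the abscissa of a node on the first side. By
     uniqueness, the interpolant of a function of [y.1 + y.2] is its interpolant along that side,
     composed with the sum. *)
  have -> : lagrange m.-1 F x = sg ^+ m * lagrange m.-1 G (x.1 + x.2, 0).
    apply: (@polys_uniq _ m.-1 (lagrange m.-1 F)
      (fun x => sg ^+ m * lagrange m.-1 G (x.1 + x.2, 0))) => //.
    - exact: polys_lagrange.
    - apply: polysZ; apply: (polys_comp (g := fun x => (x.1 + x.2, 0))
        (polys_lagrange m.-1 G)).
        by apply: polys_ext (polys_aff 0 1 1) => w /=; ring.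
      exact: polys_cst.
    - move=> i j ij; rewrite lagrange_node// FG /=; congr (_ * _).
      by have := lagrange_node d0 G (i := i + j) (j := 0); rewrite addn0 mul0r
        natrD mulrDl => ->.
  by rewrite FG; ring.
rewrite /eI interp_mkT//.
have -> : hom m c (pt T x) - lagrange m.-1 (hom m c \o pt T) x =
  (hom m c (pt T x) - F x) - lagrange m.-1 (fun y => (hom m c \o pt T) y - F y) x
  + (F x - lagrange m.-1 F x) by rewrite lagrangeB; ring.
rewrite addrC (le_trans (ler_normD _ _))// lerD//.
  rewrite FQ normrM ger0_norm ?exprn_ge0//.
  rewrite (@le_trans _ _ `|eI Q (hom m c) (pt Q (x.1 + x.2, 0))|)//.
    by rewrite ler_piMl// exprn_ile1.
  by apply: QS; exists (x.1 + x.2, 0) => //; split; rewrite /= ?addr0//; lra.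
rewrite (le_trans (ler_normB _ _))// mulrDl mul1r lerD//; first exact: FT.
by apply: lagrange_le.
Qed.

(** Constructions and estimates are written for the first side of a triangle; these permutations
    bring another side, or the reverse direction, to that place. *)
Definition rot t : triple R := ((t.1.2, t.2), t.1.1).
Definition swp t : triple R := ((t.1.2, t.1.1), t.2).

Lemma det_rot t : det (rot t) = det t.
Proof. by rewrite /det /=; ring. Qed.

Lemma det_swp t : det (swp t) = - det t.
Proof. by rewrite /det /=; ring. Qed.

Lemma pt_rot t z : pt (rot t) z = pt t (1 - z.1 - z.2, z.1).
Proof. by rewrite /pt /=; apply: pair_ext => /=; ring. Qed.

Lemma pt_swp t z : pt (swp t) z = pt t (1 - z.1 - z.2, z.2).
Proof. by rewrite /pt /=; apply: pair_ext => /=; ring. Qed.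

Lemma hull_rot t : hull (rot t) = hull t.
Proof.
apply/seteqP; split=> _ [z [z1 z2 z12] <-].
  by rewrite pt_rot; exists (1 - z.1 - z.2, z.1) => //; split=> /=; lra.
exists (z.2, 1 - z.1 - z.2); first by split=> /=; lra.
by rewrite pt_rot /=; congr pt; apply: pair_ext => /=; ring.
Qed.

Lemma hull_swp t : hull (swp t) = hull t.
Proof.
apply/seteqP; split=> _ [z [z1 z2 z12] <-].
  by rewrite pt_swp; exists (1 - z.1 - z.2, z.2) => //; split=> /=; lra.
exists (1 - z.1 - z.2, z.2); first by split=> /=; lra.
by rewrite pt_swp /=; congr pt; apply: pair_ext => /=; ring.
Qed.

Lemma eI_nodes t t' v : nodes m (mkT t) = nodes m (mkT t') -> eI t v =1 eI t' v.
Proof. by move=> tt' z; rewrite /eI /interp tt'. Qed.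

Lemma eI_rot t v : det t != 0 -> eI (rot t) v =1 eI t v.
Proof.
move=> t0; have t0' : det (rot t) != 0 by rewrite det_rot.
have dR0 : m.-1%:R != 0 :> R by rewrite pnatr_eq0 -lt0n.
apply: eI_nodes; apply/seteqP; split=> w /nodes_mkT[]// i [j [ij ->]].
  apply/nodes_mkT => //; exists (m.-1 - i - j)%N, i; split; first by lia.
  rewrite pt_rot; congr pt; apply: pair_ext => //=.
  by rewrite -subnDA natrB// natrD; field.
apply/nodes_mkT => //; exists j, (m.-1 - i - j)%N; split; first by lia.
rewrite pt_rot; congr pt; apply: pair_ext => //=.
by rewrite -subnDA natrB// natrD; field.
Qed.

Lemma eI_swp t v : det t != 0 -> eI (swp t) v =1 eI t v.
Proof.
move=> t0; have t0' : det (swp t) != 0 by rewrite det_swp oppr_eq0.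
have dR0 : m.-1%:R != 0 :> R by rewrite pnatr_eq0 -lt0n.
apply: eI_nodes; apply/seteqP; split=> w /nodes_mkT[]// i [j [ij ->]].
  apply/nodes_mkT => //; exists (m.-1 - i - j)%N, j; split; first by lia.
  rewrite pt_swp; congr pt; apply: pair_ext => //=.
  by rewrite -subnDA natrB// natrD; field.
apply/nodes_mkT => //; exists (m.-1 - i - j)%N, j; split; first by lia.
rewrite pt_swp; congr pt; apply: pair_ext => //=.
by rewrite -subnDA natrB// natrD; field.
Qed.

End pointwise_error.

(** * Areas and local errors *)

Section affine_measure.
Context {R : realType}.
Notation leb := (@lebesgue_measure R).
Local Open Scope ereal_scope.

Definition aff1 (a l : R) : measurableTypeR R -> measurableTypeR R :=
  fun x => (a + l * x)%R.

Lemma measurable_aff1 a l : measurable_fun setT (aff1 a l).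
Proof.
apply: measurable_funD; first exact: measurable_cst.
by apply: measurable_funM; [exact: measurable_cst|exact: measurable_id].
Qed.

(** The pushforward of the measure, scaled by [|l|], agrees with Lebesgue measure on half-open
    intervals, which determine it. A negative [l] only moves the closed end to the other side. *)
Lemma leb_aff1 a (l : R) (A : set (measurableTypeR R)) : l != 0%R -> measurable A ->
  leb (aff1 a l @^-1` A) = (`|l|^-1)%:E * leb A.
Proof.
move=> l0 mA; have l0' : (0 < `|l|)%R by rewrite normr_gt0.
have mf := measurable_aff1 a l.
pose nu : {measure set (measurableTypeR R) -> \bar R} :=
  mscale (NngNum (ltW l0')) (measure_function_pushforward__canonical__measure_function_Measure leb mf).
suff H : forall X, ocitv X -> leb X = nu X.
  rewrite (lebesgue_measure_unique H mA) /nu /= /mscale /= muleA -EFinM mulVf ?mul1e//.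
  by rewrite gt_eqF.
move=> X /ocitvP[->|[[u v] /= uv ->]]; first by rewrite !measure0.
rewrite /nu /mscale /= /pushforward.
have [lp|ln|/eqP] := ltgtP l 0%R; last by rewrite (negPf l0).
  have -> : aff1 a l @^-1` `]u, v]%classic = `[((v - a) / l)%R, ((u - a) / l)%R[%classic.
    apply/seteqP; split=> x; rewrite /= /aff1 !in_itv /= => /andP[h1 h2]; apply/andP.
      by rewrite ler_ndivrMr// ltr_ndivlMr//; split; lra.
    by move: h1 h2; rewrite ler_ndivrMr// ltr_ndivlMr//; split; lra.
  rewrite !lebesgue_measure_itv /= !lte_fin uv.
  have -> : ((v - a) / l < (u - a) / l)%R by rewrite ltr_nM2r ?invr_lt0//; lra.
  rewrite -!EFinD -EFinM ltr0_norm//; congr (_%:E); field; exact: l0.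
have -> : aff1 a l @^-1` `]u, v]%classic = `]((u - a) / l)%R, ((v - a) / l)%R]%classic.
  apply/seteqP; split=> x; rewrite /= /aff1 !in_itv /= => /andP[h1 h2]; apply/andP.
    by rewrite ler_pdivlMr// ltr_pdivrMr//; split; lra.
  by move: h1 h2; rewrite ler_pdivlMr// ltr_pdivrMr//; split; lra.
rewrite !lebesgue_measure_itv /= !lte_fin uv.
have -> : ((u - a) / l < (v - a) / l)%R by rewrite ltr_pM2r ?invr_gt0//; lra.
by rewrite -!EFinD -EFinM gtr0_norm//; congr (_%:E); field.
Qed.


Notation RR := (measurableTypeR R * measurableTypeR R)%type.

Lemma measurable_affine (b : R * R) (l : R) :
  measurable_fun setT ((fun z : R * R => b + l *: z)%R : RR -> RR).
Proof.
apply: measurable_fun_pair.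
  by apply: (measurableT_comp (measurable_aff1 b.1 l)); exact: measurable_fst.
by apply: (measurableT_comp (measurable_aff1 b.2 l)); exact: measurable_snd.
Qed.

Lemma leb2_preimage (b : R * R) (l : R) (A : set RR) : l != 0%R -> measurable A ->
  leb2 ((fun z : R * R => (b + l *: z)%R) @^-1` A) = ((l ^+ 2)^-1)%:E * leb2 A.
Proof.
move=> l0 mA; have l2 : (0 < l ^+ 2)%R by rewrite exprn_even_gt0.
have mf := measurable_affine b l.
pose nu : {measure set RR -> \bar R} := mscale (NngNum (ltW l2))
  (measure_function_pushforward__canonical__measure_function_Measure leb2 mf).
suff H : forall A B : set (measurableTypeR R), measurable A -> measurable B ->
    nu (A `*` B) = leb A * leb B.
  rewrite [in RHS](_ : leb2 A = nu A); last exact: product_measure_unique.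
  rewrite /nu /= /mscale /= muleA -EFinM.
  by rewrite mulVf ?mul1e// gt_eqF.
move=> {mA} {}A B mA mB; rewrite /nu /= /mscale /= /pushforward.
have -> : (fun z : R * R => (b + l *: z)%R) @^-1` (A `*` B) =
  (aff1 b.1 l @^-1` A) `*` (aff1 b.2 l @^-1` B) by [].
rewrite /leb2 product_measure1E; last 2 first.
- by rewrite -[X in measurable X]setTI; exact: measurable_aff1.
- by rewrite -[X in measurable X]setTI; exact: measurable_aff1.
transitivity ((l ^+ 2)%:E * (((`|l|^-1)%:E * leb A) * ((`|l|^-1)%:E * leb B))).
  by congr (_ * (_ * _)); exact: leb_aff1.
rewrite muleACA muleA -!EFinM -invfM -normrM -expr2 ger0_norm ?ltW//.
by rewrite muleA muleA -EFinM divff ?mul1e// gt_eqF.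
Qed.

Lemma leb2_image (b : R * R) (l : R) (A : set RR) : l != 0%R -> measurable A ->
  leb2 ((fun z : R * R => (b + l *: z)%R) @` A) = (l ^+ 2)%:E * leb2 A.
Proof.
move=> l0 mA.
have -> : (fun z : R * R => (b + l *: z)%R) @` A =
    (fun z : R * R => (- (l^-1 *: b) + l^-1 *: z)%R) @^-1` A.
  apply/seteqP; split=> [_ [z Az <-]|z Az] /=.
    by rewrite scalerDr scalerA mulVf// scale1r addKr.
  exists (- (l^-1 *: b) + l^-1 *: z)%R => //.
  by rewrite scalerDr scalerN !scalerA divff// !scale1r addrA subrr add0r.
by rewrite leb2_preimage ?invr_neq0// exprVn invrK.
Qed.

End affine_measure.

Section plane_measurability.
Context {R : realType}.
Notation RR := (measurableTypeR R * measurableTypeR R)%type.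

Lemma open_box (U : set (R * R)) (z : R * R) : open U -> U z ->
  exists2 e : R, 0 < e & forall w : R * R,
    `|z.1 - w.1| < e -> `|z.2 - w.2| < e -> U w.
Proof.
move=> oU Uz; have : nbhs z U by exact: open_nbhs_nbhs.
move=> /nbhs_ballP[e /= e0 eU]; exists e => // w w1 w2; apply: eU.
by split.
Qed.

(** The sigma-algebra on the plane is the product one, so an open set has to be written as a
    countable union of products, here of boxes with rational centre and size. *)
Lemma open_measurable2 (U : set (R * R)) : open U -> measurable (U : set RR).
Proof.
move=> oU.
pose B (q : rat * rat * rat) : set (R * R) :=
  `]ratr q.1.1 - ratr q.2, ratr q.1.1 + ratr q.2[ `*`
  `]ratr q.1.2 - ratr q.2, ratr q.1.2 + ratr q.2[.
have -> : U = \bigcup_q (if `[< B q `<=` U >] then B q else set0).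
  apply/seteqP; split=> [z Uz|z [q _]]; last first.
    by case: asboolP => // BU /BU.
  have [e e0 eU] := open_box oU Uz.
  have [|r] := @rat_in_itvoo R 0 (e / 2); first by rewrite divr_gt0.
  rewrite in_itv /= => /andP[r0 re].
  have [|x] := @rat_in_itvoo R (z.1 - ratr r) (z.1 + ratr r); first by lra.
  rewrite in_itv /= => /andP[x1 x2].
  have [|y] := @rat_in_itvoo R (z.2 - ratr r) (z.2 + ratr r); first by lra.
  rewrite in_itv /= => /andP[y1 y2].
  exists (x, y, r) => //; rewrite asboolT; last first.
    move=> w [/=]; rewrite !in_itv /= => /andP[w1 w2] /andP[w3 w4].
    by apply: eU; rewrite ltr_norml; apply/andP; split; lra.
  by split; rewrite /= in_itv /=; apply/andP; split; lra.
apply: countable_bigcupT_measurable => [|q]; first exact: countableP.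
by case: ifP => // _; apply: measurableX; exact: measurable_itv.
Qed.

Lemma closed_measurable2 (A : set (R * R)) : closed A -> measurable (A : set RR).
Proof.
by move=> /closed_openC/open_measurable2/measurableC; rewrite setCK.
Qed.

Lemma continuous_measurable2 (D : set (R * R)) (f : R * R -> R) : closed D ->
  {within D, continuous f} -> measurable_fun (D : set RR) (f : RR -> R).
Proof.
move=> cD /continuousP cf; apply: (measurability _ (RGenOpens.measurableE R)).
move=> _ [_ [a [b ->] <-]].
have /open_subspaceP[V oV VD] := cf _ (@interval_open R (BRight a) (BLeft b) isT isT).
rewrite setIC -VD.
by apply: measurableI; [exact: open_measurable2|exact: closed_measurable2].
Qed.

Lemma measurable_polys d (P : R * R -> R) : polys d P ->
  measurable_fun setT (P : RR -> R).
Proof.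
move=> [c Pc]; rewrite (_ : P = fun z => \sum_(k < d.+1)
    \sum_(l < d.+1) ((if (k + l <= d)%N then c k l else 0) * z.1 ^+ k * z.2 ^+ l)).
  apply: measurable_sum => k; apply: measurable_sum => l.
  apply: measurable_funM; first apply: measurable_funM => //.
    by apply: measurable_funX; exact: measurable_fst.
  by apply: measurable_funX; exact: measurable_snd.
apply/funext => z; rewrite Pc; apply: eq_bigr => k _.
by rewrite big_mkcond; apply: eq_bigr => l _; case: ifP => // _; rewrite !mul0r.
Qed.

Lemma polys_continuous d (P : R * R -> R) : polys d P -> continuous P.
Proof.
move=> [c Pc] z; rewrite (_ : P = fun z => \sum_(k < d.+1)
    \sum_(l < d.+1) ((if (k + l <= d)%N then c k l else 0) * (z.1 ^+ k * z.2 ^+ l))).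
  apply: cvg_big => [|k _]; first exact: add_continuous.
  apply: cvg_big => [|l _]; first exact: add_continuous.
  apply: cvgM; first exact: cvg_cst.
  apply: cvgM; (apply: (@continuous_comp _ _ _ _ (fun x : R => x ^+ _));
    last exact: exprn_continuous); [exact: cvg_fst|exact: cvg_snd].
apply/funext => {}z; rewrite Pc; apply: eq_bigr => k _.
by rewrite big_mkcond; apply: eq_bigr => l _; case: ifP => // _; rewrite ?mul0r ?mulrA.
Qed.

End plane_measurability.


Section triangle_measure.
Context {R : realType}.
Notation RR := (measurableTypeR R * measurableTypeR R)%type.
Implicit Types t : triple R.

Lemma leb2X (A B : set (measurableTypeR R)) : measurable A -> measurable B ->
  leb2 (A `*` B : set RR) = (@lebesgue_measure R A * @lebesgue_measure R B)%E.
Proof. exact: product_measure1E. Qed.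

Definition tint t : set (R * R) :=
  [set z | [/\ 0 < co1 t z, 0 < co2 t z & co1 t z + co2 t z < 1]].

Lemma measurable_gt d (P : R * R -> R) : polys d P ->
  measurable ([set z | 0 < P z] : set RR).
Proof.
move=> dP; apply: open_measurable2.
rewrite (_ : [set z | _] = P @^-1` [set x | 0 < x])//.
by apply: open_comp (@open_gt R 0) => z _; exact: (polys_continuous dP).
Qed.

Lemma polys_co3 t : polys 1 (fun z => 1 - co1 t z - co2 t z).
Proof. exact: polysB (polysB (polys_cst 1 1) (polys_co1 t)) (polys_co2 t). Qed.

Lemma tintE t : tint t = [set z | 0 < co1 t z] `&` [set z | 0 < co2 t z] `&`
  [set z | 0 < 1 - co1 t z - co2 t z].
Proof.
apply/seteqP; split=> z => [[z1 z2 z3]|[[/= z1 /= z2] /= z3]].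
  by split; [split|change (0 < 1 - co1 t z - co2 t z); lra].
by split=> //; lra.
Qed.

Lemma hullE t : det t != 0 -> hull t = [set z | 0 <= co1 t z] `&`
  [set z | 0 <= co2 t z] `&` [set z | 0 <= 1 - co1 t z - co2 t z].
Proof.
move=> t0; apply/seteqP; split=> z.
  by move=> /(hullP _ t0)[/= z1 z2 z3]; split; [split|change (0 <= 1 - co1 t z - co2 t z); lra].
by move=> [[/= z1 /= z2] /= z3]; apply/(hullP _ t0); split => //=; lra.
Qed.

Lemma measurable_tint t : measurable (tint t : set RR).
Proof.
rewrite tintE; apply: measurableI; first apply: measurableI.
- exact: measurable_gt (polys_co1 t).
- exact: measurable_gt (polys_co2 t).
- exact: measurable_gt (polys_co3 t).
Qed.

Lemma open_polys_gt d (P : R * R -> R) : polys d P -> open [set z | 0 < P z].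
Proof.
move=> dP; rewrite (_ : [set z | _] = P @^-1` [set x | 0 < x])//.
by apply: open_comp (@open_gt R 0) => z _; exact: (polys_continuous dP).
Qed.

Lemma open_tint t : open (tint t).
Proof.
rewrite tintE; apply: openI; first apply: openI.
- exact: open_polys_gt (polys_co1 t).
- exact: open_polys_gt (polys_co2 t).
- exact: open_polys_gt (polys_co3 t).
Qed.

Lemma closed_hull t : det t != 0 -> closed (hull t).
Proof.
have cl d (P : R * R -> R) : polys d P -> closed [set z | 0 <= P z].
  move=> dP; rewrite (_ : [set z | _] = P @^-1` [set x | 0 <= x])//.
  by apply: closed_comp (@closed_ge R 0) => z _; exact: (polys_continuous dP).
move=> t0; rewrite hullE//; apply: closedI; first apply: closedI.
- exact: cl (polys_co1 t).
- exact: cl (polys_co2 t).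
- exact: cl (polys_co3 t).
Qed.

Lemma measurable_hull t : det t != 0 -> measurable (hull t : set RR).
Proof. by move=> t0; apply: closed_measurable2; exact: closed_hull. Qed.

Lemma tint_hull t : det t != 0 -> tint t `<=` hull t.
Proof. by move=> t0 z [z1 z2 z3]; apply/(hullP _ t0); split => /=; lra. Qed.

Lemma leb2_fin t : det t != 0 -> leb2 (hull t) \is a fin_num.
Proof.
move=> t0.
pose r := `|t.1.1.1| + `|t.1.2.1| + `|t.2.1| + (`|t.1.1.2| + `|t.1.2.2| + `|t.2.2|).
have sub : hull t `<=` `[- r, r]%classic `*` `[- r, r]%classic.
  have aux (x y a b c : R) : 0 <= x -> 0 <= y -> x + y <= 1 ->
      `|(1 - x - y) * a + x * b + y * c| <= `|a| + `|b| + `|c|.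
    move=> x0 y0 xy; rewrite (le_trans (ler_normD _ _))// lerD//.
      rewrite (le_trans (ler_normD _ _))// !normrM lerD// ler_piMl//.
        by rewrite ger0_norm; lra.
      by rewrite ger0_norm; lra.
    by rewrite normrM ler_piMl// ger0_norm; lra.
  have h a b : 0 <= a -> 0 <= b -> forall x : R, `|x| <= a -> - (a + b) <= x <= a + b.
    by move=> a0 b0 x; rewrite ler_norml => /andP[? ?]; apply/andP; split; lra.
  move=> _ [z [z1 z2 z12] <-]; split; rewrite /= in_itv /=.
    by apply: h (aux _ _ _ _ _ z1 z2 z12); rewrite !addr_ge0.
  by rewrite [r]addrC; apply: h (aux _ _ _ _ _ z1 z2 z12); rewrite !addr_ge0.
pose I : set (measurableTypeR R) := `[- r, r]%classic.
have mI : measurable I by exact: measurable_itv.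
rewrite ge0_fin_numE//; apply: (@le_lt_trans _ _ (leb2 (I `*` I : set RR))).
  by apply: le_measure => //; rewrite inE;
    [exact: measurable_hull|exact: measurableX].
rewrite (leb2X mI mI).
by rewrite !lebesgue_measure_itv; case: ifP => _; rewrite ?mule0 ?ltry// -EFinD -EFinM ltry.
Qed.

Lemma open_leb2_gt0 (U : set (R * R)) z : open U -> U z -> (0 < leb2 (U : set RR))%E.
Proof.
move=> oU Uz; have [e e0 eU] := open_box oU Uz.
pose I (x : R) : set (measurableTypeR R) := `]x - e, x + e[%classic.
have mI x : measurable (I x) by exact: measurable_itv.
apply: (@lt_le_trans _ _ (leb2 (I z.1 `*` I z.2 : set RR))).
  rewrite (leb2X (mI _) (mI _)).
  rewrite !lebesgue_measure_itv /= !lte_fin.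
  rewrite !ifT; [|lra|lra].
  by rewrite -!EFinD -EFinM lte_fin mulr_gt0//; lra.
apply: le_measure => //; rewrite ?inE.
- exact: measurableX.
- exact: open_measurable2.
- move=> w []; rewrite /I /= !in_itv /= => /andP[w1 w2] /andP[w3 w4].
  by apply: eU; rewrite ltr_norml; apply/andP; split; lra.
Qed.

(** Defined as a measure rather than through [det], so that monotonicity and additivity come from
    the measure. *)
Definition area t : R := fine (leb2 (hull t)).

Lemma areaE t : det t != 0 -> leb2 (hull t) = (area t)%:E.
Proof. by move=> t0; rewrite /area fineK//; exact: leb2_fin. Qed.

Definition ctr t : R * R := pt t (3^-1, 3^-1).

Lemma tint_ctr t : det t != 0 -> tint t (ctr t).
Proof. by move=> t0; rewrite /tint /ctr /mkset !co1_pt// !co2_pt//=; split; lra. Qed.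

Lemma area_gt0 t : det t != 0 -> 0 < area t.
Proof.
move=> t0; rewrite -lte_fin -areaE//.
apply: (@lt_le_trans _ _ (leb2 (tint t))).
  by have := open_leb2_gt0 (@open_tint t) (tint_ctr t0).
apply: le_measure; rewrite ?inE; [exact: measurable_tint|exact: measurable_hull|].
exact: tint_hull.
Qed.

Lemma hull_tmapE (b : R * R) (l : R) t :
  hull (tmap b l t) = (fun z : R * R => b + l *: z) @` hull t.
Proof.
apply/seteqP; split=> [_ [z zr <-]|_ [_ [z zr <-] <-]].
  by exists (pt t z); [exists z|rewrite pt_tmap].
by exists z => //; rewrite pt_tmap.
Qed.

Lemma area_tmap (b : R * R) (l : R) t : l != 0 -> det t != 0 ->
  area (tmap b l t) = l ^+ 2 * area t.
Proof.
move=> l0 t0; rewrite /area hull_tmapE leb2_image//; last exact: measurable_hull.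
by rewrite areaE.
Qed.

(* Contracting [t] towards its centroid by [1 - e] sends it into its interior. *)
Lemma leb2_tint t : det t != 0 -> leb2 (tint t) = (area t)%:E.
Proof.
move=> t0; apply/eqP; rewrite eq_le; apply/andP; split.
  rewrite -areaE//; apply: le_measure; rewrite ?inE;
    [exact: measurable_tint|exact: measurable_hull|exact: tint_hull].
have sub e : 0 < e < 1 -> hull (tmap (e *: ctr t) (1 - e) t) `<=` tint t.
  move=> /andP[e0 e1] _ [z [z1 z2 z12] <-]; rewrite pt_tmap.
  have -> : e *: ctr t + (1 - e) *: pt t z =
      pt t (e * 3^-1 + (1 - e) * z.1, e * 3^-1 + (1 - e) * z.2).
    by apply: pair_ext; rewrite /ctr /pt /= !scaleE; field.
  have f1 : 0 <= (1 - e) * z.1 by rewrite mulr_ge0//; lra.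
  have f2 : 0 <= (1 - e) * z.2 by rewrite mulr_ge0//; lra.
  have f3 : (1 - e) * (z.1 + z.2) <= 1 - e by rewrite ler_piMr//; lra.
  by rewrite /tint /mkset co1_pt// co2_pt//=; split; lra.
have fin : leb2 (tint t) \is a fin_num.
  rewrite ge0_fin_numE//; apply: (@le_lt_trans _ _ (leb2 (hull t))).
    apply: le_measure; rewrite ?inE;
      [exact: measurable_tint|exact: measurable_hull|exact: tint_hull].
  by rewrite areaE// ltry.
rewrite -(fineK fin) lee_fin; set x := fine _.
have xe e : 0 < e < 1 -> (1 - e) ^+ 2 * area t <= x.
  move=> /[dup] e01 /andP[e0 e1]; have e0' : 1 - e != 0 by rewrite gt_eqF//; lra.
  rewrite -lee_fin fineK// -(area_tmap (e *: ctr t))//.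
  rewrite -areaE; last exact: det_tmap_neq0.
  apply: le_measure; rewrite ?inE; last exact: sub.
  - by apply: measurable_hull; exact: det_tmap_neq0.
  - exact: measurable_tint.
have a0 := area_gt0 t0.
rewrite leNgt; apply/negP => xa.
(* With this [e], [(1 - e)^2 * area t >= area t - 2 * e * area t > x], against [xe]. *)
pose e := Num.min 2^-1 ((area t - x) / (3 * area t)).
have e0 : 0 < e by rewrite lt_min invr_gt0 ltr0n/= divr_gt0 ?subr_gt0 ?mulr_gt0.
have e1 : e <= 2^-1 by rewrite ge_min lexx.
have e2 : e * (3 * area t) <= area t - x.
  by rewrite -ler_pdivlMr ?mulr_gt0// ge_min lexx orbT.
have := xe e; rewrite e0 /= => /(_ ltac:(lra)) h.
have : e ^+ 2 * area t >= 0 by rewrite mulr_ge0 ?sqr_ge0// ltW.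
by nra.
Qed.

(** A small move towards the centroid brings any point of [t] into the interior. [r] exceeds the
    distance to the centroid in each coordinate, and [e * r < d] keeps the moved point in the
    ball. *)
Lemma hull_closure t : det t != 0 -> hull t `<=` closure (tint t).
Proof.
move=> t0 w /(hullP _ t0) wr U /nbhs_ballP[d /= d0 dU].
pose r := 1 + `|(ctr t).1 - w.1| + `|(ctr t).2 - w.2|.
have r1 : 1 <= r by rewrite /r -addrA lerDl addr_ge0.
pose e := Num.min 2^-1 (d / (2 * r)).
have r0 : 0 < r by lra.
have e0 : 0 < e by rewrite lt_min invr_gt0 ltr0n/= divr_gt0// mulr_gt0.
have e1 : e <= 2^-1 by rewrite ge_min lexx.
have e2 : e * (2 * r) <= d by rewrite -ler_pdivlMr ?mulr_gt0// ge_min lexx orbT.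
exists (w + e *: (ctr t - w)); split.
  case: wr; set z := co t w => z1 z2 z12.
  have -> : w + e *: (ctr t - w) =
      pt t (e * 3^-1 + (1 - e) * z.1, e * 3^-1 + (1 - e) * z.2).
    by rewrite -[in LHS](coK t0 w) -/z; apply: pair_ext; rewrite /ctr /pt /= !scaleE; field.
  clearbody z; have f1 : 0 <= (1 - e) * z.1 by rewrite mulr_ge0//; lra.
  have f2 : 0 <= (1 - e) * z.2 by rewrite mulr_ge0//; lra.
  have f3 : (1 - e) * (z.1 + z.2) <= 1 - e by rewrite ler_piMr//; lra.
  by rewrite /tint /mkset co1_pt// co2_pt//=; split; lra.
apply: dU; have a1 := normr_ge0 ((ctr t).1 - w.1); have a2 := normr_ge0 ((ctr t).2 - w.2).
have er : e * r < d by nra.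
split; rewrite /ball /= opprD addrA subrr add0r normrN scaleE normrM (gtr0_norm e0);
  rewrite (le_lt_trans _ er)// ler_pM2l// /r; lra.
Qed.

End triangle_measure.

(** * Separating lines *)

Section separation.
Context {R : realType}.
Notation RR := (measurableTypeR R * measurableTypeR R)%type.
Implicit Types (t : triple R) (phi : R * R * R).

(* [(a, b, c)] stands for the affine functional [a x + b y + c]. *)
Definition afn phi (z : R * R) : R := phi.1.1 * z.1 + phi.1.2 * z.2 + phi.2.

Definition afnz phi : bool := (phi.1.1 != 0) || (phi.1.2 != 0).

Definition afn_ge phi t : bool :=
  [&& 0 <= afn phi t.1.1, 0 <= afn phi t.1.2 & 0 <= afn phi t.2].

Definition afn_le phi t : bool :=
  [&& afn phi t.1.1 <= 0, afn phi t.1.2 <= 0 & afn phi t.2 <= 0].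

(** The line is tested on the vertices only. For nondegenerate triangles this implies disjoint
    interiors, and it localizes the intersection on the line [phi = 0]. *)
Definition sep t t' : Prop :=
  exists phi, [/\ afnz phi, afn_ge phi t & afn_le phi t'].

Definition opa phi : R * R * R := (- phi.1.1, - phi.1.2, - phi.2).

Lemma afn_opa phi z : afn (opa phi) z = - afn phi z.
Proof. by rewrite /afn /=; ring. Qed.

Lemma sep_sym t t' : sep t t' -> sep t' t.
Proof.
move=> [phi [p0 /and3P[a b c] /and3P[a' b' c']]]; exists (opa phi).
split; first by rewrite /afnz /= !oppr_eq0.
  by apply/and3P; rewrite !afn_opa !oppr_ge0.
by apply/and3P; rewrite !afn_opa !oppr_le0.
Qed.

Lemma afn_pt phi t z : afn phi (pt t z) = (1 - z.1 - z.2) * afn phi t.1.1 +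
  z.1 * afn phi t.1.2 + z.2 * afn phi t.2.
Proof. by rewrite /afn /pt /=; ring. Qed.

Lemma afn_ge_hull phi t z : afn_ge phi t -> hull t z -> 0 <= afn phi z.
Proof.
move=> /and3P[a b c] [x [x1 x2 x12] <-]; rewrite afn_pt.
by rewrite !addr_ge0// mulr_ge0//; lra.
Qed.

Lemma afn_le_hull phi t z : afn_le phi t -> hull t z -> afn phi z <= 0.
Proof.
move=> /and3P[a b c] tz; rewrite -oppr_ge0 -afn_opa.
by apply: afn_ge_hull tz; apply/and3P; rewrite !afn_opa !oppr_ge0.
Qed.

Lemma sep_sub t1 t2 t1' t2' : hull t1' `<=` hull t1 -> hull t2' `<=` hull t2 ->
  sep t1 t2 -> sep t1' t2'.
Proof.
move=> s1 s2 [phi [p0 p1 p2]]; exists phi; split => //; apply/and3P.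
  by have [a b c] := hullv t1'; split; apply: afn_ge_hull p1 _; exact: s1.
by have [a b c] := hullv t2'; split; apply: afn_le_hull p2 _; exact: s2.
Qed.

(** At an interior point all barycentric weights are positive, so a nonnegative functional could
    vanish there only by vanishing at the three vertices. *)
Lemma afn_ge_tint phi t z : det t != 0 -> afnz phi -> afn_ge phi t -> tint t z ->
  0 < afn phi z.
Proof.
move=> t0 p0 /and3P[a b c] [z1 z2 z3].
rewrite -(coK t0 z) afn_pt /=.
have [a0|a0] := eqVneq (afn phi t.1.1) 0; last first.
  have h : 0 < (1 - co1 t z - co2 t z) * afn phi t.1.1.
    by rewrite mulr_gt0//; [lra|rewrite lt0r a0].
  by rewrite addrAC -addrA ltr_pwDl// addr_ge0// mulr_ge0// ltW.
have [b0|b0] := eqVneq (afn phi t.1.2) 0; last first.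
  rewrite a0 mulr0 add0r ltr_pwDl//; last exact: mulr_ge0 (ltW z2) c.
  by rewrite pmulr_rgt0// lt0r b0.
rewrite a0 b0 !mulr0 !add0r pmulr_rgt0// lt0r c andbT.
apply: contraTneq p0 => c0; rewrite /afnz negb_or !negbK.
(* Cramer's rule recovers the gradient of [phi] from the differences of its values at the vertices;
   here it would be zero. *)
have E1 : phi.1.1 * det t = 0.
  rewrite (_ : _ * _ = (afn phi t.1.2 - afn phi t.1.1) * (t.2.2 - t.1.1.2) -
    (afn phi t.2 - afn phi t.1.1) * (t.1.2.2 - t.1.1.2)).
    by rewrite a0 b0 c0 !subrr !mul0r subrr.
  by rewrite /afn /det; ring.
have E2 : phi.1.2 * det t = 0.
  rewrite (_ : _ * _ = (afn phi t.2 - afn phi t.1.1) * (t.1.2.1 - t.1.1.1) -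
    (afn phi t.1.2 - afn phi t.1.1) * (t.2.1 - t.1.1.1)).
    by rewrite a0 b0 c0 !subrr !mul0r subrr.
  by rewrite /afn /det; ring.
by move/eqP: E1; move/eqP: E2; rewrite !mulf_eq0 (negPf t0) !orbF => -> ->.
Qed.

Lemma afn_le_tint phi t z : det t != 0 -> afnz phi -> afn_le phi t -> tint t z ->
  afn phi z < 0.
Proof.
move=> t0 p0 /and3P[a b c] tz; rewrite -oppr_gt0 -afn_opa.
apply: afn_ge_tint tz => //; first by rewrite /afnz /= !oppr_eq0.
by apply/and3P; rewrite !afn_opa !oppr_ge0.
Qed.

Lemma sep_tint t t' z : det t != 0 -> det t' != 0 -> sep t t' -> tint t z ->
  ~ tint t' z.
Proof.
move=> t0 t0' [phi [p0 p1 p2]] tz tz'.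
by have := lt_trans (afn_ge_tint t0 p0 p1 tz) (afn_le_tint t0' p0 p2 tz'); rewrite ltxx.
Qed.

Lemma sep_hull_tint t t' z : det t' != 0 -> sep t t' -> hull t z ->
  ~ tint t' z.
Proof.
move=> t0' [phi [p0 p1 p2]] tz tz'.
by have := le_lt_trans (afn_ge_hull p1 tz) (afn_le_tint t0' p0 p2 tz'); rewrite ltxx.
Qed.

(** Pairwise separation over positions of the list: as a nondegenerate triangle is not separated
    from itself, it cannot occur twice. *)
Fixpoint psep (s : seq (triple R)) : Prop :=
  if s is t :: s' then (forall t', t' \in s' -> sep t t') /\ psep s' else True.

Lemma psep_cat s1 s2 : psep (s1 ++ s2) <-> [/\ psep s1, psep s2 &
  forall t1 t2, t1 \in s1 -> t2 \in s2 -> sep t1 t2].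
Proof.
elim: s1 => [|t s1 IH] /=; first by split=> [|[]].
split=> [[h1 /IH[h2 h3 h4]]|[[h1 h2] h3 h4]].
  split => //; first by split=> // t' t's; apply: h1; rewrite mem_cat t's.
  move=> t1 t2; rewrite inE => /orP[/eqP->|/h4]; last exact.
  by move=> t2s; apply: h1; rewrite mem_cat t2s orbT.
split; last by apply/IH; split=> // t1 t2 t1s; apply: h4; rewrite inE t1s orbT.
move=> t'; rewrite mem_cat => /orP[/h1//|t's]; apply: h4 => //.
by rewrite inE eqxx.
Qed.

Lemma psep_flatten (I : eqType) (g : I -> triple R) (f : I -> seq (triple R)) (s : seq I) :
  psep (map g s) -> (forall i, i \in s -> psep (f i)) ->
  (forall i t, i \in s -> t \in f i -> hull t `<=` hull (g i)) ->
  psep (flatten (map f s)).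
Proof.
elim: s => [//|i s IH] /= [h1 h2] h3 h4; apply/psep_cat; split.
- by apply: h3; rewrite inE eqxx.
- by apply: IH => // [j js|j t js]; [apply: h3|apply: h4]; rewrite inE js orbT.
move=> t1 t2 t1i /flatten_mapP[j js t2j].
apply: (@sep_sub (g i) (g j)); [|by apply: h4 => //; rewrite inE js orbT|].
  by apply: h4 => //; rewrite inE eqxx.
by apply: h1; exact: map_f.
Qed.

Lemma psep_filter (p : pred (triple R)) s : psep s -> psep [seq t <- s | p t].
Proof.
elim: s => //= t s IH [h1 h2]; case: ifP => pt; last exact: IH.
by split; [move=> t'; rewrite mem_filter => /andP[_ /h1]|exact: IH].
Qed.

Local Open Scope ereal_scope.

(** A lower sum stays below the integral: the domain loses one open triangle at each step of the
    induction. Open triangles are removed because separated closed ones may still share sides. It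
    serves both for areas and for the comparison of the discrete weights with the integral of the
    shape function. *)
Lemma sum_tint_le_integral (I : eqType) (g : I -> triple R) (k : I -> R) (s : seq I)
    (D : set (R * R)) (F : R * R -> \bar R) :
  (forall i, i \in s -> (0 <= k i)%R) ->
  measurable (D : set RR) -> measurable_fun (D : set RR) (F : RR -> \bar R) ->
  (forall z, D z -> 0 <= F z) ->
  psep (map g s) -> (forall i, i \in s -> det (g i) != 0%R) ->
  (forall i, i \in s -> tint (g i) `<=` D) ->
  (forall i z, i \in s -> tint (g i) z -> (k i)%:E <= F z) ->
  \sum_(i <- s) ((area (g i)) * k i)%:E <= \int[leb2]_(z in D) F z.
Proof.
elim: s D => [|i s IH] D k0 mD mF F0 /=.
  by move=> *; rewrite big_nil; apply: integral_ge0.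
move=> [h1 h2] nd sub le; rewrite big_cons.
have id : i \in i :: s by rewrite inE eqxx.
have sd j : j \in s -> j \in i :: s by move=> js; rewrite inE js orbT.
have mi := measurable_tint (g i).
have mDi : measurable ((D `\` tint (g i)) : set RR) by exact: measurableD.
have DE : D = tint (g i) `|` (D `\` tint (g i)).
  by rewrite setDUK//; exact: sub.
have -> : \int[leb2]_(z in D) F z = \int[leb2]_(z in tint (g i)) F z +
    \int[leb2]_(z in D `\` tint (g i)) F z.
  rewrite {1}DE ge0_integral_setU// -?DE//.
  by rewrite disj_set2E setDIK.
apply: leeD.
  rewrite mulrC EFinM -leb2_tint ?nd// -integral_cst//.
  apply: ge0_le_integral => //.
  - by move=> z _ /=; rewrite lee_fin k0.
  - by apply: measurable_funS mF => //; exact: sub.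
  - by move=> z; exact: le.
apply: IH => //.
- by move=> j /sd; exact: k0.
- by apply: measurable_funS mF => //; exact: subDsetl.
- by move=> z [Dz _]; exact: F0.
- by move=> j /sd; exact: nd.
- move=> j js z jz; split; first exact: (sub _ (sd _ js)).
  move=> iz; have := h1 _ (map_f g js); move=> /sep_tint; apply; [exact: nd| |exact: iz|exact: jz].
  by apply: nd; exact: sd.
- by move=> j z /sd; exact: le.
Qed.

Lemma sum_area_le (s : seq (triple R)) (D : set (R * R)) :
  measurable (D : set RR) -> psep s -> (forall t, t \in s -> det t != 0%R) ->
  (forall t, t \in s -> hull t `<=` D) ->
  \sum_(t <- s) (area t)%:E <= leb2 D.
Proof.
move=> mD hs nd sub.
have -> : leb2 D = \int[leb2]_(z in D) cst 1 z by rewrite integral_cst// mul1e.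
have := @sum_tint_le_integral _ id (fun=> 1%R) s D (cst 1).
under eq_bigr do rewrite mulr1.
apply => //; first by rewrite map_id.
by move=> t ts z /(tint_hull (nd _ ts)); exact: sub.
Qed.

End separation.

(** * Norms of errors over a triangle *)

Section lp_error.
Context {R : realType}.
Notation RR := (measurableTypeR R * measurableTypeR R)%type.
Notation leb2' := (leb2 : {measure set RR -> \bar R}).
Implicit Types (t : triple R) (g h : R * R -> R) (p : \bar R) (r : R).
Local Open Scope ereal_scope.

Definition nrm p t g : \bar R := normLp p (hull t) (fun z => (g z)%:E).

Lemma err_loc_nrm m p t g : det t != 0%R -> err_loc m p (mkT t) g = nrm p t (eI m t g).
Proof. by move=> t0; rewrite /err_loc tri_mkT. Qed.

(** Comes from the definition of the integral as a supremum over simple functions below the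
    integrand, and so applies to errors of an arbitrary function. *)
Lemma integral_mono (D : set (R * R)) (F G : R * R -> \bar R) :
  (forall z, D z -> 0 <= F z) -> (forall z, D z -> F z <= G z) ->
  \int[leb2']_(z in D) F z <= \int[leb2']_(z in D) G z.
Proof.
move=> F0 FG; have G0 z : D z -> 0 <= G z by move=> Dz; exact: le_trans (F0 _ Dz) (FG _ Dz).
rewrite !ge0_integralE//; apply: ereal_sup_le => _ [h hF <-]; exists h => // z.
rewrite (le_trans (hF z))// /patch; case: ifPn => // zD; apply: FG.
by rewrite inE in zD.
Qed.

Lemma nrm_fin r t g : (0 < r)%R ->
  nrm r%:E t g = (\int[leb2']_(z in hull t) (`|g z| `^ r)%:E) `^ r^-1.
Proof.
move=> r0; rewrite /nrm /normLp unlock /=; congr (_ `^ _).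
rewrite [RHS]integral_mkcond; apply: eq_integral => z _.
by rewrite /patch; case: ifP => // _; rewrite abse0 poweR0r// gt_eqF.
Qed.

Lemma leb2T_gt0 : 0 < leb2' [set: RR].
Proof. exact: (@open_leb2_gt0 _ setT (0, 0)%R openT). Qed.

Lemma nrm_infty t g : nrm +oo t g = ess_sup leb2' (fun z => `|((fun z => (g z)%:E) \_ (hull t)) z|).
Proof. by rewrite /nrm /normLp unlock leb2T_gt0. Qed.

Lemma nrm_ge0 p t g : 0 <= nrm p t g.
Proof. exact: Lnorm_ge0. Qed.

Lemma le_nrm p t g h : 1 <= p -> (forall z, hull t z -> (`|g z| <= `|h z|)%R) ->
  nrm p t g <= nrm p t h.
Proof.
case: p => [r|_|//].
  rewrite lee_fin => r1 gh; have r0 : (0 < r)%R by rewrite (lt_le_trans _ r1).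
  rewrite !nrm_fin//; apply: gt0_ler_poweR.
  - by rewrite invr_ge0 ltW.
  - by rewrite in_itv /= leey andbT integral_ge0// => z _; rewrite lee_fin powR_ge0.
  - by rewrite in_itv /= leey andbT integral_ge0// => z _; rewrite lee_fin powR_ge0.
  apply: integral_mono => z tz; first by rewrite lee_fin powR_ge0.
  by rewrite lee_fin ge0_ler_powR ?nnegrE// ?gh// ltW.
move=> gh; rewrite !nrm_infty; apply: le_ess_sup; apply: nearW => z.
by rewrite /patch; case: ifPn => // zt; rewrite lee_fin gh// -in_setE.
Qed.

(** The [L^p] norm of the constant 1 on [t]; for [p = +oo] the exponent [fine p^-1] is 0 and the
    value is 1. *)
Definition ap p t : R := (area t `^ fine p^-1)%R.

Lemma ap_ge0 p t : (0 <= ap p t)%R.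
Proof. exact: powR_ge0. Qed.

Lemma nrm_cst p t (c : R) : 1 <= p -> det t != 0%R -> (0 <= c)%R ->
  nrm p t (fun=> c) <= (c * ap p t)%:E.
Proof.
move=> + t0 c0; case: p => [r|_|//].
  rewrite lee_fin => r1; have r0 : (0 < r)%R by rewrite (lt_le_trans _ r1).
  rewrite nrm_fin//= integral_cst; last exact: measurable_hull.
  rewrite areaE// -EFinM poweR_EFin lee_fin.
  rewrite powRM ?powR_ge0//; last by rewrite ltW// area_gt0.
  by rewrite -powRrM divff ?gt_eqF// powRr1// /ap inver gt_eqF// ger0_norm.
rewrite nrm_infty /ap /= powRr0 mulr1; apply/ess_supP; apply: nearW => z.
by rewrite /patch; case: ifP => _; rewrite ?abse0 ?lee_fin// ger0_norm.
Qed.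

Lemma measurable_patch t g : det t != 0%R -> measurable_fun setT (g : RR -> R) ->
  measurable_fun setT ((g \_ (hull t))%R : RR -> R).
Proof.
move=> t0 mg; have := (measurable_restrictT (g : RR -> R) (measurable_hull t0)).1; apply.
exact: (measurable_funTS mg).
Qed.

(** The error [g] of [f] is first dominated pointwise; Minkowski's inequality is then applied to
    [|h|], the error of a polynomial, and to a constant. *)
Lemma nrmD p t g h (c : R) : 1 <= p -> det t != 0%R -> (0 <= c)%R ->
  measurable_fun setT (h : RR -> R) ->
  (forall z, hull t z -> (`|g z| <= `|h z| + c)%R) ->
  nrm p t g <= nrm p t h + (c * ap p t)%:E.
Proof.
move=> p1 t0 c0 mh gh.
apply: (@le_trans _ _ (nrm p t (fun z => `|h z| + c)%R)).
  by apply: le_nrm => // z tz; rewrite [leRHS]ger0_norm ?addr_ge0// gh.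
apply: (@le_trans _ _ (nrm p t (fun z => `|h z|)%R + nrm p t (fun=> c))); last first.
  by apply: leeD; [apply: le_nrm => // z _; rewrite normr_id|exact: nrm_cst].
have E f : nrm p t f = Lnorm leb2' p (EFin \o (f \_ (hull t))%R).
  apply: eq_Lnorm => z; rewrite /patch/=.
  by case: ifP.
rewrite !E.
have -> : ((fun z : R * R => `|h z| + c) \_ (hull t))%R =
    (((fun z : R * R => `|h z|) \_ (hull t)) \+ ((fun=> c) \_ (hull t)))%R.
  by apply/funext => z; rewrite /patch/=; case: ifP => // _; rewrite addr0.
apply: eminkowski => //; apply: measurable_patch => //.
exact: measurableT_comp.
Qed.

Lemma integral_affine (b : R * R) (l : R) (D : set (R * R)) (F : R * R -> \bar R) :
  l != 0%R -> measurable (D : set RR) -> measurable_fun setT (F : RR -> \bar R) ->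
  (forall z, 0 <= F z) ->
  \int[leb2']_(z in (fun z : R * R => b + l *: z)%R @` D) F z =
  (l ^+ 2)%:E * \int[leb2']_(z in D) F (b + l *: z)%R.
Proof.
move=> l0 mD mF F0; have l2 : (0 < l ^+ 2)%R by rewrite exprn_even_gt0.
have mf := measurable_affine b l.
set phi := (fun z : R * R => b + l *: z)%R.
have imE : phi @` D = (fun z : R * R => (- (l^-1 *: b) + l^-1 *: z)%R) @^-1` D.
  apply/seteqP; split=> [_ [z Dz <-]|z Dz] /=.
    by rewrite scalerDr scalerA mulVf// scale1r addKr.
  exists (- (l^-1 *: b) + l^-1 *: z)%R => //.
  by rewrite /phi scalerDr scalerN !scalerA divff// !scale1r addrA subrr add0r.
have mD' : measurable (phi @` D : set RR).
  rewrite imE -[X in measurable X]setTI.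
  by have /(_ measurableT D mD) := measurable_affine (- (l^-1 *: b))%R l^-1.
pose push := measure_function_pushforward__canonical__measure_function_Measure leb2' mf.
pose nu : {measure set RR -> \bar R} := mscale (NngNum (ltW l2)) push.
rewrite (@eq_measure_integral _ _ _ _ nu); last first.
  move=> A mA _; rewrite /nu /= /mscale /= /pushforward leb2_preimage//.
  by rewrite muleA -EFinM divff ?gt_eqF// mul1e.
rewrite /nu ge0_integral_mscale; [|exact: mD'|exact: measurable_funTS|by []].
suff E : \int[push]_(x in phi @` D) F x = \int[leb2']_(z in D) F (phi z) by rewrite E.
transitivity (\int[leb2']_(x in phi @^-1` (phi @` D)) (F \o phi) x).
  by apply: (ge0_integral_pushforward mf _ mD') => //; exact: measurable_funTS.
rewrite (_ : phi @^-1` _ = D)//; apply/seteqP; split=> z.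
  by move=> [w Dw /addrI/(scalerI l0) <-].
by move=> Dz; exists z.
Qed.

Lemma negligible_affine (b : R * R) (l : R) (P Q : set (R * R)) : l != 0%R ->
  (forall z, ~ P (b + l *: z)%R -> ~ Q z) ->
  {ae leb2', forall z, Q z} -> {ae leb2', forall z, P z}.
Proof.
move=> l0 PQ [N [mN N0 QN]].
exists ((fun z : R * R => (- (l^-1 *: b) + l^-1 *: z)%R) @^-1` N); split.
- rewrite -[X in measurable X]setTI.
  by have /(_ measurableT N mN) := measurable_affine (- (l^-1 *: b))%R l^-1.
- by rewrite leb2_preimage ?invr_neq0// N0 mule0.
- move=> z nP; apply: QN => /=; apply: PQ.
  by rewrite scalerDr scalerN !scalerA divff// !scale1r addrA subrr add0r.
Qed.

Lemma nrm_tmap p t b (l k : R) g h : 1 <= p -> det t != 0%R -> l != 0%R -> (0 <= k)%R ->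
  measurable_fun setT (g : RR -> R) -> measurable_fun setT (h : RR -> R) ->
  (forall z, h (b + l *: z) = k * g z)%R ->
  nrm p (tmap b l t) h <= (k * ((l ^+ 2) `^ fine p^-1))%:E * nrm p t g.
Proof.
move=> p1 t0 l0 k0 mg mh hg; have l2 : (0 < l ^+ 2)%R by rewrite exprn_even_gt0.
case: p p1 => [r|_|//].
  rewrite lee_fin => r1; have r0 : (0 < r)%R by rewrite (lt_le_trans _ r1).
  rewrite !nrm_fin// hull_tmapE (integral_affine b l0 (measurable_hull t0)); last 2 first.
  - apply/measurable_EFinP; apply: (@measurableT_comp _ _ _ _ _ _ (@powR R ^~ r)) => //.
    exact: measurableT_comp.
  - by move=> z; rewrite lee_fin powR_ge0.
  have I0 : 0 <= \int[leb2']_(z in hull t) (`|g z| `^ r)%:E.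
    by apply: integral_ge0 => z _; rewrite lee_fin powR_ge0.
  rewrite (_ : \int[leb2']_(z in hull t) (`|h (b + l *: z)%R| `^ r)%:E =
     (k `^ r)%:E * \int[leb2']_(z in hull t) (`|g z| `^ r)%:E); last first.
    rewrite -ge0_integralZl_EFin ?powR_ge0//; last 2 first.
    - exact: (measurable_hull t0).
    - apply: measurable_funTS; apply/measurable_EFinP.
      apply: (@measurableT_comp _ _ _ _ _ _ (@powR R ^~ r)) => //.
      exact: measurableT_comp.
    by apply: eq_integral => z _; rewrite hg normrM (ger0_norm k0) powRM// EFinM.
  rewrite poweRM ?mule_ge0 ?lee_fin ?powR_ge0 ?(ltW l2)//.
  rewrite poweRM ?lee_fin ?powR_ge0// !poweR_EFin -powRrM divff ?gt_eqF//.
  by rewrite powRr1// muleA -EFinM mulrC inver gt_eqF.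
rewrite /= powRr0 mulr1 !nrm_infty; apply/ess_supP.
set E := ess_sup _ _.
apply: (@negligible_affine b l _ (fun z => `|((fun z => (g z)%:E) \_ (hull t)) z| <= E)) => //;
  last exact: ess_sup_ge.
move=> z; apply: contra_not => gE.
have E0 : 0 <= E by have := nrm_ge0 +oo t g; rewrite nrm_infty.
rewrite /patch; case: ifPn => [|_]; last by rewrite abse0 mule_ge0// lee_fin.
rewrite inE hull_tmapE => -[w tw /addrI/(scalerI l0) wz]; move: gE.
rewrite /patch mem_set -?wz// wz hg /= => gE.
by rewrite normrM (ger0_norm k0) EFinM lee_wpmul2l ?lee_fin.
Qed.

(** By continuity, a value above the essential supremum would be exceeded on an open set meeting the
    interior of [t], hence on a set of positive measure. It supplies the pointwise bound that
    [eI_flat] asks for. *)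
Lemma norm_le_nrm_infty d t g z : polys d g -> det t != 0%R -> hull t z ->
  `|g z|%:E <= nrm +oo t g.
Proof.
move=> dg t0 tz; rewrite leNgt; apply/negP; rewrite nrm_infty; set E := ess_sup _ _ => Eg.
have E0 : 0 <= E by have := nrm_ge0 +oo t g; rewrite nrm_infty.
have Efin : E \is a fin_num.
  by rewrite ge0_fin_numE// (lt_trans Eg)// ltry.
pose U := [set w | fine E < `|g w|]%R.
have oU : open U.
  rewrite /U (_ : [set _ | _] = (fun w => `|g w|%R) @^-1` [set x | fine E < x]%R)//.
  apply: open_comp (@open_gt R (fine E)) => w _.
  by apply: (@continuous_comp _ _ _ g Num.norm); [exact: (@polys_continuous _ _ _ dg w)|exact: norm_continuous].
have Uz : U z by rewrite /U /= -lte_fin fineK.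
have [w [tw Uw]] := hull_closure t0 tz (open_nbhs_nbhs (conj oU Uz)).
have : 0 < leb2' (tint t `&` U).
  by apply: (@open_leb2_gt0 _ _ w); [apply: openI => //; exact: open_tint|split].
have [N [mN N0 EN]] := ess_sup_ge leb2' (fun z => `|((fun z => (g z)%:E) \_ (hull t)) z|).
rewrite ltNge => /negP; apply; rewrite -N0; apply: le_measure; rewrite ?inE//.
  by apply: measurableI; [exact: measurable_tint|exact: open_measurable2].
move=> x [tx Ux]; apply: EN => /=; rewrite /patch mem_set//; last exact: tint_hull.
by apply/negP; rewrite -ltNge -/E -(fineK Efin) lte_fin.
Qed.

End lp_error.

(** * Taylor expansion *)

Section calculus.
Context {R : realType}.
Implicit Types (F : R * R -> R) (z v : R * R).

Lemma is_derive_line F z v (s : R) : derivable F (z + s *: v) v ->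
  is_derive s 1 (fun s : R => F (z + s *: v)) ('D_v F (z + s *: v)).
Proof.
move=> dF; have E : (fun h : R => h^-1 *: (((fun s : R => F (z + s *: v)) \o shift s) (h *: 1) - F (z + s *: v)))
    = (fun h : R => h^-1 *: ((F \o shift (z + s *: v)) (h *: v) - F (z + s *: v))).
  apply/funext => h /=; rewrite /shift /=; congr (_ *: (F _ - _)).
  by rewrite [h *: 1]mulr1 scalerDl addrCA.
by split; rewrite /derivable /derive E.
Qed.

Lemma mvt_line F z v (h : R) :
  (forall s, 0 <= s <= 1 -> derivable F (z + (s * h) *: v) v) ->
  exists2 s, 0 <= s <= 1 & F (z + h *: v) - F z = h * 'D_v F (z + (s * h) *: v).
Proof.
move=> dF; pose g (s : R) := F (z + s *: v).
have dg s : 0 <= s <= 1 -> is_derive (s * h) 1 g ('D_v F (z + (s * h) *: v)).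
  by move=> s01; apply: is_derive_line; exact: dF.
have F0 : F z = g 0 by rewrite /g scale0r addr0.
have [h0|h0|h0] := ltgtP h 0; last first.
- exists 0; first by rewrite lexx ler01.
  by rewrite h0 scale0r addr0 mul0r subrr.
- have h0' : h != 0 by rewrite gt_eqF.
  have dg' c : 0 <= c <= h -> is_derive c 1 g ('D_v F (z + c *: v)).
    move=> /andP[c0 ch]; have ch1 : 0 <= c / h <= 1.
      by rewrite divr_ge0 ?(ltW h0)//= ler_pdivrMr// mul1r.
    by have := dg _ ch1; rewrite (divfK h0').
  have dgi c : c \in `]0, h[ -> is_derive c 1 g ('D_v F (z + c *: v)).
    by rewrite in_itv /= => /andP[c0 ch]; apply: dg'; rewrite !ltW.
  have cg : {within `[0, h], continuous g}.
    by apply: derivable_within_continuous => x; rewrite in_itv /= => /dg'[].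
  have [c + E] := MVT h0 dgi cg.
  rewrite in_itv /= => /andP[c0 ch]; exists (c / h).
    by rewrite divr_ge0 ?(ltW c0) ?(ltW h0)//= ler_pdivrMr// mul1r ltW.
  by rewrite divfK// F0 -/(g h) E subr0 mulrC.
- have h0' : h != 0 by rewrite lt_eqF.
  have dg' c : h <= c <= 0 -> is_derive c 1 g ('D_v F (z + c *: v)).
    move=> /andP[ch c0]; have ch1 : 0 <= c / h <= 1.
      by rewrite mulr_le0 ?invr_le0 ?(ltW h0)//= ler_ndivrMr// mul1r.
    by have := dg _ ch1; rewrite (divfK h0').
  have dgi c : c \in `]h, 0[ -> is_derive c 1 g ('D_v F (z + c *: v)).
    by rewrite in_itv /= => /andP[c0 ch]; apply: dg'; rewrite !ltW.
  have cg : {within `[h, 0], continuous g}.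
    by apply: derivable_within_continuous => x; rewrite in_itv /= => /dg'[].
  have [c + E] := MVT h0 dgi cg.
  rewrite in_itv /= => /andP[ch c0]; exists (c / h).
    by rewrite mulr_le0 ?invr_le0 ?(ltW c0) ?(ltW h0)//= ler_ndivrMr// mul1r ltW.
  rewrite divfK// F0 -/(g h) -opprB E sub0r mulrN opprK mulrC//.
Qed.

Notation e1 := (axis false : R * R).
Notation e2 := (axis true : R * R).

Lemma axisE (a b : R) : a *: e1 + b *: e2 = (a, b).
Proof. by apply: pair_ext; rewrite /= !scaleE; ring. Qed.

Lemma cont_ball (h : R * R -> R) (U : set (R * R)) z (e : R) : open U -> U z ->
  {in U, continuous h} -> 0 < e ->
  exists2 d : R, 0 < d & forall w : R * R, `|z.1 - w.1| < d -> `|z.2 - w.2| < d ->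
    U w /\ `|h w - h z| < e.
Proof.
move=> oU Uz ch e0; have /cvgrPdist_lt/(_ e e0) := ch _ (mem_set Uz).
move=> nh; have : \forall w \near z, U w /\ `|h w - h z| < e.
  near=> w; split; first by near: w; exact: open_nbhs_nbhs.
  by rewrite distrC; near: w.
move=> /nbhs_ballP[d /= d0 dU]; exists d => // w w1 w2; apply: dU.
by split.
Unshelve. all: by end_near. Qed.

Lemma weighted_le (a b x y c : R) : `|x| <= c -> `|y| <= c ->
  `|a * x + b * y| <= (`|a| + `|b|) * c.
Proof.
by move=> xc yc; rewrite (le_trans (ler_normD _ _))// !normrM mulrDl lerD// ler_wpM2l.
Qed.

(** The increment [h *: v] is split into a horizontal and a vertical step. The mean value theorem
    applies to each, and continuity brings both partial derivatives close to their values at [z]. *)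
Lemma derive_continuous_partials F (U : set (R * R)) z v : open U -> U z ->
  (forall b x, U x -> derivable F x (axis b)) ->
  (forall b, {in U, continuous (fun x => 'D_(axis b) F x)}) ->
  is_derive z v F (v.1 * 'D_e1 F z + v.2 * 'D_e2 F z).
Proof.
move=> oU Uz dF cF; set L := _ + _.
suff H : (fun h : R => h^-1 *: ((F \o shift z) (h *: v) - F z)) @ 0^' --> L.
  by split; [apply/cvg_ex; exists L|exact: cvg_lim].
apply/cvgrPdist_le => e e0.
pose V := 1 + (`|v.1| + `|v.2|).
have V0 : 0 < V by rewrite ltr_pwDl// addr_ge0.
have eV : 0 < e / V by rewrite divr_gt0.
have [d1 d10 H1] := cont_ball oU Uz (cF false) eV.
have [d2 d20 H2] := cont_ball oU Uz (cF true) eV.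
near=> h.
have h0 : h != 0 by near: h; exact: nbhs_dnbhs_neq.
have hd : `|h| * V < Num.min d1 d2.
  rewrite -ltr_pdivlMr//; near: h; apply: dnbhs0_lt.
  by rewrite divr_gt0// lt_min d10.
have small s w : 0 <= s <= 1 -> `|w| <= V -> `|s * (h * w)| < Num.min d1 d2.
  move=> /andP[s0 s1] wV; apply: le_lt_trans hd; rewrite !normrM (ger0_norm s0).
  by rewrite (@le_trans _ _ (`|h| * `|w|))// ?ler_wpM2l// ler_piMl// mulr_ge0.
have v1V : `|v.1| <= V by rewrite /V addrCA lerDl// addr_ge0.
have v2V : `|v.2| <= V by rewrite /V addrA lerDr// addr_ge0.
have zE : h *: v + z = (z + (h * v.1) *: e1) + (h * v.2) *: e2.
  by rewrite -addrA axisE addrC; congr (_ + _); apply: pair_ext.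
have P1 s : 0 <= s <= 1 -> forall w, w = z + (s * (h * v.1)) *: e1 ->
    `|z.1 - w.1| < Num.min d1 d2 /\ `|z.2 - w.2| < Num.min d1 d2.
  move=> s01 w ->; rewrite /= !scaleE mulr1 mulr0 addr0 opprD addrA !subrr add0r normrN.
  by rewrite small//= normr0 lt_min d10.
have P2 s : 0 <= s <= 1 -> forall w,
    w = z + (h * v.1) *: e1 + (s * (h * v.2)) *: e2 ->
    `|z.1 - w.1| < Num.min d1 d2 /\ `|z.2 - w.2| < Num.min d1 d2.
  move=> s01 w ->; rewrite /= !scaleE !mulr1 !mulr0 !addr0 !opprD !addrA !subrr !add0r !normrN.
  by rewrite small// -[h * v.1]mul1r small// ler01 lexx.
have [|s s01 E1] := @mvt_line F z e1 (h * v.1).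
  move=> s s01; apply: dF; have [w1 w2] := P1 s s01 _ erefl.
  by move: w1 w2; rewrite !lt_min => /andP[w1 _] /andP[w2 _]; have [] := H1 _ w1 w2.
have [|s' s01' E2] := @mvt_line F (z + (h * v.1) *: e1) e2 (h * v.2).
  move=> x x01; apply: dF; have [w1 w2] := P2 x x01 _ erefl.
  by move: w1 w2; rewrite !lt_min => /andP[w1 _] /andP[w2 _]; have [] := H1 _ w1 w2.
have [] := P1 s s01 _ erefl; rewrite !lt_min => /andP[w1 _] /andP[w2 _].
have [_ B1] := H1 _ w1 w2.
have [] := P2 s' s01' _ erefl; rewrite !lt_min => /andP[_ w3] /andP[_ w4].
have [_ B2] := H2 _ w3 w4.
pose D1 := 'D_e1 F (z + (s * (h * v.1)) *: e1).
pose D2 := 'D_e2 F (z + (h * v.1) *: e1 + (s' * (h * v.2)) *: e2).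
rewrite /= /shift zE.
have -> : h^-1 *: (F (z + (h * v.1) *: e1 + (h * v.2) *: e2) - F z) =
    v.1 * D1 + v.2 * D2.
  rewrite -(subrK (F (z + (h * v.1) *: e1)) (F (_ + _ + _))) -addrA E2 E1 scaleE -/D1 -/D2.
  by field.
rewrite /L.
have -> : v.1 * 'D_e1 F z + v.2 * 'D_e2 F z - (v.1 * D1 + v.2 * D2) =
   - (v.1 * (D1 - 'D_e1 F z) + v.2 * (D2 - 'D_e2 F z)) by ring.
rewrite normrN (le_trans (weighted_le _ _ (ltW B1) (ltW B2)))//.
by rewrite mulrCA ler_piMr ?(ltW e0)// ler_pdivrMr// mul1r /V lerDr.
Unshelve. all: by end_near. Qed.

(** The mean value theorem is used twice: in direction [u] for the difference [G] in direction [v],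
    then in direction [v] for the derivative of [F] along [u]. *)
Lemma second_difference F z u v (h : R) :
  (forall s s', 0 <= s <= 1 -> 0 <= s' <= 1 ->
     derivable F (z + (s * h) *: u + (s' * h) *: v) u /\
     derivable (fun y => 'D_u F y) (z + (s * h) *: u + (s' * h) *: v) v) ->
  exists s s', [/\ 0 <= s <= 1, 0 <= s' <= 1 &
    F (z + h *: u + h *: v) - F (z + h *: v) - (F (z + h *: u) - F z) =
    h * (h * 'D_v (fun y => 'D_u F y) (z + (s * h) *: u + (s' * h) *: v))].
Proof.
move=> dF; pose G (x : R * R) := F (x + h *: v) - F x.
have one : 0 <= (1 : R) <= 1 by rewrite ler01 lexx.
have zero : 0 <= (0 : R) <= 1 by rewrite ler01 lexx.
have dG s : 0 <= s <= 1 -> is_derive (z + (s * h) *: u) u G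
    ('D_u F (z + (s * h) *: u + h *: v) - 'D_u F (z + (s * h) *: u)).
  move=> s01; apply: is_deriveB; last first.
    by apply/derivableP; have := (dF s 0 s01 zero).1; rewrite mul0r scale0r addr0.
  have := (dF s 1 s01 one).1; rewrite mul1r => /derivableP.
  move: (z + _ *: u) => y [dd dv].
  have E : (fun t : R => t^-1 *: (((fun x => F (x + h *: v)) \o shift y) (t *: u) - F (y + h *: v)))
      = (fun t : R => t^-1 *: ((F \o shift (y + h *: v)) (t *: u) - F (y + h *: v))).
    by apply/funext => t; congr (_ *: (F _ - _)); rewrite /shift -addrA.
  by split; rewrite /derivable /derive E.
have [|a a01 Ea] := @mvt_line G z u h; first by move=> s s01; have [] := dG s s01.
have [_ dv] := dG a a01; rewrite dv in Ea.
have [|b b01 Eb] := @mvt_line (fun y => 'D_u F y) (z + (a * h) *: u) v h.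
  by move=> s s01; have [] := dF a s a01 s01.
by exists a, b; split=> //; rewrite -Eb -Ea /G; ring.
Qed.

Lemma second_difference_sym (a b c d h X Y : R) : h != 0 ->
  a - b - (c - d) = h * (h * X) -> a - c - (b - d) = h * (h * Y) -> X = Y.
Proof.
move=> h0 E1 E2; apply: (mulfI h0); apply: (mulfI h0); rewrite -E1 -E2; ring.
Qed.

Lemma dist_halves (a b X Y e : R) : `|X - a| < e / 2 -> `|Y - b| < e / 2 ->
  X = Y -> `|a - b| < e.
Proof.
move=> h1 h2 XY; rewrite -XY in h2; rewrite [ltRHS]splitr -(subrKA X).
by rewrite (le_lt_trans (ler_normD _ _))// ltrD// distrC.
Qed.

(* Both mixed derivatives are limits of the same second difference quotient. *)
Lemma schwarz F (U : set (R * R)) z : open U -> U z ->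
  (forall b x, U x -> derivable F x (axis b)) ->
  (forall b b' x, U x -> derivable (fun y => 'D_(axis b) F y) x (axis b')) ->
  (forall b b', {in U, continuous (fun x => 'D_(axis b') (fun y => 'D_(axis b) F y) x)}) ->
  'D_e2 (fun y => 'D_e1 F y) z = 'D_e1 (fun y => 'D_e2 F y) z.
Proof.
move=> oU Uz dF ddF cF.
pose A := 'D_e2 (fun y => 'D_e1 F y); pose B := 'D_e1 (fun y => 'D_e2 F y).
apply/eqP; rewrite -subr_eq0 -normr_le0 leNgt.
apply/negP => AB; set e := `|A z - B z| in AB.
have e2' : 0 < e / 2 by rewrite divr_gt0.
have [d1 d10 H1] := cont_ball oU Uz (cF false true) e2'.
have [d2 d20 H2] := cont_ball oU Uz (cF true false) e2'.
have [h [h0 hd1 hd2]] : exists h, [/\ 0 < h, h < d1 & h < d2].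
  have m0 : 0 < Num.min d1 d2 by rewrite lt_min d10.
  exists (Num.min d1 d2 / 2); rewrite divr_gt0//.
  have : Num.min d1 d2 / 2 < Num.min d1 d2 by lra.
  by move: (_ / 2) => x; rewrite lt_min => /andP[].
have box (s s' : R) : 0 <= s <= 1 -> 0 <= s' <= 1 -> forall w,
    w = z + (s * h) *: e1 + (s' * h) *: e2 ->
    [/\ `|z.1 - w.1| < d1, `|z.2 - w.2| < d1, `|z.1 - w.1| < d2 & `|z.2 - w.2| < d2].
  move=> /andP[s0 s1] /andP[s0' s1'] w ->.
  rewrite /= !scaleE !mulr1 !mulr0 !addr0 !opprD !addrA !subrr !add0r !normrN.
  rewrite (ger0_norm (mulr_ge0 s0 (ltW h0))) (ger0_norm (mulr_ge0 s0' (ltW h0))).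
  have l1 : s * h <= h by exact: ler_piMl (ltW h0) s1.
  have l2 : s' * h <= h by exact: ler_piMl (ltW h0) s1'.
  by split; [exact: le_lt_trans l1 _|exact: le_lt_trans l2 _|
    exact: le_lt_trans l1 _|exact: le_lt_trans l2 _].
have UB (s s' : R) : 0 <= s <= 1 -> 0 <= s' <= 1 -> U (z + (s * h) *: e1 + (s' * h) *: e2).
  by move=> s01 s01'; have [w1 w2 _ _] := box _ _ s01 s01' _ erefl; have [] := H1 _ w1 w2.
have [|a [b [a01 b01 E1]]] := @second_difference F z e1 e2 h.
  by move=> s s' s01 s01'; split; [apply: dF|apply: ddF]; exact: UB.
have [|c [d [c01 d01 E2]]] := @second_difference F z e2 e1 h.
  by move=> s s' s01 s01'; rewrite addrAC; split; [apply: dF|apply: ddF]; exact: UB.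
have [w1 w2 _ _] := box _ _ a01 b01 _ erefl; have [_ B1] := H1 _ w1 w2.
have [_ _ w3 w4] := box _ _ d01 c01 _ erefl; have [_ B2] := H2 _ w3 w4.
move: B1 B2 E1 E2; rewrite [z + (c * h) *: e2 + _]addrAC [z + h *: e2 + _]addrAC.
set X := 'D_e2 (fun y => 'D_e1 F y) (z + _ + _).
set Y := 'D_e1 (fun y => 'D_e2 F y) (z + _ + _).
move=> B1 B2 E1 E2; have XY : X = Y.
  exact: second_difference_sym (lt0r_neq0 h0) E1 E2.
by have := dist_halves B1 B2 XY; rewrite ltxx.
Qed.

Section taylor.
Variables (f : R * R -> R) (U : set (R * R)) (m : nat).
Hypothesis oU : open U.
Hypothesis df : forall w : seq bool, (size w < m)%N -> forall b z, U z ->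
  derivable (partials w f) z (axis b).
Hypothesis cf : forall w : seq bool, (size w <= m)%N -> {in U, continuous (partials w f)}.

Lemma partials_swap (w : seq bool) z : ((size w).+2 <= m)%N -> U z ->
  partials (true :: false :: w) f z = partials (false :: true :: w) f z.
Proof.
move=> wm Uz /=; apply: (@schwarz _ U) => //.
- by move=> b x Ux; apply: df => //; exact: ltnW.
- by move=> b b' x Ux; apply: (df (w := b :: w)).
- by move=> b b'; apply: (cf (w := [:: b', b & w])).
Qed.

Lemma near_partials b (F G : R * R -> R) : (forall z, U z -> F z = G z) ->
  forall z, U z -> 'D_(axis b) F z = 'D_(axis b) G z.
Proof.
move=> FG z Uz; apply: near_eq_derive.
by near=> w; apply: FG; near: w; exact: open_nbhs_nbhs.
Unshelve. all: by end_near. Qed.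

Lemma partials_true a (w : seq bool) z : (a + (size w).+1 <= m)%N -> U z ->
  partials (true :: nseq a false ++ w) f z = partials (nseq a false ++ true :: w) f z.
Proof.
elim: a z => [//|a IH] z; rewrite addSn => am Uz.
have -> : nseq a.+1 false ++ w = false :: (nseq a false ++ w) by [].
rewrite partials_swap//; last first.
  by rewrite size_cat size_nseq -addnS.
rewrite [LHS]/('D__ _ _) [RHS]/('D__ _ _); apply: near_partials Uz => x Ux.
by apply: IH => //; exact: ltnW.
Qed.

Lemma count_false_true (w : seq bool) : (count_mem false w + count_mem true w = size w)%N.
Proof. by elim: w => //= -[] w; rewrite ?add0n ?add1n ?addnS ?addSn => ->. Qed.

(** Repeated exchange of mixed derivatives brings every word to the sorted form that appears in
    [dmf]; the equalities hold on an open set and can therefore be differentiated again. *)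
Lemma partials_sort (w : seq bool) z : (size w <= m)%N -> U z ->
  partials w f z =
  partials (nseq (count_mem false w) false ++ nseq (count_mem true w) true) f z.
Proof.
elim: w z => [//|b w IH] z wm Uz.
have sw : (count_mem false w + (count_mem true w).+1 <= m)%N.
  by rewrite addnS count_false_true.
have H x : U x -> partials w f x = partials (nseq (count_mem false w) false ++
    nseq (count_mem true w) true) f x by move=> Ux; apply: IH => //; exact: ltnW.
transitivity ('D_(axis b) (partials w f) z) => //; rewrite (@near_partials b _ _ H z Uz).
case: b wm => wm; last by [].
apply: (@partials_true _ (nseq (count_mem true w) true) z _ Uz).
by rewrite size_nseq.
Qed.

Definition Gp a b z := partials (nseq a false ++ nseq b true) f z.

(** The [j]-th derivative of [partials w f] in direction [v], expanded into partial derivatives so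
    that it is visibly a polynomial in [v]. *)
Fixpoint dirs v j (w : seq bool) z : R :=
  if j is j'.+1 then v.1 * dirs v j' (false :: w) z + v.2 * dirs v j' (true :: w) z
  else partials w f z.

Lemma is_derive_dirs v j w z : (size w + j < m)%N -> U z ->
  is_derive z v (dirs v j w) (dirs v j.+1 w z).
Proof.
elim: j w => [|j IH] w wjm Uz.
  rewrite addn0 in wjm; apply: (@derive_continuous_partials _ U) => //.
    by move=> b x Ux; exact: df.
  by move=> b; apply: (cf (w := b :: w)).
rewrite addnS in wjm.
by apply: is_deriveD; apply: is_deriveZ; apply: IH; rewrite //= addSn.
Qed.

Lemma dirs_binom v j w z : (size w + j <= m)%N -> U z -> dirs v j w z =
  \sum_(k < j.+1) 'C(j, k)%:R * (v.1 ^+ k * v.2 ^+ (j - k) *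
    Gp (k + count_mem false w) (j - k + count_mem true w) z).
Proof.
elim: j w => [|j IH] w wjm Uz.
  rewrite addn0 in wjm; rewrite big_ord1 /= bin0 subnn !expr0 !mul1r.
  exact: partials_sort.
rewrite addnS in wjm; rewrite /= !IH//= ?addSn//.
pose T k := v.1 ^+ k * v.2 ^+ (j.+1 - k) *
  Gp (k + count_mem false w) (j.+1 - k + count_mem true w) z.
have -> : v.1 * (\sum_(k < j.+1) 'C(j, k)%:R * (v.1 ^+ k * v.2 ^+ (j - k) *
    Gp (k + (1 + count_mem false w)) (j - k + (0 + count_mem true w)) z)) =
    \sum_(k < j.+1) 'C(j, k)%:R * T k.+1.
  rewrite mulr_sumr; apply: eq_bigr => k _; rewrite /T subSS exprS !addnA addn1 addn0.
  by ring.
have -> : v.2 * (\sum_(k < j.+1) 'C(j, k)%:R * (v.1 ^+ k * v.2 ^+ (j - k) *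
    Gp (k + (0 + count_mem false w)) (j - k + (1 + count_mem true w)) z)) =
    \sum_(k < j.+1) 'C(j, k)%:R * T k.
  rewrite mulr_sumr; apply: eq_bigr => k _; rewrite /T subSn -1?ltnS// exprS !addnA.
  by rewrite addn1 addn0; ring.
rewrite -/(T _) [RHS]big_ord_recl /= bin0 mul1r.
rewrite [X in _ + X = _]big_ord_recl /= bin0 mul1r addrCA; congr (_ + _).
rewrite [X in _ + X = _](_ : _ = \sum_(k < j.+1) 'C(j, k.+1)%:R * T k.+1).
  rewrite -big_split; apply: eq_bigr => k _ /=.
  by rewrite -mulrDl -natrD addnC -binS.
by rewrite [RHS]big_ord_recr /= bin_small// mul0r addr0.
Qed.

End taylor.

Lemma is_derive_scale (F : R -> R) (a s d : R) : is_derive s 1 F d ->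
  is_derive s 1 (fun x => a * F x) (a * d).
Proof. by move=> H; have := @is_deriveZ R R^o R^o F a s 1 d H. Qed.

Lemma is_derive_sumr n (F : nat -> R -> R) (a d : nat -> R) (s : R) :
  (forall i, is_derive s 1 (F i) (d i)) ->
  is_derive s 1 (fun x => \sum_(i < n) a i * F i x) (\sum_(i < n) a i * d i).
Proof.
move=> H; elim: n => [|n IH].
  rewrite big_ord0 (_ : (fun x => _) = cst 0); first exact: is_derive_cst.
  by apply/funext => x; rewrite big_ord0.
rewrite big_ord_recr /=.
rewrite (_ : (fun x => _) = (fun x => \sum_(i < n) a i * F i x) \+ (fun x => a n * F n x)).
  by apply: is_deriveD => //; exact: is_derive_scale.
by apply/funext => x; rewrite big_ord_recr.
Qed.

Lemma taylor1 (m : nat) (h : nat -> R -> R) (c B : R) :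
  (forall j (t : R), (j < m)%N -> 0 <= t <= 1 -> is_derive t 1 (h j) (h j.+1 t)) ->
  (forall t, 0 <= t <= 1 -> `|h m t - c| <= B) -> forall t, 0 <= t <= 1 ->
  `|h 0%N t - \sum_(j < m) h j 0 * (t ^+ j / j`!%:R) - c * (t ^+ m / m`!%:R)| <= B.
Proof.
elim: m h => [|m IH] h dh hB t t01.
  by rewrite big_ord0 subr0 expr0 divr1 mulr1; exact: hB.
pose g (s : R) := h 0%N s - \sum_(j < m.+1) h j 0 * (s ^+ j / j`!%:R) - c * (s ^+ m.+1 / m.+1`!%:R).
pose g' (s : R) := h 1%N s - \sum_(j < m) h j.+1 0 * (s ^+ j / j`!%:R) - c * (s ^+ m / m`!%:R).
have mono k (s : R) : is_derive s 1 (fun s : R => s ^+ k.+1 / k.+1`!%:R) (s ^+ k / k`!%:R).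
  have H : is_derive s 1 ((@id R) ^+ k.+1) ((k.+1%:R * s ^+ k) *: 1).
    by apply: is_deriveX.
  have := @is_deriveZ R R^o R^o _ (k.+1`!%:R^-1) s 1 _ H.
  rewrite !scaleE mulr1 factS natrM invfM -mulrA [_ * (_ * s ^+ k)]mulrCA mulKf ?pnatr_eq0//.
  rewrite [_ * s ^+ k]mulrC; congr (is_derive _ _ _ _).
  by apply/funext => x; rewrite exprfctE; exact: mulrC.
have dg (s : R) : 0 <= s <= 1 -> is_derive s 1 g (g' s).
  move=> s01; have D0 := dh 0%N s isT s01.
  have D2 := is_derive_scale c (mono m s).
  have D1 := @is_derive_sumr m (fun j x => x ^+ j.+1 / j.+1`!%:R) (fun j => h j.+1 0)
    (fun j => s ^+ j / j`!%:R) s (fun j => mono j s).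
  have := is_deriveB (is_deriveB D0 (is_deriveD (is_derive_cst (h 0%N 0) s 1) D1)) D2.
  rewrite add0r; congr (is_derive _ _ _ _); apply/funext => x.
  by rewrite /g big_ord_recl /= expr0 divr1 mulr1.
have g0 : g 0 = 0.
  rewrite /g big_ord_recl /= expr0 divr1 mulr1 big1 => [|j _].
    by rewrite addr0 subrr expr0n mul0r mulr0 subr0.
  by rewrite expr0n mul0r mulr0.
have g'B s : 0 <= s <= 1 -> `|g' s| <= B.
  by move=> s01; apply: (IH (fun j => h j.+1)) => // j x jm; exact: dh.
have /andP[t0 t1] := t01.
have [s sI] : exists2 s, s \in `[0, t] & g t - g 0 = g' s * (t - 0).
  apply: MVT_segment => // [x|].
    by rewrite in_itv /= => /andP[x0 xt]; apply: dg; rewrite (ltW x0) (le_trans (ltW xt)).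
  apply: derivable_within_continuous => x; rewrite in_itv /= => /andP[x0 xt].
  by have [] := dg x; rewrite ?x0 ?(le_trans xt).
move: sI; rewrite in_itv /= => /andP[s0 st]; rewrite g0 !subr0 => gt.
rewrite -/(g t) gt normrM (ger0_norm t0).
have := g'B s; rewrite s0 (le_trans st)// => /(_ isT) h1.
by rewrite (le_trans (ler_piMr _ t1)).
Qed.

End calculus.

Section smooth.
Context {R : realType}.
Implicit Types (f : R * R -> R) (Omega : set (R * R)).

Lemma Cm_interior m Omega f : Cm m Omega f ->
  (forall w : seq bool, (size w < m)%N -> forall b z, Omega° z ->
     derivable (partials w f) z (axis b)) /\
  (forall w : seq bool, (size w <= m)%N -> {in (Omega° : set (R * R)), continuous (partials w f)}).
Proof.
move=> [_ H]; split=> [w wm b z|w wm z]; first by move/(_ w (ltnW wm)) : H => [+ _]; apply.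
rewrite inE => zO; have [_ [g [cg gE]]] := H _ wm.
have : g @ z --> g z.
  have /subspace_continuousP/(_ z (interior_subset zO)) := cg.
  by rewrite (within_interior zO).
rewrite (gE _ zO); apply: cvg_trans; apply: near_eq_cvg.
have Oz : nbhs z (Omega°) by apply: open_nbhs_nbhs; split=> //; exact: open_interior.
by apply: filterS Oz => x Ox; rewrite gE.
Qed.

Lemma within_closure_le Omega A (F : R * R -> R) (k : R) z : {within Omega, continuous F} ->
  A `<=` Omega -> Omega z -> closure A z -> (forall x, A x -> `|F x| <= k) -> `|F z| <= k.
Proof.
move=> /subspace_continuousP cF AO Oz cA Fk; rewrite leNgt; apply/negP => kF.
have kF' : 0 < `|F z| - k by rewrite subr_gt0.
have /cvgrPdist_lt/(_ _ kF') := cF z Oz.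
rewrite near_withinE => /cA[x [Ax]] /(_ (AO _ Ax)) H.
have := ler_distD (F x) (F z) 0; rewrite !subr0 => H2.
have := Fk _ Ax; lra.
Qed.

Lemma within_polysB Omega d f P : {within Omega, continuous f} -> polys d P ->
  {within Omega, continuous (fun z => f z - P z)}.
Proof.
move=> /subspace_continuousP cf dP; apply/subspace_continuousP => z Oz.
apply: cvgB; first exact: cf.
by apply: cvg_within_filter; exact: polys_continuous dP z.
Qed.

Lemma polys_dirs f (z0 : R * R) j w : polys j (fun z => dirs f (z - z0) j w z0).
Proof.
elim: j w => [|j IH] w /=; first exact: polys_cst.
rewrite -add1n; apply: polysD; apply: polysM => //.
  by apply: polys_ext (polys_aff (- z0.1) 1 0) => z /=; ring.
by apply: polys_ext (polys_aff (- z0.2) 0 1) => z /=; ring.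
Qed.

Lemma tint_convex (t : triple R) (z v : R * R) (s : R) : tint t z -> tint t (z + v) ->
  0 <= s <= 1 -> tint t (z + s *: v).
Proof.
move=> [a1 a2 a3] [b1 b2 b3] /andP[s0 s1].
have E1 : co1 t (z + s *: v) = (1 - s) * co1 t z + s * co1 t (z + v).
  by rewrite /co1 /det /= !scaleE; ring.
have E2 : co2 t (z + s *: v) = (1 - s) * co2 t z + s * co2 t (z + v).
  by rewrite /co2 /det /= !scaleE; ring.
have cvx (x y : R) : 0 < x -> 0 < y -> 0 < (1 - s) * x + s * y.
  move=> x0 y0; have [s2|s2] := ltP s (1 / 2).
    by rewrite ltr_pwDl ?mulr_gt0 ?mulr_ge0 ?(ltW y0)//; lra.
  by rewrite ltr_wpDl ?mulr_gt0 ?mulr_ge0 ?(ltW x0)//; lra.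
split; rewrite ?E1 ?E2; [exact: cvx|exact: cvx|].
have := @cvx (1 - co1 t z - co2 t z) (1 - co1 t (z + v) - co2 t (z + v)).
by rewrite !subr_gt0 => H; lra.
Qed.

(** [f] is expanded at the centroid along segments of the open triangle, which is convex and inside
    the interior of [Omega]; the estimate then extends to the closed triangle. [P] collects the
    Taylor terms of order below [m] and the lower terms created by moving the form [hom m c] from
    the centroid to the origin. *)
Lemma taylor_tint m Omega f (t : triple R) (D : R) (c : nat -> R) (w : R) : (0 < m)%N ->
  Cm m Omega f -> det t != 0 -> hull t `<=` Omega -> diam_le t D -> 0 <= w ->
  (forall z, tint t z ->
    \sum_(k < m.+1) `|Gp f k (m - k) z / (k`!%:R * (m - k)`!%:R) - c k| <= w) ->
  exists P, polys m.-1 P /\ forall z, hull t z ->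
    `|f z - hom m c z - P z| <= m`!%:R * (D ^+ m * w).
Proof.
move=> m0 fC t0 tO tD w0 fc; have [df cf] := Cm_interior fC.
have oU : open (Omega°) := @open_interior _ Omega.
have tU : tint t `<=` Omega°.
  by rewrite -(@open_subsetE _ (tint t)); [move=> x /(tint_hull t0)/tO|exact: open_tint].
pose z0 := ctr t; have z0t : tint t z0 := tint_ctr t0.
have [P0 [dP0 P0E]] := @hom_shift _ m c (- z0) 1 m0.
pose P z := \sum_(j < m) (j`!%:R^-1 * dirs f (z - z0) j [::] z0) + P0 z.
have dP : polys m.-1 P.
  apply: polysD => //; apply: polys_sum => j _; apply: polysZ.
  by apply: polys_le (polys_dirs _ _ _ _); rewrite -ltnS prednK.
exists P; split=> // z tz.
suff H x : tint t x -> `|f x - (hom m c x + P x)| <= m`!%:R * (D ^+ m * w).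
  rewrite -addrA -opprD.
  apply: (@within_closure_le Omega (tint t) (fun x => f x - (hom m c x + P x))) H => //.
  - apply: (@within_polysB _ m); first by case: fC.
    by apply: polysD; [exact: hom_polys|apply: polys_le dP; exact: leq_pred].
  - by move=> x /(tint_hull t0)/tO.
  - exact: tO.
  - exact: hull_closure.
move=> tx; pose v := x - z0.
have xE : z0 + v = x by rewrite /v addrC subrK.
have tl (s : R) : 0 <= s <= 1 -> tint t (z0 + s *: v).
  by move=> s01; apply: tint_convex => //; rewrite xE.
pose h j (s : R) : R := dirs f v j [::] (z0 + s *: v).
have dh j (s : R) : (j < m)%N -> 0 <= s <= 1 -> is_derive s 1 (h j) (h j.+1 s).
  move=> jm s01; have [dd dv] := @is_derive_dirs _ f _ m oU df cf v j [::] (z0 + s *: v) jm (tU _ (tl _ s01)).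
  by rewrite /h -dv; apply: is_derive_line.
have [v1 v2] : `|v.1| <= D /\ `|v.2| <= D.
  by have [] := tD x z0 (tint_hull t0 tx) (tint_hull t0 z0t).
(* The comparison is with [m! * hom m c v], the [m]-th derivative of [hom m c] along any line of
   direction [v]. *)
have hB (s : R) : 0 <= s <= 1 -> `|h m s - m`!%:R * hom m c v| <= m`!%:R * (D ^+ m * w).
  move=> s01; have Us := tU _ (tl _ s01).
  rewrite /h (@dirs_binom _ f _ m oU df cf v m [::] _ (leqnn m) Us).
  rewrite /hom mulr_sumr -sumrB.
  have D0 : 0 <= D := le_trans (normr_ge0 _) v1.
  rewrite (le_trans (ler_norm_sum _ _ _))//.
  rewrite (@le_trans _ _ (\sum_(k < m.+1) m`!%:R * (D ^+ m *
     `|Gp f k (m - k) (z0 + s *: v) / (k`!%:R * (m - k)`!%:R) - c k|)))//; last first.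
    by rewrite -!mulr_sumr !ler_wpM2l ?exprn_ge0// ?fc//; exact: tl.
  apply: ler_sum => k _; have km : (k <= m)%N by rewrite -ltnS.
  rewrite !addn0.
  have -> : 'C(m, k)%:R = m`!%:R / (k`!%:R * (m - k)`!%:R) :> R.
    rewrite -(bin_fact km) -natrM natrM mulfK // pnatr_eq0 muln_eq0 negb_or.
  rewrite (_ : _ - _ = m`!%:R * ((v.1 ^+ k * v.2 ^+ (m - k)) *
     (Gp f k (m - k) (z0 + s *: v) / (k`!%:R * (m - k)`!%:R) - c k))); last by ring.
  rewrite normrM (ger0_norm (ler0n _ _)) ler_wpM2l// normrM ler_wpM2r//.
  rewrite normrM !normrX -[in leRHS](subnKC km) exprD.
  by apply: ler_pM; rewrite ?exprn_ge0//; apply: lerXn2r; rewrite ?nnegrE.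
have := taylor1 dh hB (t := 1); rewrite ler01 lexx => /(_ isT).
rewrite /h scale1r scale0r addr0 xE.
apply: le_trans; rewrite le_eqVlt; apply/orP; left; apply/eqP; congr (`| _ |).
rewrite /P opprD !addrA [f x - hom m c x - _]addrAC -!addrA; congr (_ + _).
have -> : m`!%:R * hom m c v * (1 ^+ m / m`!%:R) = hom m c v.
  by rewrite expr1n mulrC mul1r mulKf// pnatr_eq0 -lt0n fact_gt0.
rewrite -opprD -opprD; congr (- _).
have -> : hom m c v = hom m c x + P0 x.
  rewrite /v (_ : x - z0 = - z0 + 1 *: x); last by rewrite scale1r addrC.
  by rewrite P0E expr1n mul1r.
rewrite -addrA [P0 x + _]addrC; congr (_ + _); apply: eq_bigr => j _.
by rewrite expr1n mul1r mulrC.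
Qed.

End smooth.

(** * Grids and strips *)

Section affine_images.
Context {R : realType}.
Implicit Types (t Q : triple R).

Definition aff Q t : triple R := ((pt Q t.1.1, pt Q t.1.2), pt Q t.2).

Lemma pt_aff Q t z : pt (aff Q t) z = pt Q (pt t z).
Proof. by apply: pair_ext; rewrite /= /pt /=; ring. Qed.

Lemma det_aff Q t : det (aff Q t) = det Q * det t.
Proof. by rewrite /det /aff /pt /=; ring. Qed.

Lemma hull_aff Q t : hull (aff Q t) = pt Q @` hull t.
Proof. by rewrite /hull image_comp; apply: eq_imagel => z _; rewrite /= pt_aff. Qed.

Definition std : triple R := (((0, 0), (1, 0)), (0, 1)).

Lemma aff_std b (l : R) Q : aff Q (tmap b l std) = tmap (pt Q b - l *: Q.1.1) l Q.
Proof.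
have E a : pt Q (b + l *: a) = pt Q b - l *: Q.1.1 + l *: pt Q a.
  by apply: pair_ext; rewrite /= !scaleE; ring.
rewrite /aff /tmap /= !E; congr (_ + _ *: _, _ + _ *: _, _ + _ *: _);
  by apply: pair_ext; rewrite /= ; ring.
Qed.

Lemma sep_aff Q t t' : det Q != 0 -> sep t t' -> sep (aff Q t) (aff Q t').
Proof.
move=> Q0 [phi [pz pge ple]].
pose u1 := Q.1.2.1 - Q.1.1.1; pose u2 := Q.1.2.2 - Q.1.1.2.
pose v1 := Q.2.1 - Q.1.1.1; pose v2 := Q.2.2 - Q.1.1.2.
have dE : u1 * v2 - v1 * u2 = det Q by [].
(* [psi] is [phi] composed with the inverse of [pt Q]: [A] and [B] solve the linear system [a1],
   [a2]. *)
pose A := (phi.1.1 * v2 - phi.1.2 * u2) / det Q.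
pose B := (phi.1.2 * u1 - phi.1.1 * v1) / det Q.
pose psi := (A, B, phi.2 - A * Q.1.1.1 - B * Q.1.1.2).
have a1 : A * u1 + B * u2 = phi.1.1 by rewrite /A /B -dE; field; rewrite dE.
have a2 : A * v1 + B * v2 = phi.1.2 by rewrite /A /B -dE; field; rewrite dE.
have E z : afn psi (pt Q z) = afn phi z.
  by rewrite /afn /psi /= -a1 -a2 /u1 /u2 /v1 /v2; ring.
exists psi; split; [|by rewrite /afn_ge /= !E|by rewrite /afn_le /= !E].
apply: contraTT pz; rewrite /afnz /= !negb_or !negbK => /andP[/eqP A0 /eqP B0].
by rewrite -a1 -a2 A0 B0 !mul0r addr0 eqxx.
Qed.

Lemma psep_map (f : triple R -> triple R) s :
  (forall t t', sep t t' -> sep (f t) (f t')) -> psep s -> psep (map f s).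
Proof.
move=> H; elim: s => //= t s IH [h1 /IH h2]; split=> // t' /mapP[x xs ->].
by apply: H; exact: h1.
Qed.

Lemma psep_uniq (I : eqType) (f : I -> triple R) (s : seq I) : uniq s ->
  (forall x y, x \in s -> y \in s -> x != y -> sep (f x) (f y)) -> psep (map f s).
Proof.
elim: s => //= x s IH /andP[xs us] H; split.
  move=> t' /mapP[y ys ->]; apply: H; rewrite ?inE ?eqxx ?ys ?orbT//.
  by apply: contraNneq xs => ->.
by apply: IH => // a b sa sb; apply: H; rewrite inE ?sa ?sb orbT.
Qed.

Lemma psep_mem s t t' : psep s -> t \in s -> t' \in s -> t != t' -> sep t t'.
Proof.
elim: s => //= x s IH [H1 H2]; rewrite !inE => /predU1P[->|ts] /predU1P[->|ts']; rewrite ?eqxx//.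
- by move=> _; exact: H1.
- by move=> _; apply: sep_sym; exact: H1.
- exact: IH.
Qed.

Lemma reft_convex (a b c z : R * R) : reft a -> reft b -> reft c -> reft z ->
  reft (pt ((a, b), c) z).
Proof.
move=> [a1 a2 a3] [b1 b2 b3] [c1 c2 c3] [z1 z2 z3].
have z0 : 0 <= 1 - z.1 - z.2 by lra.
split; rewrite /= ?addr_ge0 ?mulr_ge0//.
rewrite -subr_ge0 [X in 0 <= X](_ : _ = (1 - z.1 - z.2) * (1 - (a.1 + a.2)) +
  z.1 * (1 - (b.1 + b.2)) + z.2 * (1 - (c.1 + c.2))); last by ring.
by rewrite !addr_ge0// mulr_ge0// subr_ge0.
Qed.

Lemma hull_convex Q a b c : det Q != 0 -> hull Q a -> hull Q b -> hull Q c ->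
  hull ((a, b), c) `<=` hull Q.
Proof.
move=> Q0 /(hullP _ Q0) ha /(hullP _ Q0) hb /(hullP _ Q0) hc _ [z rz <-].
exists (pt ((co Q a, co Q b), co Q c) z); first exact: reft_convex.
by rewrite -pt_aff /aff !coK.
Qed.

Definition vs t : seq (R * R) := [:: t.1.1; t.1.2; t.2].

Lemma hull_sub Q t : det Q != 0 -> (forall v, v \in vs t -> hull Q v) -> hull t `<=` hull Q.
Proof.
case: t => [[a b] c] Q0 H; apply: hull_convex => //; apply: H; rewrite !inE eqxx ?orbT//.
Qed.

Lemma hull_vs t v : v \in vs t -> hull t v.
Proof.
by have [h1 h2 h3] := hullv t; rewrite !inE => /or3P[] /eqP ->.
Qed.

Lemma hull_std : hull std = reft.
Proof.
have E z : pt std z = z by apply: pair_ext; rewrite /pt /=; ring.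
apply/seteqP; split=> [_ [z rz <-]|z rz]; first by rewrite E.
by exists z; rewrite ?E.
Qed.

Lemma det_std : det std = 1.
Proof. by rewrite /det /=; ring. Qed.

End affine_images.

Section grid.
Context {R : realType}.
Variable n : nat.
Hypothesis n0 : (0 < n)%N.

Let nR0 : 0 < n%:R :> R.
Proof. by rewrite ltr0n. Qed.

(** Tiles are indexed by a full square: pairs with [i + j < n] give the upright tiles and the
    remaining pairs the inverted ones, which makes exactly [n^2] tiles. *)
Definition gtile (ij : nat * nat) : triple R :=
  if (ij.1 + ij.2 < n)%N then tmap (ij.1%:R / n%:R, ij.2%:R / n%:R) n%:R^-1 std
  else tmap ((n - ij.1)%:R / n%:R, (n - ij.2)%:R / n%:R) (- n%:R^-1) std.

Definition gidx : seq (nat * nat) := [seq (i, j) | i <- iota 0 n, j <- iota 0 n].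

Lemma mem_gidx ij : (ij \in gidx) = (ij.1 < n)%N && (ij.2 < n)%N.
Proof.
case: ij => i j; apply/allpairsP/andP => /= [[[a b] /= [+ + [-> ->]]]|[hi hj]].
  by rewrite !mem_iota.
by exists (i, j); rewrite !mem_iota.
Qed.

Lemma uniq_gidx : uniq gidx.
Proof. by apply: allpairs_uniq; rewrite ?iota_uniq// => -[a b] [c d]. Qed.

Lemma size_gidx : size gidx = (n * n)%N.
Proof. by rewrite size_allpairs !size_iota. Qed.

Definition lpt (a b : nat) : R * R := (a%:R / n%:R, b%:R / n%:R).

Definition lat (v : R * R) : Prop := exists a b, (a + b <= n)%N /\ v = lpt a b.

(* Coordinates in units of the mesh size, so that tiles are unit cells. *)
Definition gkey (ij : nat * nat) : nat * nat * nat :=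
  if (ij.1 + ij.2 < n)%N then (ij.1, ij.2, ij.1 + ij.2)%N
  else ((n - ij.1).-1, (n - ij.2).-1, (n - ij.1 + (n - ij.2)).-1)%N.

Definition cell (k : nat * nat * nat) (z : R * R) : Prop :=
  [/\ k.1.1%:R <= n%:R * z.1 <= k.1.1.+1%:R, k.1.2%:R <= n%:R * z.2 <= k.1.2.+1%:R &
      k.2%:R <= n%:R * (z.1 + z.2) <= k.2.+1%:R].

Lemma gkey_inj : {in gidx &, injective gkey}.
Proof.
move=> [i j] [i' j']; rewrite !mem_gidx /gkey /= => /andP[h1 h2] /andP[h3 h4].
by case: ifPn => h5; case: ifPn => h6 [] *; congr (_, _); lia.
Qed.

Lemma gtile_cell ij z : ij \in gidx -> hull (gtile ij) z -> cell (gkey ij) z.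
Proof.
case: ij => i j; rewrite mem_gidx /gtile /gkey /= => /andP[hi hj].
have nn : n%:R != 0 :> R by rewrite gt_eqF.
case: ifPn => hij; rewrite hull_tmapE hull_std => -[[x y] [/= x0 y0 xy] <-].
  have E1 : n%:R * (i%:R / n%:R + n%:R^-1 * x) = i%:R + x by field.
  have E2 : n%:R * (j%:R / n%:R + n%:R^-1 * y) = j%:R + y by field.
  rewrite /cell /= !scaleE [n%:R * (_ + _ + (_ + _))]mulrDr E1 E2 -!natr1 natrD; split; lra.
have E1 : n%:R * ((n - i)%:R / n%:R + - n%:R^-1 * x) = (n - i)%:R - x by field.
have E2 : n%:R * ((n - j)%:R / n%:R + - n%:R^-1 * y) = (n - j)%:R - y by field.
have p1 : ((n - i).-1.+1 = n - i)%N by lia.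
have p2 : ((n - j).-1.+1 = n - j)%N by lia.
have p3 : ((n - i + (n - j)).-1.+1 = (n - i) + (n - j))%N by lia.
have q1 : (n - i)%:R = (n - i).-1%:R + 1 :> R by rewrite natr1 p1.
have q2 : (n - j)%:R = (n - j).-1%:R + 1 :> R by rewrite natr1 p2.
have q3 : (n - i)%:R + (n - j)%:R = (n - i + (n - j)).-1%:R + 1 :> R by rewrite natr1 p3 natrD.
rewrite /cell /= !scaleE [n%:R * (_ + _ + (_ + _))]mulrDr E1 E2 p1 p2 p3 natrD; split; lra.
Qed.

Lemma gtile_lat ij v : ij \in gidx -> v \in vs (gtile ij) -> lat v.
Proof.
case: ij => i j; rewrite mem_gidx /gtile /= => /andP[hi hj].
have nn : n%:R != 0 :> R by rewrite gt_eqF.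
have e1 (a : nat) : a.+1%:R / n%:R = a%:R / n%:R + n%:R^-1 * 1 :> R by rewrite -natr1; field.
have e0 (a : nat) : a%:R / n%:R = a%:R / n%:R + n%:R^-1 * 0 :> R by field.
have f1 (a : nat) : (0 < a)%N -> a.-1%:R / n%:R = a%:R / n%:R + - n%:R^-1 * 1 :> R.
  by move=> a0; rewrite -[in RHS](prednK a0) -natr1; field.
have f0 (a : nat) : a%:R / n%:R = a%:R / n%:R + - n%:R^-1 * 0 :> R by field.
case: ifPn => hij; rewrite /vs /tmap /= !inE => /or3P[] /eqP ->.
- by exists i, j; split; [lia|apply: pair_ext; rewrite /= scaleE -e0].
- by exists i.+1, j; split; [lia|apply: pair_ext; rewrite /= scaleE ?e1 -?e0].
- by exists i, j.+1; split; [lia|apply: pair_ext; rewrite /= scaleE ?e1 -?e0].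
- by exists (n - i)%N, (n - j)%N; split; [lia|apply: pair_ext; rewrite /= scaleE -f0].
- by exists (n - i).-1, (n - j)%N; split; [lia|apply: pair_ext; rewrite /= scaleE -?f0 ?f1 // subn_gt0].
- by exists (n - i)%N, (n - j).-1; split; [lia|apply: pair_ext; rewrite /= scaleE -?f0 ?f1 // subn_gt0].
Qed.

Lemma lat_gtile ij v : ij \in gidx -> lat v -> hull (gtile ij) v -> v \in vs (gtile ij).
Proof.
move=> ijn [a [b [abn ->]]] /(gtile_cell ijn).
have nn : n%:R != 0 :> R by rewrite gt_eqF.
rewrite /cell /lpt /= -mulrDl ![n%:R * (_ / _)]mulrC !divfK// -!natrD !ler_nat.
have e1 (x : nat) : x.+1%:R / n%:R = x%:R / n%:R + n%:R^-1 * 1 :> R by rewrite -natr1; field.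
have e0 (x : nat) : x%:R / n%:R = x%:R / n%:R + n%:R^-1 * 0 :> R by field.
have f1 (x : nat) : (0 < x)%N -> x.-1%:R / n%:R = x%:R / n%:R + - n%:R^-1 * 1 :> R.
  by move=> a0; rewrite -[in RHS](prednK a0) -natr1; field.
have f0 (x : nat) : x%:R / n%:R = x%:R / n%:R + - n%:R^-1 * 0 :> R by field.
case: ij ijn => i j; rewrite mem_gidx /gtile /gkey /= => /andP[hi hj].
case: ifPn => hij /= [] h1 h2 h3.
  have [] : [\/ a = i /\ b = j, a = i.+1 /\ b = j | a = i /\ b = j.+1].
  - case: (eqVneq a i) => ?; case: (eqVneq b j) => ?; [apply: Or31|apply: Or33|apply: Or32|exfalso]; lia.
  - by move=> [-> ->]; apply/or3P; apply: Or31; apply/eqP; apply: pair_ext; rewrite /= scaleE -e0.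
  - by move=> [-> ->]; apply/or3P; apply: Or32; apply/eqP; apply: pair_ext; rewrite /= scaleE -?e0 ?e1.
  - by move=> [-> ->]; rewrite !inE; apply/or3P; apply: Or33; apply/eqP; apply: pair_ext; rewrite /= scaleE -?e0 ?e1.
have [] : [\/ a = (n - i)%N /\ b = (n - j)%N, a = (n - i).-1 /\ b = (n - j)%N | a = (n - i)%N /\ b = (n - j).-1].
- case: (eqVneq a (n - i)%N) => ?; case: (eqVneq b (n - j)%N) => ?; [apply: Or31|apply: Or33|apply: Or32|exfalso]; lia.
- by move=> [-> ->]; apply/or3P; apply: Or31; apply/eqP; apply: pair_ext; rewrite /= scaleE -f0.
- by move=> [-> ->]; apply/or3P; apply: Or32; apply/eqP; apply: pair_ext; rewrite /= scaleE -?f0 ?f1// subn_gt0.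
- by move=> [-> ->]; rewrite !inE; apply/or3P; apply: Or33; apply/eqP; apply: pair_ext; rewrite /= scaleE -?f0 ?f1// subn_gt0.
Qed.

Lemma cell_sep k k' t t' : (forall v, v \in vs t -> cell k v) ->
  (forall v, v \in vs t' -> cell k' v) ->
  [|| (k.1.1 < k'.1.1)%N, (k.1.2 < k'.1.2)%N | (k.2 < k'.2)%N] -> sep t' t.
Proof.
move=> tk tk'.
have [[a1 a2 a3] [b1 b2 b3] [c1 c2 c3]] : [/\ cell k t.1.1, cell k t.1.2 & cell k t.2].
  by split; apply: tk; rewrite !inE eqxx ?orbT.
have [[a1' a2' a3'] [b1' b2' b3'] [c1' c2' c3']] : [/\ cell k' t'.1.1, cell k' t'.1.2 & cell k' t'.2].
  by split; apply: tk'; rewrite !inE eqxx ?orbT.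
have nn : n%:R != 0 :> R by rewrite gt_eqF.
move=> /or3P[] kk.
- have kR : k.1.1.+1%:R <= k'.1.1%:R :> R by rewrite ler_nat.
  exists (n%:R, 0, - k'.1.1%:R); split; first by rewrite /afnz /= nn.
    by apply/and3P; split; rewrite /afn /= mul0r addr0 subr_ge0; [case/andP: a1'|case/andP: b1'|case/andP: c1'].
  by apply/and3P; split; rewrite /afn /= mul0r addr0 subr_le0 (le_trans _ kR)//; [case/andP: a1|case/andP: b1|case/andP: c1].
- have kR : k.1.2.+1%:R <= k'.1.2%:R :> R by rewrite ler_nat.
  exists (0, n%:R, - k'.1.2%:R); split; first by rewrite /afnz /= nn orbT.
    by apply/and3P; split; rewrite /afn /= mul0r add0r subr_ge0; [case/andP: a2'|case/andP: b2'|case/andP: c2'].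
  by apply/and3P; split; rewrite /afn /= mul0r add0r subr_le0 (le_trans _ kR)//; [case/andP: a2|case/andP: b2|case/andP: c2].
- have kR : k.2.+1%:R <= k'.2%:R :> R by rewrite ler_nat.
  exists (n%:R, n%:R, - k'.2%:R); split; first by rewrite /afnz /= nn.
    by apply/and3P; split; rewrite /afn /= -mulrDr subr_ge0; [case/andP: a3'|case/andP: b3'|case/andP: c3'].
  by apply/and3P; split; rewrite /afn /= -mulrDr subr_le0 (le_trans _ kR)//; [case/andP: a3|case/andP: b3|case/andP: c3].
Qed.

(** Tiles are caught between consecutive lattice lines in three directions. Two different keys
    differ in one direction, and a lattice line of that direction separates the cells. *)
Lemma gtile_sep ij ij' : ij \in gidx -> ij' \in gidx -> ij != ij' -> sep (gtile ij) (gtile ij').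
Proof.
move=> h h' ne; have kne : gkey ij != gkey ij'.
  by apply: contra_neq ne => /gkey_inj; apply.
have c v : v \in vs (gtile ij) -> cell (gkey ij) v by move/hull_vs/(gtile_cell h).
have c' v : v \in vs (gtile ij') -> cell (gkey ij') v by move/hull_vs/(gtile_cell h').
case: (boolP [|| ((gkey ij).1.1 < (gkey ij').1.1)%N, ((gkey ij).1.2 < (gkey ij').1.2)%N | ((gkey ij).2 < (gkey ij').2)%N]) => k1.
  by apply: sep_sym; exact: cell_sep k1.
apply: (cell_sep c' c); move: kne k1; case: (gkey ij) => [[a b] d]; case: (gkey ij') => [[a' b'] d'] /=.
rewrite !xpair_eqE !negb_or !negb_and -!leqNgt => H /and3P[h1 h2 h3].
by apply: contraT; rewrite !negb_or -!leqNgt => /and3P[h4 h5 h6]; lia.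
Qed.

Lemma psep_gtile : psep (map gtile gidx).
Proof. by apply: psep_uniq; [exact: uniq_gidx|exact: gtile_sep]. Qed.

Lemma gtile_cover z : reft z -> exists2 ij, ij \in gidx & hull (gtile ij) z.
Proof.
have nn : n%:R != 0 :> R by rewrite gt_eqF.
(* The least admissible [i] is taken: a point with [x = 1] falls in the last column, and [i < n x]
   unless [i = 0], which is what gives [i + j < n] below. *)
have idx (x : R) : 0 <= x -> x <= 1 -> exists i, [/\ (i < n)%N, i%:R <= n%:R * x <= i.+1%:R &
    i = 0%N \/ i%:R < n%:R * x].
  move=> x0 x1; have nx : n%:R * x <= n%:R by rewrite ler_piMr// ltW.
  have : exists i, (i < n)%N && (n%:R * x <= i.+1%:R).
    by exists n.-1; rewrite !prednK// leqnn nx.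
  move=> /ex_minnP[i /andP[hi xi] imin]; exists i; split => //.
    rewrite xi andbT; case: i hi xi imin => [|i] hi xi imin; first by rewrite mulr_ge0.
    rewrite leNgt; apply/negP => h; have := imin i; rewrite (ltnW hi) (ltW h) => /(_ isT).
    by rewrite ltnn.
  case: i hi xi imin => [|i] hi xi imin; first by left.
  right; rewrite ltNge; apply/negP => h; have := imin i; rewrite (ltnW hi) h => /(_ isT).
  by rewrite ltnn.
case: z => x y [/= x0 y0 xy].
have [|i [hi /andP[i1 i2] i3]] := idx x x0; first by lra.
have [|j [hj /andP[j1 j2] j3]] := idx y y0; first by lra.
have nxy : n%:R * x + n%:R * y <= n%:R by rewrite -mulrDr ler_piMr// ltW.
have hij : (i + j < n)%N.
  case: i3 => [->|i3]; first by rewrite add0n.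
  by rewrite -(ltr_nat R) natrD; lra.
have [up|dn] := leP (n%:R * x + n%:R * y) (i + j).+1%:R.
  exists (i, j); rewrite ?mem_gidx ?hi// /gtile hij hull_tmapE hull_std.
  exists (n%:R * x - i%:R, n%:R * y - j%:R).
    by clear -i1 j1 up; move: up; rewrite -natr1 natrD => up; split=> /=; lra.
  by apply: pair_ext; rewrite /= scaleE; field.
have hij' : ((i + j).+1 < n)%N by rewrite -(ltr_nat R) (lt_le_trans dn).
have hij2 : (n - i.+1 + (n - j.+1) < n)%N = false by clear -hi hj hij'; lia.
exists (n - i.+1, n - j.+1)%N; first by clear -hi hj hij'; rewrite mem_gidx /=; lia.
rewrite /gtile /= hij2.
rewrite hull_tmapE hull_std !subKn//; exists (i.+1%:R - n%:R * x, j.+1%:R - n%:R * y).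
  by clear -i2 j2 dn; move: i2 j2 dn; rewrite -!natr1 natrD => i2 j2 dn; split=> /=; lra.
by apply: pair_ext; rewrite /= scaleE; field.
Qed.

Lemma gtile_sub ij : ij \in gidx -> hull (gtile ij) `<=` reft.
Proof.
move=> h; rewrite -hull_std; apply: hull_sub; first by rewrite det_std oner_neq0.
move=> v /(gtile_lat h)[a [b [ab ->]]]; rewrite hull_std /lpt.
split=> /=; rewrite ?divr_ge0//.
by rewrite -mulrDl ler_pdivrMr// mul1r -natrD ler_nat.
Qed.

End grid.

(** * The strip along one side *)

Section strip.
Context {R : realType}.
Variables (n : nat) (h : R).
Hypotheses (n0 : (0 < n)%N) (h0 : 0 < h) (h1 : 3 * h < 1).
Implicit Types (st : R * R) (s : seq (R * R)) (w : R).

(** Abscissae of the tile vertices at height [h]. The tiles fill the triangle where all three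
    barycentric coordinates are at least [h]; its lower side runs from [h] to [1 - 2 * h], hence the
    condition [3 * h < 1]. *)
Definition top (c : nat) : R := h + (1 - 3 * h) * (c%:R / n%:R).

(* A state [(b, a)] stands for the segment from [(b, 0)] to [(a, h)]; the strip is
   cut into triangles by a left-to-right sequence of states. *)
Definition stri st st' : triple R :=
  if st.1 == st'.1 then (((st'.2, h), (st.2, h)), (st.1, 0))
  else (((st.2, h), (st.1, 0)), (st'.1, 0)).

(** The functional that vanishes on the segment of the state and is positive on its right;
    consecutive triangles are separated by it. *)
Definition phs st : R * R * R := (1, - ((st.2 - st.1) / h), - st.1).

(** Either the upper end passes from tile vertex [i] to [i + 1], the lower end waiting at [i / n],
    or the lower end advances within [[i / n, (i + 1) / n]] below the tile vertex [i + 1]. The two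
    ends thus keep pace, and every triangle has length of order [1 / n + h]. *)
Definition step st st' : Prop := exists i, (i < n)%N /\
  ((st = (i%:R / n%:R, top i) /\ st' = (i%:R / n%:R, top i.+1)) \/
   [/\ st.2 = top i.+1, st'.2 = top i.+1, i%:R / n%:R <= st.1, st.1 < st'.1 &
       st'.1 <= i.+1%:R / n%:R]).

Fixpoint chain st s : Prop :=
  if s is st' :: s' then step st st' /\ chain st' s' else True.

Fixpoint stris st s : seq (triple R) :=
  if s is st' :: s' then stri st st' :: stris st' s' else [::].

(** A prescribed point [w] of the side splits one advance of the lower end. A new point of the side
    therefore costs exactly one triangle, on which the adjustment of the cardinality relies. *)
Fixpoint insw w st s : seq (R * R) :=
  if s is st' :: s' then
    if st.1 < w < st'.1 then (w, st.2) :: st' :: s' else st' :: insw w st' s'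
  else [::].

Lemma phs_bot st b : afn (phs st) (b, 0) = b - st.1.
Proof. by rewrite /afn /=; ring. Qed.

Lemma phs_top st a : afn (phs st) (a, h) = a - st.2.
Proof. by rewrite /afn /=; field; rewrite gt_eqF. Qed.

Lemma afnz_phs st : afnz (phs st).
Proof. by rewrite /afnz /= oner_neq0. Qed.

Lemma top_le c c' : (c <= c')%N -> top c <= top c'.
Proof.
move=> cc; rewrite lerD2l ler_wpM2l// ?subr_ge0 ?(ltW h1)// ler_pM2r ?ler_nat//.
by rewrite invr_gt0 ltr0n.
Qed.

Lemma top_lt c c' : (c < c')%N -> top c < top c'.
Proof.
move=> cc; rewrite ltrD2l ltr_pM2l// ?subr_gt0// ltr_pM2r ?ltr_nat//.
by rewrite invr_gt0 ltr0n.
Qed.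

Lemma top0 : top 0 = h.
Proof. by rewrite /top mul0r mulr0 addr0. Qed.

Lemma topn : top n = 1 - 2 * h.
Proof. by rewrite /top divff ?mulr1 ?pnatr_eq0 -?lt0n//; ring. Qed.

Lemma frac01 i : (i <= n)%N -> 0 <= (i%:R / n%:R : R) <= 1.
Proof.
by move=> im; rewrite divr_ge0//= ler_pdivrMr ?ltr0n// mul1r ler_nat.
Qed.

Lemma step_range st st' : step st st' ->
  [/\ 0 <= st.1, st.1 <= st'.1 & st'.1 <= 1] /\
  [/\ h <= st.2, st.2 <= st'.2 & st'.2 <= 1 - 2 * h].
Proof.
move=> [i [hi [[-> ->]|[-> -> h2 h3 h4]]]] /=.
  have /andP[f0 f1] := frac01 (ltnW hi).
  by rewrite -topn -top0 !top_le.
have /andP[f0 f1] := frac01 (ltnW hi); have /andP[f2 f3] := frac01 hi.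
rewrite -topn -top0 !top_le//; split; split=> //; [exact: le_trans h2|exact: ltW|exact: le_trans f3].
Qed.

Lemma chain_le st s x : chain st s -> x \in s -> st.1 <= x.1 /\ st.2 <= x.2.
Proof.
elim: s st => //= st' s IH st [/step_range[[_ h2 _] [_ h3 _]] /IH H]; rewrite inE => /predU1P[->//|/H[h4 h5]].
by split; [exact: le_trans h4|exact: le_trans h5].
Qed.

Lemma det_stri st st' : step st st' -> det (stri st st') != 0.
Proof.
move=> [i [hi [[-> ->]|[e1 e2 h2 h3 h4]]]]; rewrite /stri /=.
  rewrite eqxx /det /= (_ : _ - _ = h * (top i.+1 - top i)); last by ring.
  by rewrite mulf_neq0 ?gt_eqF// subr_gt0 top_lt.
rewrite (lt_eqF h3) /det /= (_ : _ - _ = h * (st'.1 - st.1)); last by ring.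
by rewrite mulf_neq0 ?gt_eqF// subr_gt0.
Qed.

Lemma stri_afn_le st st' st2 : step st st' -> st'.1 <= st2.1 -> st'.2 <= st2.2 ->
  afn_le (phs st2) (stri st st').
Proof.
move=> /step_range[[_ a2 _] [_ b2 _]] h2 h3.
have a3 := le_trans a2 h2; have b3 := le_trans b2 h3.
by rewrite /stri; case: ifP => _; rewrite /afn_le /= !phs_bot !phs_top !subr_le0 ?h2 ?h3 ?a3 ?b3.
Qed.

Lemma stri_afn_ge st st' st2 : step st st' -> st2.1 <= st.1 -> st2.2 <= st.2 ->
  afn_ge (phs st2) (stri st st').
Proof.
move=> /step_range[[_ a2 _] [_ b2 _]] h2 h3.
have a3 := le_trans h2 a2; have b3 := le_trans h3 b2.
by rewrite /stri; case: ifP => _; rewrite /afn_ge /= !phs_bot !phs_top !subr_ge0 ?h2 ?h3 ?a3 ?b3.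
Qed.

Lemma mem_stris st s t : chain st s -> t \in stris st s ->
  exists st1 st2, [/\ step st1 st2, t = stri st1 st2, st.1 <= st1.1 /\ st.2 <= st1.2 &
    forall x, x \in map fst (st :: s) -> x <= st1.1 \/ st2.1 <= x].
Proof.
elim: s st => //= st' s IH st [sst cs]; have [[_ a2 _] [_ b2 _]] := step_range sst.
rewrite inE => /predU1P[->|/(IH _ cs)[st1 [st2 [h2 h3 [h4 h4'] h5]]]].
  exists st, st'; split=> // x; rewrite !inE => /or3P[/eqP ->|/eqP ->|/mapP[y ys ->]].
  - by left.
  - by right.
  - by right; have [] := chain_le cs ys.
exists st1, st2; split=> //; first by split; [exact: le_trans h4|exact: le_trans h4'].
move=> x; rewrite inE => /predU1P[->|/h5//]; left; exact: le_trans h4.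
Qed.

Lemma psep_stris st s : chain st s -> psep (stris st s).
Proof.
elim: s st => //= st' s IH st [sst cs]; split; last exact: IH.
move=> t /(mem_stris cs)[st1 [st2 [h2 -> [h3 h4] _]]].
apply: sep_sym; exists (phs st'); split; [exact: afnz_phs|exact: stri_afn_ge|exact: stri_afn_le].
Qed.

Lemma size_stris st s : size (stris st s) = size s.
Proof. by elim: s st => //= st' s IH st; rewrite IH. Qed.

(** Following the states, the first one that leaves [z] on its left determines a triangle: [z] then
    lies between two consecutive segments. *)
Lemma stris_cover st s z : chain st s -> 0 <= z.2 <= h ->
  0 <= afn (phs st) z -> afn (phs (last st s)) z <= 0 -> s != [::] ->
  exists2 t, t \in stris st s & hull t z.
Proof.
move=> + /andP[z0 zh]; elim: s st => //= st' s IH st [sst cs] hst hl _.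
have [le0|gt0] := leP (afn (phs st') z) 0; last first.
  case: s IH cs hl => [|st2 s] IH cs hl; first by move: hl gt0 => /= hl; rewrite ltNge hl.
  by have [t ht htz] := IH _ cs (ltW gt0) hl isT; exists t; rewrite // inE ht orbT.
exists (stri st st'); rewrite ?inE ?eqxx//.
have hn : h != 0 by rewrite gt_eqF.
have eta1 : 0 <= 1 - z.2 / h by rewrite subr_ge0 ler_pdivrMr// mul1r.
have eta0 : 0 <= z.2 / h by rewrite divr_ge0// ltW.
case: sst => i [hi [[E E']|[e1 e2 h2 h3 h4]]].
  rewrite E E' /= in hst le0 * => {cs IH hl}; rewrite /stri /= eqxx.
  have d0 : 0 < top i.+1 - top i by rewrite subr_gt0 top_lt.
  set b := i%:R / n%:R in hst le0 *; move: hst le0; rewrite /afn /=.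
  set f1 := (X in 0 <= X); set f2 := (X in X <= 0) => hf1 hf2.
  have fE : f1 - f2 = (z.2 / h) * (top i.+1 - top i) by rewrite /f1 /f2; field.
  exists (- f2 / (top i.+1 - top i), 1 - z.2 / h).
    split=> //=; first by rewrite divr_ge0 ?oppr_ge0// ltW.
    have : - f2 / (top i.+1 - top i) <= z.2 / h by rewrite ler_pdivrMr// -fE; lra.
    by move: (- f2 / _) (z.2 / h) => u v uv; lra.
  apply: pair_ext; rewrite /=; last by field; rewrite hn gt_eqF.
  by rewrite /f2; field; rewrite hn gt_eqF.
rewrite /stri (lt_eqF h3).
have d0 : 0 < st'.1 - st.1 by rewrite subr_gt0.
move: hst le0; rewrite /afn /= e2 e1.
set f1 := (X in 0 <= X); set f2 := (X in X <= 0) => hf1 hf2.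
have fE : f1 - f2 = (1 - z.2 / h) * (st'.1 - st.1) by rewrite /f1 /f2; field.
exists (- f2 / (st'.1 - st.1), f1 / (st'.1 - st.1)).
  split=> /=; rewrite ?divr_ge0 ?oppr_ge0 ?(ltW d0)//.
  by rewrite -mulrDl addrC fE mulfK ?gt_eqF// gerBl.
apply: pair_ext; rewrite /=; first by rewrite /f1 /f2; field; rewrite hn gt_eqF.
by rewrite /f1 /f2; field; rewrite hn gt_eqF.
Qed.

Lemma chain_insw w st s : chain st s -> chain st (insw w st s).
Proof.
elim: s st => //= st' s IH st [sst cs]; case: ifPn => [/andP[h2 h3]|_]; last first.
  by split=> //; exact: IH.
case: sst => i [hi [[E E']|[e1 e2 h4 h5 h6]]].
  by move: h2 h3; rewrite E E' /= => h2 /(lt_trans h2); rewrite ltxx.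
split; [|split=> //]; exists i; split=> //; right; split=> //=.
- by rewrite (le_trans (ltW h3)).
- by rewrite (le_trans h4)// ltW.
Qed.

Lemma last_insw w st s : last st (insw w st s) = last st s.
Proof. by elim: s st => //= st' s IH st; case: ifP => //= _; rewrite IH. Qed.

Lemma mem_insw w st s x : x \in map fst (insw w st s) -> x = w \/ x \in map fst s.
Proof.
elim: s st => //= st' s IH st; case: ifP => _ /=; rewrite !inE.
  by move=> /or3P[/eqP|/eqP ->|->]; rewrite ?eqxx ?orbT; [left|right|right].
by move=> /predU1P[->|/IH[]]; [rewrite eqxx; right|left|move=> ->; rewrite orbT; right].
Qed.

Lemma insw_sub w st s : {subset map fst s <= map fst (insw w st s)}.
Proof.
elim: s st => //= st' s IH st x; case: ifP => _ /=; rewrite !inE; first by move=> ->; rewrite orbT.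
by move=> /predU1P[->|/IH ->]; rewrite ?eqxx ?orbT.
Qed.

Lemma insw_mem w st s : chain st s -> st.1 <= w -> w <= (last st s).1 ->
  w \in map fst (st :: insw w st s).
Proof.
elim: s st => [|st' s IH] st /=; first by move=> _ h2 h3; rewrite inE eq_le h2 h3.
move=> [sst cs] h2 h3; case: ifPn => [_|]; first by rewrite /= !inE eqxx orbT.
rewrite negb_and -!leNgt => /orP[h4|h4]; first by rewrite inE eq_le h2 h4.
by rewrite inE; apply/orP; right; exact: IH.
Qed.

Lemma size_insw_le w st s : (size (insw w st s) <= (size s).+1)%N.
Proof. by elim: s st => //= st' s IH st; case: ifP => _ //=; exact: IH. Qed.

Lemma size_insw w st s : chain st s -> st.1 <= w -> w <= (last st s).1 ->
  w \notin map fst (st :: s) -> size (insw w st s) = (size s).+1.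
Proof.
elim: s st => [|st' s IH] st /=; first by move=> _ h2 h3; rewrite inE eq_le h2 h3.
move=> [sst cs] h2 h3; rewrite inE negb_or => /andP[w1 w2]; case: ifPn => [//|].
rewrite negb_and -!leNgt => /orP[h4|h4]; first by rewrite eq_le h2 h4 in w1.
by rewrite /= IH.
Qed.

Definition base : seq (R * R) :=
  flatten [seq [:: (i%:R / n%:R, top i.+1); (i.+1%:R / n%:R, top i.+1)] | i <- iota 0 n].

Lemma size_base : size base = (2 * n)%N.
Proof.
suff H (F : nat -> R * R) G k j : size (flatten [seq [:: F i; G i] | i <- iota j k]) = (2 * k)%N.
  exact: H.
by elim: k j => //= k IH j; rewrite IH; lia.
Qed.

Lemma base_chain : chain (0, top 0) base /\ last (0, top 0) base = (1, top n).
Proof.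
suff H k j : (j + k = n)%N ->
  let b := flatten [seq [:: (i%:R / n%:R, top i.+1); (i.+1%:R / n%:R, top i.+1)] | i <- iota j k] in
  chain (j%:R / n%:R, top j) b /\ last (j%:R / n%:R, top j) b = (1, top n).
  by have := H n 0%N (add0n _); rewrite mul0r.
elim: k j => [|k IH] j jk /=.
  by rewrite addn0 in jk; rewrite jk divff// pnatr_eq0 -lt0n.
have jn : (j < n)%N by lia.
have [c l] := IH j.+1 (eq_trans (addSnnS _ _) jk); split; last exact: l.
split; last split=> //; exists j; split=> //; first by left.
by right; split=> //=; rewrite ?lexx// ltr_pM2r ?ltr_nat// invr_gt0 ltr0n.
Qed.

Definition side ws : seq (R * R) := foldr (fun w s => insw w (0, top 0) s) base ws.

Lemma side_chain ws : chain (0, top 0) (side ws) /\ last (0, top 0) (side ws) = (1, top n).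
Proof.
elim: ws => [|w ws [IH1 IH2]]; first exact: base_chain.
by split; [exact: chain_insw|rewrite last_insw].
Qed.

Lemma side_neq_nil ws : side ws != [::].
Proof.
have [_] := side_chain ws; case: (side ws) => //= -[/eqP].
by rewrite eq_sym oner_eq0.
Qed.

Lemma side_mem ws w : w \in ws -> 0 <= w <= 1 -> w \in map fst ((0, top 0) :: side ws).
Proof.
move=> + /andP[w0 w1]; elim: ws => // x ws IH; have [c l] := side_chain ws.
rewrite inE => /predU1P[<-|/IH].
  by apply: (@insw_mem w (0, top 0) (side ws) c); rewrite ?l.
by rewrite !inE => /predU1P[->|/(insw_sub x (0, top 0)) ws']; rewrite ?eqxx// [X in _ || X]ws' orbT.
Qed.

Lemma mem_side ws x : x \in map fst ((0, top 0) :: side ws) ->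
  x \in ws \/ exists2 i, (i <= n)%N & x = i%:R / n%:R.
Proof.
rewrite inE => /predU1P[->|]; first by right; exists 0%N; rewrite ?mul0r.
elim: ws => [|w ws IH] /=; last first.
  by move=> /mem_insw[->|/IH[xw|]]; [left; rewrite inE eqxx|left; rewrite inE xw orbT|right].
move=> /mapP[y /flatten_mapP[i]]; rewrite mem_iota add0n => hi.
rewrite !inE => /orP[] /eqP -> ->; right; [by exists i; rewrite // ltnW|by exists i.+1].
Qed.

Lemma size_side_le ws : (size (side ws) <= 2 * n + size ws)%N.
Proof.
elim: ws => [|w ws IH] /=; first by rewrite size_base addn0.
by rewrite addnS (leq_trans (size_insw_le _ _ _)).
Qed.

Lemma size_side ws w : 0 <= w <= 1 -> w \notin map fst ((0, top 0) :: side ws) ->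
  size (side (w :: ws)) = (size (side ws)).+1.
Proof.
by move=> /andP[w0 w1] nw; have [c l] := side_chain ws; apply: size_insw; rewrite ?l.
Qed.

Definition strip ws := stris (0, top 0) (side ws).

Lemma psep_strip ws : psep (strip ws).
Proof. by apply: psep_stris; have [] := side_chain ws. Qed.

Lemma mem_strip ws t : t \in strip ws -> exists st st', [/\ step st st', t = stri st st' &
  forall x, x \in map fst ((0, top 0) :: side ws) -> x <= st.1 \/ st'.1 <= x].
Proof.
have [c _] := side_chain ws.
by move=> /(mem_stris c)[st [st' [h2 h3 _ h4]]]; exists st, st'.
Qed.

Lemma det_strip ws t : t \in strip ws -> det t != 0.
Proof. by move=> /mem_strip[st [st' [h2 -> _]]]; exact: det_stri. Qed.

(** The slanted ends of the strip are lines on which the second barycentric coordinate equals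
    another one. The points covered are those where it is the least of the three and at most [h], so
    that the strips of the three sides fit together. *)
Lemma strip_cover ws z : 0 <= z.2 <= h -> z.2 <= z.1 -> z.1 + 2 * z.2 <= 1 ->
  exists2 t, t \in strip ws & hull t z.
Proof.
move=> z2 z12 z3; have [c l] := side_chain ws; apply: stris_cover => //; last exact: side_neq_nil.
  rewrite (_ : afn _ z = z.1 - z.2); first by rewrite subr_ge0.
  by rewrite /afn /= top0; field; rewrite gt_eqF.
rewrite l /afn /= topn (_ : _ + _ = z.1 + 2 * z.2 - 1); first by lra.
by field; rewrite gt_eqF.
Qed.

Lemma stri_region st st' z : step st st' -> hull (stri st st') z ->
  [/\ 0 <= z.2, z.2 <= h, z.2 <= z.1 & z.1 + 2 * z.2 <= 1].
Proof.
move=> /step_range[[a1 a2 a3] [b1 b2 b3]] hz.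
have H phi : (forall b, 0 <= b <= 1 -> 0 <= afn phi (b, 0)) ->
   (forall a, h <= a <= 1 - 2 * h -> 0 <= afn phi (a, h)) -> 0 <= afn phi z.
  move=> h2 h3; apply: afn_ge_hull hz; rewrite /stri; case: ifP => _; rewrite /afn_ge /=.
    by rewrite !h3 ?h2//; lra.
  by rewrite !h2 ?h3//; lra.
have H1 := H (0, 1, 0); have H2 := H (0, -1, h); have H3 := H (1, -1, 0); have H4 := H (-1, -2, 1).
rewrite /afn /= in H1 H2 H3 H4; split.
- by rewrite -[X in _ <= X](_ : 0 * z.1 + 1 * z.2 + 0 = _); [apply: H1 => x _; [rewrite mul0r mulr0 !addr0|rewrite mul0r mul1r add0r addr0 ltW]|ring].
- by rewrite -subr_ge0 -[X in _ <= X](_ : 0 * z.1 + -1 * z.2 + h = _); [apply: H2 => x _; [rewrite mul0r mulr0 !add0r ltW|rewrite mul0r mulN1r add0r addNr]|ring].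
- by rewrite -subr_ge0 -[X in _ <= X](_ : 1 * z.1 + -1 * z.2 + 0 = _); [apply: H3 => x /andP[x0 x1]; [rewrite mul1r mulr0 !addr0|rewrite mul1r mulN1r addr0 subr_ge0]|ring].
- by rewrite -subr_ge0 -[X in _ <= X](_ : -1 * z.1 + -2 * z.2 + 1 = _); [apply: H4 => x /andP[x0 x1]; [rewrite mulN1r mulr0 addr0 addrC subr_ge0|rewrite mulN1r mulNr; lra]|ring].
Qed.

Lemma stri_bottom st st' x : step st st' -> hull (stri st st') (x, 0) -> st.1 <= x <= st'.1.
Proof.
move=> sst hz; have := afn_ge_hull (stri_afn_ge sst (lexx _) (lexx _)) hz.
have := afn_le_hull (stri_afn_le sst (lexx _) (lexx _)) hz.
by rewrite !phs_bot subr_le0 subr_ge0 => -> ->.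
Qed.

Lemma stri_top st st' a : step st st' -> hull (stri st st') (a, h) -> st.2 <= a <= st'.2.
Proof.
move=> sst hz; have := afn_ge_hull (stri_afn_ge sst (lexx _) (lexx _)) hz.
have := afn_le_hull (stri_afn_le sst (lexx _) (lexx _)) hz.
by rewrite !phs_top subr_le0 subr_ge0 => -> ->.
Qed.

Lemma stri_vs_bot st st' : step st st' -> (st.1, 0) \in vs (stri st st') /\ (st'.1, 0) \in vs (stri st st').
Proof.
move=> [i [hi [[-> ->]|[_ _ _ h3 _]]]]; rewrite /stri.
  by rewrite eqxx !inE eqxx !orbT.
by rewrite (lt_eqF h3) !inE !eqxx !orbT.
Qed.

Lemma strip_bottom_vertex ws t x : t \in strip ws -> x \in map fst ((0, top 0) :: side ws) ->
  hull t (x, 0) -> (x, 0) \in vs t.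
Proof.
move=> /mem_strip[st [st' [sst -> H]]] /H xst /(stri_bottom sst)/andP[h2 h3].
have [v1 v2] := stri_vs_bot sst.
have [->//|->//] : x = st.1 \/ x = st'.1.
by case: xst => h4; [left|right]; apply/le_anti; rewrite ?h2 ?h3 ?h4.
Qed.

Lemma strip_top_vertex ws t j : t \in strip ws -> hull t (top j, h) -> (top j, h) \in vs t.
Proof.
move=> /mem_strip[st [st' [sst -> _]]] /(stri_top sst)/andP[].
move: sst => [i [hi [[-> ->]|[e1 -> _ h3 _]]]] /= h4 h5; rewrite /stri /=.
  have ij : (i <= j)%N by rewrite leqNgt; apply/negP => /top_lt; rewrite ltNge h4.
  have ji : (j <= i.+1)%N by rewrite leqNgt; apply/negP => /top_lt; rewrite ltNge h5.
  rewrite eqxx !inE; have [->|->] : j = i.+1 \/ j = i by lia.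
    by rewrite eqxx.
  by rewrite eqxx orbT.
by rewrite (lt_eqF h3) e1 in h4 *; rewrite (le_anti (introT andP (conj h5 h4))) inE eqxx.
Qed.

Lemma strip_vertices ws t v : t \in strip ws -> v \in vs t ->
  (exists2 x, x \in map fst ((0, top 0) :: side ws) & v = (x, 0)) \/
  (exists2 j, (j <= n)%N & v = (top j, h)).
Proof.
have [c _] := side_chain ws; rewrite /strip.
have : (0, top 0).2 = top 0 by []. 
move: (side ws) (0, top 0) c => s st c _.
elim: s st c => //= st' s IH st [sst cs]; rewrite inE => /predU1P[->|].
  move: sst => [i [hi [[-> ->]|[e1 _ _ h3 _]]]]; rewrite /stri /=.
    rewrite eqxx !inE => /or3P[] /eqP ->.
    - by right; exists i.+1.
    - by right; exists i; rewrite // ltnW.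
    - by left; exists (i%:R / n%:R); rewrite ?inE ?eqxx.
  rewrite (lt_eqF h3) !inE => /or3P[] /eqP ->.
  - by right; exists i.+1; rewrite // e1.
  - by left; exists st.1; rewrite ?inE ?eqxx.
  - by left; exists st'.1; rewrite ?inE ?eqxx ?orbT.
move=> ts vt; case: (IH st' cs ts vt) => [[x xs ->]|[j jn ->]].
  by left; exists x; rewrite // inE xs orbT.
by right; exists j.
Qed.

End strip.

Notation rots Q' Q := [\/ Q' = Q, Q' = rot Q | Q' = rot (rot Q)].

Section rotations.
Context {R : realType}.
Implicit Types (Q t : triple R).

Lemma rot3 Q : rot (rot (rot Q)) = Q.
Proof. by case: Q => [[a b] c]. Qed.

Lemma co1_rot Q w : co1 (rot Q) w = co2 Q w.
Proof. by rewrite /co1 /co2 det_rot; congr (_ / _); rewrite /rot /det /=; ring. Qed.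

Lemma co2_rot Q w : det Q != 0 -> co2 (rot Q) w = 1 - co1 Q w - co2 Q w.
Proof.
move=> Q0; rewrite /co1 /co2 det_rot -{1}(divff Q0) -!mulrBl; congr (_ / _).
by rewrite /rot /det /=; ring.
Qed.

Lemma tint_rot Q : det Q != 0 -> tint (rot Q) = tint Q.
Proof.
move=> Q0; apply/seteqP; split=> z [].
  by rewrite co1_rot co2_rot// => a1 a2 a3; split; lra.
move=> a1 a2 a3.
by split; rewrite ?co1_rot ?co2_rot//; lra.
Qed.

Lemma hull_aff_pt Q t z : det Q != 0 -> hull (aff Q t) (pt Q z) <-> hull t z.
Proof.
move=> Q0; rewrite hull_aff; split=> [[x hx /(can_inj (ptK Q0)) <-//]|hz].
by exists z.
Qed.

Lemma vs_aff Q t : vs (aff Q t) = map (pt Q) (vs t).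
Proof. by []. Qed.

Lemma sep_co Q (phi : R * R * R) t t' : det Q != 0 -> afnz phi ->
  (forall v, v \in vs t -> 0 <= afn phi (co Q v)) ->
  (forall v, v \in vs t' -> afn phi (co Q v) <= 0) -> sep t t'.
Proof.
move=> Q0 pz h h'.
have E u : u = aff Q ((co Q u.1.1, co Q u.1.2), co Q u.2).
  by case: u => [[a b] c]; rewrite /aff /= !coK.
rewrite (E t) (E t'); apply: sep_aff => //; exists phi; split=> //; apply/and3P; split;
  (apply: h || apply: h'); by rewrite !inE eqxx ?orbT.
Qed.

End rotations.

(** * Tiles and strips of one cell *)

Section pattern.
Context {R : realType}.
Variables (n : nat) (h : R).
Hypotheses (n0 : (0 < n)%N) (h0 : 0 < h) (h1 : 3 * h < 1).
Implicit Types (Q t : triple R) (W : seq (R * R)) (v w : R * R).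

Let tp := top n h.

Definition inref : triple R := tmap (h, h) (1 - 3 * h) std.

Lemma pt_inref (a b : nat) : pt inref (lpt n a b) = (tp a, tp b).
Proof. by apply: pair_ext; rewrite /= !scaleE /tp /top; ring. Qed.

Lemma det_inref : det inref != 0.
Proof. by apply: det_tmap_neq0; rewrite ?det_std ?oner_neq0// gt_eqF// subr_gt0. Qed.

Lemma hull_inref z : [/\ h <= z.1, h <= z.2 & z.1 + z.2 <= 1 - h] <-> hull inref z.
Proof.
have d0 : 0 < 1 - 3 * h by rewrite subr_gt0.
split=> [[z1 z2 z3]|]; last first.
  rewrite hull_tmapE hull_std => -[[x y] [/= x0 y0 xy] <-] /=; rewrite !scaleE.
  have := mulr_ge0 (ltW d0) x0; have := mulr_ge0 (ltW d0) y0.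
  have : (1 - 3 * h) * (x + y) <= 1 - 3 * h by rewrite ler_piMr// ltW.
  by rewrite mulrDr; split; lra.
rewrite hull_tmapE hull_std; exists ((z.1 - h) / (1 - 3 * h), (z.2 - h) / (1 - 3 * h)).
  split=> /=; rewrite ?[0 <= _ / _]divr_ge0 ?subr_ge0 ?(ltW h1)//.
  by rewrite -mulrDl ler_pdivrMr//; lra.
by apply: pair_ext; rewrite /= scaleE; field; rewrite gt_eqF.
Qed.

Definition tile Q ij : triple R := aff Q (aff inref (gtile n ij)).

(** [W] is one set of points for all cells; each strip extracts the abscissae of those lying on its
    own side. *)
Definition wsel Q W : seq R :=
  [seq co1 Q w | w <- W & (co2 Q w == 0) && (0 <= co1 Q w <= 1)].

Definition strp Q W : seq (triple R) := map (aff Q) (strip n h (wsel Q W)).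

Definition pieces Q W : seq (triple R) :=
  map (tile Q) (gidx n) ++ strp Q W ++ strp (rot Q) W ++ strp (rot (rot Q)) W.

Definition latQ Q v : Prop := exists a b, (a + b <= n)%N /\ v = pt Q (tp a, tp b).

Lemma latQ_rot Q v : latQ Q v -> latQ (rot Q) v.
Proof.
move=> [a [b [ab ->]]]; exists b, (n - a - b)%N; split; first by lia.
rewrite pt_rot /=; congr (pt Q (_, _)).
have nn : n%:R != 0 :> R by rewrite pnatr_eq0 -lt0n.
by rewrite /tp /top -subnDA natrB// natrD; field.
Qed.

Lemma latQ_bounds Q v : det Q != 0 -> latQ Q v ->
  [/\ h <= co1 Q v, h <= co2 Q v & co1 Q v + co2 Q v <= 1 - h].
Proof.
move=> Q0 [a [b [ab ->]]]; rewrite co1_pt// co2_pt// -pt_inref.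
by apply/hull_inref; exists (lpt n a b); [exact: reft_node|].
Qed.

Lemma latQ_tint Q v : det Q != 0 -> latQ Q v -> tint Q v.
Proof. by have h0' := h0; move=> Q0 /(latQ_bounds Q0)[a1 a2 a3]; split; lra. Qed.

Lemma tile_vs Q ij v : ij \in gidx n -> v \in vs (tile Q ij) -> latQ Q v.
Proof.
move=> ijn; rewrite /tile !vs_aff -map_comp => /mapP[x /(gtile_lat n0 ijn)[a [b [ab ->]]] ->].
by exists a, b; rewrite /= pt_inref.
Qed.

Lemma det_tile Q ij : det Q != 0 -> det (tile Q ij) != 0.
Proof.
move=> Q0; rewrite !det_aff !mulf_neq0 ?det_inref// /gtile.
have nn : n%:R != 0 :> R by rewrite pnatr_eq0 -lt0n.
by case: ifP => _; apply: det_tmap_neq0; rewrite ?oppr_eq0 ?invr_eq0// det_std oner_neq0.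
Qed.

Lemma tile_bounds Q ij z : det Q != 0 -> ij \in gidx n -> hull (tile Q ij) z ->
  [/\ h <= co1 Q z, h <= co2 Q z & co1 Q z + co2 Q z <= 1 - h].
Proof.
move=> Q0 ijn; rewrite -{1}(coK Q0 z) => /(hull_aff_pt _ _ Q0).
rewrite hull_aff => -[x /(gtile_sub n0 ijn) rx E].
by apply/(hull_inref (co Q z)); exists x.
Qed.

Lemma psep_tiles Q : det Q != 0 -> psep (map (tile Q) (gidx n)).
Proof.
move=> Q0; rewrite (_ : map _ _ = map (aff Q) (map (aff inref) (map (gtile n) (gidx n)))).
  apply: psep_map => [t t'|]; first exact: sep_aff.
  apply: psep_map => [t t'|]; first by apply: sep_aff; exact: det_inref.
  exact: psep_gtile.
by rewrite -!map_comp.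
Qed.

Lemma mem_strp Q W t : t \in strp Q W -> exists2 t0, t0 \in strip n h (wsel Q W) & t = aff Q t0.
Proof. by move=> /mapP[t0 h2 ->]; exists t0. Qed.

Lemma strp_region Q W t z : det Q != 0 -> t \in strp Q W -> hull t z ->
  [/\ 0 <= co2 Q z, co2 Q z <= h, co2 Q z <= co1 Q z & co1 Q z + 2 * co2 Q z <= 1].
Proof.
move=> Q0 /mem_strp[t0 ht ->]; rewrite -{1}(coK Q0 z) => /(hull_aff_pt _ _ Q0).
have [st [st' [sst -> _]]] := mem_strip n0 h0 h1 ht.
by move=> /(stri_region n0 h0 h1 sst).
Qed.

Lemma det_strp Q W t : det Q != 0 -> t \in strp Q W -> det t != 0.
Proof.
move=> Q0 /mem_strp[t0 ht ->]; rewrite det_aff mulf_neq0//.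
exact: det_strip ht.
Qed.

Lemma psep_strp Q W : det Q != 0 -> psep (strp Q W).
Proof.
move=> Q0; apply: psep_map => [t t'|]; first exact: sep_aff.
exact: psep_strip.
Qed.

Lemma sep_tile_strp Q Q' W ij t : det Q != 0 -> det Q' != 0 -> ij \in gidx n ->
  (forall z, hull (tile Q ij) z -> h <= co2 Q' z) -> t \in strp Q' W -> sep (tile Q ij) t.
Proof.
move=> Q0 Q0' ijn H ht; apply: (@sep_co _ Q' (0, 1, - h)) => //.
- by rewrite /afnz /= oner_neq0 orbT.
- by move=> v /hull_vs/H; rewrite /afn /=; lra.
- by move=> v /hull_vs/(strp_region Q0' ht)[_ + _ _]; rewrite /afn /=; lra.
Qed.

(** Two strips are separated by the line through their common vertex where the two barycentric
    coordinates measuring the distance to their sides are equal: [1 - x - 2 y = 0]. *)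
Lemma sep_strp_rot Q W t t' : det Q != 0 -> t \in strp Q W -> t' \in strp (rot Q) W -> sep t t'.
Proof.
move=> Q0 ht ht'; have Q0' : det (rot Q) != 0 by rewrite det_rot.
apply: (@sep_co _ Q (-1, -2, 1)) => //.
- by rewrite /afnz /= oppr_eq0 oner_neq0.
- by move=> v /hull_vs/(strp_region Q0 ht)[_ _ _ +]; rewrite /afn /=; lra.
- move=> v /hull_vs/(strp_region Q0' ht')[_ _ + _].
  by rewrite /afn /= co1_rot co2_rot//; lra.
Qed.

Lemma psep_pieces Q W : det Q != 0 -> psep (pieces Q W).
Proof.
move=> Q0; have Q1 : det (rot Q) != 0 by rewrite det_rot.
have Q2 : det (rot (rot Q)) != 0 by rewrite !det_rot.
apply/psep_cat; split; first exact: psep_tiles.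
  apply/psep_cat; split; first exact: psep_strp.
    apply/psep_cat; split; [exact: psep_strp|exact: psep_strp|].
    by move=> t1 t2; exact: sep_strp_rot.
  move=> t1 t2 h2; rewrite mem_cat => /orP[h3|h3]; first exact: sep_strp_rot h2 h3.
  apply: sep_sym; apply: sep_strp_rot Q2 h3 _; rewrite rot3; exact: h2.
move=> _ t2 /mapP[ij ijn ->]; have B := tile_bounds Q0 ijn.
rewrite !mem_cat => /or3P[]; apply: sep_tile_strp => // z /B[b1 b2 b3] //.
  by rewrite co2_rot//; lra.
by rewrite co2_rot// co1_rot co2_rot//; lra.
Qed.

Lemma mem_pieces Q W t : t \in pieces Q W -> (exists2 ij, ij \in gidx n & t = tile Q ij) \/
  exists2 Q', t \in strp Q' W & [\/ Q' = Q, Q' = rot Q | Q' = rot (rot Q)].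
Proof.
rewrite !mem_cat => /or4P[/mapP[ij ijn ->]|ht|ht|ht].
- by left; exists ij.
- by right; exists Q => //; apply: Or31.
- by right; exists (rot Q) => //; apply: Or32.
- by right; exists (rot (rot Q)) => //; apply: Or33.
Qed.

Lemma rots_det Q Q' : det Q != 0 -> [\/ Q' = Q, Q' = rot Q | Q' = rot (rot Q)] -> det Q' != 0.
Proof. by move=> Q0 [] ->; rewrite ?det_rot. Qed.

Lemma rots_tint Q Q' : det Q != 0 -> [\/ Q' = Q, Q' = rot Q | Q' = rot (rot Q)] -> tint Q' = tint Q.
Proof. by move=> Q0 [] ->; rewrite ?tint_rot ?det_rot. Qed.

Lemma rots_hull Q Q' : [\/ Q' = Q, Q' = rot Q | Q' = rot (rot Q)] -> hull Q' = hull Q.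
Proof. by move=> [] ->; rewrite ?hull_rot. Qed.

Lemma rots_lat Q Q' v : [\/ Q' = Q, Q' = rot Q | Q' = rot (rot Q)] -> latQ Q v <-> latQ Q' v.
Proof.
have L Q1 : latQ Q1 v <-> latQ (rot Q1) v.
  by split=> [/latQ_rot//|/latQ_rot/latQ_rot]; rewrite rot3.
by move=> [] ->; rewrite -?L.
Qed.

Lemma det_pieces Q W t : det Q != 0 -> t \in pieces Q W -> det t != 0.
Proof.
move=> Q0 /mem_pieces[[ij _ ->]|[Q' ht /(rots_det Q0) Q0']]; first exact: det_tile.
exact: det_strp ht.
Qed.

Lemma pieces_sub Q W t : det Q != 0 -> t \in pieces Q W -> hull t `<=` hull Q.
Proof.
move=> Q0 /mem_pieces[[ij ijn ->]|[Q' ht QQ']] z hz.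
  by have h0' := h0; apply/(hullP _ Q0); have [b1 b2 b3] := tile_bounds Q0 ijn hz; split=> /=; lra.
have Q0' := rots_det Q0 QQ'; rewrite -(rots_hull QQ'); apply/(hullP _ Q0').
by have [b1 b2 b3 b4] := strp_region Q0' ht hz; split=> /=; lra.
Qed.

Lemma strp_cover Q W z : det Q != 0 -> 0 <= co2 Q z <= h -> co2 Q z <= co1 Q z ->
  co1 Q z + 2 * co2 Q z <= 1 -> exists2 t, t \in strp Q W & hull t z.
Proof.
move=> Q0 z0 z1 z2; have [t ht hz] := @strip_cover _ _ _ n0 h0 h1 (wsel Q W) (co Q z) z0 z1 z2.
exists (aff Q t); first exact: map_f.
by rewrite -(coK Q0 z); apply/hull_aff_pt.
Qed.

Lemma sector_cases (k x y : R) :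
  [/\ k <= x, k <= y & k <= 1 - x - y] \/ [/\ x < k, x <= y & x <= 1 - x - y] \/
  [/\ y < k, y <= x & y <= 1 - x - y] \/ [/\ 1 - x - y < k, 1 - x - y <= x & 1 - x - y <= y].
Proof.
set c := 1 - x - y.
have [xy|xy] := leP x y; have [xc|xc] := leP x c; have [yc|yc] := leP y c.
- have [kx|kx] := leP k x; last by right; left.
  by left; split=> //; exact: le_trans xy || exact: le_trans xc.
- have [kx|kx] := leP k x; last by right; left.
  by left; split=> //; exact: le_trans xy || exact: le_trans xc.
- by have := lt_le_trans xc (le_trans xy yc); rewrite ltxx.
- have [kx|kx] := leP k c; last by right; right; right; split=> //; exact: ltW.
  by left; split=> //; [exact: le_trans (ltW xc)|exact: le_trans (le_trans (ltW xc) xy)].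
- have [kx|kx] := leP k y; last by right; right; left; split=> //; exact: ltW.
  by left; split=> //; [exact: le_trans (ltW xy)|exact: le_trans yc].
- have [kx|kx] := leP k c; last by right; right; right; split=> //; [exact: le_trans (ltW yc) (ltW xy)|exact: ltW].
  by left; split=> //; [exact: le_trans (le_trans (ltW yc) (ltW xy))|exact: le_trans (ltW yc)].
- have [kx|kx] := leP k y; last by right; right; left; split=> //; exact: ltW.
  by left; split=> //; [exact: le_trans (ltW xy)|exact: le_trans yc].
- have [kx|kx] := leP k c; last by right; right; right; split; rewrite ?ltW.
  by left; split=> //; [exact: le_trans (ltW xc)|exact: le_trans (ltW yc)].
Qed.

Lemma pieces_cover Q W z : det Q != 0 -> hull Q z -> exists2 t, t \in pieces Q W & hull t z.
Proof.
move=> Q0 /(hullP _ Q0)[/=]; set x := co1 Q z; set y := co2 Q z => x0 y0 xy.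
have Q1 : det (rot Q) != 0 by rewrite det_rot.
have Q2 : det (rot (rot Q)) != 0 by rewrite !det_rot.
have S Q' : [\/ Q' = Q, Q' = rot Q | Q' = rot (rot Q)] ->
    (exists2 t, t \in strp Q' W & hull t z) -> exists2 t, t \in pieces Q W & hull t z.
  by move=> [] -> [t ht hz]; exists t; rewrite // !mem_cat ht ?orbT.
have B : h <= x -> h <= y -> h <= 1 - x - y -> exists2 t, t \in pieces Q W & hull t z.
  move=> b1 b2 b3.
  have /(hull_inref (co Q z))[u /(gtile_cover n0)[ij ijn hu] E] :
    [/\ h <= (co Q z).1, h <= (co Q z).2 & (co Q z).1 + (co Q z).2 <= 1 - h].
    by split; rewrite /= -/x -/y; lra.
  exists (tile Q ij); first by rewrite mem_cat map_f.
  by rewrite -(coK Q0 z); apply/hull_aff_pt => //; rewrite -E; apply/hull_aff_pt => //; exact: det_inref.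
have A0 : x < h -> x <= y -> x <= 1 - x - y -> exists2 t, t \in pieces Q W & hull t z.
  move=> b1 b2 b3; apply: (@S (rot (rot Q))); first exact: Or33.
  by apply: strp_cover => //; rewrite ?co1_rot !co2_rot// co1_rot -/x -/y; lra.
have A1 : y < h -> y <= x -> y <= 1 - x - y -> exists2 t, t \in pieces Q W & hull t z.
  move=> b1 b2 b3; apply: (@S Q); first exact: Or31.
  by apply: strp_cover => //; rewrite -/x -/y; lra.
have A2 : 1 - x - y < h -> 1 - x - y <= x -> 1 - x - y <= y -> exists2 t, t \in pieces Q W & hull t z.
  move=> b1 b2 b3; apply: (@S (rot Q)); first exact: Or32.
  by apply: strp_cover => //; rewrite ?co1_rot co2_rot// -/x -/y; lra.
by have [[]|[[]|[[]|[]]]] := sector_cases h x y.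
Qed.

Definition sidept Q i : R * R := pt Q (i%:R / n%:R, 0).

Lemma pieces_vertices Q W t v : det Q != 0 -> t \in pieces Q W -> v \in vs t ->
  [\/ latQ Q v, v \in W |
   exists Q' i, [/\ [\/ Q' = Q, Q' = rot Q | Q' = rot (rot Q)], (i <= n)%N & v = sidept Q' i]].
Proof.
move=> Q0 /mem_pieces[[ij ijn ->] /(tile_vs ijn)|[Q' ht QQ']]; first by move=> lv; apply: Or31.
have Q0' := rots_det Q0 QQ'.
have [t0 ht0 ->] := mem_strp ht; rewrite vs_aff => /mapP[x xt0 ->].
have [[y ys ->]|[j jn ->]] := strip_vertices n0 h0 h1 ht0 xt0; last first.
  apply: Or31; apply/(rots_lat _ QQ'); exists j, 0%N; rewrite addn0; split=> //.
  by rewrite /tp top0.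
case: (mem_side ys) => [/mapP[w]|[i hi ->]]; last by apply: Or33; exists Q', i.
rewrite mem_filter => /andP[/andP[/eqP w0 _] wW] ->; apply: Or32.
by rewrite (_ : (co1 Q' w, 0) = co Q' w) ?coK// /co w0.
Qed.

(** Conformity inside a cell: tiles and strips share the same row of points at height [h], and a
    strip triangle has no other lattice point. *)
Lemma lat_vertex Q W t v : det Q != 0 -> t \in pieces Q W -> latQ Q v -> hull t v ->
  v \in vs t.
Proof.
move=> Q0 /mem_pieces[[ij ijn ->]|[Q' ht QQ']] lv; last first.
  have Q0' := rots_det Q0 QQ'; move: lv => /(rots_lat _ QQ')[a [b [ab ->]]].
  have [t0 ht0 ->] := mem_strp ht; rewrite hull_aff_pt// vs_aff => hz.
  apply: map_f; have [st [st' [sst tE _]]] := mem_strip n0 h0 h1 ht0.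
  have := hz; rewrite {1}tE => /(stri_region n0 h0 h1 sst)[/= _ + _ _].
  case: b ab hz => [|b] ab; last first.
    have lt0 : top n h 0 < top n h b.+1 by exact: top_lt.
    by move=> _; rewrite leNgt -[X in X < _](top0 n h) lt0.
  by rewrite /tp top0 => hz _; exact: strip_top_vertex ht0 hz.
case: lv => a [b [ab ->]]; rewrite -pt_inref hull_aff_pt// hull_aff_pt ?det_inref//.
move=> /(lat_gtile n0 ijn) H; rewrite /tile !vs_aff; apply/map_f/map_f/H.
by exists a, b.
Qed.

(** Conformity across cells: a piece has as vertices all the points of [W] that it contains on the
    boundary of its cell, and both neighbours of a side use the same [W]. *)
Lemma bdry_vertex Q W t v : det Q != 0 -> t \in pieces Q W -> ~ tint Q v -> v \in W ->
  hull t v -> v \in vs t.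
Proof.
move=> Q0 /mem_pieces[[ij ijn ->]|[Q' ht QQ']] nv vW hv.
  have h0' := h0; exfalso; apply: nv; have [b1 b2 b3] := tile_bounds Q0 ijn hv; split; lra.
have Q0' := rots_det Q0 QQ'; rewrite -(rots_tint Q0 QQ') in nv.
have [r1 r2 r3 r4] := strp_region Q0' ht hv.
have y0 : co2 Q' v = 0.
  by apply/le_anti; rewrite r1 andbT leNgt; apply/negP => y0; apply: nv; split; lra.
have [t0 ht0 tE] := mem_strp ht; move: hv; rewrite tE -(coK Q0' v) hull_aff_pt// /co y0 vs_aff => hv.
apply/map_f; apply: (strip_bottom_vertex n0 h0 h1 ht0) hv.
apply: side_mem => //; last by lra.
by apply/mapP; exists v; rewrite // mem_filter vW y0 eqxx andbT /=; lra.
Qed.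

Lemma size_pieces Q W : size (pieces Q W) =
  (n * n + (size (side n h (wsel Q W)) + (size (side n h (wsel (rot Q) W)) +
    size (side n h (wsel (rot (rot Q)) W)))))%N.
Proof. by rewrite !size_cat !size_map size_gidx !size_stris. Qed.

Lemma size_pieces_le Q W : (size (pieces Q W) <= n * n + 6 * n + 3 * size W)%N.
Proof.
have H Q' : (size (side n h (wsel Q' W)) <= 2 * n + size W)%N.
  rewrite (leq_trans (size_side_le n0 h0 h1 _))// leq_add2l /wsel size_map size_filter.
  exact: count_size.
rewrite size_pieces; have := H Q; have := H (rot Q); have := H (rot (rot Q)); lia.
Qed.

End pattern.

(** * Conforming meshes *)

Section segments.
Context {R : realType}.
Implicit Types (a b c d z w : R * R).

Lemma segmentP a b z : segment a b z <-> exists2 l : R, 0 <= l <= 1 & z = a + l *: (b - a).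
Proof.
have E (l : R) : (1 - l) *: a + l *: b = a + l *: (b - a).
  by apply: pair_ext; rewrite /= !scaleE; ring.
split=> [[l /= + <-]|[l l01 ->]]; first by rewrite in_itv /= => l01; exists l; rewrite ?E.
by exists l; rewrite /= ?in_itv.
Qed.

Lemma segmentC a b : segment a b = segment b a.
Proof.
suff H x y z : segment x y z -> segment y x z by apply/seteqP; split=> z; exact: H.
move=> /segmentP[l /andP[l0 l1] ->]; apply/segmentP; exists (1 - l); first by lra.
by apply: pair_ext; rewrite /= !scaleE; ring.
Qed.

Lemma line_param (phi : R * R * R) a b w : afnz phi -> a != b ->
  afn phi a = 0 -> afn phi b = 0 -> afn phi w = 0 -> exists l : R, w = a + l *: (b - a).
Proof.
move=> pz ab; rewrite /afn => ha hb hw.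
have E1 : phi.1.1 * (b.1 - a.1) + phi.1.2 * (b.2 - a.2) = 0 by lra.
have E2 : phi.1.1 * (w.1 - a.1) + phi.1.2 * (w.2 - a.2) = 0 by lra.
have [u1|u1] := eqVneq (b.1 - a.1) 0.
  have u2 : b.2 - a.2 != 0.
    apply: contraNneq ab => u2; apply/eqP/pair_ext; apply/eqP; rewrite eq_sym -subr_eq0; exact/eqP.
  move: E1 pz; rewrite u1 mulr0 add0r => /eqP; rewrite mulf_eq0 (negbTE u2) orbF /afnz => p2.
  rewrite p2 orbF => p1; rewrite (eqP p2) mul0r addr0 in E2.
  move/eqP: E2; rewrite mulf_eq0 (negbTE p1)/= => /eqP w1.
  exists ((w.2 - a.2) / (b.2 - a.2)); apply: pair_ext; rewrite /= !scaleE; last by field.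
  by rewrite u1 mulr0; lra.
have p2 : phi.1.2 != 0.
  apply/eqP => p2; move: E1 pz; rewrite p2 mul0r addr0 /afnz p2 eqxx orbF => /eqP.
  by rewrite mulf_eq0 (negbTE u1) orbF => /eqP ->; rewrite eqxx.
exists ((w.1 - a.1) / (b.1 - a.1)); apply: pair_ext; rewrite /= !scaleE; first by field.
apply: (mulfI p2); have -> : phi.1.2 * w.2 = phi.1.2 * a.2 - phi.1.1 * (w.1 - a.1) by lra.
have -> : phi.1.1 = - (phi.1.2 * (b.2 - a.2)) / (b.1 - a.1).
  by apply: (mulIf u1); rewrite divfK//; lra.
by field.
Qed.

(** On the common line only the order of the four end points matters; exchanging [c] and [d] allows
    their parameters to satisfy [g < e]. An end point inside the other segment must be one of its
    ends, which leaves the three configurations of a conforming triangulation. *)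
Lemma segment_meet (phi : R * R * R) a b c d : afnz phi -> a != b -> c != d ->
  afn phi a = 0 -> afn phi b = 0 -> afn phi c = 0 -> afn phi d = 0 ->
  (segment c d a -> a = c \/ a = d) -> (segment c d b -> b = c \/ b = d) ->
  (segment a b c -> c = a \/ c = b) -> (segment a b d -> d = a \/ d = b) ->
  [\/ segment a b `&` segment c d = set0,
      exists z, [/\ z = a \/ z = b, z = c \/ z = d & segment a b `&` segment c d = [set z]] |
      [/\ a = c \/ a = d, b = c \/ b = d & segment c d = segment a b]].
Proof.
move=> pz ab cd pa pb pc pd ha hb hc hd.
have [g gE] := line_param pz ab pa pb pc; have [e eE] := line_param pz ab pa pb pd.
have inj (x y : R) : a + x *: (b - a) = a + y *: (b - a) -> x = y.
  move=> /addrI/eqP; rewrite -subr_eq0 -scalerBl scaler_eq0 [b - a == 0]subr_eq0.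
  by rewrite (eq_sym b) (negbTE ab) orbF subr_eq0 => /eqP.
have P0 : a = a + 0 *: (b - a) by rewrite scale0r addr0.
have P1 : b = a + 1 *: (b - a) by rewrite scale1r addrC subrK.
wlog ge : c d g e cd pc pd ha hb hc hd gE eE / g < e.
  move=> W; have [ge|eg|E] := ltgtP g e; first exact: (W c d g e).
    have dc : d != c by rewrite eq_sym.
    have := W d c e g dc pd pc; rewrite !(segmentC d c).
    have S (x y z : R * R) : x = y \/ x = z -> x = z \/ x = y by tauto.
    case/(_ _ _ hd hc eE gE eg) => [/ha/S//|/hb/S//|z|[z [z1 /S z2 z3]]|[/S z1 /S z2 z3]].
    - exact: Or31.
    - by apply: Or32; exists z.
    - exact: Or33.
  by move: cd; rewrite gE eE E eqxx.
have sab x : segment a b (a + x *: (b - a)) <-> 0 <= x <= 1.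
  split=> [/segmentP[l l01 /inj ->]//|x01]; by apply/segmentP; exists x.
have scd x : segment c d (a + x *: (b - a)) <-> g <= x <= e.
  have dc : d - c = (e - g) *: (b - a).
    by rewrite gE eE opprD addrACA subrr add0r -scalerBl.
  split=> [/segmentP[l /andP[l0 l1]]|/andP[gx xe]].
    rewrite dc scalerA gE -addrA -scalerDl => /inj ->.
    have e0 : 0 <= e - g by rewrite subr_ge0 ltW.
    have := mulr_ge0 l0 e0; have := ler_piMl e0 l1; lra.
  apply/segmentP; exists ((x - g) / (e - g)).
    by rewrite divr_ge0 ?subr_ge0 ?(ltW ge)//= ler_pdivrMr ?subr_gt0// mul1r lerB.
  by rewrite dc scalerA divfK ?subr_eq0 ?gt_eqF// gE -addrA -scalerDl [g + _]addrC subrK.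
have allP z : segment a b z -> exists x, z = a + x *: (b - a).
  by move=> /segmentP[l _ ->]; exists l.
have ha' : g <= 0 <= e -> 0 = g \/ 0 = e.
  move=> H; case: ha; first by rewrite {1}P0; apply/scd.
    by rewrite {1}P0 gE => /inj; left.
  by rewrite {1}P0 eE => /inj; right.
have hb' : g <= 1 <= e -> 1 = g \/ 1 = e.
  move=> H; case: hb; first by rewrite {1}P1; apply/scd.
    by rewrite {1}P1 gE => /inj; left.
  by rewrite {1}P1 eE => /inj; right.
have hc' : 0 <= g <= 1 -> g = 0 \/ g = 1.
  move=> H; case: hc; first by rewrite {1}gE; apply/sab.
    by move=> E; left; apply: inj; rewrite -gE -P0.
  by move=> E; right; apply: inj; rewrite -gE -P1.
have hd' : 0 <= e <= 1 -> e = 0 \/ e = 1.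
  move=> H; case: hd; first by rewrite {1}eE; apply/sab.
    by move=> E; left; apply: inj; rewrite -eE -P0.
  by move=> E; right; apply: inj; rewrite -eE -P1.
have [e0|e0|e0] := ltgtP e 0.
- apply: Or31; rewrite -subset0 => z [z1 z2]; have [x xE] := allP z z1.
  by move: z1 z2; rewrite xE => /sab/andP[x0 x1] /scd/andP[x2 x3]; lra.
- have [g1|g1|g1] := ltgtP g 1; last first.
  + apply: Or32; exists b; split; [by right|by left; rewrite gE g1 -P1|].
    apply/seteqP; split=> [z [z1 z2]|_ ->]; last first.
      split; first by rewrite {2}P1; apply/sab; rewrite ler01 lexx.
    by rewrite P1; apply/scd; lra.
    have [x xE] := allP z z1; move: z1 z2; rewrite xE => /sab/andP[x0 x1] /scd/andP[x2 x3].
    by rewrite /= [RHS]P1; congr (_ + _ *: _); lra.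
  + apply: Or31; rewrite -subset0 => z [z1 z2]; have [x xE] := allP z z1.
    by move: z1 z2; rewrite xE => /sab/andP[x0 x1] /scd/andP[x2 x3]; lra.
  + have [g0|g0] := ltP g 0.
      by case: ha' => [||E]; lra.
    have gz : g = 0 by case: hc' => [||E]; lra.
    have [e1|e1] := ltP e 1; first by case: hd' => [||E]; lra.
    have ez : e = 1 by case: hb' => [||E]; lra.
    have cE : c = a by rewrite gE gz -P0.
    have dE : d = b by rewrite eE ez -P1.
    by apply: Or33; rewrite cE dE; split; [left|right|].
- apply: Or32; exists a; split; [by left|by right; rewrite eE e0 -P0|].
  apply/seteqP; split=> [z [z1 z2]|_ ->]; last first.
    split; first by rewrite {2}P0; apply/sab; rewrite ler01 lexx.
    by rewrite {1}P0; apply/scd; lra.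
  have [x xE] := allP z z1; move: z1 z2; rewrite xE => /sab/andP[x0 x1] /scd/andP[x2 x3].
  by rewrite /= [RHS]P0; congr (_ + _ *: _); lra.
Qed.

End segments.

Section conforming.
Context {R : realType}.
Implicit Types (t : triple R) (s : seq (triple R)).

Lemma hull_two (a b c : R * R) (phi : R * R * R) z : det ((a, b), c) != 0 ->
  afn phi a = 0 -> afn phi b = 0 -> 0 < afn phi c ->
  (hull ((a, b), c) z /\ afn phi z = 0) <-> segment a b z.
Proof.
move=> t0 pa pb pc; split=> [[[u [u1 u2 u3] <-]]|/segmentP[l l01 ->]].
  rewrite afn_pt /= pa pb !mulr0 !add0r => /eqP; rewrite mulf_eq0 (gt_eqF pc) orbF => /eqP u20.
  apply/segmentP; exists u.1; first by lra.
  by apply: pair_ext; rewrite /= !scaleE u20; ring.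
have E : a + l *: (b - a) = pt ((a, b), c) (l, 0).
  by apply: pair_ext; rewrite /= !scaleE; ring.
rewrite E; split; first by exists (l, 0) => //; split=> /=; lra.
by rewrite afn_pt /= pa pb; ring.
Qed.

Lemma hull_one (a b c : R * R) (phi : R * R * R) z :
  afn phi a = 0 -> 0 < afn phi b -> 0 < afn phi c ->
  (hull ((a, b), c) z /\ afn phi z = 0) <-> z = a.
Proof.
move=> pa pb pc; split=> [[[u [u1 u2 u3] <-]]|->].
  rewrite afn_pt /= pa mulr0 add0r => /eqP.
  rewrite paddr_eq0 ?mulr_ge0 ?(ltW pb) ?(ltW pc)// !mulf_eq0 (gt_eqF pc) (gt_eqF pb) !orbF.
  by move=> /andP[/eqP u10 /eqP u20]; apply: pair_ext; rewrite /= u10 u20; ring.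
by split=> //; have [] := hullv ((a, b), c).
Qed.

Definition facet t (F : set (R * R)) : Prop :=
  [\/ F = set0, exists2 v, v \in vs t & F = [set v] |
      exists a b, [/\ a \in vs t /\ b \in vs t, a != b, F = segment a b &
        forall w, w \in vs t -> F w -> w = a \/ w = b]].

Lemma det_neq t : det t != 0 -> t.1.1 != t.1.2.
Proof.
by apply: contraNneq => E; rewrite /det E; apply/eqP; ring.
Qed.


Lemma rots_vs t t' v : rots t' t -> (v \in vs t') = (v \in vs t).
Proof.
by move=> [] ->; rewrite // !inE; do 3![case: (v == _)].
Qed.

Lemma facet_cases t phi : det t != 0 -> afnz phi -> afn_ge phi t ->
  [\/ [/\ 0 < afn phi t.1.1, 0 < afn phi t.1.2 & 0 < afn phi t.2],
    exists2 t', rots t' t & [/\ afn phi t'.1.1 = 0, 0 < afn phi t'.1.2 & 0 < afn phi t'.2] |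
    exists2 t', rots t' t & [/\ afn phi t'.1.1 = 0, afn phi t'.1.2 = 0 & 0 < afn phi t'.2]].
Proof.
move=> t0 pz /and3P[].
rewrite !le_eqVlt => /predU1P[/esym a0|a0] /predU1P[/esym b0|b0] /predU1P[/esym c0|c0].
- exfalso; have := afn_ge_tint t0 pz _ (tint_ctr t0).
  by rewrite /afn_ge a0 b0 c0 lexx /ctr afn_pt a0 b0 c0 !mulr0 !addr0 ltxx => /(_ isT).
- by apply: Or33; exists t => //; exact: Or31.
- by apply: Or33; exists (rot (rot t)) => //; exact: Or33.
- by apply: Or32; exists t => //; exact: Or31.
- by apply: Or33; exists (rot t) => //; exact: Or32.
- by apply: Or32; exists (rot t) => //; exact: Or32.
- by apply: Or32; exists (rot (rot t)) => //; exact: Or33.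
- exact: Or31.
Qed.

(** A line leaving [t] on one side meets it in nothing, a vertex or an edge, according to the number
    of vertices where [phi] vanishes; three zeros would contradict nondegeneracy. *)
Lemma facetP t phi : det t != 0 -> afnz phi -> afn_ge phi t ->
  facet t [set z | hull t z /\ afn phi z = 0].
Proof.
move=> t0 pz pge.
case: (facet_cases t0 pz pge) => [[a0 b0 c0]|[t' tt' [h1 h2 h3]]|[t' tt' [h1 h2 h3]]].
- apply: Or31; rewrite -subset0 => _ [[u [u1 u2 u3] <-] E].
  move: E; rewrite afn_pt => E.
  have k0 : 0 <= 1 - u.1 - u.2 by lra.
  have := mulr_ge0 k0 (ltW a0); have := mulr_ge0 u1 (ltW b0); have := mulr_ge0 u2 (ltW c0).
  move=> k1 k2 k3.
  have /eqP : (1 - u.1 - u.2) * afn phi t.1.1 = 0 by lra.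
  have /eqP : u.1 * afn phi t.1.2 = 0 by lra.
  have /eqP : u.2 * afn phi t.2 = 0 by lra.
  rewrite !mulf_eq0 (gt_eqF a0) (gt_eqF b0) (gt_eqF c0) !orbF => /eqP ? /eqP ? /eqP ?.
  by lra.
- apply: Or32; exists t'.1.1; first by rewrite -(rots_vs _ tt') inE eqxx.
  rewrite -(rots_hull tt'); apply/funext => z; apply/propext.
  by case: t' h1 h2 h3 {tt'} => [[a b] c] h1 h2 h3; exact: hull_one.
- have u0 := rots_det t0 tt'.
  apply: Or33; exists t'.1.1, t'.1.2; split; rewrite -?(rots_vs _ tt') ?inE ?eqxx ?orbT// ?det_neq//.
    rewrite -(rots_hull tt'); apply/funext => z; apply/propext.
    by case: t' h1 h2 h3 u0 {tt'} => [[a b] c] h1 h2 h3 u0; exact: hull_two.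
  move=> w; rewrite -(rots_vs _ tt') !inE => /or3P[] /eqP -> [_ E]; [by left|by right|].
  by rewrite E ltxx in h3.
Qed.

Definition nohang s : Prop := forall t t' v, t \in s -> t' \in s -> v \in vs t' ->
  hull t v -> v \in vs t.

(** The intersection lies on the separating line, so it is the intersection of two facets, and the
    absence of hanging vertices reduces the case of two edges to [segment_meet]. *)
Lemma meetP t t' : det t != 0 -> det t' != 0 -> sep t t' ->
  (forall v, v \in vs t' -> hull t v -> v \in vs t) ->
  (forall v, v \in vs t -> hull t' v -> v \in vs t') ->
  [\/ hull t `&` hull t' = set0,
      exists z, [/\ z \in vs t, z \in vs t' & hull t `&` hull t' = [set z]] |
      exists a b, [/\ a != b, a \in vs t /\ b \in vs t, a \in vs t' /\ b \in vs t' &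
        hull t `&` hull t' = segment a b]].
Proof.
move=> t0 t0' [phi [pz pge ple]] H H'.
have ple' : afn_ge (opa phi) t' by rewrite /afn_ge !afn_opa !oppr_ge0.
have pz' : afnz (opa phi) by rewrite /afnz /= !oppr_eq0.
set F := [set z | hull t z /\ afn phi z = 0].
set F' := [set z | hull t' z /\ afn (opa phi) z = 0].
have IE : hull t `&` hull t' = F `&` F'.
  apply/seteqP; split=> z; last by move=> [[? _] [? _]].
  move=> [h1 h2]; have h3 := afn_ge_hull pge h1; have h4 := afn_le_hull ple h2.
  have h5 : afn phi z = 0 by apply/le_anti; rewrite h3 h4.
  by split; split; rewrite ?afn_opa ?h5 ?oppr0.
have FH z : F z -> hull t z by case.
have FH' z : F' z -> hull t' z by case.
have FP z : F z -> afn phi z = 0 by case.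
have FP' z : F' z -> afn phi z = 0 by case=> _ /eqP; rewrite afn_opa oppr_eq0 => /eqP.
have fF : facet t F := facetP t0 pz pge.
have fF' : facet t' F' := facetP t0' pz' ple'.
rewrite IE; case: fF => [->|[v hv FE]|[a [b [[ha hb] ab FE V]]]].
- by apply: Or31; rewrite set0I.
- have [vF'|nv] := pselect (F' v).
    apply: Or32; exists v; split=> //; first by apply: H' => //; exact: FH'.
    by rewrite FE setIC; apply/seteqP; split=> [z [_ ->]//|_ ->].
  by apply: Or31; rewrite -subset0 FE => z [/= ->].
case: fF' => [->|[v hv F'E]|[c [d [[hc hd] cd F'E V']]]].
- by apply: Or31; rewrite setI0.
- have [vF|nv] := pselect (F v).
    apply: Or32; exists v; split=> //; first by apply: H => //; exact: FH.
    by rewrite F'E; apply/seteqP; split=> [z [_ ->]//|_ ->].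
  by apply: Or31; rewrite -subset0 F'E => z [+ /= zE]; rewrite zE.
have sa (x y : R * R) : segment x y x by apply/segmentP; exists 0; rewrite ?scale0r ?addr0// lexx ler01.
have sb (x y : R * R) : segment x y y by rewrite segmentC; exact: sa.
have Fa : F a by rewrite FE. have Fb : F b by rewrite FE.
have Fc : F' c by rewrite F'E. have Fd : F' d by rewrite F'E.
have ha1 : segment c d a -> a = c \/ a = d.
  by rewrite -F'E => /[dup] aF /FH' h; apply: V' => //; exact: H'.
have hb1 : segment c d b -> b = c \/ b = d.
  by rewrite -F'E => /[dup] bF /FH' h; apply: V' => //; exact: H'.
have hc1 : segment a b c -> c = a \/ c = b.
  by rewrite -FE => /[dup] cF /FH h; apply: V => //; exact: H.
have hd1 : segment a b d -> d = a \/ d = b.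
  by rewrite -FE => /[dup] dF /FH h; apply: V => //; exact: H.
have := segment_meet pz ab cd (FP _ Fa) (FP _ Fb) (FP' _ Fc) (FP' _ Fd) ha1 hb1 hc1 hd1.
have vt z : z = a \/ z = b -> z \in vs t by case=> ->.
have vt' z : z = c \/ z = d -> z \in vs t' by case=> ->.
rewrite FE F'E; case=> [E|[z [z1 z2 zE]]|[z1 z2 zE]]; first exact: Or31.
  by apply: Or32; exists z; split; [exact: vt|exact: vt'|].
by apply: Or33; exists a, b; split; rewrite ?zE ?setIid//; split; exact: vt'.
Qed.

Lemma is_vertex_mkT t v : det t != 0 -> v \in vs t -> is_vertex (mkT t) v.
Proof.
move=> t0; have [v0 v1 v2] := vtx_mkT t0; rewrite !inE => /or3P[] /eqP ->.
- by exists ord0.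
- by exists (inord 1).
- by exists (inord 2).
Qed.

Lemma is_edge_mkT t a b : det t != 0 -> a \in vs t -> b \in vs t -> a != b ->
  is_edge (mkT t) (segment a b).
Proof.
move=> t0 /(is_vertex_mkT t0)[i iE] /(is_vertex_mkT t0)[j jE] ab.
exists i, j; split; last by rewrite iE jE.
by apply: contraNneq ab => ij; rewrite iE jE ij.
Qed.

Lemma sep_irr t : det t != 0 -> ~ sep t t.
Proof. by move=> t0 /(sep_tint t0 t0)/(_ (tint_ctr t0)) /(_ (tint_ctr t0)). Qed.

Lemma psep_uniq_seq s : psep s -> (forall t, t \in s -> det t != 0) -> uniq s.
Proof.
elim: s => //= t s IH [h1 h2] h3; rewrite IH//; last by move=> u us; apply: h3; rewrite inE us orbT.
by rewrite andbT; apply/negP => /h1 /sep_irr; apply; apply: h3; rewrite inE eqxx.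
Qed.

Definition meshT s : {fset triangle R} := [fset T in map (@mkT R) s]%fset.

Lemma mkT_inj s : (forall t, t \in s -> det t != 0) -> {in s &, injective (@mkT R)}.
Proof.
move=> s0 t t' /s0 t0 /s0 t0' E; have [v0 v1 v2] := vtx_mkT t0.
have [v0' v1' v2'] := vtx_mkT t0'; move: v0 v1 v2; rewrite E v0' v1' v2'.
by case: t t' {t0 t0' E v0' v1' v2'} => [[a b] c] [[a' b'] c'] /= -> -> ->.
Qed.

Lemma uniq_map_mkT s : psep s -> (forall t, t \in s -> det t != 0) -> uniq (map (@mkT R) s).
Proof.
by move=> ps s0; rewrite map_inj_in_uniq ?psep_uniq_seq//; exact: mkT_inj.
Qed.

Lemma card_meshT s : psep s -> (forall t, t \in s -> det t != 0) -> #|` meshT s| = size s.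
Proof.
by move=> ps s0; rewrite /meshT card_fseq undup_id ?size_map// uniq_map_mkT.
Qed.

Lemma perm_meshT s : psep s -> (forall t, t \in s -> det t != 0) ->
  perm_eq (meshT s) (map (@mkT R) s).
Proof.
move=> ps s0; apply: uniq_perm; rewrite ?fset_uniq ?uniq_map_mkT//.
by move=> T; rewrite /meshT inE.
Qed.

Lemma conforming_meshT (Omega : set (R * R)) s : psep s ->
  (forall t, t \in s -> det t != 0) -> nohang s ->
  (forall z, Omega z <-> exists2 t, t \in s & hull t z) ->
  conforming Omega (meshT s).
Proof.
move=> ps s0 nh cov; split.
  apply/seteqP; split=> [z [T /=]|z /cov[t ts tz]].
    rewrite /meshT inE => /mapP[t ts ->]; rewrite (tri_mkT (s0 _ ts)) => tz.
    by apply/cov; exists t.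
  exists (mkT t); last by rewrite tri_mkT// s0.
  by rewrite /= /meshT inE map_f.
move=> T T'; rewrite /meshT !inE => /mapP[t ts ->] /mapP[t' ts' ->] ne.
have tt' : t != t' by apply: contraNneq ne => ->.
have st := psep_mem ps ts ts' tt'.
have [t0 t0'] := (s0 _ ts, s0 _ ts'); rewrite !tri_mkT//; split.
  rewrite -subset0 => z [zt zt'].
  have /(hull_closure t0)/(_ _ zt')[y [yt yt']] := interior_subset zt.
  exact: (sep_hull_tint t0 (sep_sym st) yt' yt).
case: (@meetP t t' t0 t0' st) => [v|v|E|[z [z1 z2 zE]]|[a [b [ab [a1 b1] [a2 b2] E]]]].
- by move=> vt' hv; apply: (nh t t').
- by move=> vt hv; apply: (nh t' t).
- exact: Or31.
- by apply: Or32; exists z; split=> //; exact: is_vertex_mkT.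
- by apply: Or33; rewrite E; split; exact: is_edge_mkT.
Qed.

End conforming.

(** * A portion of side belonging to a single triangle *)

Section free_side.
Context {R : realType}.
Implicit Types (t u Q : triple R).

Lemma rots_trans t u v : rots u t -> rots v u -> rots v t.
Proof.
move=> [] -> [] ->; rewrite ?rot3.
all: by [exact: Or31|exact: Or32|exact: Or33].
Qed.

Lemma avoid (s : seq R) (a b : R) : a < b -> exists2 g, a < g < b & g \notin s.
Proof.
elim: s b => [|x s IH] b ab; first by exists ((a + b) / 2); rewrite // ; lra.
have [/andP[ax xb]|nx] := boolP (a < x < b).
  have [g /andP[ag gx] gs] := IH _ ax; exists g; first by rewrite ag (lt_trans gx).
  by rewrite inE negb_or gs lt_eqF.
have [g gab gs] := IH _ ab; exists g => //; rewrite inE negb_or gs andbT.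
by apply: contraNneq nx => <-.
Qed.

Variable y0 : R.

Definition crosses Q : bool := (Q.1.1.2 - y0) * (Q.1.2.2 - y0) < 0.
Definition gcross Q : R := (y0 - Q.1.1.2) / (Q.1.2.2 - Q.1.1.2).
Definition cpt Q : R * R := pt Q (gcross Q, 0).

Lemma crossesP Q : crosses Q -> [/\ Q.1.2.2 - Q.1.1.2 != 0, 0 < gcross Q < 1 & (cpt Q).2 = y0].
Proof.
rewrite /crosses /gcross => c.
have d0 : Q.1.2.2 - Q.1.1.2 != 0.
  apply/eqP => d0; have E : Q.1.2.2 = Q.1.1.2 by lra.
  by move: c; rewrite E ltNge -expr2 sqr_ge0.
split=> //; last by rewrite /cpt /= /gcross; field.
have : (Q.1.1.2 - y0 < 0 /\ 0 < Q.1.2.2 - y0) \/ (0 < Q.1.1.2 - y0 /\ Q.1.2.2 - y0 < 0).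
  have [a0|a0|a0] := ltgtP (Q.1.1.2 - y0) 0.
  - by left; split=> //; rewrite -(nmulr_rlt0 _ a0).
  - by right; split=> //; rewrite -(pmulr_rlt0 _ a0).
  - by rewrite a0 mul0r ltxx in c.
move=> [[a0 b0]|[a0 b0]].
  have p : 0 < Q.1.2.2 - Q.1.1.2 by lra.
  by rewrite divr_gt0 ?ltr_pdivrMr//; lra.
have p : Q.1.2.2 - Q.1.1.2 < 0 by lra.
by rewrite ltr_ndivrMr// ltr_ndivlMr//; lra.
Qed.

Lemma afn_cpt (phi : R * R * R) Q : afn phi (cpt Q) =
  (1 - gcross Q) * afn phi Q.1.1 + gcross Q * afn phi Q.1.2.
Proof. by rewrite afn_pt /= subr0 mul0r addr0. Qed.

(* The hypothesis [0 < phi.1.1 * afn phi Q.2] says that [Q] lies to the right of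
   its first side. *)
Lemma cross_right (phi : R * R * R) Q : crosses Q -> Q.2.2 != y0 ->
  afn phi Q.1.1 = 0 -> afn phi Q.1.2 = 0 -> 0 < phi.1.1 * afn phi Q.2 ->
  exists2 Q', rots Q' Q & crosses Q' /\ (cpt Q).1 < (cpt Q').1.
Proof.
move=> cQ c2 pa pb pc; have [_ _ zy] := crossesP cQ.
have key Q' : crosses Q' -> 0 < phi.1.1 * afn phi (cpt Q') -> (cpt Q).1 < (cpt Q').1.
  move=> cQ' H; have [_ _ zy'] := crossesP cQ'.
  have z0 : afn phi (cpt Q) = 0 by rewrite afn_cpt pa pb !mulr0 addr0.
  have E : afn phi (cpt Q') = phi.1.1 * ((cpt Q').1 - (cpt Q).1).
    by rewrite -[LHS]subr0 -z0 /afn zy zy'; ring.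
  rewrite E mulrA -expr2 in H; rewrite -subr_gt0.
  by move: H; rewrite pmulr_rgt0// lt_neqAle sqr_ge0 andbT; apply: contraTneq pc => /esym/eqP; rewrite sqrf_eq0 => /eqP ->; rewrite mul0r ltxx.
have [h|h] := boolP (crosses (rot Q)).
  exists (rot Q); first exact: Or32.
  split=> //; apply: key => //; have [_ /andP[g0 g1] _] := crossesP h.
  by rewrite afn_cpt /= pb mulr0 add0r mulrCA mulr_gt0.
have h' : crosses (rot (rot Q)).
  move: cQ h; rewrite /crosses /= -leNgt => cQ h.
  have c2' : Q.2.2 - y0 != 0 by rewrite subr_eq0.
  have b0 : Q.1.2.2 - y0 != 0 by apply: contraTneq cQ => ->; rewrite mulr0 ltxx.
  rewrite -(pmulr_rlt0 (x := (Q.1.2.2 - y0) ^+ 2)); last by rewrite exprn_even_gt0.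
  have -> : (Q.1.2.2 - y0) ^+ 2 * ((Q.2.2 - y0) * (Q.1.1.2 - y0)) =
    ((Q.1.2.2 - y0) * (Q.2.2 - y0)) * ((Q.1.1.2 - y0) * (Q.1.2.2 - y0)) by ring.
  by rewrite pmulr_rlt0// lt_neqAle eq_sym mulf_neq0.
exists (rot (rot Q)); first exact: Or33.
split=> //; apply: key => //; have [_ /andP[g0 g1] _] := crossesP h'.
by rewrite afn_cpt /= pa mulr0 addr0 mulrCA mulr_gt0// subr_gt0.
Qed.

Lemma seq_argmax (T : eqType) (F : T -> R) (s : seq T) x0 : x0 \in s ->
  exists2 x, x \in s & forall y, y \in s -> F y <= F x.
Proof.
elim: s x0 => // a s IH x0 _; case: s IH => [|b s] IH.
  by exists a; rewrite ?inE// => y; rewrite inE => /eqP ->.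
have [|x xs xmax] := IH b; first by rewrite inE eqxx.
have [ax|xa] := leP (F a) (F x).
  exists x; first by rewrite inE xs orbT.
  by move=> y; rewrite inE => /predU1P[->//|/xmax].
exists a; first by rewrite inE eqxx.
by move=> y; rewrite inE => /predU1P[->//|/xmax h]; exact: le_trans (ltW xa).
Qed.

(** A violated barycentric inequality is affine in the parameter [g], so it stays violated
    nearby. *)
Lemma hull_away u Q (g : R) : det u != 0 -> ~ hull u (pt Q (g, 0)) ->
  exists2 d : R, 0 < d & forall g', `|g' - g| < d -> ~ hull u (pt Q (g', 0)).
Proof.
move=> u0 nh.
have H (F : R * R -> R) : (forall x : R, F (pt Q (x, 0)) = F (pt Q (0, 0)) + x * (F (pt Q (1, 0)) - F (pt Q (0, 0)))) ->
    (forall z, hull u z -> 0 <= F z) -> F (pt Q (g, 0)) < 0 ->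
    exists2 d : R, 0 < d & forall g', `|g' - g| < d -> ~ hull u (pt Q (g', 0)).
  move=> FE Fh Fg; set q := F (pt Q (1, 0)) - F (pt Q (0, 0)) in FE.
  have q1 : 0 < 1 + `|q| by rewrite ltr_pwDl.
  exists (- F (pt Q (g, 0)) / (1 + `|q|)); first by rewrite divr_gt0// oppr_gt0.
  move=> g'; rewrite ltr_pdivlMr// => gg /Fh; rewrite leNgt => /negP; apply.
  have -> : F (pt Q (g', 0)) = F (pt Q (g, 0)) + (g' - g) * q by rewrite (FE g') (FE g); ring.
  have : (g' - g) * q <= `|g' - g| * (1 + `|q|).
    by rewrite (le_trans (ler_norm _))// normrM ler_wpM2l// lerDr.
  by lra.
have hE z : hull u z <-> [/\ 0 <= co1 u z, 0 <= co2 u z & co1 u z + co2 u z <= 1] := hullP z u0.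
have [c1|c1] := ltP (co1 u (pt Q (g, 0))) 0.
  apply: H c1 => [x|z /hE[]//]; rewrite /co1 /det /=; ring.
have [c2|c2] := ltP (co2 u (pt Q (g, 0))) 0.
  apply: H c2 => [x|z /hE[]//]; rewrite /co2 /det /=; ring.
have [c3|c3] := ltP (1 - co1 u (pt Q (g, 0)) - co2 u (pt Q (g, 0))) 0.
  apply: (H (fun z => 1 - co1 u z - co2 u z)) c3 => [x|z /hE[_ _]]; last by lra.
  by rewrite /co1 /co2 /det /=; ring.
by exfalso; apply: nh; apply/hE; split=> //; lra.
Qed.

Lemma hulls_away (s : seq (triple R)) Q (g : R) : (forall u, u \in s -> det u != 0 /\ ~ hull u (pt Q (g, 0))) ->
  exists2 d : R, 0 < d & forall g' u, u \in s -> `|g' - g| < d -> ~ hull u (pt Q (g', 0)).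
Proof.
elim: s => [|u s IH] H; first by exists 1.
have [d d0 hd] : exists2 d : R, 0 < d & forall g' u, u \in s -> `|g' - g| < d -> ~ hull u (pt Q (g', 0)).
  by apply: IH => v vs; apply: H; rewrite inE vs orbT.
have [|u0 nu] := H u; first by rewrite inE eqxx.
have [e e0 he] := hull_away u0 nu; exists (Num.min d e); first by rewrite lt_min d0.
move=> g' v; rewrite inE lt_min => /predU1P[->|vs] /andP[h1 h2]; [exact: he|exact: hd].
Qed.

(** A horizontal line through no vertex is followed to its last crossing with a side. A second
    triangle touching that point would have a side on the same line and lie on its right, and the
    horizontal line would leave it further to the right. A neighbourhood of the crossing in the side
    is then free as well, the other triangles being closed. *)
Lemma free_side_at (s : seq (triple R)) t1 : psep s -> (forall t, t \in s -> det t != 0) ->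
  (forall t v, t \in s -> v \in vs t -> v.2 != y0) -> t1 \in s -> (exists2 Q1, rots Q1 t1 & crosses Q1) ->
  exists t Q (g1 g2 : R), [/\ t \in s, rots Q t, 0 <= g1, g1 < g2 & g2 <= 1] /\
    forall g u, g1 < g < g2 -> u \in s -> u != t -> ~ hull u (pt Q (g, 0)).
Proof.
move=> ps s0 gen t1s [Q1 tQ1 ct1].
pose E := [seq Q <- flatten [seq [:: t; rot t; rot (rot t)] | t <- s] | crosses Q].
have EP Q : Q \in E <-> crosses Q /\ exists2 t, t \in s & rots Q t.
  rewrite mem_filter; split=> [/andP[-> /flatten_mapP[t ts]]|[-> [t ts tQ]]].
    by rewrite !inE => /or3P[] /eqP ->; split=> //; exists t => //; [exact: Or31|exact: Or32|exact: Or33].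
  by apply/flatten_mapP; exists t; rewrite // !inE; case: tQ => ->; rewrite eqxx ?orbT.
have [|Q /EP[cQ [t ts tQ]] Qmax] := @seq_argmax _ (fun Q => (cpt Q).1) E Q1.
  by apply/EP; split=> //; exists t1.
have noright v Q' (phi : R * R * R) : v \in s -> rots Q' v -> crosses Q' ->
    afn phi Q'.1.1 = 0 -> afn phi Q'.1.2 = 0 -> (cpt Q).1 <= (cpt Q').1 ->
    phi.1.1 * afn phi Q'.2 <= 0.
  move=> vs vQ' cQ' pa pb le; rewrite leNgt; apply/negP => gt0.
  have [|Q'' h1 [h2 h3]] := cross_right cQ' _ pa pb gt0.
    by apply: (gen v) => //; rewrite -(rots_vs _ vQ') !inE eqxx !orbT.
  have : Q'' \in E by apply/EP; split=> //; exists v => //; exact: rots_trans h1.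
  by move=> /Qmax; rewrite leNgt (le_lt_trans le).
have [bne /andP[g0 g1] zy] := crossesP cQ.
have nohit u : u \in s -> u != t -> ~ hull u (cpt Q).
  move=> us ut hu; have tu : t != u by rewrite eq_sym.
  have [phi [pz pge ple]] := psep_mem ps ts us tu.
  have t0 := s0 _ ts; have u0 := s0 _ us.
  have hQ : forall v, v \in vs Q -> 0 <= afn phi v.
    move=> v; rewrite (rots_vs _ tQ) => vt; apply: (afn_ge_hull pge); exact: hull_vs.
  have hz := afn_le_hull ple hu.
  have ha : 0 <= afn phi Q.1.1 by apply: hQ; rewrite inE eqxx.
  have hb : 0 <= afn phi Q.1.2 by apply: hQ; rewrite !inE eqxx orbT.
  have hc : 0 <= afn phi Q.2 by apply: hQ; rewrite !inE eqxx !orbT.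
  have g1' : 0 < 1 - gcross Q by rewrite subr_gt0.
  have : (1 - gcross Q) * afn phi Q.1.1 + gcross Q * afn phi Q.1.2 == 0.
    by rewrite -afn_cpt; apply/eqP/le_anti; rewrite hz afn_cpt addr_ge0// mulr_ge0// ltW.
  have k3 := mulr_ge0 (ltW g1') ha; have k4 := mulr_ge0 (ltW g0) hb.
  rewrite (paddr_eq0 k3 k4) => /andP[].
  rewrite mulf_eq0 (gt_eqF g1') => /eqP pa; rewrite mulf_eq0 (gt_eqF g0) => /eqP pb.
  clear k3 k4.
  have pc : 0 < afn phi Q.2.
    rewrite lt_neqAle hc andbT; apply/eqP => pc.
    have Q0 := rots_det t0 tQ; have := afn_ge_tint Q0 pz _ (tint_ctr Q0).
    by rewrite /afn_ge ha hb hc /ctr afn_pt pa pb -pc !mulr0 !addr0 ltxx => /(_ isT).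
  (* By maximality of the crossing, [t] is on the left of the separating line, which contains the
     first side of [Q]; [u] is then on its right. *)
  have A0 : phi.1.1 < 0.
    have : phi.1.1 * afn phi Q.2 <= 0 by apply: (noright t).
    rewrite pmulr_lle0// le_eqVlt => /predU1P[A0|//]; exfalso.
    have : phi.1.2 * (Q.1.2.2 - Q.1.1.2) = 0.
      by move: pa pb; rewrite /afn A0; lra.
    move=> /eqP; rewrite mulf_eq0 (negbTE bne) orbF => /eqP B0.
    by move: pz; rewrite /afnz A0 B0 eqxx.
  have ule : afn_ge (opa phi) u by rewrite /afn_ge !afn_opa !oppr_ge0.
  have uz : afnz (opa phi) by rewrite /afnz /= !oppr_eq0.
  have zz : afn (opa phi) (cpt Q) = 0 by rewrite afn_opa afn_cpt pa pb !mulr0 addr0 oppr0.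
  case: (facet_cases u0 uz ule) => [[k1 k2 k3]|[Q' uQ' [k1 k2 k3]]|[Q' uQ' [k1 k2 k3]]].
  - move: hu => [w [w1 w2 w3] wE]; move: zz; rewrite -wE afn_pt => zz.
    have w0 : 0 <= 1 - w.1 - w.2 by lra.
    have := mulr_ge0 w0 (ltW k1); have := mulr_ge0 w1 (ltW k2); have := mulr_ge0 w2 (ltW k3).
    move=> e1 e2 e3.
    have /eqP : (1 - w.1 - w.2) * afn (opa phi) u.1.1 = 0 by lra.
    have /eqP : w.1 * afn (opa phi) u.1.2 = 0 by lra.
    have /eqP : w.2 * afn (opa phi) u.2 = 0 by lra.
    rewrite !mulf_eq0 (gt_eqF k1) (gt_eqF k2) (gt_eqF k3) !orbF => /eqP ? /eqP ? /eqP ?; lra.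
  - have : cpt Q = Q'.1.1.
      rewrite -(rots_hull uQ') in hu; case: Q' k1 k2 k3 hu {uQ'} => [[a b] c] k1 k2 k3 hu.
      by apply/(hull_one _ k1 k2 k3).
    move=> E1; have ne : Q'.1.1.2 != y0 by apply: (gen u) => //; rewrite -(rots_vs _ uQ') inE eqxx.
    by rewrite -E1 zy eqxx in ne.
  (* [u] has a whole side on the separating line. This side crosses the horizontal line at the same
     point, and [noright] contradicts the position of [u]. *)
  - have Q0' := rots_det u0 uQ'.
    have : segment Q'.1.1 Q'.1.2 (cpt Q).
      rewrite -(rots_hull uQ') in hu; case: Q' k1 k2 k3 hu Q0' {uQ'} => [[a b] c] k1 k2 k3 hu Q0'.
      by apply/(hull_two _ Q0' k1 k2 k3).
    move=> /segmentP[l /andP[l0 l1] lE].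
    have a2 : Q'.1.1.2 != y0 by apply: (gen u) => //; rewrite -(rots_vs _ uQ') inE eqxx.
    have b2 : Q'.1.2.2 != y0 by apply: (gen u) => //; rewrite -(rots_vs _ uQ') !inE eqxx orbT.
    have yE : y0 = Q'.1.1.2 + l * (Q'.1.2.2 - Q'.1.1.2) by rewrite -zy lE.
    have cQ' : crosses Q'.
      rewrite /crosses; have -> : Q'.1.1.2 - y0 = - (l * (Q'.1.2.2 - Q'.1.1.2)) by rewrite {1}yE; ring.
      have -> : Q'.1.2.2 - y0 = (1 - l) * (Q'.1.2.2 - Q'.1.1.2) by rewrite {1}yE; ring.
      have d0 : Q'.1.2.2 - Q'.1.1.2 != 0.
        by apply: contraNneq a2 => d0; rewrite yE d0 mulr0 addr0.
      have l0' : 0 < l.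
        by rewrite lt_neqAle l0 andbT; apply: contraNneq a2 => l0'; rewrite yE -l0' mul0r addr0.
      have l1' : 0 < 1 - l.
        rewrite subr_gt0 lt_neqAle l1 andbT; apply: contraNneq b2 => l1'; rewrite yE l1' mul1r.
        by rewrite addrC subrK.
      by rewrite mulNr oppr_lt0 mulrACA -expr2 (mulr_gt0 (mulr_gt0 l0' l1'))// exprn_even_gt0.
    have [d0 _ zy'] := crossesP cQ'.
    have gl : gcross Q' = l by rewrite /gcross yE; field.
    have xE : cpt Q' = cpt Q.
      by rewrite lE /cpt gl; apply: pair_ext; rewrite /= !scaleE; ring.
    have := noright u Q' (opa phi) us uQ' cQ' k1 k2.
    rewrite xE lexx => /(_ isT); rewrite /= leNgt => /negP; apply.
    by rewrite pmulr_lgt0// oppr_gt0.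
have [|d d0 hd] := @hulls_away [seq u <- s | u != t] Q (gcross Q).
  by move=> u; rewrite mem_filter => /andP[ut us]; split; [exact: s0|exact: nohit].
exists t, Q, (Num.max 0 (gcross Q - d)), (Num.min 1 (gcross Q + d)); split.
  split; rewrite ?le_max ?lexx// ?ge_min ?lexx//.
  by rewrite gt_max !lt_min ltr01 /=; apply/and3P; split; lra.
move=> g u; rewrite gt_max lt_min => /andP[/andP[h1 h2] /andP[h3 h4]] us ut.
by apply: hd; rewrite ?mem_filter ?ut// ltr_distl; lra.
Qed.

End free_side.

Section free_side_exists.
Context {R : realType}.

Lemma free_side (s : seq (triple R)) t1 : psep s -> (forall t, t \in s -> det t != 0) ->
  t1 \in s ->
  exists t Q (g1 g2 : R), [/\ t \in s, rots Q t, 0 <= g1, g1 < g2 & g2 <= 1] /\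
    forall g u, g1 < g < g2 -> u \in s -> u != t -> ~ hull u (pt Q (g, 0)).
Proof.
move=> ps s0 t1s.
have [Q tQ dQ] : exists2 Q, rots Q t1 & Q.1.1.2 != Q.1.2.2.
  have [e1|e1] := eqVneq t1.1.1.2 t1.1.2.2; last by exists t1 => //; exact: Or31.
  exists (rot t1); first exact: Or32.
  rewrite /=; apply: contraNneq (s0 _ t1s) => e2; rewrite /det e1 e2; apply/eqP; ring.
pose ys := flatten [seq map snd (vs t) | t <- s].
have [y0 y0Q y0s] : exists2 y0, (Q.1.1.2 - y0) * (Q.1.2.2 - y0) < 0 & y0 \notin ys.
  have [lt|lt|E] := ltgtP Q.1.1.2 Q.1.2.2; last by rewrite E eqxx in dQ.
  - have [y /andP[h1 h2] ny] := avoid ys lt; exists y => //.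
    by rewrite pmulr_llt0 ?subr_gt0// subr_lt0.
  - have [y /andP[h1 h2] ny] := avoid ys lt; exists y => //.
    by rewrite pmulr_rlt0 ?subr_gt0// subr_lt0.
have gen t v : t \in s -> v \in vs t -> v.2 != y0.
  move=> ts vt; apply: contraNneq y0s => <-; apply/flatten_mapP; exists t => //.
  exact: map_f.
by apply: (free_side_at ps s0 gen t1s); exists Q.
Qed.

End free_side_exists.

Section pieces_count.
Context {R : realType}.
Variables (n : nat) (h : R).
Hypotheses (n0 : (0 < n)%N) (h0 : 0 < h) (h1 : 3 * h < 1).

Lemma rots_size_pieces (Q Q' : triple R) W : rots Q' Q -> size (pieces n h Q W) = size (pieces n h Q' W).
Proof. by move=> [] ->; rewrite !size_pieces ?rot3; lia. Qed.

Lemma size_pieces_out (Q : triple R) w W : det Q != 0 -> ~ hull Q w ->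
  size (pieces n h Q (w :: W)) = size (pieces n h Q W).
Proof.
move=> Q0 nw; have H Q' : rots Q' Q -> wsel Q' (w :: W) = wsel Q' W.
  move=> QQ'; rewrite /wsel /=; case: ifP => // /andP[/eqP c2 /andP[c10 c11]]; exfalso.
  apply: nw; rewrite -(rots_hull QQ'); apply/hullP; first exact: rots_det QQ'.
  by split; rewrite /= ?c2 ?addr0.
by rewrite !size_pieces !H//; [exact: Or33|exact: Or32|exact: Or31].
Qed.

Lemma size_pieces_in (Q : triple R) (g : R) W : det Q != 0 -> 0 < g < 1 ->
  g \notin map fst ((0, top n h 0) :: side n h (wsel Q W)) ->
  size (pieces n h Q (pt Q (g, 0) :: W)) = (size (pieces n h Q W)).+1.
Proof.
move=> Q0 /andP[g0 g1] gs; have g01 : 0 <= g <= 1 by rewrite !ltW.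
have w0 : wsel Q (pt Q (g, 0) :: W) = g :: wsel Q W.
  by rewrite /wsel /= co1_pt// co2_pt//= eqxx g01 /= co1_pt.
have w1 : wsel (rot Q) (pt Q (g, 0) :: W) = wsel (rot Q) W.
  by rewrite /wsel /= co2_rot// co1_pt// co2_pt//= subr0 subr_eq0 (gt_eqF g1).
have w2 : wsel (rot (rot Q)) (pt Q (g, 0) :: W) = wsel (rot (rot Q)) W.
  rewrite /wsel /= co2_rot ?det_rot// co2_rot// co1_rot co1_pt// co2_pt//= !subr0.
  by rewrite subKr (gt_eqF g0).
by rewrite !size_pieces w0 w1 w2 size_side//; lia.
Qed.

End pieces_count.

(** * Gluing the cells *)

Section mesh.
Context {R : realType}.
Variables (K : nat) (hh : nat -> R) (L : seq (triple R * nat)).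
Hypotheses (K0 : (0 < K)%N) (hh0 : forall n, (0 < n)%N -> 0 < hh n /\ 3 * hh n < 1).
Hypotheses (Lp : psep (map fst L)) (Ld : forall x, x \in L -> det x.1 != 0 /\ (0 < x.2)%N).
Implicit Types W : seq (R * R).

Definition mesh W := flatten [seq pieces x.2 (hh x.2) x.1 W | x <- L].

(** The regular subdivision with step [1 / (K n)] contains the one with step [1 / n] that every
    strip uses anyway, so a neighbour learns of all these vertices from [W]. The factor [K] makes
    the lower sides of strip triangles short compared with [1 / n]. *)
Definition admissible W : Prop :=
  (forall w x, w \in W -> x \in L -> ~ tint x.1 w) /\
  (forall x Q i, x \in L -> rots Q x.1 -> (i <= K * x.2)%N -> sidept (K * x.2) Q i \in W).

Definition grid_sides : seq (R * R) :=
  flatten [seq flatten [seq [seq sidept (K * x.2) Q i | i <- iota 0 (K * x.2).+1] |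
    Q <- [:: x.1; rot x.1; rot (rot x.1)]] | x <- L].

Let LQ x : x \in L -> det x.1 != 0. Proof. by case/Ld. Qed.
Let Ln x : x \in L -> (0 < x.2)%N. Proof. by case/Ld. Qed.

Lemma L_inj x y : x \in L -> y \in L -> x.1 = y.1 -> x = y.
Proof.
have : uniq (map fst L).
  by apply: psep_uniq_seq => // t /mapP[z zL ->]; exact: LQ.
elim: L => // a l IH /= /andP[al ul]; rewrite !inE => /predU1P[->|xl] /predU1P[->|yl] E //.
- by rewrite E map_f in al.
- by rewrite -E map_f in al.
- exact: IH.
Qed.

Lemma mem_mesh W t : t \in mesh W -> exists2 x, x \in L & t \in pieces x.2 (hh x.2) x.1 W.
Proof. by move=> /flatten_mapP. Qed.

Lemma L_sep x y : x \in L -> y \in L -> x.1 != y.1 -> sep x.1 y.1.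
Proof. by move=> xL yL; apply: (psep_mem Lp); exact: map_f. Qed.

Lemma side_not_tint Q (g : R) : det Q != 0 -> ~ tint Q (pt Q (g, 0)).
Proof. by move=> Q0 []; rewrite co1_pt// co2_pt//= ltxx. Qed.

Lemma side_hull Q (g : R) : 0 <= g <= 1 -> hull Q (pt Q (g, 0)).
Proof. by move=> /andP[g0 g1]; exists (g, 0) => //; split=> //=; rewrite addr0. Qed.

Lemma side_adm x y Q (g : R) : x \in L -> y \in L -> rots Q x.1 -> 0 <= g <= 1 ->
  ~ tint y.1 (pt Q (g, 0)).
Proof.
move=> xL yL xQ g01; have Q0 := rots_det (LQ xL) xQ.
have [E|ne] := eqVneq x.1 y.1.
  by rewrite -E -(rots_tint (LQ xL) xQ); exact: side_not_tint.
apply: (sep_hull_tint (LQ yL) (L_sep xL yL ne)).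
by rewrite -(rots_hull xQ); exact: side_hull.
Qed.

Lemma grid_sides_adm : admissible grid_sides.
Proof.
split=> [w y /flatten_mapP[x xL /flatten_mapP[Q Qx /mapP[i]]]|x Q i xL xQ iK].
  rewrite mem_iota add0n ltnS => /andP[_ iK] -> yL; apply: (side_adm xL) => //.
    by move: Qx; rewrite !inE => /or3P[] /eqP ->; [exact: Or31|exact: Or32|exact: Or33].
  by apply: frac01; rewrite // muln_gt0 K0 Ln.
apply/flatten_mapP; exists x => //; apply/flatten_mapP; exists Q.
  by case: xQ => ->; rewrite !inE eqxx ?orbT.
by apply/mapP; exists i; rewrite // mem_iota.
Qed.

Lemma size_grid_sides : size grid_sides = (\sum_(x <- L) 3 * (K * x.2).+1)%N.
Proof.
rewrite /grid_sides size_flatten sumnE /shape -map_comp big_map; apply: eq_bigr => x _ /=.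
by rewrite !size_cat /= !size_cat /= !size_cat /= !size_map !size_iota; lia.
Qed.

Lemma psep_mesh W : psep (mesh W).
Proof.
apply: (psep_flatten (g := fst)) => //.
  by move=> x xL; have [h0 h1] := hh0 (Ln xL); apply: psep_pieces => //; [exact: Ln|exact: LQ].
by move=> x t xL; have [h0 h1] := hh0 (Ln xL); apply: pieces_sub => //; [exact: Ln|exact: LQ].
Qed.

Lemma det_mesh W t : t \in mesh W -> det t != 0.
Proof.
move=> /mem_mesh[x xL]; have [h0 h1] := hh0 (Ln xL); apply: det_pieces => //; first exact: Ln.
exact: LQ.
Qed.

Lemma mesh_cover W z : (exists2 t, t \in mesh W & hull t z) <-> exists2 x, x \in L & hull x.1 z.
Proof.
split=> [[t /mem_mesh[x xL tx] tz]|[x xL xz]]; have [h0 h1] := hh0 (Ln xL).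
  by exists x => //; apply: (pieces_sub _ h0 h1 (LQ xL) tx) tz; exact: Ln.
have [t ht tz] := pieces_cover (Ln xL) h0 h1 W (LQ xL) xz.
by exists t => //; apply/flatten_mapP; exists x.
Qed.

Lemma sidept_mul (Q : triple R) n i : (0 < n)%N -> sidept n Q i = sidept (K * n) Q (K * i).
Proof.
move=> n0; rewrite /sidept !natrM; congr (pt Q (_, _)).
by field; rewrite !pnatr_eq0 -!lt0n K0 n0.
Qed.

(** A vertex is a lattice point, a point of [W] or a point of the regular subdivision of a side. The
    first kind is interior to its cell and seen only from that cell; the last two kinds belong to
    [W], the index [i / n] being [(K i) / (K n)]. *)
Lemma nohang_mesh W : admissible W -> nohang (mesh W).
Proof.
move=> [W1 W2] t t' v /mem_mesh[x xL tx] /mem_mesh[y yL ty] vt' tv.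
have [h0 h1] := hh0 (Ln xL); have [k0 k1] := hh0 (Ln yL).
have [x0 y0] := (LQ xL, LQ yL); have [xn yn] := (Ln xL, Ln yL).
have xv := pieces_sub xn h0 h1 x0 tx tv.
have bd : v \in W -> v \in vs t.
  by move=> vW; apply: (bdry_vertex xn h0 h1 x0 tx) => //; exact: W1.
case: (pieces_vertices yn k0 k1 y0 ty vt') => [lv|vW|[Q [i [yQ iy vE]]]]; first last.
- by apply: bd; rewrite vE sidept_mul//; apply: W2 yQ _; rewrite // leq_pmul2l.
- exact: bd.
have yv := latQ_tint yn k0 k1 y0 lv.
have E : x.1 = y.1.
  apply/eqP; apply: contraT => ne; exfalso.
  exact: (sep_hull_tint y0 (L_sep xL yL ne) xv yv).
have xy : x = y := L_inj xL yL E.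
by apply: (lat_vertex xn h0 h1 x0 tx) tv; rewrite xy.
Qed.

Lemma size_mesh W : size (mesh W) = (\sum_(x <- L) size (pieces x.2 (hh x.2) x.1 W))%N.
Proof. by rewrite /mesh size_flatten sumnE /shape -map_comp big_map. Qed.

(** The new point is taken on a free portion of side, away from the existing vertices: its own cell
    gains exactly one triangle and the others do not contain it. *)
Lemma pad_one W : L != [::] -> admissible W ->
  exists2 w, admissible (w :: W) & size (mesh (w :: W)) = (size (mesh W)).+1.
Proof.
move=> Ln0 [W1 W2].
have [t1 t1L] : exists t1, t1 \in map fst L.
  by case: L Ln0 => // a l _; exists a.1; rewrite /= inE eqxx.
have Ld' t : t \in map fst L -> det t != 0 by move=> /mapP[x xL ->]; exact: LQ.
have [t [Q [g1 [g2 [[tL tQ g10 g12 g21] free]]]]] := free_side Lp Ld' t1L.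
have [x xL tE] := mapP tL; rewrite {t}tE in tL tQ free.
have [h0 h1] := hh0 (Ln xL).
have [g /andP[gg1 gg2] gs] := avoid (map fst ((0, top x.2 (hh x.2) 0) :: side x.2 (hh x.2) (wsel Q W))) g12.
have g01 : 0 < g < 1 by rewrite (le_lt_trans g10)//= (lt_le_trans gg2).
have g01' : 0 <= g <= 1 by case/andP: g01 => *; rewrite !ltW.
exists (pt Q (g, 0)).
  split=> [w y|y Q' i yL yQ' iK]; last by rewrite inE W2// orbT.
  rewrite inE => /predU1P[->|wW] yL; last exact: W1.
  exact: (side_adm xL).
have uL : uniq L by apply: (@map_uniq _ _ fst); exact: psep_uniq_seq.
rewrite !size_mesh (big_rem x)//= [in RHS](big_rem x)//= -addSn; congr (_ + _)%N.
  have E V : size (pieces x.2 (hh x.2) x.1 V) = size (pieces x.2 (hh x.2) Q V).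
    by apply: rots_size_pieces => //; exact: Ln.
  rewrite !E.
  by apply: size_pieces_in => //; [exact: Ln|exact: rots_det (LQ xL) tQ].
apply: eq_big_seq => y; rewrite mem_rem_uniq// inE => /andP[yx yL].
apply: size_pieces_out; first exact: LQ.
apply: free; rewrite ?gg1 ?gg2 ?map_f//.
by apply: contraNneq yx => /(L_inj yL xL) ->.
Qed.

Lemma pad N : L != [::] -> (size (mesh grid_sides) <= N)%N ->
  exists2 W, admissible W & size (mesh W) = N.
Proof.
move=> Ln0; elim: N => [|N IH].
  by rewrite leqn0 => /eqP E; exists grid_sides; [exact: grid_sides_adm|].
rewrite leq_eqVlt => /predU1P[E|/IH[W aW <-]].
  by exists grid_sides; [exact: grid_sides_adm|].
by have [w aw E] := pad_one Ln0 aW; exists (w :: W).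
Qed.

Lemma size_mesh_le : (size (mesh grid_sides) <=
  \sum_(x <- L) (x.2 * x.2 + 6 * x.2 + 3 * \sum_(y <- L) 3 * (K * y.2).+1))%N.
Proof.
rewrite size_mesh !big_seq; apply: leq_sum => x xL; rewrite -big_seq -size_grid_sides.
by have [h0 h1] := hh0 (Ln xL); apply: size_pieces_le => //; exact: Ln.
Qed.

End mesh.

(** * Errors on the pieces *)

Section strip_shapes.
Context {R : realType}.
Implicit Types (t Q : triple R).

Lemma tmap_comp (b b' : R * R) (l l' : R) t : tmap b l (tmap b' l' t) = tmap (b + l *: b') (l * l') t.
Proof.
by rewrite /tmap /=; congr (_, _, _); rewrite scalerDr scalerA addrA.
Qed.

Lemma tileE n (h : R) Q ij : (0 < n)%N ->
  exists b (l : R), tile n h Q ij = tmap b l Q /\ `|l| = `|1 - 3 * h| / n%:R.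
Proof.
move=> n0; rewrite /tile /gtile; case: ifP => _; rewrite aff_std /inref tmap_comp aff_std.
  by eexists; eexists; split; [reflexivity|rewrite normrM normfV mulrC normr_nat].
by eexists; eexists; split; [reflexivity|rewrite normrM normrN normfV mulrC normr_nat].
Qed.

Lemma diam_aff Q t (D X Y : R) : diam_le Q D ->
  (forall z w, hull t z -> hull t w -> `|z.1 - w.1| <= X /\ `|z.2 - w.2| <= Y) ->
  diam_le (aff Q t) ((X + Y) * D).
Proof.
move=> QD tXY z w; rewrite hull_aff => -[z' hz' <-] [w' hw' <-].
have [X1 Y1] := tXY _ _ hz' hw'; have [q0 q1 q2] := hullv Q.
have [a1 a2] := QD _ _ q1 q0; have [b1 b2] := QD _ _ q2 q0.
have H (u v x y : R) : `|u| <= X -> `|v| <= Y -> `|x| <= D -> `|y| <= D -> `|u * x + v * y| <= (X + Y) * D.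
  move=> uX vY xD yD; rewrite (le_trans (ler_normD _ _))// mulrDl !normrM.
  by rewrite lerD// ler_pM.
split=> /=.
  rewrite (_ : _ - _ = (z'.1 - w'.1) * (Q.1.2.1 - Q.1.1.1) + (z'.2 - w'.2) * (Q.2.1 - Q.1.1.1)); last by ring.
  exact: H.
rewrite (_ : _ - _ = (z'.1 - w'.1) * (Q.1.2.2 - Q.1.1.2) + (z'.2 - w'.2) * (Q.2.2 - Q.1.1.2)); last by ring.
exact: H.
Qed.

Section one_strip.
Variables (n : nat) (h : R).
Hypotheses (n0 : (0 < n)%N) (h0 : 0 < h) (h1 : 3 * h < 1).

Lemma top_near c : (c <= n)%N -> - (2 * h) <= top n h c - c%:R / n%:R <= h.
Proof.
move=> cn; have /andP[f0 f1] := @frac01 R n n0 c cn; have h0' := h0.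
have -> : top n h c - c%:R / n%:R = h - 3 * (h * (c%:R / n%:R)) by rewrite /top; ring.
have := mulr_ge0 (ltW h0) f0; have := ler_piMr (ltW h0) f1; lra.
Qed.

Lemma stri_diam st st' : step n h st st' -> forall z w, hull (stri h st st') z ->
  hull (stri h st st') w -> `|z.1 - w.1| <= n%:R^-1 + 3 * h /\ `|z.2 - w.2| <= h.
Proof.
move=> sst z w hz hw.
have [z2 z2' _ _] := stri_region n0 h0 h1 sst hz; have [w2 w2' _ _] := stri_region n0 h0 h1 sst hw.
split; last by rewrite ler_norml; lra.
have [a aP] : exists a, forall z, hull (stri h st st') z -> a <= z.1 <= a + (n%:R^-1 + 3 * h).
  have h0' := h0; move: (sst) => [i [hi E]].
  have /andP[t1 t2] := top_near (ltnW hi); have /andP[t3 t4] := top_near hi.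
  have iE : i.+1%:R / n%:R = i%:R / n%:R + n%:R^-1 :> R by rewrite -natr1 mulrDl mul1r.
  have n0' : 0 < n%:R^-1 :> R by rewrite invr_gt0 ltr0n.
  exists (i%:R / n%:R - 2 * h) => u hu.
  have key phi : (forall b, i%:R / n%:R <= b <= i%:R / n%:R + n%:R^-1 -> 0 <= afn phi (b, 0)) ->
      0 <= afn phi (top n h i, h) -> 0 <= afn phi (top n h i.+1, h) -> 0 <= afn phi u.
    move=> k1 k2 k3; apply: afn_ge_hull hu; rewrite /stri.
    case: E => [[-> ->]|[-> -> e1 e2 e3]] /=; rewrite /afn_ge ?eqxx /=.
      by rewrite k2 k3 k1//; lra.
    by rewrite (lt_eqF e2) /= k3 !k1//; rewrite -?iE; lra.
  have /key : forall b, i%:R / n%:R <= b <= i%:R / n%:R + n%:R^-1 -> 0 <= afn (1, 0, - (i%:R / n%:R - 2 * h)) (b, 0).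
    by move=> b /andP[b1 b2]; rewrite /afn /=; lra.
  have /key : forall b, i%:R / n%:R <= b <= i%:R / n%:R + n%:R^-1 -> 0 <= afn (-1, 0, i%:R / n%:R + n%:R^-1 + h) (b, 0).
    by move=> b /andP[b1 b2]; rewrite /afn /=; lra.
  rewrite /afn /= => K1 K2; have := K1 _ _; have := K2 _ _.
  move=> /(_ ltac:(lra) ltac:(lra)) L1 /(_ ltac:(lra) ltac:(lra)) L2; lra.
have := aP _ hz; have := aP _ hw; rewrite ler_norml; lra.
Qed.

Lemma strp_diam Q W t (D : R) : diam_le Q D -> t \in strp n h Q W ->
  diam_le t ((n%:R^-1 + 4 * h) * D).
Proof.
move=> QD /mem_strp[t0 ht0 ->]; have [st [st' [sst -> _]]] := mem_strip n0 h0 h1 ht0.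
rewrite (_ : n%:R^-1 + 4 * h = (n%:R^-1 + 3 * h) + h); last by ring.
by apply: diam_aff QD _; exact: stri_diam.
Qed.

(** No subdivision point lies strictly between the lower ends of a strip triangle, so the first
    point [j / (K n)] beyond [st.1] bounds [st'.1] from above. *)
Lemma strp_fine K Q W t : (0 < K)%N ->
  (forall i, (i <= K * n)%N -> i%:R / (K * n)%:R \in wsel Q W) -> t \in strp n h Q W ->
  exists st st', [/\ step n h st st', t = aff Q (stri h st st') & st'.1 - st.1 <= (K * n)%:R^-1].
Proof.
move=> K0 fineW /mem_strp[t0 ht0 ->]; have [st [st' [sst -> H]]] := mem_strip n0 h0 h1 ht0.
exists st, st'; split=> //.
have [[s0 ss s1] _] := step_range n0 h1 sst.
have kn0 : 0 < (K * n)%:R :> R by rewrite ltr0n muln_gt0 K0.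
have [E|ne] := eqVneq st.1 st'.1; first by rewrite E subrr invr_ge0 ltW.
have lt : st.1 < st'.1 by rewrite lt_neqAle ne.
have : exists j, (j <= K * n)%N && (st.1 < j%:R / (K * n)%:R).
  by exists (K * n)%N; rewrite leqnn divff ?gt_eqF// (lt_le_trans lt).
move=> /ex_minnP[j /andP[jK sj] jmin].
case: j jK sj jmin => [|j] jK sj jmin.
  by move: sj; rewrite mul0r ltNge s0.
have jb : j%:R / (K * n)%:R <= st.1.
  by rewrite leNgt; apply/negP => hj; have := jmin j; rewrite hj (ltnW jK) => /(_ isT); rewrite ltnn.
have /H[h2|h2] : j.+1%:R / (K * n)%:R \in map fst ((0, top n h 0) :: side n h (wsel Q W)).
  by apply: (side_mem n0 h0 h1); [exact: fineW|apply: frac01; rewrite // muln_gt0 K0].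
  by move: h2; rewrite leNgt sj.
move: h2; rewrite -natr1 mulrDl mul1r; lra.
Qed.

End one_strip.
End strip_shapes.

(** * Flat triangles of the strips *)

Section strip_errors.
Context {R : realType} (m : nat) (m2 : (2 <= m)%N).
Implicit Types (t Q : triple R).

Lemma flat_coord (u v e g X Y D : R) : `|u| <= X -> `|v| <= Y -> `|e| <= D -> `|g| <= D ->
  `|u * e + v * g| <= (X + Y) * D.
Proof.
move=> uX vY xD yD; rewrite (le_trans (ler_normD _ _))// mulrDl !normrM.
by rewrite lerD// ler_pM.
Qed.

Lemma flat_edges Q (v0 v1 : R * R) (D sg nu X Y k : R) : diam_le Q D ->
  `|v1.1 - v0.1 + nu * sg| <= X -> `|v1.2 - v0.2| <= Y -> (X + Y) * D <= k ->
  `|(pt Q v1).1 - (pt Q v0).1 - nu * sg * (Q.1.1.1 - Q.1.2.1)| <= k /\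
  `|(pt Q v1).2 - (pt Q v0).2 - nu * sg * (Q.1.1.2 - Q.1.2.2)| <= k.
Proof.
move=> QD hX hY kE; have [q0 q1 q2] := hullv Q.
have [a1 a2] := QD _ _ q1 q0; have [b1 b2] := QD _ _ q2 q0.
split; apply: le_trans kE.
  rewrite (_ : _ - _ = (v1.1 - v0.1 + nu * sg) * (Q.1.2.1 - Q.1.1.1) + (v1.2 - v0.2) * (Q.2.1 - Q.1.1.1)).
    exact: flat_coord.
  by rewrite /=; ring.
rewrite (_ : _ - _ = (v1.1 - v0.1 + nu * sg) * (Q.1.2.2 - Q.1.1.2) + (v1.2 - v0.2) * (Q.2.2 - Q.1.1.2)).
  exact: flat_coord.
by rewrite /=; ring.
Qed.

(** At scale [1 / n] a strip triangle is within [k] of a degenerate one along the side of [Q]: its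
    height is at most [h], the tile vertices are displaced by at most [2 * h], and its lower side is
    at most [1 / (K n)]. *)
Lemma strp_flat n (h : R) K Q W t c (D r S k : R) : (0 < n)%N -> 0 < h -> 3 * h < 1 -> (0 < K)%N ->
  det Q != 0 ->
  (forall i, (i <= K * n)%N -> i%:R / (K * n)%:R \in wsel Q W) -> t \in strp n h Q W ->
  diam_le Q D -> D <= r -> 1 <= r -> 0 <= k <= 1 ->
  (3 * h + (K * n)%:R^-1) * D <= n%:R^-1 * k ->
  (forall z, hull Q z -> `|eI m Q (hom m c) z| <= S) ->
  forall z, hull t z -> `|eI m t (hom m c) z| <=
    n%:R^-1 ^+ m * (S + (1 + Lam m.-1) * (cnorm m c * (m%:R * (r + 1) ^+ m * k))).
Proof.
move=> n0 h0 h1 K0 Q0 fineW ht QD Dr r1 k01 kE QS.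
have t0 : det t != 0 := det_strp n0 h0 h1 Q0 ht.
have [st [st' [sst tE dst]]] := strp_fine n0 h0 h1 K0 fineW ht.
have [i [hi E]] := sst.
have /andP[p1 p2] := top_near n0 h0 (ltnW hi); have /andP[p3 p4] := top_near n0 h0 hi.
have iE : i.+1%:R / n%:R = i%:R / n%:R + n%:R^-1 :> R by rewrite -natr1 mulrDl mul1r.
have n0' : 0 < n%:R^-1 :> R by rewrite invr_gt0 ltr0n.
have nn : n%:R != 0 :> R by rewrite pnatr_eq0 -lt0n.
have D0 : 0 <= D := diam_ge0 QD.
have kn0 : 0 <= (K * n)%:R^-1 :> R by rewrite invr_ge0.
have mono X Y : X + Y <= 3 * h + (K * n)%:R^-1 -> (X + Y) * D <= n%:R^-1 * k.
  by move=> XY; apply: le_trans kE; rewrite ler_wpM2r.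
have [q0 q1 q2] := hullv Q; have [a1 a2] := QD _ _ q0 q1.
(* The first vertex of a strip triangle is an upper right one; up to terms of order [h] the two
   others lie on its left, so the side of [Q] is traversed backwards. *)
have Q0' : det (swp Q) != 0 by rewrite det_swp oppr_eq0.
have QS' z : hull (swp Q) z -> `|eI m (swp Q) (hom m c) z| <= S.
  by rewrite hull_swp eI_swp//; exact: QS.
have key sg : 0 <= sg <= 1 ->
  (forall v, v = (stri h st st').1.2 \/ v = (stri h st st').2 ->
     exists X Y, [/\ X + Y <= 3 * h + (K * n)%:R^-1,
       `|v.1 - (stri h st st').1.1.1 + n%:R^-1 * sg| <= X &
       `|v.2 - (stri h st st').1.1.2| <= Y]) ->
  forall z, hull t z -> `|eI m t (hom m c) z| <=
    n%:R^-1 ^+ m * (S + (1 + Lam m.-1) * (cnorm m c * (m%:R * (r + 1) ^+ m * k))).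
  move=> sg01 H.
  have [X1 [Y1 [XY1 hX1 hY1]]] := H _ (or_introl erefl).
  have [X2 [Y2 [XY2 hX2 hY2]]] := H _ (or_intror erefl).
  have [e1 e2] := flat_edges QD hX1 hY1 (mono _ _ XY1).
  have [e3 e4] := flat_edges QD hX2 hY2 (mono _ _ XY2).
  apply: (@eI_flat _ m m2 t (swp Q) c n%:R^-1 sg k r S) => //; rewrite ?tE//=.
  - exact: le_trans Dr.
  - exact: le_trans Dr.
have h0' : 0 <= h := ltW h0.
(* When the upper end advances, both other vertices are about [1 / n] away, whence [sg = 1]. When
   the lower end advances, they are about [(i + 1) / n - st.1] away and within [1 / (K n)] of each
   other. *)
case: E => [[stE st'E]|[s1 s2 s3 s4 s5]].
  apply: (key 1); first by rewrite ler01 lexx.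
  rewrite mulr1 /stri stE st'E /= eqxx => v [] -> /=.
    exists (3 * h), 0; rewrite subrr normr0 lexx addr0 lerDl; split=> //.
    have /andP[f0 f1] := @frac01 R n n0 1 n0.
    have -> : top n h i - top n h i.+1 + n%:R^-1 = 3 * (h * n%:R^-1).
      by rewrite /top iE; ring.
    rewrite div1r in f0 f1; have := mulr_ge0 h0' f0; have := ler_piMr h0' f1.
    by rewrite ler_norml; lra.
  exists (2 * h), h; rewrite sub0r normrN (ger0_norm h0') lexx; split=> //; first by lra.
  by rewrite ler_norml; lra.
apply: (key (n%:R * (i.+1%:R / n%:R - st.1))).
  rewrite mulr_ge0 ?subr_ge0 ?(le_trans (ltW s4))//= -ler_pdivlMl ?ltr0n// mulr1.
  by lra.
rewrite mulKf// /stri (lt_eqF s4) s1 /= => v [] -> /=.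
  exists (2 * h), h; rewrite sub0r normrN (ger0_norm h0') lexx; split=> //; first by lra.
  by rewrite ler_norml; lra.
exists (2 * h + (K * n)%:R^-1), h; rewrite sub0r normrN (ger0_norm h0') lexx; split=> //; first by lra.
by rewrite ler_norml; lra.
Qed.

End strip_errors.

Section local_errors.
Context {R : realType} (m : nat) (m2 : (2 <= m)%N).
Variables (p : \bar R) (Omega : set (R * R)) (f : R * R -> R).
Hypotheses (p1 : (1 <= p)%E) (fC : Cm m Omega f).
Implicit Types (t Q : triple R).
Notation RR := (measurableTypeR R * measurableTypeR R)%type.

Let m0 : (0 < m)%N. Proof. exact: ltnW m2. Qed.

(** The data frozen on a cell: [c] is within [w] of the Taylor coefficients in the [l^1] norm, at
    the points where the derivatives of [f] exist. *)
Definition fits Q (c : nat -> R) (w D : R) : Prop :=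
  [/\ det Q != 0, hull Q `<=` Omega, diam_le Q D, 0 <= w &
   forall z, hull Q z -> Omega° z ->
     \sum_(k < m.+1) `|Gp f k (m - k) z / (k`!%:R * (m - k)`!%:R) - c k| <= w].

Definition Cosc : R := (1 + Lam m.-1) * m`!%:R.

Lemma Cosc_ge0 : 0 <= Cosc.
Proof. by rewrite mulr_ge0// addr_ge0// Lam_ge0. Qed.

Lemma measurable_eI t c : det t != 0 -> measurable_fun setT (eI m t (hom m c) : RR -> R).
Proof.
move=> t0; apply: (@measurable_polys _ m); apply: polysB; first exact: hom_polys.
by apply: polys_le (polys_interp m2 _ t0); exact: leq_pred.
Qed.

Lemma fits_osc Q c w D t d z : fits Q c w D -> det t != 0 -> hull t `<=` hull Q ->
  diam_le t d -> hull t z ->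
  `|eI m t f z - eI m t (hom m c) z| <= Cosc * (d ^+ m * w).
Proof.
move=> [Q0 QO QD w0 Qw] t0 tQ td tz.
have tO : hull t `<=` Omega by move=> x /tQ/QO.
have tU : tint t `<=` Omega°.
  by rewrite -(@open_subsetE _ (tint t)); [move=> x /(tint_hull t0)/tO|exact: open_tint].
have [|P [dP H]] := taylor_tint m0 fC t0 tO td w0 (c := c).
  by move=> x xt; apply: Qw; [apply/tQ/tint_hull|exact: tU].
rewrite /Cosc -mulrA; apply: eI_approx H tz => //.
by rewrite !mulr_ge0// exprn_ge0// (diam_ge0 td).
Qed.

Lemma err_fits Q c w D t d : fits Q c w D -> det t != 0 -> hull t `<=` hull Q ->
  diam_le t d ->
  (err_loc m p (mkT t) f <= nrm p t (eI m t (hom m c)) + (Cosc * (d ^+ m * w) * ap p t)%:E)%E.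
Proof.
move=> QF t0 tQ td; have [_ _ _ w0 _] := QF.
rewrite err_loc_nrm//; apply: nrmD => //.
- by rewrite mulr_ge0 ?Cosc_ge0// mulr_ge0// exprn_ge0// (diam_ge0 td).
- exact: measurable_eI.
- move=> z tz; rewrite -lerBlDl (le_trans (lerB_dist _ _))//.
  exact: fits_osc QF t0 tQ td tz.
Qed.

Lemma nrm_hom_le Q c D : det Q != 0 -> diam_le Q D ->
  (nrm p Q (eI m Q (hom m c)) <= ((1 + Lam m.-1) * (cnorm m c * D ^+ m) * ap p Q)%:E)%E.
Proof.
move=> Q0 QD; set k := (1 + _) * _.
have k0 : 0 <= k.
  by rewrite mulr_ge0 ?addr_ge0 ?Lam_ge0// mulr_ge0 ?cnorm_ge0// exprn_ge0// (diam_ge0 QD).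
apply: le_trans (nrm_cst p1 Q0 k0); apply: le_nrm => // z Qz.
by rewrite (ger0_norm k0); exact: eI_hom_le.
Qed.

Lemma nrm_hom_fin Q c D : det Q != 0 -> diam_le Q D ->
  nrm p Q (eI m Q (hom m c)) = (fine (nrm p Q (eI m Q (hom m c))))%:E.
Proof.
move=> Q0 QD; rewrite fineK// ge0_fin_numE ?nrm_ge0//.
by rewrite (le_lt_trans (nrm_hom_le c Q0 QD))// ltry.
Qed.

Lemma ap_tmap b (l : R) Q : l != 0 -> det Q != 0 ->
  ap p (tmap b l Q) = (l ^+ 2) `^ fine p^-1 * ap p Q.
Proof.
by move=> l0 Q0; rewrite /ap area_tmap// powRM ?sqr_ge0// ltW// area_gt0.
Qed.

Lemma nrm_hom_tmap b (l : R) Q c : l != 0 -> det Q != 0 ->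
  (nrm p (tmap b l Q) (eI m (tmap b l Q) (hom m c)) <=
   (`|l| ^+ m * (l ^+ 2) `^ fine p^-1)%:E * nrm p Q (eI m Q (hom m c)))%E.
Proof.
move=> l0 Q0; have t0 := det_tmap_neq0 b l0 Q0.
pose g z := `|eI m Q (hom m c) z|; pose h z := `|eI m (tmap b l Q) (hom m c) z|.
have -> : nrm p Q (eI m Q (hom m c)) = nrm p Q g.
  by apply/le_anti; rewrite !le_nrm// => z _; rewrite normr_id.
have -> : nrm p (tmap b l Q) (eI m (tmap b l Q) (hom m c)) = nrm p (tmap b l Q) h.
  by apply/le_anti; rewrite !le_nrm// => z _; rewrite normr_id.
apply: nrm_tmap => //.
- by apply: measurableT_comp; [exact: normr_measurable|exact: measurable_eI].
- by apply: measurableT_comp; [exact: normr_measurable|exact: measurable_eI].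
- by move=> z; rewrite /h /g eI_tmap// normrM normrX.
Qed.

Definition eQ Q c (w D sg : R) : R :=
  fine (nrm p Q (eI m Q (hom m c))) + Cosc * (D ^+ m * w) * ap p Q + sg.

Lemma err_tmap b (l : R) Q c w D sg : l != 0 -> 0 <= sg -> fits Q c w D ->
  hull (tmap b l Q) `<=` hull Q ->
  (err_loc m p (mkT (tmap b l Q)) f <=
   (`|l| ^+ m * (l ^+ 2) `^ fine p^-1 * eQ Q c w D sg)%:E)%E.
Proof.
move=> l0 sg0 QF sub; have [Q0 _ QD w0 _] := QF; have t0 := det_tmap_neq0 b l0 Q0.
have td : diam_le (tmap b l Q) (`|l| * D) by exact: diam_le_tmap.
apply: (le_trans (err_fits QF t0 sub td)).
apply: (le_trans (leeD2r _ (nrm_hom_tmap b c l0 Q0))).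
rewrite (nrm_hom_fin c Q0 QD) -EFinM -EFinD lee_fin ap_tmap// /eQ -subr_ge0.
rewrite [X in 0 <= X](_ : _ = `|l| ^+ m * (l ^+ 2) `^ fine p^-1 * sg); last by rewrite exprMn; ring.
by rewrite mulr_ge0// mulr_ge0 ?exprn_ge0 ?powR_ge0.
Qed.

Definition Cst (c : nat -> R) (w : R) : R := (1 + Lam m.-1) * cnorm m c + Cosc * w.

Lemma Cst_ge0 c w : 0 <= w -> 0 <= Cst c w.
Proof.
by move=> w0; rewrite addr_ge0 ?mulr_ge0 ?Cosc_ge0 ?cnorm_ge0// addr_ge0// Lam_ge0.
Qed.

Lemma err_small Q c w D t d : fits Q c w D -> det t != 0 -> hull t `<=` hull Q ->
  diam_le t d -> (err_loc m p (mkT t) f <= (Cst c w * d ^+ m * ap p t)%:E)%E.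
Proof.
move=> QF t0 tQ td; apply: (le_trans (err_fits QF t0 tQ td)).
apply: (le_trans (leeD2r _ (nrm_hom_le c t0 td))).
by rewrite -EFinD lee_fin /Cst le_eqVlt; apply/orP; left; apply/eqP; ring.
Qed.

Lemma eQ_ge c w Q D sg : 0 <= w -> 0 <= D -> sg <= eQ Q c w D sg.
Proof.
move=> w0 D0; rewrite /eQ lerDr addr_ge0// ?fine_ge0 ?nrm_ge0//.
by rewrite mulr_ge0 ?ap_ge0// mulr_ge0 ?Cosc_ge0// mulr_ge0// exprn_ge0.
Qed.

End local_errors.

Section sup_errors.
Context {R : realType} (m : nat) (m2 : (2 <= m)%N).
Variables (Omega : set (R * R)) (f : R * R -> R).
Hypothesis fC : Cm m Omega f.
Implicit Types (t Q : triple R).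

(** The cell enters with [2 * D] because [4 * h <= 1 / n] bounds the diameter of a strip triangle by
    [2 * D / n]. The excess over the degenerate error is at most [sg] at scale [1 / n]. *)
Lemma err_strp_infty n (h : R) K Q' Q W t c (w D r k sg : R) : (0 < n)%N -> 0 < h ->
  3 * h < 1 -> (0 < K)%N -> fits m Omega f Q c w D -> rots Q' Q ->
  (forall i, (i <= K * n)%N -> i%:R / (K * n)%:R \in wsel Q' W) -> t \in strp n h Q' W ->
  D <= r -> 1 <= r -> 0 <= k <= 1 -> (3 * h + (K * n)%:R^-1) * D <= n%:R^-1 * k ->
  4 * h <= n%:R^-1 ->
  (1 + Lam m.-1) * (cnorm m c * (m%:R * (r + 1) ^+ m * k)) <= sg ->
  (err_loc m +oo (mkT t) f <= (n%:R^-1 ^+ m * eQ m +oo Q c w (2 * D) sg)%:E)%E.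
Proof.
move=> n0 h0 h1 K0 QF QQ' fineW ht Dr r1 k01 kE hn sgE.
have [Q0 _ QD w0 _] := QF; have Q0' := rots_det Q0 QQ'.
have QD' : diam_le Q' D by move=> z v; rewrite (rots_hull QQ'); exact: QD.
have t0 : det t != 0 := det_strp n0 h0 h1 Q0' ht.
have tQ : hull t `<=` hull Q.
  rewrite -(rots_hull QQ') => z tz; have [b1 b2 b3 b4] := strp_region n0 h0 h1 Q0' ht tz.
  by apply/(hullP _ Q0'); split=> /=; lra.
have td := strp_diam n0 h0 h1 QD' ht.
have D0 := diam_ge0 QD.
have td' : diam_le t (n%:R^-1 * (2 * D)).
  have dd : (n%:R^-1 + 4 * h) * D <= n%:R^-1 * (2 * D).
    rewrite mulrA ler_wpM2r// mulr_natr mulr2n lerD2l//.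
  move=> z v tz tv; have [u1 u2] := td z v tz tv.
  by split; exact: le_trans dd.
pose S := fine (nrm +oo Q (eI m Q (hom m c))).
have SE := nrm_hom_fin m2 (leey _ : (1 <= +oo)%E) c Q0 QD; rewrite -/S in SE.
have QS z : hull Q z -> `|eI m Q (hom m c) z| <= S.
  move=> Qz; rewrite -lee_fin -SE; apply: (@norm_le_nrm_infty _ m) => //.
  apply: polysB; first exact: hom_polys.
  by apply: polys_le (polys_interp m2 _ Q0); exact: leq_pred.
have QS' z : hull Q' z -> `|eI m Q' (hom m c) z| <= S.
  by rewrite (rots_hull QQ'); case: QQ' => ->; rewrite ?eI_rot ?det_rot//; exact: QS.
have H := strp_flat m2 n0 h0 h1 K0 Q0' fineW ht QD' Dr r1 k01 kE QS'.
set B := (1 + _) * _ in H sgE.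
have nm : 0 <= n%:R^-1 ^+ m :> R by rewrite exprn_ge0// invr_ge0.
rewrite err_loc_nrm//; set rhs := _ * eQ _ _ _ _ _ _ _.
have S0 : 0 <= S by rewrite fine_ge0// nrm_ge0.
have rhs0 : 0 <= rhs.
  have e0 : sg <= eQ m +oo Q c w (2 * D) sg by apply: eQ_ge; rewrite ?mulr_ge0.
  rewrite mulr_ge0// (le_trans _ e0)// (le_trans _ sgE)//; case/andP: k01 => k0 _.
  by rewrite mulr_ge0 ?addr_ge0 ?Lam_ge0// mulr_ge0 ?cnorm_ge0// mulr_ge0// mulr_ge0// exprn_ge0//; lra.
have ap1 u : ap +oo%E u = 1 :> R by rewrite /ap invey /= powRr0.
have := @nrm_cst R +oo%E t rhs (leey _) t0 rhs0; rewrite ap1 mulr1.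
apply: le_trans; apply: le_nrm; first exact: leey.
move=> z tz; rewrite (ger0_norm rhs0) -(subrK (eI m t (hom m c) z) (eI m t f z)).
rewrite (le_trans (ler_normD _ _))//.
have o1 := fits_osc m2 fC QF t0 tQ td' tz; have o2 := H z tz.
rewrite (le_trans (lerD o1 o2))// /rhs /eQ -/S ap1 mulr1 exprMn.
rewrite -subr_ge0 [X in 0 <= X](_ : _ = n%:R^-1 ^+ m * (sg - B)); last by ring.
by rewrite mulr_ge0// subr_ge0.
Qed.

End sup_errors.

Section piece_sums.
Context {R : realType} (m : nat) (m2 : (2 <= m)%N).
Variables (Omega : set (R * R)) (f : R * R -> R).
Hypothesis fC : Cm m Omega f.
Implicit Types (t Q : triple R).
Definition strips n (h : R) Q W := strp n h Q W ++ strp n h (rot Q) W ++ strp n h (rot (rot Q)) W.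

Lemma piecesE n (h : R) Q W : pieces n h Q W = map (tile n h Q) (gidx n) ++ strips n h Q W.
Proof. by []. Qed.

Lemma mem_strips n (h : R) Q W t : t \in strips n h Q W -> exists2 Q', t \in strp n h Q' W & rots Q' Q.
Proof.
rewrite !mem_cat => /or3P[ht|ht|ht].
- by exists Q => //; exact: Or31.
- by exists (rot Q) => //; exact: Or32.
- by exists (rot (rot Q)) => //; exact: Or33.
Qed.

(** The tiles occupy the proportion [(1 - 3 h)^2] of the cell, and [1 - (1 - 3 h)^2 <= 6 h]. *)
Lemma sum_strips_area n (h : R) Q W : (0 < n)%N -> 0 < h -> 3 * h < 1 -> det Q != 0 ->
  \sum_(t <- strips n h Q W) area t <= 6 * h * area Q.
Proof.
move=> n0 h0 h1 Q0.
have := @sum_area_le R (pieces n h Q W) (hull Q) (measurable_hull Q0) (psep_pieces n0 h0 h1 W Q0)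
  (fun t ht => det_pieces n0 h0 h1 Q0 ht) (fun t ht => pieces_sub n0 h0 h1 Q0 ht).
rewrite areaE// sumEFin lee_fin piecesE big_cat /= big_map.
have -> : \sum_(ij <- gidx n) area (tile n h Q ij) = (1 - 3 * h) ^+ 2 * area Q.
  have nn : n%:R != 0 :> R by rewrite pnatr_eq0 -lt0n.
  rewrite (eq_bigr (fun=> ((1 - 3 * h) / n%:R) ^+ 2 * area Q)); last first.
    move=> ij _; have [b [l [-> lE]]] := tileE h Q ij n0.
    have l2 : l ^+ 2 = ((1 - 3 * h) / n%:R) ^+ 2.
      by rewrite -[l ^+ 2]real_normK ?num_real// lE ger0_norm// subr_ge0 ltW.
    rewrite area_tmap ?l2//; apply/eqP => l0; move/eqP: lE; rewrite l0 normr0 eq_sym.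
    rewrite mulf_eq0 normr_eq0 invr_eq0 (negbTE nn) orbF; apply/negP.
    by rewrite gt_eqF// subr_gt0.
  rewrite big_const_seq count_predT size_gidx iter_addr_0 -[_ *+ (n * n)]mulr_natl natrM.
  by field.
have a0 := area_gt0 Q0; have := mulr_ge0 (sqr_ge0 h) (ltW a0).
move=> h2.
rewrite -lerBrDl => /le_trans; apply; rewrite -subr_ge0.
rewrite [X in 0 <= X](_ : _ = 9 * (h ^+ 2 * area Q)); last by ring.
by rewrite mulr_ge0.
Qed.

Lemma ap_powR (r : R) t : 0 < r -> ap r%:E t `^ r = area t.
Proof.
move=> r0; rewrite /ap /= inver gt_eqF//= -powRrM mulVf ?gt_eqF// powRr1//.
by rewrite /area fine_ge0.
Qed.

(** Each of the [n^2] tiles contributes at most [(n^-m e)^r / n^2]. The strips have errors of the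
    same order per unit of area, hence a small total; the hypothesis lets it fit between [e^r] and
    [(e + sg)^r]. *)
Lemma sum_err_pieces (r : R) n (h : R) Q W c (w D sg : R) : 1 <= r -> (0 < n)%N -> 0 < h ->
  3 * h < 1 -> 4 * h <= n%:R^-1 -> 0 <= sg -> fits m Omega f Q c w D ->
  (Cst m c w * (2 * D) ^+ m) `^ r * (6 * h * area Q) <=
    (eQ m r%:E Q c w (2 * D) sg + sg) `^ r - eQ m r%:E Q c w (2 * D) sg `^ r ->
  (\sum_(t <- pieces n h Q W) err_loc m r%:E (mkT t) f `^ r <=
    ((n%:R^-1 ^+ m * (eQ m r%:E Q c w (2 * D) sg + sg)) `^ r)%:E)%E.
Proof.
move=> r1 n0 h0 h1 hn sg0 QF H; have [Q0 QO QD w0 Qw] := QF.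
have r0 : 0 < r := lt_le_trans ltr01 r1; have D0 := diam_ge0 QD.
have p1 : (1 <= r%:E)%E by rewrite lee_fin.
have nn : n%:R != 0 :> R by rewrite pnatr_eq0 -lt0n.
have ni : 0 < n%:R^-1 :> R by rewrite invr_gt0 ltr0n.
have QD2 : diam_le Q (2 * D).
  move=> z v Qz Qv; have [a1 a2] := QD _ _ Qz Qv; split; apply: le_trans (_ : D <= _) => //.
    by rewrite ler_peMl// ler1n.
  by rewrite ler_peMl// ler1n.
have QF2 : fits m Omega f Q c w (2 * D) by split.
set e := eQ m r%:E Q c w (2 * D) sg in H *.
have e0 : 0 <= e by apply: le_trans sg0 _; apply: eQ_ge; rewrite ?mulr_ge0.
have mono x y : (0 <= x)%E -> (x <= y)%E -> (x `^ r <= y `^ r)%E.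
  move=> x0 xy; apply: gt0_ler_poweR => //; first exact: ltW.
    by rewrite in_itv /= x0 leey.
  by rewrite in_itv /= leey (le_trans x0).
have err0 t : (0 <= err_loc m r%:E (mkT t) f)%E by exact: Lnorm_ge0.
rewrite piecesE big_cat /= big_map.
have nm0 : 0 <= n%:R^-1 ^+ m :> R by rewrite exprn_ge0// ltW.
have T1 : (\sum_(ij <- gidx n) err_loc m r%:E (mkT (tile n h Q ij)) f `^ r <=
    ((n%:R^-1 ^+ m * e) `^ r)%:E)%E.
  apply: (@le_trans _ _ (\sum_(ij <- gidx n) ((n%:R^-1 ^+ m * e) `^ r * n%:R^-1 ^+ 2)%:E)%E); last first.
    rewrite sumEFin lee_fin big_const_seq count_predT size_gidx iter_addr_0.
    by rewrite -[_ *+ (n * n)]mulr_natl natrM le_eqVlt; apply/orP; left; apply/eqP; field.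
  rewrite big_seq [leRHS]big_seq; apply: lee_sum => ij ijn.
  have [b [l [tE lE]]] := tileE h Q ij n0.
  have l0 : l != 0.
    apply/eqP => l0; move/eqP: lE; rewrite l0 normr0 eq_sym mulf_eq0 normr_eq0 invr_eq0 (negbTE nn) orbF.
    by apply/negP; rewrite gt_eqF// subr_gt0.
  have sub : hull (tmap b l Q) `<=` hull Q.
    rewrite -tE; apply: (pieces_sub (W := W) n0 h0 h1 Q0); rewrite piecesE mem_cat map_f//.
  have ln : `|l| <= n%:R^-1.
    rewrite lE ger0_norm ?subr_ge0 ?(ltW h1)// ler_piMl ?(ltW ni)//.
    by rewrite gerBl mulr_ge0// ltW.
  have := @err_tmap R m m2 r%:E Omega f p1 fC b l Q c w (2 * D) sg l0 sg0 QF2 sub; rewrite -/e -tE => /(mono _ _ (err0 _))/le_trans; apply.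
  rewrite poweR_EFin lee_fin.
  have fE : fine r%:E^-1 = r^-1 by rewrite inver gt_eqF.
  have l2 : l ^+ 2 <= n%:R^-1 ^+ 2.
    by rewrite -[l ^+ 2]real_normK ?num_real//; apply: lerXn2r => //; rewrite nnegrE ltW.
  rewrite fE (_ : n%:R^-1 ^+ 2 = ((n%:R^-1 ^+ 2) `^ r^-1) `^ r); last first.
    by rewrite -powRrM mulVf ?gt_eqF// powRr1// sqr_ge0.
  rewrite -powRM ?mulr_ge0 ?powR_ge0//; apply: ge0_ler_powR; rewrite ?nnegrE ?mulr_ge0 ?exprn_ge0 ?powR_ge0 ?(ltW r0)//.
  rewrite [leRHS]mulrAC ler_wpM2r// ler_pM ?exprn_ge0 ?powR_ge0//.
    by apply: lerXn2r => //; rewrite nnegrE ltW.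
  by apply: ge0_ler_powR; rewrite ?nnegrE ?sqr_ge0// invr_ge0 ltW.
have T2 : (\sum_(t <- strips n h Q W) err_loc m r%:E (mkT t) f `^ r <=
    ((n%:R^-1 ^+ m) `^ r * ((Cst m c w * (2 * D) ^+ m) `^ r * (6 * h * area Q)))%:E)%E.
  have C0 : 0 <= Cst m c w by exact: Cst_ge0.
  apply: (@le_trans _ _ (\sum_(t <- strips n h Q W) ((n%:R^-1 ^+ m) `^ r * ((Cst m c w * (2 * D) ^+ m) `^ r * area t))%:E)%E); last first.
    rewrite sumEFin lee_fin -mulr_sumr ler_wpM2l ?powR_ge0// -mulr_sumr ler_wpM2l ?powR_ge0//.
    exact: sum_strips_area.
  rewrite big_seq [leRHS]big_seq; apply: lee_sum => t ht.
  have [Q' ht' QQ'] := mem_strips ht; have Q0' := rots_det Q0 QQ'.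
  have QD' : diam_le Q' D by move=> z v; rewrite (rots_hull QQ'); exact: QD.
  have tp : t \in pieces n h Q W by rewrite piecesE mem_cat ht orbT.
  have t0 := det_pieces n0 h0 h1 Q0 tp; have tQ := pieces_sub n0 h0 h1 Q0 tp.
  have td' : diam_le t (n%:R^-1 * (2 * D)).
    have td := strp_diam n0 h0 h1 QD' ht'.
    have dd : (n%:R^-1 + 4 * h) * D <= n%:R^-1 * (2 * D).
      by rewrite mulrA ler_wpM2r// mulr_natr mulr2n lerD2l.
    move=> z v tz tv; have [u1 u2] := td z v tz tv.
    by split; exact: le_trans dd.
  have := err_small m2 p1 fC QF t0 tQ td' => /(mono _ _ (err0 _))/le_trans; apply.
  rewrite poweR_EFin lee_fin -(ap_powR t r0) -!powRM ?mulr_ge0 ?ap_ge0 ?powR_ge0 ?exprn_ge0 ?mulr_ge0//.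
  by rewrite le_eqVlt; apply/orP; left; apply/eqP; congr (_ `^ _); rewrite exprMn; ring.
apply: (le_trans (leeD T1 T2)); rewrite -EFinD lee_fin.
rewrite (powRM _ nm0 e0) (powRM _ nm0 (addr_ge0 e0 sg0)) -mulrDr ler_wpM2l ?powR_ge0//.
by move: H; rewrite lerBrDl.
Qed.

Lemma max_err_pieces n (h : R) K Q W c (w D k sg : R) t : (0 < n)%N -> 0 < h ->
  3 * h < 1 -> 4 * h <= n%:R^-1 -> (0 < K)%N -> 0 <= sg -> fits m Omega f Q c w D ->
  (forall Q' i, rots Q' Q -> (i <= K * n)%N -> i%:R / (K * n)%:R \in wsel Q' W) ->
  0 <= k <= 1 -> (3 * h + (K * n)%:R^-1) * D <= n%:R^-1 * k ->
  (1 + Lam m.-1) * (cnorm m c * (m%:R * (Num.max 1 D + 1) ^+ m * k)) <= sg ->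
  t \in pieces n h Q W ->
  (err_loc m +oo (mkT t) f <= (n%:R^-1 ^+ m * (eQ m +oo Q c w (2 * D) sg + sg))%:E)%E.
Proof.
move=> n0 h0 h1 hn K0 sg0 QF fineW k01 kE sgE; have [Q0 QO QD w0 Qw] := QF.
have D0 := diam_ge0 QD.
have nn : n%:R != 0 :> R by rewrite pnatr_eq0 -lt0n.
have ni : 0 < n%:R^-1 :> R by rewrite invr_gt0 ltr0n.
have nm0 : 0 <= n%:R^-1 ^+ m :> R by rewrite exprn_ge0// ltW.
have QD2 : diam_le Q (2 * D).
  move=> z v Qz Qv; have [a1 a2] := QD _ _ Qz Qv; split; apply: le_trans (_ : D <= _) => //.
    by rewrite ler_peMl// ler1n.
  by rewrite ler_peMl// ler1n.
have QF2 : fits m Omega f Q c w (2 * D) by split.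
set e := eQ m +oo Q c w (2 * D) sg.
have e0 : 0 <= e by apply: le_trans sg0 _; apply: eQ_ge; rewrite ?mulr_ge0.
have eE : ((n%:R^-1 ^+ m * e)%:E <= (n%:R^-1 ^+ m * (e + sg))%:E)%E.
  by rewrite lee_fin ler_wpM2l// lerDl.
rewrite piecesE mem_cat => /orP[/mapP[ij ijn ->]|/mem_strips[Q' ht QQ']]; apply: le_trans eE; last first.
  apply: (err_strp_infty m2 fC n0 h0 h1 K0 QF QQ' _ ht (r := Num.max 1 D) (k := k)) => //.
  - by move=> i; exact: fineW.
  - by rewrite le_max lexx orbT.
  - by rewrite le_max lexx.
have [b [l [tE lE]]] := tileE h Q ij n0.
have l0 : l != 0.
  apply/eqP => l0; move/eqP: lE; rewrite l0 normr0 eq_sym mulf_eq0 normr_eq0 invr_eq0 (negbTE nn) orbF.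
  by apply/negP; rewrite gt_eqF// subr_gt0.
have sub : hull (tmap b l Q) `<=` hull Q.
  rewrite -tE; apply: (pieces_sub (W := W) n0 h0 h1 Q0); rewrite piecesE mem_cat map_f//.
have ln : `|l| <= n%:R^-1.
  rewrite lE ger0_norm ?subr_ge0 ?(ltW h1)// ler_piMl ?(ltW ni)//.
  by rewrite gerBl mulr_ge0// ltW.
have := @err_tmap R m m2 +oo%E Omega f (leey _) fC b l Q c w (2 * D) sg l0 sg0 QF2 sub; rewrite -/e -tE => /le_trans; apply.
rewrite lee_fin invey /= powRr0 mulr1 ler_wpM2r//.
by apply: lerXn2r => //; rewrite nnegrE ltW.
Qed.

End piece_sums.

(** * Numbers of tiles and the global error *)

Section assembly.
Context {R : realType} (m : nat) (m2 : (2 <= m)%N).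
Variables (Omega : set (R * R)) (f : R * R -> R) (p : \bar R) (q : R).
Hypotheses (fC : Cm m Omega f) (p1 : (1 <= p)%E).
Hypothesis (hq : (q^-1)%:E = ((m%:R / 2)%:E + p^-1)%E).
Implicit Types (t Q : triple R).

Lemma exponentE : p^-1%E = (fine p^-1)%:E :> \bar R /\ 0 <= fine p^-1%E.
Proof.
case: p p1 => [r|_|//]; last by rewrite invey.
by rewrite lee_fin => r1; rewrite inver gt_eqF ?(lt_le_trans ltr01)//= invr_ge0 (le_trans ler01).
Qed.

Lemma exponent_q : q^-1 = m%:R / 2 + fine p^-1%E /\ 0 < q.
Proof.
have [pE s0] := exponentE; move: hq; rewrite pE -EFinD => -[qE]; split=> //.
by rewrite -invr_gt0 qE ltr_wpDr// divr_gt0// ltr0n ltnW.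
Qed.

Lemma small_delta (T : eqType) (P : seq T) (F : T -> R) : (forall x, 0 <= F x) ->
  exists d : R, 0 < d <= 1 /\ forall x, x \in P -> F x * d <= 1.
Proof.
move=> F0; have S0 : 0 <= \sum_(x <- P) F x by exact: sumr_ge0.
have S1 : 0 < 1 + \sum_(x <- P) F x by rewrite ltr_pwDl.
exists (1 + \sum_(x <- P) F x)^-1; split.
  by rewrite invr_gt0 S1 invf_le1// lerDl.
move=> x xP; rewrite ler_pdivrMr// mul1r (big_rem x)//= addrCA lerDl addr_ge0//.
exact: sumr_ge0.
Qed.

Lemma wsel_sidept n Q W i : det Q != 0 -> (0 < n)%N -> (i <= n)%N -> sidept n Q i \in W ->
  i%:R / n%:R \in wsel Q W.
Proof.
move=> Q0 n0 iN iW; apply/mapP; exists (sidept n Q i); last by rewrite co1_pt.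
by rewrite mem_filter iW andbT co1_pt// co2_pt//= eqxx frac01.
Qed.

Variables (P : seq (triple R)) (cc : triple R -> nat -> R) (ww DD : triple R -> R) (sg : R).
Hypotheses (Ps : psep P) (P0 : P != [::]) (sg0 : 0 < sg).
Hypothesis PF : forall Q, Q \in P -> fits m Omega f Q (cc Q) (ww Q) (DD Q).
Hypothesis PO : forall z, Omega z <-> exists2 Q, Q \in P & hull Q z.

Definition ePQ Q : R := eQ m p Q (cc Q) (ww Q) (2 * DD Q) sg + sg.

Let PQ0 Q : Q \in P -> det Q != 0. Proof. by case/PF. Qed.

Lemma ePQ_gt0 Q : Q \in P -> 0 < ePQ Q.
Proof.
move=> /PF[Q0 _ QD w0 _]; rewrite ltr_wpDl// (le_trans (ltW sg0))//.
by apply: eQ_ge; rewrite // mulr_ge0 ?(diam_ge0 QD).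
Qed.

(* The strips are thin for [p < oo] and aligned with [Q] for [p = oo]. *)
Lemma pieces_scale : exists (kap : R) (K : nat), [/\ 0 < kap, kap <= 4^-1, (0 < K)%N &
  forall n Q W, (0 < n)%N -> Q \in P ->
   (forall Q' i, rots Q' Q -> (i <= K * n)%N -> i%:R / (K * n)%:R \in wsel Q' W) ->
   match p with
   | r%:E => is_true (\sum_(t <- pieces n (kap / n%:R) Q W) err_loc m p (mkT t) f `^ r <=
              ((n%:R^-1 ^+ m * ePQ Q) `^ r)%:E)%E
   | _ => forall t, t \in pieces n (kap / n%:R) Q W ->
           (err_loc m p (mkT t) f <= (n%:R^-1 ^+ m * ePQ Q)%:E)%E
   end].
Proof.
have kapn (kap : R) n : 0 < kap -> kap <= 4^-1 -> (0 < n)%N ->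
  [/\ 0 < kap / n%:R, 3 * (kap / n%:R) < 1 & 4 * (kap / n%:R) <= n%:R^-1].
  move=> k0 k4 n0; have ni : 0 < n%:R^-1 :> R by rewrite invr_gt0 ltr0n.
  have ni1 : n%:R^-1 <= 1 :> R by rewrite invf_le1 ?ltr0n// ler1n.
  have kn : 4 * (kap / n%:R) <= n%:R^-1 by rewrite mulrA ler_piMl ?(ltW ni)//; lra.
  by split=> //; [rewrite mulr_gt0|have : 0 < kap / n%:R by [rewrite mulr_gt0]; lra].
rewrite /ePQ; have PF' := PF; case: p p1 => [r p1'|_|//].
  rewrite lee_fin in p1'; have r0 : 0 < r := lt_le_trans ltr01 p1'.
  pose e Q := eQ m r%:E Q (cc Q) (ww Q) (2 * DD Q) sg.
  (* The strip errors for one unit of relative strip area, over the room left by the slack. [d]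
     satisfies [F Q * d <= 1] on all cells, and [kap = d / 6] offsets the factor 6 of
     [sum_strips_area]. *)
  pose F Q := (Cst m (cc Q) (ww Q) * (2 * DD Q) ^+ m) `^ r * area Q / ((e Q + sg) `^ r - e Q `^ r).
  have [d [/andP[d0 d1] dF]] := @small_delta _ P (fun Q => `|F Q|) (fun Q => normr_ge0 _).
  exists (d / 6), 1%N; split=> //; first by rewrite divr_gt0.
    by rewrite ler_pdivrMr//; lra.
  move=> n Q W n0 QP _; have [||h0 h1 h4] := @kapn (d / 6) n _ _ n0.
  - by rewrite divr_gt0.
  - by rewrite ler_pdivrMr//; lra.
  have QF := PF' _ QP; have [Q0 _ QD w0 _] := QF.
  have HH := @sum_err_pieces R m m2 Omega f fC r n (d / 6 / n%:R) Q W (cc Q) (ww Q) (DD Q) sg p1' n0 h0 h1 h4 (ltW sg0) QF.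
  apply: HH.
  have e0 : 0 <= e Q by apply: le_trans (ltW sg0) _; apply: eQ_ge; rewrite ?mulr_ge0 ?(diam_ge0 QD).
  have dd : 0 < (e Q + sg) `^ r - e Q `^ r.
    have e1 : 0 <= e Q + sg := addr_ge0 e0 (ltW sg0).
    by rewrite subr_gt0; apply: gt0_ltr_powR; rewrite ?nnegrE// ltrDl.
  rewrite -/(e Q).
  have := le_trans (ler_wpM2r (ltW d0) (ler_norm (F Q))) (dF _ QP).
  rewrite /F mulrAC ler_pdivrMr// mul1r; apply: le_trans.
  have a0 := area_gt0 Q0.
  have -> : 6 * (d / 6 / n%:R) = d / n%:R by field; rewrite pnatr_eq0 -lt0n.
  rewrite -[leRHS]mulrA ler_wpM2l ?powR_ge0// [leRHS]mulrC ler_wpM2r ?(ltW a0)//.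
  by rewrite ler_piMr ?(ltW d0)// invf_le1 ?ltr0n// ler1n.
pose C Q := (1 + Lam m.-1) * (cnorm m (cc Q) * (m%:R * (Num.max 1 (DD Q) + 1) ^+ m)).
have [d [/andP[d0 d1] dF]] := @small_delta _ P (fun Q => `|DD Q| + `|C Q * DD Q / sg|) (fun Q => addr_ge0 (normr_ge0 _) (normr_ge0 _)).
(* With [kap = d / 6] the flatness [3 * kap + 1 / K] is at most [d], so [k = DD Q * d] is allowed;
   [d] was chosen to keep [k <= 1] and the resulting error below [sg]. *)
pose K := (Num.trunc (2 / d)).+1.
have Kd : K%:R^-1 <= d / 2.
  have /andP[_] : (Num.trunc (2 / d))%:R <= 2 / d < K%:R by apply: truncn_itv; rewrite divr_ge0// ltW.
  move=> /ltW h; rewrite -[leRHS]invrK lef_pV2 ?posrE ?invr_gt0 ?divr_gt0 ?ltr0n//.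
  by rewrite invf_div.
exists (d / 6), K; split=> //; first by rewrite divr_gt0.
  by rewrite ler_pdivrMr//; lra.
move=> n Q W n0 QP fineW t ht; have [||h0 h1 h4] := @kapn (d / 6) n _ _ n0.
- by rewrite divr_gt0.
- by rewrite ler_pdivrMr//; lra.
have QF := PF' _ QP; have [Q0 _ QD w0 _] := QF; have D0 := diam_ge0 QD.
have C0 : 0 <= C Q.
  rewrite mulr_ge0 ?addr_ge0 ?Lam_ge0// mulr_ge0 ?cnorm_ge0// mulr_ge0// exprn_ge0// addr_ge0//.
  by rewrite le_max ler01.
have CD0 : 0 <= C Q * DD Q / sg := divr_ge0 (mulr_ge0 C0 D0) (ltW sg0).
have := dF _ QP; rewrite mulrDl (ger0_norm D0) (ger0_norm CD0) => dQ.
have Dd0 : 0 <= DD Q * d by rewrite mulr_ge0// ltW.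
have Cd0 : 0 <= C Q * DD Q / sg * d := mulr_ge0 CD0 (ltW d0).
apply: (max_err_pieces m2 fC (K := K) (k := DD Q * d) n0 h0 h1 h4 _ (ltW sg0) QF fineW) => //.
- by rewrite Dd0; lra.
- have -> : 3 * (d / 6 / n%:R) + (K * n)%:R^-1 = (d / 2 + K%:R^-1) / n%:R.
    by rewrite natrM invfM; field; rewrite !pnatr_eq0 -!lt0n n0.
  rewrite mulrAC mulrC ler_wpM2l ?invr_ge0// [leRHS]mulrC ler_wpM2r//.
  by rewrite [leRHS]splitr lerD2l.
- have : C Q * DD Q / sg * d <= 1 by lra.
  rewrite mulrAC ler_pdivrMr// mul1r; apply: le_trans; rewrite le_eqVlt; apply/orP; left; apply/eqP.
  by rewrite /C; ring.
Qed.

(** Rounding [aQ Q * tau] gives about [tau^2 * ePQ Q^q] tiles in [Q], and the successor keeps the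
    number positive. With [tau^2 = N / S'] the tiles number about [N S / S'], where [S < S'] is the
    sum of the weights. *)
Let aQ Q : R := ePQ Q `^ (q / 2).
Definition nQ (tau : R) Q : nat := (Num.trunc (aQ Q * tau)).+1.

Lemma aQ_gt0 Q : Q \in P -> 0 < aQ Q.
Proof. by move=> QP; rewrite powR_gt0// ePQ_gt0. Qed.

Lemma aQ2 Q : Q \in P -> aQ Q ^+ 2 = ePQ Q `^ q.
Proof.
by move=> QP; rewrite -powR_mulrn ?powR_ge0// /aQ -powRrM divfK.
Qed.

Lemma nQ_bounds tau Q : 1 <= tau -> aQ Q * tau <= (nQ tau Q)%:R <= aQ Q * tau + 1.
Proof.
move=> t1; have a0 : 0 <= aQ Q * tau by rewrite mulr_ge0 ?powR_ge0 ?(le_trans ler01).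
by have /andP[h1 h2] := truncn_itv a0; rewrite (ltW h2) /nQ -natr1 lerD2r.
Qed.

(** The count is at most [tau^2 S + B tau], where [B] gathers the rounding, the strips and the
    prescribed points. It is below [tau^2 S' = N] as soon as [tau >= B / (S' - S)]; [X] is this
    threshold, raised to at least 1. *)
Lemma mesh_count (K : nat) (S' : R) : \sum_(Q <- P) ePQ Q `^ q < S' ->
  exists N0 : nat, forall N, (N0 <= N)%N ->
    [/\ 0 < N%:R / S', 1 <= Num.sqrt (N%:R / S') &
    (\sum_(x <- [seq (Q, nQ (Num.sqrt (N%:R / S')) Q) | Q <- P])
      (x.2 * x.2 + 6 * x.2 + 3 * \sum_(y <- [seq (Q, nQ (Num.sqrt (N%:R / S')) Q) | Q <- P]) 3 * (K * y.2).+1) <= N)%N].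
Proof.
move=> SS'; set S := \sum_(Q <- P) _ in SS'.
have S0 : 0 <= S by apply: sumr_ge0 => Q _; exact: powR_ge0.
have S'0 : 0 < S' := le_lt_trans S0 SS'.
have a0 Q : 0 <= aQ Q by exact: powR_ge0.
pose b Q : R := aQ Q + 1.
pose B := \sum_(Q <- P) ((2 * aQ Q + 1) + 6 * b Q + 3 * \sum_(y <- P) 3 * (K%:R * b y + 1)).
have b0 Q : 0 <= b Q by rewrite addr_ge0.
have B0 : 0 <= B.
  apply: sumr_ge0 => Q _; rewrite !addr_ge0 ?mulr_ge0//.
  by apply: sumr_ge0 => y _; rewrite mulr_ge0// addr_ge0// mulr_ge0.
pose X := Num.max 1 (B / (S' - S)).
have X1 : 1 <= X by rewrite le_max lexx.
have XB : B <= X * (S' - S).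
  by rewrite -ler_pdivrMr ?subr_gt0// le_max lexx orbT.
have X0 : 0 <= X := le_trans ler01 X1.
exists (Num.trunc (X ^+ 2 * S')).+1 => N hN.
have NX : X ^+ 2 <= N%:R / S'.
  rewrite ler_pdivlMr//; have /andP[_ /ltW h] := truncn_itv (mulr_ge0 (sqr_ge0 X) (ltW S'0)).
  by rewrite (le_trans h)// ler_nat.
set tau := Num.sqrt (N%:R / S').
have tX : X <= tau.
  by rewrite -[X]ger0_norm// -sqrtr_sqr ler_wsqrtr.
have t1 : 1 <= tau := le_trans X1 tX.
have N0 : 0 < N%:R / S' by apply: lt_le_trans NX; rewrite exprn_gt0// (lt_le_trans ltr01).
split=> //.
have t2 : N%:R = tau ^+ 2 * S' by rewrite sqr_sqrtr ?(ltW N0)// divfK// gt_eqF.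
rewrite -(ler_nat R) natr_sum big_map /= t2.
have t0 : 0 <= tau := le_trans ler01 t1.
have nb Q : (nQ tau Q)%:R <= b Q * tau.
  have /andP[_ h] := nQ_bounds Q t1; rewrite (le_trans h)// mulrDl mul1r lerD2l//.
have W1 : (\sum_(y <- [seq (Q, nQ tau Q) | Q <- P]) 3 * (K * y.2).+1)%N%:R <=
    (\sum_(y <- P) 3 * (K%:R * b y + 1)) * tau.
  rewrite natr_sum big_map mulr_suml; apply: ler_sum => y _ /=.
  rewrite natrM -mulrA ler_wpM2l// -natr1 natrM mulrDl mul1r lerD//.
  by rewrite -mulrA ler_wpM2l.
apply: (@le_trans _ _ (tau ^+ 2 * S + B * tau)); last first.
  have : B * tau <= tau ^+ 2 * (S' - S).
    rewrite (le_trans (ler_wpM2r t0 XB))// expr2 mulrAC -mulrA [_ * tau]mulrC.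
    by rewrite -mulrA ler_wpM2r// mulr_ge0// subr_ge0 ltW.
  by rewrite mulrBr; lra.
have -> : tau ^+ 2 * S + B * tau = \sum_(Q <- P) (tau ^+ 2 * ePQ Q `^ q +
    ((2 * aQ Q + 1) + 6 * b Q + 3 * \sum_(y <- P) 3 * (K%:R * b y + 1)) * tau).
  by rewrite big_split /= -mulr_sumr -mulr_suml.
rewrite big_seq [leRHS]big_seq; apply: ler_sum => Q QP.
rewrite natrD natrD natrM natrM natrM -(aQ2 QP).
have /andP[n1 n2] := nQ_bounds Q t1.
have nn : (nQ tau Q)%:R * (nQ tau Q)%:R <= tau ^+ 2 * aQ Q ^+ 2 + (2 * aQ Q + 1) * tau.
  have h : (nQ tau Q)%:R * (nQ tau Q)%:R <= (aQ Q * tau + 1) ^+ 2.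
    by rewrite expr2; apply: ler_pM.
  rewrite (le_trans h)// sqrrD expr1n mulr1 exprMn [aQ Q ^+ 2 * _]mulrC -addrA lerD2l.
  by rewrite mulr2n mulrDl mul1r; lra.
have n6 : 6 * (nQ tau Q)%:R <= 6 * b Q * tau by rewrite -mulrA ler_wpM2l.
have n3 : 3 * (\sum_(y <- [seq (Q, nQ tau Q) | Q <- P]) 3 * (K * y.2).+1)%N%:R <=
  3 * (\sum_(y <- P) 3 * (K%:R * b y + 1)) * tau by rewrite -mulrA ler_wpM2l.
rewrite [leRHS](_ : _ = tau ^+ 2 * aQ Q ^+ 2 + (2 * aQ Q + 1) * tau + 6 * b Q * tau +
    3 * (\sum_(y <- P) 3 * (K%:R * b y + 1)) * tau); last by ring.
exact: lerD (lerD nn n6) n3.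
Qed.

(** [nQ >= tau * ePQ^(q/2)] leaves the exponent [1 - q m / 2], which is [q / p] because
    [q (m / 2 + 1 / p) = 1]. *)
Lemma scaled_error tau Q : 1 <= tau -> Q \in P ->
  (nQ tau Q)%:R^-1 ^+ m * ePQ Q <= tau^-1 ^+ m * ePQ Q `^ (q * fine p^-1%E).
Proof.
move=> t1 QP; have t0 : 0 < tau := lt_le_trans ltr01 t1.
have e0 := ePQ_gt0 QP; have a0 := aQ_gt0 QP; have /andP[n1 _] := nQ_bounds Q t1.
have [qE q0] := exponent_q.
have aE : (aQ Q)^-1 ^+ m * ePQ Q = ePQ Q `^ (q * fine p^-1%E).
  rewrite exprVn -powR_mulrn ?ltW// /aQ -powRrM -powRN -{2}[ePQ Q]powRr1 ?ltW// -powRD.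
    congr (_ `^ _); have : q * q^-1 = 1 by rewrite divff ?gt_eqF.
    rewrite qE mulrDr; have -> : q / 2 * m%:R = q * (m%:R / 2) by field.
    lra.
  by rewrite (gt_eqF e0) implybT.
have at0 : 0 < aQ Q * tau := mulr_gt0 a0 t0.
have h : (nQ tau Q)%:R^-1 <= (aQ Q * tau)^-1.
  by rewrite lef_pV2 ?posrE// (lt_le_trans at0).
have hm : (nQ tau Q)%:R^-1 ^+ m <= (aQ Q * tau)^-1 ^+ m.
  by apply: lerXn2r h; rewrite nnegrE invr_ge0// ltW.
rewrite -aE mulrA ler_wpM2r ?(ltW e0)// (le_trans hm)// invfM exprMn mulrC lexx//.
Qed.

(** By [scaled_error], the [p]-th powers of the errors sum to at most [tau^(-m p)] times the sum of
    the weights [ePQ^q], and for [p = +oo] every error is at most [tau^-m]. Then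
    [N^(m/2) tau^-m = S'^(m/2)], and the exponents [m / 2] and [1 / p] add up to [1 / q]. *)
Theorem adapted_meshes (S' : R) : \sum_(Q <- P) ePQ Q `^ q < S' ->
  exists N0 : nat, forall N, (N0 <= N)%N -> exists TT : {fset triangle R},
    [/\ conforming Omega TT, #|` TT| = N &
     ((N%:R `^ (m%:R / 2))%:E * err_glob m p TT f <= (S' `^ q^-1)%:E)%E].
Proof.
move=> SS'; have [kap [K [k0 k4 K0 piecesE]]] := pieces_scale.
have [N0 HN] := mesh_count K SS'.
set S := \sum_(Q <- P) _ in SS'.
have S0 : 0 <= S by apply: sumr_ge0 => Q _; exact: powR_ge0.
have S'0 : 0 < S' := le_lt_trans S0 SS'.
exists N0 => N /HN[N1 t1 cnt]; set tau := Num.sqrt _ in t1 cnt.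
pose L := [seq (Q, nQ tau Q) | Q <- P]; pose hh n := kap / n%:R : R.
have Lf : map fst L = P by rewrite -map_comp map_id.
have hh0 n : (0 < n)%N -> 0 < hh n /\ 3 * hh n < 1.
  move=> n0; have ni : 0 < n%:R^-1 :> R by rewrite invr_gt0 ltr0n.
  have ni1 : n%:R^-1 <= 1 :> R by rewrite invf_le1 ?ltr0n// ler1n.
  have : hh n <= kap by rewrite ler_piMr// ltW.
  by split; [rewrite mulr_gt0|lra].
have Lp : psep (map fst L) by rewrite Lf.
have Ld x : x \in L -> det x.1 != 0 /\ (0 < x.2)%N.
  by move=> /mapP[Q QP ->]; split; [exact: PQ0|].
have Ln0 : L != [::] by rewrite -size_eq0 size_map size_eq0.
have [|W aW sW] := @pad R K hh L K0 hh0 Lp Ld N Ln0.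
  apply: leq_trans cnt; exact: size_mesh_le.
pose M := mesh hh L W.
have Mp : psep M := psep_mesh hh0 Lp Ld W.
have Md t : t \in M -> det t != 0 by exact: det_mesh.
exists (meshT M); split.
- apply: conforming_meshT => //; first exact: nohang_mesh aW.
  move=> z; rewrite (mesh_cover hh0 Ld) PO; split=> [[Q QP Qz]|[x /mapP[Q QP ->] Qz]].
    by exists (Q, nQ tau Q) => //; exact: map_f.
  by exists Q.
- by rewrite card_meshT.
have t0 : 0 < tau := lt_le_trans ltr01 t1.
have tau0 : 0 <= tau^-1 ^+ m by rewrite exprn_ge0// invr_ge0 ltW.
have [qE q0] := exponent_q; have [pE s0] := exponentE.
have Ngl : (err_glob m p (meshT M) f <= (tau^-1 ^+ m * S' `^ fine p^-1%E)%:E)%E.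
  have fineW Q : Q \in P -> forall Q' i, rots Q' Q -> (i <= K * nQ tau Q)%N ->
      i%:R / (K * nQ tau Q)%:R \in wsel Q' W.
    move=> QP Q' i QQ' iK; have [_ W2] := aW.
    apply: wsel_sidept => //; first exact: rots_det (PQ0 QP) QQ'.
      by rewrite muln_gt0 K0.
    by apply: (W2 (Q, nQ tau Q)) => //; exact: map_f.
  have pc Q (QP : Q \in P) := piecesE (nQ tau Q) Q W isT QP (fineW Q QP).
  have sc Q (QP : Q \in P) := scaled_error t1 QP.
  have nm0 Q : Q \in P -> 0 <= (nQ tau Q)%:R^-1 ^+ m * ePQ Q.
    by move=> QP; rewrite mulr_ge0 ?exprn_ge0 ?invr_ge0// ltW// ePQ_gt0.
  move: pc sc s0; rewrite /err_glob; case: p p1 => [r p1'|_|//]; last first.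
    rewrite invey /= => pc sc _; rewrite powRr0 mulr1.
    rewrite (perm_big _ (perm_meshT Mp Md)) /= big_map big_seq.
    apply: bigmax_le; first by rewrite lee_fin.
    move=> t /mem_mesh[x /mapP[Q QP ->] /= ht].
    apply: (le_trans (pc Q QP t ht)); rewrite lee_fin (le_trans (sc Q QP))//.
    by rewrite mulr0 powRr0 mulr1.
  rewrite lee_fin in p1'; have r0 : 0 < r := lt_le_trans ltr01 p1'.
  have -> : fine r%:E^-1 = r^-1 by rewrite inver gt_eqF.
  move=> pc sc _; rewrite (perm_big _ (perm_meshT Mp Md)) /= big_map /M /mesh big_flatten /= big_map big_map.
  have sumE : (\sum_(Q <- P) \sum_(t <- pieces (nQ tau Q) (hh (nQ tau Q)) Q W) err_loc m r%:E (mkT t) f `^ r <=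
     ((tau^-1 ^+ m * S' `^ r^-1) `^ r)%:E)%E.
    apply: (@le_trans _ _ (\sum_(Q <- P) ((tau^-1 ^+ m) `^ r * ePQ Q `^ q)%:E)%E).
      rewrite big_seq [leRHS]big_seq; apply: lee_sum => Q QP.
      apply: (le_trans (pc Q QP)); rewrite lee_fin.
      have -> : ePQ Q `^ q = (ePQ Q `^ (q * r^-1)) `^ r by rewrite -powRrM divfK// gt_eqF.
      rewrite -powRM ?powR_ge0//; apply: ge0_ler_powR; rewrite ?nnegrE ?mulr_ge0 ?powR_ge0 ?(ltW r0) ?(ltW (ePQ_gt0 QP)) ?exprn_ge0 ?invr_ge0 ?(ltW t0)//.
      exact: sc.
    rewrite sumEFin lee_fin -mulr_sumr powRM ?powR_ge0// -powRrM mulVf ?gt_eqF// powRr1 ?(ltW S'0)//.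
    by rewrite ler_wpM2l ?powR_ge0// ltW.
  have X0 : 0 <= tau^-1 ^+ m * S' `^ r^-1 by rewrite mulr_ge0// powR_ge0.
  have -> : ((tau^-1 ^+ m * S' `^ r^-1)%:E = ((tau^-1 ^+ m * S' `^ r^-1) `^ r)%:E `^ r^-1)%E.
    by rewrite poweR_EFin -powRrM divff ?gt_eqF// powRr1.
  apply: gt0_ler_poweR sumE; rewrite ?invr_ge0 ?(ltW r0)//.
    rewrite in_itv /= leey andbT; apply: sume_ge0 => Q _; apply: sume_ge0 => t _; exact: poweR_ge0.
  by rewrite in_itv /= leey andbT lee_fin powR_ge0.
apply: (le_trans (lee_wpmul2l _ Ngl)); first by rewrite lee_fin powR_ge0.
rewrite -EFinM lee_fin mulrA.
have -> : N%:R `^ (m%:R / 2) * tau^-1 ^+ m = S' `^ (m%:R / 2).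
  have NE : N%:R = tau ^+ 2 * S' by rewrite sqr_sqrtr ?(ltW N1)// divfK// gt_eqF.
  rewrite NE powRM ?sqr_ge0 ?(ltW S'0)// -[tau ^+ 2]powR_mulrn ?(ltW t0)// -powRrM.
  rewrite (_ : 2 * (m%:R / 2) = m%:R); last by field.
  by rewrite powR_mulrn ?(ltW t0)// mulrAC exprVn mulfV ?mul1r// expf_neq0// gt_eqF.
by rewrite qE powRD// (gt_eqF S'0) implybT.
Qed.

End assembly.

(** * Subdivisions of polygons *)

Section subdivisions.
Context {R : realType}.
Implicit Types (t u : triple R) (s : seq (triple R)).

Definition subdiv t s : Prop :=
  [/\ psep s, forall u, u \in s -> det u != 0 /\ hull u `<=` hull t &
      forall z, hull t z -> exists2 u, u \in s & hull u z].

Lemma subdiv1 t : det t != 0 -> subdiv t [:: t].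
Proof.
move=> t0; split=> [|u|z tz]; first by split.
  by rewrite inE => /eqP ->; split.
by exists t; rewrite ?inE.
Qed.

Lemma subdiv_hull t t' s : hull t = hull t' -> subdiv t s -> subdiv t' s.
Proof. by move=> E [h1 h2 h3]; split=> //; rewrite -E. Qed.

Lemma subdiv_flatten t s (F : triple R -> seq (triple R)) : subdiv t s ->
  (forall u, u \in s -> subdiv u (F u)) -> subdiv t (flatten (map F s)).
Proof.
move=> [h1 h2 h3] H; split.
- apply: (psep_flatten (g := id)); rewrite ?map_id// => u.
    by move=> us; have [] := H _ us.
  by move=> v us vF; have [_ + _] := H _ us => /(_ _ vF)[].
- move=> v /flatten_mapP[u us vF]; have [_ + _] := H _ us => /(_ _ vF)[v0 vu].
  by split=> // z /vu; have [_ +] := h2 _ us; apply.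
- move=> z /h3[u us uz]; have [_ _ /(_ _ uz)[v vF vz]] := H _ us.
  by exists v => //; apply/flatten_mapP; exists u.
Qed.

Lemma subdiv_split (a b c : R * R) (l : R) : det ((a, b), c) != 0 -> 0 < l < 1 ->
  let w := a + l *: (b - a) in subdiv ((a, b), c) [:: ((a, w), c); ((w, b), c)].
Proof.
move=> t0 /andP[l0 l1] w; set d := det ((a, b), c) in t0.
have ln : l != 0 by rewrite gt_eqF.
have l1' : 0 < 1 - l by rewrite subr_gt0.
have d1 : det ((a, w), c) = l * d by rewrite /d /det /= !scaleE; ring.
have d2 : det ((w, b), c) = (1 - l) * d by rewrite /d /det /= !scaleE; ring.
have [ha hb hc] := hullv ((a, b), c).
have hw : hull ((a, b), c) w.
  exists (l, 0); first by split=> /=; lra.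
  by apply: pair_ext; rewrite /= !scaleE; ring.
split.
- split; last by split.
  move=> t'; rewrite inE => /eqP ->; apply: sep_sym.
  (* The line through [w] and [c]; the factor [d] makes the signs at [a] and [b] independent of the
     orientation of the triangle. *)
  pose phi := (d * (c.2 - w.2), - (d * (c.1 - w.1)), d * ((c.1 - w.1) * w.2 - w.1 * (c.2 - w.2))).
  have pw : afn phi w = 0 by rewrite /afn /phi /=; ring.
  have pc : afn phi c = 0 by rewrite /afn /phi /=; ring.
  have pa : afn phi a = - (l * d ^+ 2) by rewrite /afn /phi /d /det /= !scaleE; ring.
  have pb : afn phi b = (1 - l) * d ^+ 2 by rewrite /afn /phi /d /det /= !scaleE; ring.
  have dd : 0 < d ^+ 2 by rewrite exprn_even_gt0.
  exists phi; split; rewrite /afn_ge /afn_le /= ?pw ?pc ?pa ?pb ?lexx ?andbT//.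
  + rewrite /afnz /phi /= oppr_eq0 !mulf_eq0 !negb_or t0 /= -negb_and.
    apply/negP => /andP[/eqP e1 /eqP e2]; move: pb; rewrite /afn /phi /= e1 e2 !(mulr0, mul0r, oppr0, add0r, subr0).
    by move/eqP; rewrite eq_sym mulf_eq0 !gt_eqF.
  + by rewrite mulr_ge0// ltW.
  + by rewrite oppr_le0 mulr_ge0// ltW.
- move=> u; rewrite !inE => /orP[] /eqP ->.
    by split; [rewrite d1 mulf_neq0|exact: hull_convex].
  by split; [rewrite d2 mulf_neq0// gt_eqF|exact: hull_convex].
- move=> _ [[x y] [/= x0 y0 xy] <-].
  have [h|h] := leP (x / l + y) 1.
    exists ((a, w), c); rewrite ?inE ?eqxx//; exists (x / l, y).
      by split=> //=; rewrite divr_ge0// ltW.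
    by apply: pair_ext; rewrite /= !scaleE; field.
  exists ((w, b), c); rewrite ?inE ?eqxx ?orbT//; exists (1 - y - (1 - x - y) / (1 - l), y).
    have k : (1 - x - y) / (1 - l) <= 1 - y.
      rewrite ler_pdivrMr//; move: h; rewrite -ltrBlDr ltr_pdivlMr// => h; lra.
    have k' : 0 <= (1 - x - y) / (1 - l) by rewrite divr_ge0 ?(ltW l1')//; lra.
    by split=> //=; lra.
  by apply: pair_ext; rewrite /= !scaleE; field; rewrite gt_eqF.
Qed.

Definition onside (phi : R * R * R) u : Prop := afn_ge phi u \/ afn_le phi u.

Lemma onside3 (phi : R * R * R) a b c : 0 <= afn phi a * afn phi b -> 0 <= afn phi b * afn phi c ->
  0 <= afn phi c * afn phi a -> onside phi ((a, b), c).
Proof.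
rewrite /onside /afn_ge /afn_le /=; move: (afn phi a) (afn phi b) (afn phi c) => x y z xy yz zx.
have H (u v : R) : 0 < u -> 0 <= u * v -> 0 <= v by move=> u0; rewrite pmulr_rge0.
have H' (u v : R) : u < 0 -> 0 <= u * v -> v <= 0 by move=> u0; rewrite nmulr_rge0.
have [x0|x0|x0] := ltgtP x 0.
- right; rewrite (H' _ _ x0 xy) /=; rewrite mulrC in zx; exact: H' x0 zx.
- left; rewrite (H _ _ x0 xy) /=; rewrite mulrC in zx; exact: H x0 zx.
have [y0|y0|y0] := ltgtP y 0.
- by right; rewrite (H' _ _ y0 yz).
- by left; rewrite (H _ _ y0 yz).
by case: (leP z 0) => z0; [right|left; rewrite ltW].
Qed.

Lemma cut_edge (phi : R * R * R) a b c : det ((a, b), c) != 0 -> afn phi a * afn phi b < 0 ->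
  exists w, afn phi w = 0 /\ subdiv ((a, b), c) [:: ((a, w), c); ((w, b), c)].
Proof.
move=> t0 ab; pose l := afn phi a / (afn phi a - afn phi b).
have [dn l01] : afn phi a - afn phi b != 0 /\ 0 < l < 1.
  rewrite /l; move: (afn phi a) (afn phi b) ab => x y xy.
  have [[x0 y0]|[x0 y0]] : (x < 0 /\ 0 < y) \/ (0 < x /\ y < 0).
    have [x0|x0|x0] := ltgtP x 0.
    - by left; rewrite -(nmulr_rlt0 _ x0).
    - by right; rewrite -(pmulr_rlt0 _ x0).
    - by rewrite x0 mul0r ltxx in xy.
  - have d : x - y < 0 by lra.
    by rewrite lt_eqF// ltr_ndivrMr// ltr_ndivlMr//; split=> //; lra.
  - have d : 0 < x - y by lra.
    by rewrite gt_eqF// ltr_pdivrMr// ltr_pdivlMr//; split=> //; lra.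
exists (a + l *: (b - a)); split; last exact: subdiv_split.
have -> : afn phi (a + l *: (b - a)) = (1 - l) * afn phi a + l * afn phi b.
  by rewrite /afn /= !scaleE; ring.
by rewrite /l; field.
Qed.

Lemma cut_zero (phi : R * R * R) t : det t != 0 -> afn phi t.2 = 0 -> exists s,
  [/\ (size s <= 2)%N, subdiv t s & forall u, u \in s -> onside phi u].
Proof.
case: t => [[a b] c] t0 /= c0; have [ab|ab] := ltP (afn phi a * afn phi b) 0; last first.
  exists [:: ((a, b), c)]; split=> //; first exact: subdiv1.
  by move=> u; rewrite inE => /eqP ->; apply: onside3; rewrite ?c0 ?mulr0 ?mul0r.
have [w [w0 ws]] := cut_edge t0 ab; exists [:: ((a, w), c); ((w, b), c)]; split=> //.
by move=> u; rewrite !inE => /orP[] /eqP ->; apply: onside3; rewrite ?c0 ?w0 ?mulr0 ?mul0r.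
Qed.

(** Once a crossed side is cut, each half has a vertex on the line, and [cut_zero] finishes it with
    at most two parts. The explicit number of parts matters for the estimate of the boundary pieces
    in a tiling by copies. *)
Lemma cut_line (phi : R * R * R) t : det t != 0 -> exists s,
  [/\ (size s <= 4)%N, subdiv t s & forall u, u \in s -> onside phi u].
Proof.
have key u : det u != 0 -> afn phi u.1.1 * afn phi u.1.2 < 0 -> exists s,
    [/\ (size s <= 4)%N, subdiv u s & forall v, v \in s -> onside phi v].
  case: u => [[a b] c] u0 /= ab; have [w [w0 ws]] := cut_edge u0 ab.
  have [_ sub _] := ws.
  have [d1 _] := sub ((a, w), c) (mem_head _ _).
  have [d2 _] : det ((w, b), c) != 0 /\ hull ((w, b), c) `<=` hull ((a, b), c).
    by apply: sub; rewrite !inE eqxx orbT.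
  have d1' : det (rot (rot ((a, w), c))) != 0 by rewrite !det_rot.
  have d2' : det (rot ((w, b), c)) != 0 by rewrite !det_rot.
  have [s1 [z1 v1 o1]] := @cut_zero phi (rot (rot ((a, w), c))) d1' w0.
  have [s2 [z2 v2 o2]] := @cut_zero phi (rot ((w, b), c)) d2' w0.
  have neq : ((w, b), c) != ((a, w), c).
    apply/eqP => -[E _]; rewrite E in w0; move: ab; by rewrite w0 mul0r ltxx.
  exists (s1 ++ s2); split.
  - by rewrite size_cat (leq_add z1 z2).
  - have := @subdiv_flatten ((a, b), c) _ (fun u => if u == ((a, w), c) then s1 else s2) ws.
    rewrite /= eqxx (negbTE neq) cats0; apply=> v; rewrite !inE => /orP[] /eqP ->.
      by rewrite eqxx; apply: subdiv_hull v1; rewrite !hull_rot.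
    by rewrite (negbTE neq); apply: subdiv_hull v2; rewrite !hull_rot.
  - by move=> v; rewrite mem_cat => /orP[/o1|/o2].
move=> t0.
have [h1|h1] := ltP (afn phi t.1.1 * afn phi t.1.2) 0; first exact: key.
have [h2|h2] := ltP (afn phi t.1.2 * afn phi t.2) 0.
  have [|s [z v o]] := key (rot t) _ h2; first by rewrite det_rot.
  by exists s; split=> //; apply: subdiv_hull v; rewrite hull_rot.
have [h3|h3] := ltP (afn phi t.2 * afn phi t.1.1) 0.
  have [|s [z v o]] := key (rot (rot t)) _ h3; first by rewrite !det_rot.
  by exists s; split=> //; apply: subdiv_hull v; rewrite !hull_rot.
exists [:: t]; split=> //; first exact: subdiv1.
by move=> u; rewrite inE => /eqP ->; case: t t0 h1 h2 h3 => [[a b] c] t0 h1 h2 h3; exact: onside3.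
Qed.

Lemma afn_ge_sub phi u t : hull u `<=` hull t -> afn_ge phi t -> afn_ge phi u.
Proof.
move=> ut tp; have [h1 h2 h3] := hullv u.
by apply/and3P; split; apply: (afn_ge_hull tp); exact: ut.
Qed.

Lemma afn_le_sub phi u t : hull u `<=` hull t -> afn_le phi t -> afn_le phi u.
Proof.
move=> ut tp; have [h1 h2 h3] := hullv u.
by apply/and3P; split; apply: (afn_le_hull tp); exact: ut.
Qed.

Lemma cut_lines (phis : seq (R * R * R)) t : det t != 0 -> exists s,
  [/\ (size s <= 4 ^ size phis)%N, subdiv t s &
      forall u phi, u \in s -> phi \in phis -> onside phi u].
Proof.
elim: phis t => [|phi phis IH] t t0.
  by exists [:: t]; split=> //; exact: subdiv1.
have [s [zs vs os]] := IH t t0.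
have C u : exists s' : seq (triple R), det u != 0 ->
    [/\ (size s' <= 4)%N, subdiv u s' & forall v, v \in s' -> onside phi v].
  have [u0|u0] := boolP (det u != 0); last by exists [::].
  by have [s' H] := cut_line phi u0; exists s'.
have [F HF] := choice C; have [_ sd _] := vs.
have HF' u : u \in s -> [/\ (size (F u) <= 4)%N, subdiv u (F u) & forall v, v \in F u -> onside phi v].
  by move=> /sd[u0 _]; exact: HF.
exists (flatten (map F s)); split.
- rewrite size_flatten sumnE /shape -map_comp big_map expnS.
  apply: (@leq_trans (\sum_(u <- s) 4)).
    by rewrite big_seq [leqRHS]big_seq; apply: leq_sum => u /HF'[].
  by rewrite big_const_seq count_predT iter_addn_0 leq_mul2l zs orbT.
- by apply: subdiv_flatten vs _ => u /HF'[].
- move=> v psi /flatten_mapP[u us vF]; have [_ [_ + _] o] := HF' _ us => /(_ _ vF)[_ vu].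
  rewrite inE => /predU1P[->|ps]; first exact: o.
  by case: (os u psi us ps) => h; [left; exact: afn_ge_sub h|right; exact: afn_le_sub h].
Qed.

End subdivisions.

Section polygons.
Context {R : realType}.
Implicit Types (t u : triple R) (Omega : set (R * R)).

Lemma line_through (a b : R * R) : exists phi : R * R * R, afnz phi /\
  forall z, segment a b z -> afn phi z = 0.
Proof.
have [E|ne] := eqVneq a b.
  exists (1, 0, - a.1); split; first by rewrite /afnz /= oner_neq0.
  move=> z /segmentP[l _ ->]; rewrite E subrr scaler0 addr0 /afn /=; ring.
exists (b.2 - a.2, - (b.1 - a.1), (b.1 - a.1) * a.2 - (b.2 - a.2) * a.1); split.
  rewrite /afnz /= oppr_eq0 !subr_eq0 -negb_and; apply: contra ne => /andP[/eqP e1 /eqP e2].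
  by apply/eqP/pair_ext.
by move=> z /segmentP[l _ ->]; rewrite /afn /= !scaleE; ring.
Qed.

Lemma tint_side (phi : R * R * R) u z : det u != 0 -> afnz phi -> onside phi u -> tint u z ->
  afn phi z != 0.
Proof.
move=> u0 pz [h|h] uz; first by rewrite gt_eqF// (afn_ge_tint u0 pz h uz).
by rewrite lt_eqF// (afn_le_tint u0 pz h uz).
Qed.

(* Take the last point of [Omega] on the segment. *)
Lemma leave_boundary Omega (z v : R * R) : closed Omega -> Omega z -> ~ Omega (z + v) ->
  exists2 s : R, 0 <= s <= 1 & (Omega `\` Omega°) (z + s *: v).
Proof.
move=> cO Oz nO.
pose A : set R := [set s | 0 <= s <= 1 /\ Omega (z + s *: v)].
have A0 : A 0 by split; [rewrite lexx ler01|rewrite scale0r addr0].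
have As : has_sup A by split; [exists 0|exists 1 => s [/andP[_ s1] _]].
pose l := sup A.
have l0 : 0 <= l by exact: sup_upper_bound.
have l1 : l <= 1 by apply: ge_sup; [exists 0|move=> s [/andP[_ s1] _]].
have cont : continuous (fun s : R => z + s *: v).
  move=> s; apply: cvgD; first exact: cvg_cst.
  by apply: cvgZr_tmp; exact: cvg_id.
have Ol : Omega (z + l *: v).
  apply: contrapT => nl.
  have : nbhs (z + l *: v) (~` Omega) by apply: open_nbhs_nbhs; split=> //; exact: closed_openC.
  move=> /cont /nbhs_ballP[e /= e0 He].
  have [s As' sl] := sup_adherent e0 As.
  have := He s; rewrite /ball /= => /(_ _)/(_ As'.2); apply.
  by rewrite ger0_norm ?subr_ge0; [rewrite ltrBlDr -ltrBlDl -/l|exact: sup_upper_bound].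
exists l; first by rewrite l0.
split=> // il; have [E|ne] := eqVneq l 1; first by rewrite E scale1r in Ol.
have : nbhs (z + l *: v) Omega by exact: il.
move=> /cont /nbhs_ballP[e /= e0 He].
have l1' : l < 1 by rewrite lt_neqAle ne.
pose s := Num.min 1 (l + e / 2).
have ls : l < s by rewrite lt_min l1' ltrDl divr_gt0.
have : A s.
  split; first by rewrite (le_trans l0 (ltW ls)) /= ge_min lexx.
  apply: He; rewrite /ball /= ltr0_norm ?subr_lt0// opprB ltrBlDl.
  by rewrite (@le_lt_trans _ _ (l + e / 2)) ?ge_min ?lexx ?orbT// ltrD2l ltr_pdivrMr// ltr_pMr// ltr1n.
by move=> /(sup_upper_bound As); rewrite -/l leNgt ls.
Qed.

Lemma big_triangle Omega : compact Omega -> exists t : triple R, det t != 0 /\ Omega `<=` hull t.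
Proof.
move=> /compact_bounded[M [_ HM]].
pose B := Num.max 1 (M + 1).
have B1 : 1 <= B by rewrite le_max lexx.
have B0 : 0 < B := lt_le_trans ltr01 B1.
exists (tmap (- B, - B) (4 * B) std); split.
  by apply: det_tmap_neq0; rewrite ?det_std ?oner_neq0// mulf_neq0 ?gt_eqF.
move=> z Oz; have : `|z| <= B.
  apply: HM Oz; apply: lt_le_trans (_ : M + 1 <= _); first by rewrite ltrDl.
  by rewrite le_max lexx orbT.
rewrite prod_normE ge_max !ler_norml => /andP[/andP[a1 a2] /andP[b1 b2]].
rewrite hull_tmapE hull_std; have B4 : 4 * B != 0 by rewrite mulf_neq0 ?gt_eqF.
exists ((z.1 + B) / (4 * B), (z.2 + B) / (4 * B)).
  split=> /=; rewrite ?divr_ge0 ?mulr_ge0 ?(ltW B0)//; [lra|lra|].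
  by rewrite -mulrDl ler_pdivrMr ?mulr_gt0// mul1r; lra.
by apply: pair_ext; rewrite /= scaleE; field; rewrite gt_eqF.
Qed.

Lemma closed_hulls (P : seq (triple R)) : (forall t, t \in P -> det t != 0) ->
  closed [set z | exists2 t, t \in P & hull t z].
Proof.
elim: P => [_|t P IH H].
  by rewrite (_ : [set z | _] = set0); [exact: closed0|rewrite -subset0 => z [t]].
rewrite (_ : [set z | _] = hull t `|` [set z | exists2 t, t \in P & hull t z]).
  apply: closedU; first by apply: closed_hull; apply: H; rewrite inE eqxx.
  by apply: IH => u uP; apply: H; rewrite inE uP orbT.
apply/seteqP; split=> z /=.
  by move=> [u]; rewrite inE => /predU1P[->|uP] uz; [left|right; exists u].
by move=> [tz|[u uP uz]]; [exists t; rewrite ?inE ?eqxx|exists u; rewrite ?inE ?uP ?orbT].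
Qed.

(** A large triangle is cut along the lines carrying the boundary segments. An open part avoids the
    boundary, so it lies entirely in [Omega] or entirely outside; the parts meeting [Omega] are
    kept. They cover the interior, hence its closure, which is [Omega]. *)
Lemma polygon_triangles Omega : polygonal_domain Omega -> exists P : seq (triple R),
  [/\ psep P, P != [::], forall t, t \in P -> det t != 0 &
      forall z, Omega z <-> exists2 t, t \in P & hull t z].
Proof.
move=> [cO [z0 Oz0] clO [segs sE]].
have clO' : closed Omega by exact: compact_closed.
have [T [T0 OT]] := big_triangle cO.
have C (ab : (R * R) * (R * R)) : exists phi : R * R * R, afnz phi /\ forall z, segment ab.1 ab.2 z -> afn phi z = 0.
  exact: line_through.
have [line Hl] := choice C.
have [s [_ [ps sd sc] os]] := cut_lines (map line segs) T0.
have nb u z : u \in s -> tint u z -> ~ (Omega `\` Omega°) z.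
  move=> us uz; rewrite sE => -[ab /= abs abz]; have [lz l0] := Hl ab.
  have [u0 _] := sd _ us.
  have : onside (line ab) u by apply: os; rewrite ?map_f.
  by move=> /(tint_side u0 lz)/(_ uz); rewrite l0// eqxx.
have dich u z w : u \in s -> tint u z -> tint u w -> Omega z -> Omega w.
  move=> us uz uw Oz; apply: contrapT => nO.
  have wE : w = z + (w - z) by rewrite addrC subrK.
  rewrite wE in nO uw; have [l l01 bl] := leave_boundary clO' Oz nO.
  by apply: (nb u _ us _ bl); exact: tint_convex.
pose keep u := `[< exists2 z, tint u z & Omega z >].
pose P := [seq u <- s | keep u].
have Pdet t : t \in P -> det t != 0 by rewrite mem_filter => /andP[_ /sd[]].
have Psub u : u \in P -> hull u `<=` Omega.
  rewrite mem_filter => /andP[/asboolP[z uz Oz] us] w /(hull_closure (sd _ us).1) cw.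
  apply: clO'.
  by apply: (closure_subset _ cw) => x ux; exact: (dich u z x us uz ux Oz).
have Pcov z : Omega z -> exists2 t, t \in P & hull t z.
  rewrite -clO => Oz; apply: (closed_hulls Pdet); apply: closure_subset Oz => y Oy.
  have [u us uy] := sc _ (OT _ (interior_subset Oy)).
  exists u => //; rewrite mem_filter us andbT; apply/asboolP.
  have [w [uw Ow]] := hull_closure (sd _ us).1 uy Oy.
  by exists w.
exists P; split.
- exact: psep_filter.
- by have [u uP _] := Pcov _ Oz0; case: (P) uP.
- exact: Pdet.
- move=> z; split=> [/Pcov//|[t tP tz]]; exact: Psub tz.
Qed.

End polygons.

(** * The shape function with bounded diameter *)

Section coefficients.
Context {R : realType}.
Implicit Types (Omega : set (R * R)) (f h g : R * R -> R).

Lemma extend_continuous Omega h g z : closure (Omega°) z -> Omega z ->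
  {within Omega, continuous g} -> (forall x, Omega° x -> g x = h x) -> extend Omega h z = g z.
Proof.
move=> cz Oz /subspace_continuousP/(_ z Oz) cg gh; rewrite /extend.
have PF : ProperFilter (within Omega° (nbhs z)) by exact: within_nbhs_proper.
apply: cvg_lim => //; apply: cvg_trans (cvg_trans _ cg).
  apply: near_eq_cvg; rewrite near_withinE; apply: nearW => x Ox; exact: gh.
apply: cvg_app; apply: within_subset => //; exact: interior_subset.
Qed.

(** [Cm] provides a continuous extension of each derivative; one is chosen for each monomial,
    factorials included. The density of the interior identifies it with the limit in [dmf]. *)
Lemma coefficients m Omega f : closure (Omega°) = Omega -> Cm m Omega f ->
  exists cz : R * R -> nat -> R,
  [/\ forall k, (k <= m)%N -> {within Omega, continuous (fun z => cz z k)},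
      forall k z, (k <= m)%N -> Omega° z ->
        Gp f k (m - k) z / (k`!%:R * (m - k)`!%:R) = cz z k &
      forall z, Omega z -> dmf m Omega f z = hom m (cz z)].
Proof.
move=> clO [_ H].
have C k : exists g : R * R -> R, (k <= m)%N -> {within Omega, continuous g} /\
    forall z, Omega° z -> g z = partials (nseq k false ++ nseq (m - k) true) f z.
  have [km|km] := leqP k m; last by exists (fun=> 0).
  have [_ [g Hg]] := H (nseq k false ++ nseq (m - k) true) ltac:(by rewrite size_cat !size_nseq subnKC).
  by exists g.
have [g Hg] := choice C.
exists (fun z k => g k z / (k`!%:R * (m - k)`!%:R)); split.
- move=> k /Hg[/subspace_continuousP cg _]; apply/subspace_continuousP => z Oz.
  by apply: cvgMl; exact: cg.
- by move=> k z /Hg[_ gE] Oz; rewrite gE.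
- move=> z Oz; apply/funext => xy; rewrite /dmf /hom; apply: eq_bigr => k _.
  have [cg gE] := Hg k (ltn_ord k).
  rewrite (extend_continuous _ Oz cg gE) ?clO//.
  have h1 : k`!%:R != 0 :> R by rewrite pnatr_eq0 -lt0n fact_gt0.
  have h2 : (m - k)`!%:R != 0 :> R by rewrite pnatr_eq0 -lt0n fact_gt0.
  by field; rewrite h1 h2.
Qed.

Lemma compact_uniform Omega g (w : R) : compact Omega -> {within Omega, continuous g} -> 0 < w ->
  \forall d \near 0^'+, forall x y, Omega x -> Omega y -> `|x - y| <= d -> `|g x - g y| <= w.
Proof.
move=> cO /subspace_continuousP cg w0.
suff : \forall d \near 0^'+, Omega `<=` [set x | forall y, Omega x -> Omega y -> `|x - y| <= d -> `|g x - g y| <= w].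
  by apply: filterS => d Hd x y Ox Oy; exact: (Hd x Ox y).
apply: ((compact_near_coveringP Omega).1 cO _ _ (fun d x => forall y, Omega x -> Omega y -> `|x - y| <= d -> `|g x - g y| <= w)).
move=> x Ox.
have w2 : 0 < w / 2 by rewrite divr_gt0.
have /cvgrPdist_lt/(_ _ w2) := cg x Ox.
rewrite near_withinE => /nbhs_ballP[r /= r0 Hr].
have r2 : 0 < r / 2 by rewrite divr_gt0.
have near_dist : \forall x' \near x, `|x - x'| < r / 2.
  by apply/nbhs_ballP; exists (r / 2) => //= y; rewrite -ball_normE.
near=> x' d => y Ox' Oy /= xy.
have h1 : `|g x - g x'| < w / 2.
  apply: Hr => //; rewrite -ball_normE /=.
  suff : `|x - x'| < r / 2 by move/lt_trans; apply; lra.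
  near: x'; exact: near_dist.
have h2 : `|g x - g y| < w / 2.
  apply: Hr => //; rewrite -ball_normE /=.
  have a1 : `|x - x'| < r / 2 by near: x'; exact: near_dist.
  have a2 : d < r / 2 by near: d; exact: nbhs_right_lt.
  have h := ler_distD x' x y; rewrite (le_lt_trans h)//; lra.
have h := ler_distD (g x) (g x') (g y); rewrite (distrC (g x') (g x)) in h.
by apply: (le_trans h); rewrite /from_subspace /= in h1 h2 *; lra.
Unshelve. all: by end_near.
Qed.

Lemma coefficients_uniform m Omega (cz : R * R -> nat -> R) (w : R) : compact Omega ->
  (forall k, (k <= m)%N -> {within Omega, continuous (fun z => cz z k)}) -> 0 < w ->
  exists2 d : R, 0 < d & forall x y, Omega x -> Omega y -> `|x - y| <= d ->
    cnorm m (fun k => cz x k - cz y k) <= w.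
Proof.
move=> cO cc w0; have w1 : 0 < w / m.+1%:R by rewrite divr_gt0.
have : \forall d \near (0 : R)^'+, 0 < d /\ forall k : 'I_m.+1, forall x y, Omega x -> Omega y -> `|x - y| <= d ->
    `|cz x k - cz y k| <= w / m.+1%:R.
  apply: filterI; first exact: nbhs_right_gt.
  pose Q (k : 'I_m.+1) (d : R) := forall x y, Omega x -> Omega y -> `|x - y| <= d ->
    `|cz x k - cz y k| <= w / m.+1%:R.
  have QF k : \forall d \near (0 : R)^'+, Q k d by exact: (compact_uniform cO (cc k (ltn_ord k)) w1).
  exact: (filter_forall _ QF).
move=> /filter_ex[d [d0 Hd]]; exists d => // x y Ox Oy xy.
apply: (@le_trans _ _ (\sum_(k < m.+1) w / m.+1%:R)).
  by apply: ler_sum => k _; exact: Hd.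
by rewrite sumr_const card_ord -[_ *+ _]mulr_natr divfK// pnatr_eq0.
Qed.

Lemma coefficients_bounded m Omega (cz : R * R -> nat -> R) : compact Omega ->
  (forall k, (k <= m)%N -> {within Omega, continuous (fun z => cz z k)}) ->
  exists B, forall z, Omega z -> cnorm m (cz z) <= B.
Proof.
move=> cO cc.
have H (k : 'I_m.+1) : exists B, forall z, Omega z -> `|cz z k| <= B.
  have /compact_bounded[B [_ HB]] := continuous_compact (cc k (ltn_ord k)) cO.
  exists (B + 1) => z Oz; apply: (HB (B + 1)); first by rewrite ltrDl.
  by exists z.
have [B HB] := choice H; exists (\sum_(k < m.+1) B k) => z Oz.
by apply: ler_sum => k _; exact: HB.
Qed.

End coefficients.

Section restricted_shape.
Context {R : realType} (m : nat) (m2 : (2 <= m)%N) (p : \bar R) (p1 : (1 <= p)%E).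
Implicit Types (t : triple R) (c : nat -> R).
Notation RR := (measurableTypeR R * measurableTypeR R)%type.

Definition unit_triangle M t : Prop := [/\ det t != 0, area t = 1 & diam_le t M].

Definition errh t c : R := fine (nrm p t (eI m t (hom m c))).

(* Bounding the diameter makes the error uniformly Lipschitz in the coefficients,
   hence [shapeM M] continuous; it decreases to the shape function as [M] grows. *)
Definition shapeM M c : R := inf [set errh t c | t in unit_triangle M].

Lemma errhE M t c : unit_triangle M t -> nrm p t (eI m t (hom m c)) = (errh t c)%:E.
Proof. by move=> [t0 _ tM]; exact: (nrm_hom_fin m2 p1 c t0 tM). Qed.

Lemma errh_ge0 t c : 0 <= errh t c.
Proof. by rewrite fine_ge0// nrm_ge0. Qed.

Lemma ap_unit M t : unit_triangle M t -> ap p t = 1.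
Proof. by move=> [_ t1 _]; rewrite /ap t1 powR1. Qed.

Lemma errh_lip M t c c' : unit_triangle M t ->
  errh t c <= errh t c' + (1 + Lam m.-1) * (cnorm m (fun k => c k - c' k) * M ^+ m).
Proof.
move=> tu; have [t0 t1 tM] := tu; set k := (1 + _) * _.
have k0 : 0 <= k.
  by rewrite mulr_ge0 ?addr_ge0 ?Lam_ge0// mulr_ge0 ?cnorm_ge0// exprn_ge0// (diam_ge0 tM).
rewrite -lee_fin EFinD -!(errhE _ tu) -[k]mulr1 -(ap_unit tu).
apply: (nrmD p1 t0 k0 (measurable_eI m2 c' t0)) => z tz.
have E : eI m t (hom m c) z = eI m t (hom m c') z + eI m t (hom m (fun k => c k - c' k)) z.
  rewrite /eI homB.
  rewrite (eq_interp m2 t0 (homB m c c')) interpB//; ring.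
rewrite E (le_trans (ler_normD _ _))// lerD2l.
by apply: eI_hom_le => //; lia.
Qed.

Lemma unit_triangle_exists : exists M t, unit_triangle M t.
Proof.
have d0 : det (@std R) != 0 by rewrite det_std oner_neq0.
have a0 := area_gt0 d0; pose l := (Num.sqrt (area (@std R)))^-1.
have l0 : l != 0 by rewrite invr_eq0 gt_eqF// sqrtr_gt0.
have sD : diam_le (@std R) 1.
  move=> z w; rewrite hull_std => -[z1 z2 z3] [w1 w2 w3].
  by rewrite !ler_norml; split; lra.
exists (`|l| * 1), (tmap 0 l std); split; [exact: det_tmap_neq0| |exact: diam_le_tmap].
by rewrite area_tmap// exprVn sqr_sqrtr ?(ltW a0)// mulVf ?gt_eqF.
Qed.

Lemma unit_triangle_le M M' t : M <= M' -> unit_triangle M t -> unit_triangle M' t.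
Proof.
move=> MM [t0 t1 tM]; split=> // z w tz tw; have [h1 h2] := tM z w tz tw.
by split; [apply: le_trans h1 MM|apply: le_trans h2 MM].
Qed.

Lemma diam_exists t : exists D, diam_le t D.
Proof.
pose D := 2 * (`|t.1.2.1 - t.1.1.1| + `|t.2.1 - t.1.1.1| + `|t.1.2.2 - t.1.1.2| + `|t.2.2 - t.1.1.2|).
exists D => z w [x [x1 x2 x3] <-] [y [y1 y2 y3] <-].
have H (u v : R) : `|(x.1 - y.1) * u + (x.2 - y.2) * v| <= `|u| + `|v|.
  rewrite (le_trans (ler_normD _ _))// !normrM lerD// ler_piMl// ler_norml; apply/andP; split; lra.
have a1 := normr_ge0 (t.1.2.1 - t.1.1.1); have a2 := normr_ge0 (t.2.1 - t.1.1.1).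
have a3 := normr_ge0 (t.1.2.2 - t.1.1.2); have a4 := normr_ge0 (t.2.2 - t.1.1.2).
split.
  rewrite (_ : _ - _ = (x.1 - y.1) * (t.1.2.1 - t.1.1.1) + (x.2 - y.2) * (t.2.1 - t.1.1.1)); last by rewrite /pt /=; ring.
  by apply: (le_trans (H _ _)); rewrite /D; lra.
rewrite (_ : _ - _ = (x.1 - y.1) * (t.1.2.2 - t.1.1.2) + (x.2 - y.2) * (t.2.2 - t.1.1.2)); last by rewrite /pt /=; ring.
by apply: (le_trans (H _ _)); rewrite /D; lra.
Qed.

Section with_bound.
Variables (M : R) (t0 : triple R).
Hypothesis t0M : unit_triangle M t0.

Let M0 : 0 <= M. Proof. by have [_ _ /diam_ge0] := t0M. Qed.

Let lb c : has_lbound [set errh t c | t in unit_triangle M].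
Proof. by exists 0 => _ [t _ <-]; exact: errh_ge0. Qed.

Let ne c : [set errh t c | t in unit_triangle M] !=set0.
Proof. by exists (errh t0 c); exists t0. Qed.

Lemma shapeM_le t c : unit_triangle M t -> shapeM M c <= errh t c.
Proof. by move=> tM; apply: ge_inf => //; exists t. Qed.

Lemma shapeM_ge0 c : 0 <= shapeM M c.
Proof. by apply: lb_le_inf => // _ [t _ <-]; exact: errh_ge0. Qed.

Lemma shapeM_near c (e : R) : 0 < e -> exists2 t, unit_triangle M t & errh t c < shapeM M c + e.
Proof.
move=> e0; have [_ [t tM <-] h] := @inf_adherent _ _ e e0 (conj (ne c) (lb c)).
by exists t.
Qed.

Lemma shapeM_lip c c' :
  shapeM M c <= shapeM M c' + (1 + Lam m.-1) * (cnorm m (fun k => c k - c' k) * M ^+ m).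
Proof.
rewrite -lerBlDr; apply: lb_le_inf => // _ [t tM <-]; rewrite lerBlDr.
by apply: le_trans (shapeM_le _ tM) _; exact: errh_lip tM.
Qed.

Lemma shapeM_bound c : shapeM M c <= (1 + Lam m.-1) * (cnorm m c * M ^+ m).
Proof.
apply: (le_trans (shapeM_le c t0M)); rewrite -lee_fin -(errhE c t0M).
have [d0 _ tM] := t0M.
by have := nrm_hom_le m2 p1 c d0 tM; rewrite (ap_unit t0M) mulr1.
Qed.

End with_bound.

Lemma shapeM_anti M M' t c : unit_triangle M t -> M <= M' -> shapeM M' c <= shapeM M c.
Proof.
move=> tM MM; apply: lb_le_inf; first by exists (errh t c); exists t.
move=> _ [u uM <-]; exact: shapeM_le (unit_triangle_le MM uM).
Qed.

Lemma shape_fun_triple c : shape_fun m p (hom m c) =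
  ereal_inf [set nrm p t (eI m t (hom m c)) | t in [set t | det t != 0 /\ area t = 1]].
Proof.
rewrite /shape_fun; congr ereal_inf; apply/seteqP; split=> _ [T /= H <-].
  have [t [d0 TE]] := mkT_surj T; exists t; last by rewrite TE err_loc_nrm.
  by split=> //; move: H; rewrite TE tri_mkT// areaE// => -[].
have [d0 t1] := H; exists (mkT T); last by rewrite err_loc_nrm.
by rewrite /= tri_mkT// areaE// t1.
Qed.

End restricted_shape.

(** A ratio [x / (a + b)] in [[0, 1]] is at most its [q]-th power; the two ratios add up to 1. *)
Lemma powRD_le (R : realType) (q a b : R) : 0 < q <= 1 -> 0 <= a -> 0 <= b ->
  (a + b) `^ q <= a `^ q + b `^ q.
Proof.
move=> /andP[q0 q1] a0 b0; have [ab|] := ltP 0 (a + b); last first.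
  move=> ab; have /eqP : a + b = 0 by apply/le_anti; rewrite ab addr_ge0.
  by rewrite paddr_eq0// => /andP[/eqP -> /eqP ->]; rewrite addr0 powR0 ?gt_eqF// addr0.
have H x : 0 <= x -> x <= a + b -> x / (a + b) * (a + b) `^ q <= x `^ q.
  rewrite le_eqVlt => /predU1P[<-|x0] xab; first by rewrite !mul0r powR0 ?gt_eqF.
  rewrite -[leRHS](_ : (x / (a + b)) `^ q * (a + b) `^ q = _); last first.
    by rewrite -powRM ?divfK ?gt_eqF// ?divr_ge0// ltW.
  rewrite ler_wpM2r ?powR_ge0//; apply: ger1_powR => //.
  by rewrite divr_gt0//= ler_pdivrMr// mul1r.
have := lerD (H a a0 _) (H b b0 _); rewrite -!mulrDl divff ?gt_eqF// mul1r; apply.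
  by rewrite lerDl.
by rewrite lerDr.
Qed.

Section shape_integral.
Context {R : realType} (m : nat) (m2 : (2 <= m)%N) (p : \bar R) (p1 : (1 <= p)%E).
Variables (q : R) (q01 : 0 < q <= 1) (Omega : set (R * R)) (cz : R * R -> nat -> R).
Hypothesis cO : compact Omega.
Hypothesis cc : forall k, (k <= m)%N -> {within Omega, continuous (fun z => cz z k)}.
Notation RR := (measurableTypeR R * measurableTypeR R)%type.
Notation leb2' := (leb2 : {measure set RR -> \bar R}).
Notation shapeM := (shapeM m p).

Let q0 : 0 < q. Proof. by have /andP[] := q01. Qed.

Let clO : closed Omega. Proof. exact: compact_closed. Qed.

Let mO : measurable (Omega : set RR). Proof. exact: closed_measurable2. Qed.

Lemma leb2_compact : (leb2' Omega < +oo)%E.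
Proof.
have [t [t0 Ot]] := big_triangle cO.
apply: (@le_lt_trans _ _ (leb2' (hull t))); last by rewrite areaE// ltry.
by apply: le_measure; rewrite ?inE//; exact: measurable_hull.
Qed.

Lemma shapeM_continuous M t : unit_triangle M t -> {within Omega, continuous (fun z => shapeM M (cz z))}.
Proof.
move=> tM; apply/subspace_continuousP => z Oz; apply/cvgrPdist_le => e e0.
have [_ _ /diam_ge0 M0] := tM.
pose k := (1 + Lam m.-1) * M ^+ m.
have k0 : 0 <= k by rewrite mulr_ge0 ?addr_ge0 ?Lam_ge0// exprn_ge0.
have ek : 0 < e / (k + 1) by rewrite divr_gt0//; lra.
have [d d0 Hd] := coefficients_uniform cO cc ek.
rewrite near_withinE; apply/nbhs_ballP; exists d => //= x; rewrite -ball_normE /= => zx Ox.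
have bd c c' : cnorm m (fun k => c k - c' k) <= e / (k + 1) -> shapeM M c - shapeM M c' <= e.
  move=> cE; have h := shapeM_lip m2 p1 tM c c'; rewrite lerBlDl (le_trans h)// lerD2l.
  rewrite [_ * M ^+ m]mulrC mulrA -/k mulrC.
  apply: (@le_trans _ _ (e / (k + 1) * k)); first by rewrite ler_wpM2r.
  by rewrite mulrAC ler_pdivrMr ?ler_wpM2l ?(ltW e0)//; lra.
rewrite ler_norml; apply/andP; split; last by apply: bd; apply: Hd => //; exact: ltW.
by rewrite lerNl opprB; apply: bd; apply: Hd => //; rewrite distrC ltW.
Qed.

Lemma measurable_shapeM M t (rho : R) : unit_triangle M t ->
  measurable_fun (Omega : set RR) ((fun z => ((shapeM M (cz z) + rho) `^ q)%:E) : RR -> \bar R).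
Proof.
move=> tM; apply/measurable_EFinP; apply: (@measurableT_comp _ _ _ _ _ _ (@powR R ^~ q)) => //.
apply: measurable_funD => //.
exact: (continuous_measurable2 clO (shapeM_continuous tM)).
Qed.

Let K z := shape_fun m p (hom m (cz z)).

Lemma shape_fun_cvg (t0 : triple R) (M : R) z : unit_triangle M t0 ->
  (((shapeM (M + n%:R) (cz z) + n.+1%:R^-1) `^ q)%:E) @[n --> \oo] --> ((K z) `^ q)%E.
Proof.
move=> t0M.
have uM n : unit_triangle (M + n%:R) t0 by apply: unit_triangle_le t0M; rewrite lerDl.
have K0 : (0 <= K z)%E.
  by apply: le_ereal_inf_tmp => _ [T _ <-]; exact: Lnorm_ge0.
have KM n : (K z <= (shapeM (M + n%:R) (cz z))%:E)%E.
  apply/lee_addgt0Pr => e e0; have [t tM te] := shapeM_near m p (uM n) (cz z) e0.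
  apply: (@le_trans _ _ (errh m p t (cz z))%:E); last by rewrite -EFinD lee_fin ltW.
  rewrite -(errhE m2 p1 _ tM) /K shape_fun_triple//; apply: ereal_inf_lbound.
  by have [h1 h2 _] := tM; exists t.
have Kf : K z \is a fin_num.
  by rewrite ge0_fin_numE// (le_lt_trans (KM 0%N))// ltry.
have cv : (shapeM (M + n%:R) (cz z) + n.+1%:R^-1) @[n --> \oo] --> fine (K z).
  rewrite -[fine (K z)]addr0; apply: cvgD; last exact: cvg_harmonic.
  apply/cvgrPdist_le => e e0.
  have : (K z < K z + e%:E)%E by rewrite lteDl.
  rewrite {1}/K shape_fun_triple// => /ereal_inf_lt[_ [t [d0 t1] <-] te].
  have [D tD] := diam_exists t.
  have tDu : unit_triangle D t by [].
  exists (Num.trunc D).+1 => // n /= nD.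
  have DM : D <= M + n%:R.
    have [_ _ /diam_ge0 M0] := t0M; have D0 := diam_ge0 tD.
    have /andP[_ h] := truncn_itv D0.
    have : (Num.trunc D).+1%:R <= n%:R :> R by rewrite ler_nat.
    lra.
  have h1 := shapeM_le m p (cz z) (unit_triangle_le DM tDu).
  have h2 := KM n; move: h2 te.
  rewrite (errhE m2 p1 _ tDu) -(fineK Kf) -EFinD lee_fin lte_fin => h2 te.
  rewrite ler_norml; apply/andP; split; lra.
have F0 : 0 <= fine (K z) by rewrite fine_ge0.
rewrite -(fineK Kf) poweR_EFin; apply: cvg_EFin; first exact: nearW.
(* Subadditivity gives [x^q - K^q <= (x - K)^q], so the tolerance [e] asks for
   [x - K <= e^(1/q)]. *)
apply/cvgrPdist_le => e e0; have d0 : 0 < e `^ q^-1 by exact: powR_gt0.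
have /cvgrPdist_le/(_ _ d0) := cv; apply: filterS => n /=.
have : fine (K z) <= shapeM (M + n%:R) (cz z) + n.+1%:R^-1.
  by have := KM n; rewrite -{1}(fineK Kf) lee_fin => h; rewrite ler_wpDr// invr_ge0.
move: (_ + n.+1%:R^-1) => x Kx; rewrite distrC ger0_norm ?subr_ge0// => xe.
rewrite distrC ger0_norm ?subr_ge0 ?ge0_ler_powR ?nnegrE ?(ltW q0) ?(le_trans F0)//.
have xK : 0 <= x - fine (K z) by rewrite subr_ge0.
rewrite lerBlDl (le_trans _ (le_trans (powRD_le q01 F0 xK) _)) ?[_ + (x - _)]addrC ?subrK//.
rewrite lerD2l -[leRHS]powRr1 ?(ltW e0)// -(mulVf (lt0r_neq0 q0)) powRrM.
by rewrite ge0_ler_powR ?nnegrE ?(ltW q0) ?(ltW d0).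
Qed.

(** Dominated convergence on a set of finite measure, with the constant bound given by the coarsest
    diameter [M]. It also yields the finiteness of the limit integral, and the measurability of [K]
    comes from that of the approximations. *)
Lemma shape_integral_approx : (\int[leb2']_(z in Omega) (K z `^ q) < +oo)%E /\
  forall S : R, (\int[leb2']_(z in Omega) (K z `^ q) < S%:E)%E ->
  exists M t (rho : R), [/\ unit_triangle M t, 0 < rho &
    (\int[leb2']_(z in Omega) ((shapeM M (cz z) + rho) `^ q)%:E < S%:E)%E].
Proof.
have [M [t tM]] := @unit_triangle_exists R.
have uM n : unit_triangle (M + n%:R) t by apply: unit_triangle_le tM; rewrite lerDl.
pose F n z := ((shapeM (M + n%:R) (cz z) + n.+1%:R^-1) `^ q)%:E.
have [B HB] := coefficients_bounded cO cc.
pose k := (1 + Lam m.-1) * (`|B| * M ^+ m) + 1.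
have mF n := measurable_shapeM n.+1%:R^-1 (uM n).
have cv z : F^~ z @ \oo --> (K z `^ q)%E by exact: shape_fun_cvg tM.
have sh0 n z : 0 <= shapeM (M + n%:R) (cz z) by exact: (shapeM_ge0 m p (uM n)).
have [] := @dominated_convergence _ _ _ leb2' Omega mO F (fun z => K z `^ q)%E (fun=> (k `^ q)%:E) mF.
- by apply: (@emeasurable_fun_cvg _ _ _ _ F) => // z _; exact: cv.
- by apply: nearW => z _; exact: cv.
- apply/integrableP; split=> //.
  by rewrite integral_cst// lte_mul_pinfty ?leb2_compact.
- apply: nearW => z n Oz; rewrite /F gee0_abs ?lee_fin ?powR_ge0//.
  rewrite ge0_ler_powR ?nnegrE ?(ltW q0) ?addr_ge0 ?invr_ge0//.
    have [_ _ /diam_ge0 M0] := tM.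
    by rewrite mulr_ge0 ?addr_ge0 ?Lam_ge0// mulr_ge0// exprn_ge0.
  apply: lerD; last by rewrite invf_le1 ?ltr0n// ler1n.
  have MM : M <= M + n%:R by rewrite lerDl.
  apply: (le_trans (shapeM_anti m p _ tM MM)); apply: (le_trans (shapeM_bound m2 p1 tM _)).
  have [_ _ /diam_ge0 M0] := tM.
  rewrite ler_wpM2l ?addr_ge0 ?Lam_ge0// ler_wpM2r ?exprn_ge0//.
  by rewrite (le_trans (HB z Oz))// ler_norm.
move=> /integrableP[_ IK] _ cvI; split.
  apply: le_lt_trans IK; apply: integral_mono => z _; first exact: poweR_ge0.
  exact: lee_abs.
move=> S IS; have ISn : nbhs (\int[leb2']_(z in Omega) (K z `^ q))%E [set x | x < S%:E]%E.
  by apply: open_nbhs_nbhs; split=> //; exact: open_ereal_lt_ereal.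
have [n _ /(_ n (leqnn n)) Hn] := cvI _ ISn.
by exists (M + n%:R), t, n.+1%:R^-1; split=> //; rewrite invr_gt0.
Qed.

End shape_integral.

(** * Filling a triangle with copies of another one *)

Section side_functionals.
Context {R : realType}.
Implicit Types (t u : triple R) (phi : R * R * R).

(** The barycentric coordinates as explicit affine functionals, the form in which they serve as
    cutting and separating lines. *)
Definition side1 t : R * R * R :=
  ((t.2.2 - t.1.1.2) / det t, - (t.2.1 - t.1.1.1) / det t,
   ((t.2.1 - t.1.1.1) * t.1.1.2 - (t.2.2 - t.1.1.2) * t.1.1.1) / det t).

Definition side2 t : R * R * R :=
  (- (t.1.2.2 - t.1.1.2) / det t, (t.1.2.1 - t.1.1.1) / det t,
   ((t.1.2.2 - t.1.1.2) * t.1.1.1 - (t.1.2.1 - t.1.1.1) * t.1.1.2) / det t).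

Definition side3 t : R * R * R :=
  (- (side1 t).1.1 - (side2 t).1.1, - (side1 t).1.2 - (side2 t).1.2,
   1 - (side1 t).2 - (side2 t).2).

Definition sides t := [:: side1 t; side2 t; side3 t].

Lemma afn_side1 t z : afn (side1 t) z = co1 t z.
Proof. by rewrite /afn /co1 /side1 [in RHS]/det /=; ring. Qed.

Lemma afn_side2 t z : afn (side2 t) z = co2 t z.
Proof. by rewrite /afn /co2 /side2 [in RHS]/det /=; ring. Qed.

Lemma afn_side3 t z : afn (side3 t) z = 1 - co1 t z - co2 t z.
Proof. by rewrite -afn_side1 -afn_side2 /afn /side3 /=; ring. Qed.

Lemma hull_sides t z : det t != 0 ->
  hull t z <-> forall phi, phi \in sides t -> 0 <= afn phi z.
Proof.
move=> t0; rewrite hullE//; split=> [[[/= h1 h2] h3] phi|H].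
  by rewrite !inE => /or3P[] /eqP ->; rewrite ?afn_side1 ?afn_side2 ?afn_side3.
rewrite /= -afn_side1 -afn_side2.
by split; [split|rewrite afn_side1 afn_side2 -afn_side3]; apply: H; rewrite !inE eqxx ?orbT.
Qed.

Lemma tint_sides t z phi : tint t z -> phi \in sides t -> 0 < afn phi z.
Proof.
rewrite tintE => -[[/= h1 h2] h3].
by rewrite !inE => /or3P[] /eqP ->; rewrite ?afn_side1 ?afn_side2 ?afn_side3.
Qed.

Lemma afn_ctr t phi : det t != 0 -> phi \in sides t -> afn phi (ctr t) = 3^-1.
Proof.
move=> t0; rewrite !inE => /or3P[] /eqP ->;
  by rewrite ?afn_side1 ?afn_side2 ?afn_side3 /ctr ?co1_pt// ?co2_pt//=; field.
Qed.

Lemma afnz_side t phi : det t != 0 -> phi \in sides t -> afnz phi.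
Proof.
move=> t0 ph; apply/negPn/negP; rewrite /afnz negb_or !negbK => /andP[/eqP a /eqP b].
have E z : afn phi z = phi.2 by rewrite /afn a b !mul0r !add0r.
suff [z z0] : exists z, afn phi z = 0.
  have := afn_ctr t0 ph; rewrite E -(E z) z0 => /esym/eqP; rewrite invr_eq0.
  by rewrite pnatr_eq0.
move: ph; rewrite !inE => /or3P[] /eqP ->.
- by exists (pt t (0, 0)); rewrite afn_side1 co1_pt.
- by exists (pt t (0, 0)); rewrite afn_side2 co2_pt.
- by exists (pt t (1, 0)); rewrite afn_side3 co1_pt// co2_pt//= subr0 subrr.
Qed.

Lemma afn_comb phi (s : R) w z : afn phi (s *: w + (1 - s) *: z) = s * afn phi w + (1 - s) * afn phi z.
Proof. by rewrite /afn /= !scaleE; ring. Qed.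

Definition slope t : R := \sum_(phi <- sides t) (`|phi.1.1| + `|phi.1.2|).

Lemma slope_ge0 t : 0 <= slope t.
Proof. by apply: sumr_ge0 => phi _; rewrite addr_ge0. Qed.

Lemma afn_lip t phi z w (D : R) : phi \in sides t -> `|z.1 - w.1| <= D -> `|z.2 - w.2| <= D ->
  `|afn phi z - afn phi w| <= slope t * D.
Proof.
move=> ph h1 h2; have D0 : 0 <= D := le_trans (normr_ge0 _) h1.
have -> : afn phi z - afn phi w = phi.1.1 * (z.1 - w.1) + phi.1.2 * (z.2 - w.2).
  by rewrite /afn; ring.
apply: (@le_trans _ _ ((`|phi.1.1| + `|phi.1.2|) * D)).
  by rewrite (le_trans (ler_normD _ _))// mulrDl !normrM lerD// ler_wpM2l.
apply: ler_wpM2r => //.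
rewrite /slope /sides !big_cons big_nil addr0.
have a1 := normr_ge0 (side1 t).1.1; have a2 := normr_ge0 (side1 t).1.2.
have a3 := normr_ge0 (side2 t).1.1; have a4 := normr_ge0 (side2 t).1.2.
have a5 := normr_ge0 (side3 t).1.1; have a6 := normr_ge0 (side3 t).1.2.
by move: ph; rewrite !inE => /or3P[] /eqP ->; lra.
Qed.

(** The copy is placed with its centroid at a vertex of [u]. Barycentric coordinates are [1/3] at
    the centroid and vary over [u] by at most [slope t * D / L], which is at most [1/3] for [L]
    large. *)
Lemma homothetic_cover t u : det t != 0 -> det u != 0 -> exists2 L0 : R, 0 < L0 &
  forall L, L0 <= L -> exists b, hull u `<=` hull (tmap b L t).
Proof.
move=> t0 u0.
pose D := `|u.1.2.1 - u.1.1.1| + `|u.1.2.2 - u.1.1.2| + `|u.2.1 - u.1.1.1| + `|u.2.2 - u.1.1.2|.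
have D0 : 0 <= D by rewrite /D !addr_ge0.
have s0 := slope_ge0 t.
exists (3 * (slope t * D) + 1) => [|L LL]; first by have := mulr_ge0 s0 D0; lra.
have L0 : 0 < L by have := mulr_ge0 s0 D0; lra.
have Ln : L != 0 by rewrite gt_eqF.
pose b := u.1.1 - L *: ctr t; exists b.
apply: hull_sub; first exact: det_tmap_neq0.
move=> v vu; rewrite hull_tmapE.
exists (ctr t + L^-1 *: (v - u.1.1)); last first.
  by apply: pair_ext; rewrite /b /= !scaleE; field.
apply/(hull_sides _ t0) => phi ph.
have [v1 v2] : `|v.1 - u.1.1.1| <= D /\ `|v.2 - u.1.1.2| <= D.
  have a1 := normr_ge0 (u.1.2.1 - u.1.1.1); have a2 := normr_ge0 (u.1.2.2 - u.1.1.2).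
  have a3 := normr_ge0 (u.2.1 - u.1.1.1); have a4 := normr_ge0 (u.2.2 - u.1.1.2).
  move: vu; rewrite !inE => /or3P[] /eqP ->; rewrite ?subrr ?normr0 /D; split; lra.
have := afn_lip (z := ctr t + L^-1 *: (v - u.1.1)) (w := ctr t) (D := L^-1 * D) ph.
rewrite afn_ctr//= !scaleE ![ (ctr t).1 + _ ]addrC ![ (ctr t).2 + _ ]addrC !addrK.
rewrite !normrM (ger0_norm (_ : 0 <= L^-1)) ?invr_ge0 ?(ltW L0)//.
have Li : 0 <= L^-1 by rewrite invr_ge0 ltW.
move=> /(_ (ler_wpM2l Li v1) (ler_wpM2l Li v2)).
have : slope t * (L^-1 * D) <= 3^-1.
  rewrite mulrCA mulrC ler_pdivrMr//; lra.
set x := afn _ _; rewrite ler_norml => h /andP[+ _]; lra.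
Qed.

(** The triangles lie between the copies of [t] of ratios [1 - 3 e] and [1 + 3 e] about its
    centroid, where all coordinates are [1/3]; and [(1 + 3 e)^2 - (1 - 3 e)^2 = 12 e]. *)
Lemma shell_area t s (e : R) : det t != 0 -> 0 <= e -> 3 * e < 1 ->
  psep s -> (forall u, u \in s -> det u != 0) ->
  (forall u z phi, u \in s -> hull u z -> phi \in sides t -> - e <= afn phi z) ->
  (forall u, u \in s -> exists2 phi, phi \in sides t & forall z, hull u z -> afn phi z <= e) ->
  \sum_(u <- s) area u <= 12 * e * area t.
Proof.
move=> t0 e0 e1 sp sd out inn.
have l1 : 1 - 3 * e != 0 by rewrite gt_eqF// subr_gt0.
have l2 : 1 - (- (3 * e)) != 0 by rewrite opprK gt_eqF//; lra.
pose I := tmap ((3 * e) *: ctr t) (1 - 3 * e) t.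
pose O := tmap ((- (3 * e)) *: ctr t) (1 - (- (3 * e))) t.
have I0 : det I != 0 by exact: det_tmap_neq0.
have O0 : det O != 0 by exact: det_tmap_neq0.
have inO z : (forall phi, phi \in sides t -> - e <= afn phi z) -> hull O z.
  move=> H; rewrite hull_tmapE.
  exists ((1 - (- (3 * e)))^-1 *: (z + (3 * e) *: ctr t)).
    apply/(hull_sides _ t0) => phi ph.
    have := H _ ph; have c3 := afn_ctr t0 ph.
    have -> : afn phi ((1 - - (3 * e))^-1 *: (z + (3 * e) *: ctr t)) =
       (1 - - (3 * e))^-1 * (afn phi z + 3 * e * afn phi (ctr t)).
      by rewrite /afn /= !scaleE; field.
    rewrite c3 => Hz; rewrite mulr_ge0 ?invr_ge0//; lra.
  by apply: pair_ext; rewrite /= !scaleE; field.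
have Iv v phi : v \in vs I -> phi \in sides t -> e <= afn phi v.
  move=> /hull_vs; rewrite hull_tmapE => -[y ty <-] ph.
  rewrite afn_comb afn_ctr//.
  have := (hull_sides _ t0).1 ty _ ph => H.
  have h1 : 0 <= 1 - 3 * e by lra.
  have := mulr_ge0 h1 H; lra.
have := @sum_area_le R (s ++ [:: I]) (hull O) (measurable_hull O0).
have -> : leb2 (hull O) = (((1 - (- (3 * e))) ^+ 2) * area t)%:E by rewrite areaE// area_tmap.
rewrite sumEFin lee_fin big_cat big_seq1 /= area_tmap// => H.
have Hs : \sum_(u <- s) area u + (1 - 3 * e) ^+ 2 * area t <= (1 - - (3 * e)) ^+ 2 * area t.
  apply: H.
  - apply/psep_cat; split=> // u v us; rewrite inE => /eqP ->.
    have [phi ph pe] := inn _ us; apply: sep_sym.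
    have af z : afn (phi.1, phi.2 - e) z = afn phi z - e by rewrite /afn /=; ring.
    exists (phi.1, phi.2 - e); split; first exact: (afnz_side t0 ph).
    + by apply/and3P; split; rewrite af subr_ge0; apply: Iv => //; rewrite !inE eqxx ?orbT.
    + have [h1 h2 h3] := hullv u.
      by apply/and3P; split; rewrite af subr_le0; apply: pe.
  - by move=> u; rewrite mem_cat inE => /orP[/sd//|/eqP ->].
  - move=> u; rewrite mem_cat inE => /orP[us z uz|/eqP ->].
      by apply: inO => phi ph; exact: (out u).
    apply: hull_sub => // v vI; apply: inO => phi ph.
    have := Iv _ _ vI ph; lra.
rewrite -(lerD2r ((1 - 3 * e) ^+ 2 * area t)) (le_trans Hs)// le_eqVlt; apply/orP; left.
by apply/eqP; ring.
Qed.

End side_functionals.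

Section copies.
Context {R : realType}.
Implicit Types (t u : triple R).

Lemma subdiv_grid n t : (0 < n)%N -> det t != 0 ->
  subdiv t [seq aff t (gtile n ij) | ij <- gidx n].
Proof.
move=> n0 t0; split.
- rewrite map_comp; apply: psep_map => [u v|]; first exact: sep_aff.
  exact: psep_gtile.
- move=> u /mapP[ij ijn ->]; split.
    rewrite det_aff mulf_neq0// /gtile; case: ifP => _; apply: det_tmap_neq0;
      by rewrite ?oppr_eq0 ?invr_eq0 ?pnatr_eq0 -?lt0n// det_std oner_neq0.
  rewrite hull_aff => _ [z hz <-]; exists z => //.
  exact: (gtile_sub n0 ijn).
- move=> z [y /(gtile_cover n0)[ij ijn hy] <-]; exists (aff t (gtile n ij)); first exact: map_f.
  by rewrite hull_aff; exists y.
Qed.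

Lemma grid_copy n (b : R * R) (l : R) t u :
  u \in [seq aff (tmap b l t) (gtile n ij) | ij <- gidx n] ->
  exists b' l', u = tmap b' l' t /\ `|l'| = `|l| / n%:R.
Proof.
have tc (b1 b2 : R * R) (l1 l2 : R) (v : triple R) : tmap b1 l1 (tmap b2 l2 v) = tmap (b1 + l1 *: b2) (l1 * l2) v.
  by rewrite /tmap /=; congr (_, _, _); rewrite scalerDr scalerA addrA.
move=> /mapP[ij ijn ->]; rewrite /gtile; case: ifP => _; rewrite aff_std tc.
  by eexists; eexists; split; [reflexivity|rewrite normrM normfV normr_nat mulrC].
by eexists; eexists; split; [reflexivity|rewrite normrM normrN normfV normr_nat mulrC].
Qed.

Lemma size_flatten_le (A B : eqType) (F : A -> seq B) (s : seq A) k :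
  (forall x, x \in s -> (size (F x) <= k)%N) -> (size (flatten (map F s)) <= k * size s)%N.
Proof.
elim: s => //= x s IH H; rewrite size_cat mulnS leq_add ?H ?mem_head//.
by apply: IH => y ys; apply: H; rewrite inE ys orbT.
Qed.

(** [C * l] will be the variation of a side functional over a tile of scale [l], hence the width of
    the shell, and [64 = 4^3] bounds the number of parts of a tile cut along three sides. *)
Lemma shell_scale (C a e : R) : 0 <= C -> 0 <= a -> 0 < e -> exists2 l0, 0 < l0 &
  forall l, 0 < l <= l0 -> [/\ 0 <= C * l, 3 * (C * l) < 1 &
    forall x y, x <= 64 * y -> y * l ^+ 2 <= 12 * (C * l) * a -> x * l ^+ 2 <= e].
Proof.
move=> C0 a0 e0; pose k : R := 64 * (12 * C * a).
have k0 : 0 <= k by apply: mulr_ge0 => //; apply: mulr_ge0 => //; exact: mulr_ge0.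
have k1 : 0 < k + 1 by rewrite ltr_wpDl.
have C1 : 0 < 6 * C + 1 by rewrite ltr_wpDl// mulr_ge0.
exists (Num.min (e / (k + 1)) (6 * C + 1)^-1); first by rewrite lt_min divr_gt0 ?invr_gt0.
move=> l /andP[lp]; rewrite le_min ler_pdivlMr// -[_^-1]div1r ler_pdivlMr// => /andP[h1 h2].
have Cl : 0 <= C * l by rewrite mulr_ge0// ltW.
split=> // [|x y xy yl]; first by lra.
have l2 : 0 <= l ^+ 2 by exact: sqr_ge0.
have h3 := ler_wpM2r l2 xy; rewrite /k in h1; lra.
Qed.

(* Grid a large homothetic copy of [t]; the cells that meet the boundary of [r]
   are cut along its sides, and they fill a thin shell. *)
Lemma tiling_by_copies r t (M e : R) : det r != 0 -> det t != 0 -> area t = 1 -> diam_le t M ->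
  0 < e -> exists2 l0 : R, 0 < l0 & forall l : R, 0 < l <= l0 -> exists kept part,
    [/\ subdiv r (kept ++ part),
        forall u, u \in kept -> exists b l', u = tmap b l' t /\ `|l'| = l,
        forall u, u \in part -> diam_le u (l * M) /\ area u <= l ^+ 2 &
        (size part)%:R * l ^+ 2 <= e].
Proof.
move=> r0 t0 t1 tM e0.
have M0 : 0 <= M := diam_ge0 tM.
have [L0 L0p HL] := homothetic_cover t0 r0.
have cut u : exists s, det u != 0 ->
   [/\ (size s <= 4 ^ 3)%N, subdiv u s & forall v phi, v \in s -> phi \in sides r -> onside phi v].
  have [u0|u0] := eqVneq (det u) 0; first by exists [::].
  by have [s Hs] := cut_lines (sides r) u0; exists s => _; exact: Hs.
have [F HF] := choice cut.
pose C := slope r * M; have C0 : 0 <= C by rewrite mulr_ge0// slope_ge0.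
have [l0 l00 Hl0] := shell_scale C0 (ltW (area_gt0 r0)) e0.
exists l0 => // l ll0; have [Cl0 Cl3 Cle] := Hl0 _ ll0; have /andP[lp _] := ll0.
(* The large copy has ratio [l * n >= L0], so that its [n]-grid consists of copies of scale exactly
   [l]. *)
pose n := (Num.trunc (L0 / l)).+1; have n0 : (0 < n)%N by [].
have nR : 0 < n%:R :> R by rewrite ltr0n.
have [b rb] : exists b, hull r `<=` hull (tmap b (l * n%:R) t).
  apply: HL; have /truncn_itv/andP[_] : 0 <= L0 / l by rewrite divr_ge0// ltW.
  by rewrite ltr_pdivrMr// mulrC => /ltW.
set B := tmap b (l * n%:R) t in rb.
have B0 : det B != 0 by apply: det_tmap_neq0 t0; rewrite gt_eqF// mulr_gt0.
have [tp td tc] := subdiv_grid n0 B0; set tl := [seq _ | _ <- _] in tp td tc.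
have tcopy u : u \in tl -> exists b l', u = tmap b l' t /\ `|l'| = l.
  move=> /grid_copy[b' [l' [-> E]]]; exists b', l'; split=> //.
  by rewrite E ger0_norm ?mulfK ?gt_eqF// mulr_ge0 ?ltW.
have tsize u : u \in tl -> diam_le u (l * M) /\ area u = l ^+ 2.
  move=> /tcopy[b' [l' [-> E]]]; split; first by rewrite -E; exact: diam_le_tmap.
  have l'0 : l' != 0 by rewrite -normr_eq0 E gt_eqF.
  by rewrite area_tmap// t1 mulr1 -E real_normK ?num_real.
pose inr u := `[< hull u `<=` hull r >].
pose meets u := `[< exists2 z, hull u z & hull r z >].
pose kept := [seq u <- tl | inr u].
pose bdry := [seq u <- tl | ~~ inr u && meets u].
pose G u := [seq v <- F u | inr v].
pose part := flatten (map G bdry).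
have bd u : u \in bdry -> [/\ u \in tl, det u != 0, ~ hull u `<=` hull r & exists2 z, hull u z & hull r z].
  by rewrite mem_filter => /andP[/andP[/asboolPn ? /asboolP ?] us]; split=> //; have [] := td _ us.
have partP v : v \in part -> exists u, [/\ u \in bdry, v \in F u & hull v `<=` hull r].
  by move=> /flatten_mapP[u ub]; rewrite mem_filter => /andP[/asboolP vr vF]; exists u.
have kdet u : u \in kept ++ part -> det u != 0 /\ hull u `<=` hull r.
  rewrite mem_cat => /orP[|/partP[v [vb uF ur]]].
    by rewrite mem_filter => /andP[/asboolP ur /td[]].
  have [vt v0 _ _] := bd _ vb; have [_ [_ Fd _] _] := HF _ v0.
  by split=> //; have [] := Fd _ uF.
exists kept, part; split.
- split=> //.
  + apply/psep_cat; split; first exact: psep_filter.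
      apply: (psep_flatten (g := id)); rewrite ?map_id; first exact: psep_filter.
        move=> u /bd[ut u0 _ _]; have [_ [Fp _ _] _] := HF _ u0; exact: psep_filter.
      move=> u v /bd[ut u0 _ _]; have [_ [_ Fd _] _] := HF _ u0.
      by rewrite mem_filter => /andP[_ /Fd[]].
    move=> u v; rewrite mem_filter => /andP[/asboolP ur ut] /partP[w [/bd[wt w0 wr _] vF _]].
    have [_ [_ Fd _] _] := HF _ w0; have [_ vw] := Fd _ vF.
    apply: (@sep_sub _ u w) => //; apply: (psep_mem tp) => //.
    by apply/eqP => uw; apply: wr; rewrite -uw.
  (* The union of the list is closed, so points [y] of the open triangle suffice. The side
     functionals are positive at [y], which decides on which side of each line the part containing
     [y] lies, and places it inside [r]. *)
  + move=> z /(hull_closure r0) rz; apply: (closed_hulls (fun u us => (kdet u us).1)).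
    apply: closure_subset rz => y ry; have hry := tint_hull r0 ry.
    have [u ut uy] := tc _ (rb _ hry).
    have [ur|ur] := asboolP (hull u `<=` hull r).
      by exists u => //; rewrite mem_cat mem_filter ut andbT; apply/orP; left; exact/asboolP.
    have ub : u \in bdry.
      by rewrite mem_filter ut andbT; apply/andP; split; [exact/asboolPn|apply/asboolP; exists y].
    have [_ u0 _ _] := bd _ ub; have [_ [_ _ Fc] Fo] := HF _ u0.
    have [v vF vy] := Fc _ uy; exists v => //.
    rewrite mem_cat; apply/orP; right; apply/flatten_mapP; exists u => //.
    rewrite mem_filter vF andbT; apply/asboolP; apply: hull_sub => // x xv.
    apply/(hull_sides _ r0) => phi ph; case: (Fo _ _ vF ph) => [h|h].
      by apply: (afn_ge_hull h); exact: hull_vs.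
    by have := afn_le_hull h vy; rewrite leNgt (tint_sides ry ph).
- by move=> u; rewrite mem_filter => /andP[_ /tcopy].
- move=> u up; have := kdet u; rewrite mem_cat up orbT => /(_ isT)[u0 _].
  have [v [/bd[vt v0 _ _] uF _]] := partP _ up; have [_ [_ Fd _] _] := HF _ v0.
  have [_ uv] := Fd _ uF; have [vD vA] := tsize _ vt.
  split; first exact: diam_le_sub uv vD.
  rewrite -vA -lee_fin -!areaE//; apply: le_measure => //; rewrite inE.
    exact: measurable_hull u0.
  exact: measurable_hull v0.
- have sz : (size part <= 64 * size bdry)%N.
    apply: size_flatten_le => u /bd[ut u0 _ _]; have [Fs _ _] := HF _ u0.
    by rewrite size_filter (leq_trans (count_size _ _)).
  have lip u z w phi : u \in bdry -> hull u z -> hull u w -> phi \in sides r ->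
      `|afn phi z - afn phi w| <= C * l.
    move=> /bd[ut _ _ _] uz uw ph; have [uD _] := tsize _ ut; have [h1 h2] := uD _ _ uz uw.
    by rewrite /C -mulrA [M * l]mulrC; exact: afn_lip.
  have sh : \sum_(u <- bdry) area u <= 12 * (C * l) * area r.
    apply: shell_area => //.
    + exact: psep_filter.
    + by move=> u /bd[].
    + move=> u z phi ub uz ph; have [_ _ _ [w uw rw]] := bd _ ub.
      have := lip _ _ _ _ ub uz uw ph; rewrite ler_norml => /andP[h _].
      by apply: le_trans h _; rewrite gerBl; exact: ((hull_sides _ r0).1 rw _ ph).
    + move=> u ub; have [_ _ nr _] := bd _ ub.
      apply: contrapT => H; apply: nr => z uz; apply/(hull_sides _ r0) => phi ph.
      rewrite leNgt; apply/negP => pz; apply: H; exists phi => // w uw.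
      have := lip _ _ _ _ ub uw uz ph; rewrite ler_norml => /andP[_ h].
      by apply: le_trans h; rewrite lerDl oppr_ge0 ltW.
  have bE : \sum_(u <- bdry) area u = (size bdry)%:R * l ^+ 2.
    rewrite (eq_big_seq (fun=> l ^+ 2)) => [|u /bd[/tsize[_ ->]]//].
    by rewrite big_const_seq count_predT iter_addr_0 mulr_natl.
  by rewrite bE in sh; apply: (Cle _ _ _ sh); rewrite -natrM ler_nat.
Qed.

End copies.

(** * Adapted tilings *)

Section tilings.
Context {R : realType}.
Implicit Types (t u : triple R) (Omega : set (R * R)).

Definition tiling Omega (P : seq (triple R)) : Prop :=
  [/\ psep P, P != [::], forall t, t \in P -> det t != 0 &
      forall z, Omega z <-> exists2 t, t \in P & hull t z].

Lemma tiling_sub Omega P t : tiling Omega P -> t \in P -> hull t `<=` Omega.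
Proof. by move=> [_ _ _ H] tP z tz; apply/H; exists t. Qed.

Lemma tiling_flatten Omega P (F : triple R -> seq (triple R)) : tiling Omega P ->
  (forall t, t \in P -> subdiv t (F t)) -> tiling Omega (flatten (map F P)).
Proof.
move=> TP H; have [ps P0 Pd PO] := TP.
have cover z : Omega z <-> exists2 t, t \in flatten (map F P) & hull t z.
  split=> [/PO[t tP tz]|[u /flatten_mapP[t tP ut] uz]].
    have [_ _ Hc] := H _ tP; have [u ut uz] := Hc _ tz; exists u => //.
    by apply/flatten_mapP; exists t.
  by have [_ Hs _] := H _ tP; apply: (tiling_sub TP tP); apply: (Hs _ ut).2.
split=> //.
- apply: (psep_flatten (g := id)); rewrite ?map_id// => t.
    by move=> /H[].
  by move=> u tP ut; have [_ Hs _] := H _ tP; exact: (Hs _ ut).2.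
- case: P P0 TP {Pd ps H} PO cover => // t P _ TP _ cover.
  have [h _ _] := hullv t.
  have [u uP _] := (cover t.1.1).1 (tiling_sub TP (mem_head _ _) h).
  by apply/eqP => E; rewrite E in uP.
- move=> u /flatten_mapP[t tP ut]; have [_ Hs _] := H _ tP; exact: (Hs _ ut).1.
Qed.

Lemma fine_subdiv t (d : R) : det t != 0 -> 0 < d -> exists s, subdiv t s /\
  forall u, u \in s -> diam_le u d.
Proof.
move=> t0 d0; have [D tD] := diam_exists t; have D0 := diam_ge0 tD.
pose n := (Num.trunc (D / d)).+1.
have nR : 0 < n%:R :> R by rewrite ltr0n.
have Dn : D / n%:R <= d.
  have /truncn_itv/andP[_] : 0 <= D / d by rewrite divr_ge0// ltW.
  by rewrite ltr_pdivrMr// mulrC => /ltW h; rewrite ler_pdivrMr.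
have E : tmap 0 1 t = t.
  by case: t {t0 tD} => [[a b] c]; rewrite /tmap /= !scale1r !add0r.
exists [seq aff t (gtile n ij) | ij <- gidx n]; split; first exact: subdiv_grid.
move=> u; rewrite -[in aff t]E => /grid_copy[b [l [-> lE]]] z w uz uw.
have := (diam_le_tmap (b := b) (l := l) tD) _ _ uz uw; rewrite lE normr1 mul1r mulrC.
by move=> [h1 h2]; split; apply: le_trans Dn.
Qed.

Lemma fine_tiling Omega P (d : R) : tiling Omega P -> 0 < d -> exists2 S, tiling Omega S &
  forall u, u \in S -> diam_le u d.
Proof.
move=> TP d0.
have C t : exists s, det t != 0 -> subdiv t s /\ forall u, u \in s -> diam_le u d.
  have [t0|t0] := eqVneq (det t) 0; first by exists [::].
  by have [s Hs] := fine_subdiv t0 d0; exists s.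
have [F HF] := choice C; have [_ _ Pd _] := TP.
exists (flatten (map F P)).
  by apply: tiling_flatten => // t /Pd/HF[].
by move=> u /flatten_mapP[t /Pd/HF[_ +] ut]; apply.
Qed.

Lemma slack (a b c d rho : R) : a <= b + d -> c + d <= rho / 2 -> a + rho / 2 + c <= b + rho.
Proof. by move=> h1 h2; lra. Qed.

Lemma three_quarters (I S a b c : R) : 0 < S - I -> a <= I -> b <= (S - I) / 4 ->
  c <= (S - I) / 4 -> a + b + c < S.
Proof. by move=> h1 h2 h3 h4; lra. Qed.

(** A single [l] for all macro triangles gives all pieces the same diameter bound [l * M] and the
    same area scale [l^2]. *)
Lemma common_scale (T : eqType) (s : seq T) (Q : T -> R -> Prop) :
  (forall x, x \in s -> exists2 l0 : R, 0 < l0 & forall l, 0 < l <= l0 -> Q x l) ->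
  exists2 l : R, 0 < l & forall x, x \in s -> Q x l.
Proof.
move=> H; suff [l0 l00 Hl] : exists2 l0 : R, 0 < l0 & forall l, 0 < l <= l0 -> forall x, x \in s -> Q x l.
  by exists l0 => //; apply: Hl; rewrite l00 lexx.
elim: s H => [|x s IH] H; first by exists 1.
have [|l1 l10 H1] := IH; first by move=> y ys; apply: H; rewrite inE ys orbT.
have [l2 l20 H2] := H x (mem_head _ _).
exists (Num.min l1 l2) => [|l /andP[lp]]; first by rewrite lt_min l10.
rewrite le_min => /andP[h1 h2] y; rewrite inE => /predU1P[->|ys].
  by apply: H2; rewrite lp.
by apply: H1 => //; rewrite lp.
Qed.

End tilings.

Section adapted_tiling.
Context {R : realType} (m : nat) (m2 : (2 <= m)%N).
Variables (Omega : set (R * R)) (f : R * R -> R) (p : \bar R) (q : R).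
Hypotheses (fC : Cm m Omega f) (p1 : (1 <= p)%E).
Hypothesis (hq : (q^-1)%:E = ((m%:R / 2)%:E + p^-1)%E).
Implicit Types (t u Q : triple R).
Notation RR := (measurableTypeR R * measurableTypeR R)%type.
Notation leb2' := (leb2 : {measure set RR -> \bar R}).

Let e0 Q c (w D : R) : R := eQ m p Q c w (2 * D) 0.

(** For positive [l] this is [l^(2/q)]: the [q]-th powers of the errors scale like areas and can be
    compared with an integral. *)
Let gain (l : R) : R := l ^+ m * (l ^+ 2) `^ fine p^-1%E.

Lemma exponent_le1 : 0 < q <= 1.
Proof.
have [qE q0] := exponent_q m2 p1 hq; have [_ s0] := exponentE p1; rewrite q0 /=.
have m1 : 2 <= m%:R :> R by rewrite ler_nat.
rewrite -[q]invrK invf_le1 ?invr_gt0// qE; lra.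
Qed.

Lemma gain_powR (l X : R) : 0 < l -> 0 <= X -> (gain l * X) `^ q = l ^+ 2 * X `^ q.
Proof.
move=> l0 X0; have [qE q0] := exponent_q m2 p1 hq.
have l2 : 0 < l ^+ 2 by exact: exprn_gt0.
rewrite powRM ?mulr_ge0 ?exprn_ge0 ?powR_ge0 ?(ltW l0)//; congr (_ * _).
have -> : gain l = (l ^+ 2) `^ q^-1.
  rewrite qE powRD ?(gt_eqF l2) ?implybT// /gain; congr (_ * _).
  rewrite -powR_mulrn ?(ltW l0)// -(powR_mulrn 2) ?(ltW l0)// -powRrM; congr (_ `^ _).
  by field.
by rewrite -powRrM mulVf ?gt_eqF// powRr1// ltW.
Qed.

Lemma gain_ge0 l : 0 <= l -> 0 <= gain l.
Proof. by move=> l0; rewrite mulr_ge0 ?exprn_ge0 ?powR_ge0. Qed.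

Lemma copy_error t (M l w X : R) b l' c : unit_triangle M t -> 0 < l -> `|l'| = l -> 0 <= w ->
  errh m p t c <= X ->
  e0 (tmap b l' t) c w (l * M) <= gain l * (X + Cosc m * ((2 * M) ^+ m * w)).
Proof.
move=> tM lp lE w0 tX; have [t0 t1 tD] := tM.
have l'0 : l' != 0 by rewrite -normr_eq0 lE gt_eqF.
have l2E : l' ^+ 2 = l ^+ 2 by rewrite -lE real_normK ?num_real.
have u0 := det_tmap_neq0 b l'0 t0.
have uD : diam_le (tmap b l' t) (l * M) by rewrite -lE; exact: diam_le_tmap.
rewrite /e0 /eQ addr0 mulrDr lerD//.
  have := nrm_hom_tmap m2 p1 b c l'0 t0.
  rewrite (nrm_hom_fin m2 p1 c u0 uD) (errhE m2 p1 c tM) -EFinM lee_fin lE l2E => h.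
  by rewrite (le_trans h)// ler_wpM2l// gain_ge0// ltW.
rewrite ap_tmap// l2E (ap_unit _ tM) mulr1 mulrCA !exprMn /gain.
by rewrite le_eqVlt; apply/orP; left; apply/eqP; ring.
Qed.

(** A boundary part has no controlled shape, but its diameter and area are those of a copy at most.
    This gives the right scaling with a poor constant, compensated by the small number of such
    parts. *)
Lemma part_error u (M l w B : R) c : det u != 0 -> diam_le u (l * M) -> area u <= l ^+ 2 ->
  0 < l -> 0 <= M -> 0 <= w -> cnorm m c <= B ->
  e0 u c w (l * M) <= gain l * ((1 + Lam m.-1) * (B * M ^+ m) + Cosc m * ((2 * M) ^+ m * w)).
Proof.
move=> u0 uD uA lp M0 w0 cB; have [_ s0] := exponentE p1.
have al : ap p u <= (l ^+ 2) `^ fine p^-1%E.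
  by rewrite /ap ge0_ler_powR ?nnegrE ?sqr_ge0// ltW// area_gt0.
have L0 : 0 <= 1 + Lam (R := R) m.-1 by rewrite addr_ge0 ?Lam_ge0.
have lm : 0 <= l ^+ m by rewrite exprn_ge0// ltW.
rewrite /e0 /eQ addr0 mulrDr lerD//.
  have := nrm_hom_le m2 p1 c u0 uD; rewrite (nrm_hom_fin m2 p1 c u0 uD) lee_fin => /le_trans; apply.
  rewrite exprMn /gain mulrC [leRHS](_ : _ = (l ^+ 2) `^ fine p^-1%E * ((1 + Lam m.-1) * (B * (l ^+ m * M ^+ m)))); last by ring.
  have lM : 0 <= l ^+ m * M ^+ m by rewrite mulr_ge0// exprn_ge0.
  apply: ler_pM => //; first exact: ap_ge0.
    by apply: mulr_ge0 => //; apply: mulr_ge0 => //; exact: cnorm_ge0.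
  by rewrite ler_wpM2l// ler_wpM2r.
rewrite /gain [leRHS](_ : _ = (Cosc m * ((2 * (l * M)) ^+ m * w)) * (l ^+ 2) `^ fine p^-1%E).
  by rewrite ler_wpM2l// mulr_ge0 ?Cosc_ge0// mulr_ge0 ?exprn_ge0 ?mulr_ge0// ltW.
by rewrite !exprMn; ring.
Qed.

Variable cz : R * R -> nat -> R.
Hypothesis cO : compact Omega.
Hypothesis cc : forall k, (k <= m)%N -> {within Omega, continuous (fun z => cz z k)}.
Hypothesis czE : forall k z, (k <= m)%N -> Omega° z ->
  Gp f k (m - k) z / (k`!%:R * (m - k)`!%:R) = cz z k.

Lemma adapted_tiling P0 (M rho S : R) tm : tiling Omega P0 -> unit_triangle M tm -> 0 < rho ->
  (\int[leb2']_(z in Omega) ((shapeM m p M (cz z) + rho) `^ q)%:E < S%:E)%E ->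
  exists P c w D sg, [/\ tiling Omega P, 0 < sg,
    forall Q, Q \in P -> fits m Omega f Q (c Q) (w Q) (D Q) &
    \sum_(Q <- P) ePQ m p c w D sg Q `^ q < S].
Proof.
move=> TP0 tmM rho0 IS; have /andP[q0 q1] := exponent_le1.
have [_ _ /diam_ge0 M0] := tmM.
set F := (fun z => ((shapeM m p M (cz z) + rho) `^ q)%:E) in IS.
have F0 z : (0 <= F z)%E by rewrite lee_fin powR_ge0.
have mO : measurable (Omega : set RR) by apply: closed_measurable2; exact: compact_closed.
have mF : measurable_fun (Omega : set RR) (F : RR -> \bar R).
  exact: (measurable_shapeM m2 p1 q cO cc rho tmM).
have I0 : (0 <= \int[leb2']_(z in Omega) F z)%E by apply: integral_ge0 => z _.
have [I IE] : exists I : R, (\int[leb2']_(z in Omega) F z = I%:E)%E.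
  exists (fine (\int[leb2']_(z in Omega) F z)%E); rewrite fineK// ge0_fin_numE//.
  by rewrite (lt_trans IS)// ltry.
rewrite IE lte_fin in IS.
have [B' HB'] := coefficients_bounded cO cc.
pose B := `|B'|; have HB z : Omega z -> cnorm m (cz z) <= B.
  by move=> /HB'/le_trans; apply; exact: ler_norm.
have L0 : 0 <= 1 + Lam (R := R) m.-1 by rewrite addr_ge0 ?Lam_ge0.
have C0 := Cosc_ge0 (R := R) m.
(* [w] must make two effects fit in [rho / 2]: the Taylor oscillation on a copy and the variation of
   [shapeM] over a macro triangle. The other [rho / 2] is spent on the near optimality of the chosen
   triangle. *)
pose kw := Cosc m * (2 * M) ^+ m + (1 + Lam m.-1) * M ^+ m.
have kw0 : 0 <= kw by rewrite addr_ge0// mulr_ge0// exprn_ge0// mulr_ge0.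
have [w w0 kww] : exists2 w : R, 0 < w & kw * w <= rho / 2.
  exists (rho / 2 / (kw + 1)); first by rewrite !divr_gt0//; lra.
  by rewrite mulrCA ler_piMr ?divr_ge0 ?(ltW rho0)// ler_pdivrMr; lra.
have MM : 0 <= M ^+ m by exact: exprn_ge0.
have MM2 : 0 <= (2 * M) ^+ m by rewrite exprn_ge0// mulr_ge0.
have w0' := ltW w0.
pose X2 := (1 + Lam m.-1) * (B * M ^+ m) + Cosc m * ((2 * M) ^+ m * w).
have X20 : 0 <= X2.
  apply: addr_ge0; apply: mulr_ge0 => //; apply: mulr_ge0 => //; exact: normr_ge0.
have [d d0 Hd] := coefficients_uniform cO cc w0.
have [Rs TR Rd] := fine_tiling TP0 d0; have [Rp _ Rdet RO] := TR.
pose gap := S - I; have gap0 : 0 < gap by rewrite subr_gt0.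
have X2q : 0 <= X2 `^ q := powR_ge0 _ _.
(* The budget for the boundary parts of one macro triangle: after multiplication by their weight
   [X2^q] and summation over [Rs], it is at most a quarter of the gap. *)
pose e1 := gap / (4 * ((size Rs).+1%:R * (X2 `^ q + 1))).
have e10 : 0 < e1 by rewrite divr_gt0// mulr_gt0// mulr_gt0//; lra.
have rho2 : 0 < rho / 2 by rewrite divr_gt0.
have Ct (r : triple R) : exists t, unit_triangle M t /\
    errh m p t (cz r.1.1) <= shapeM m p M (cz r.1.1) + rho / 2.
  have [t tM te] := shapeM_near m p tmM (cz r.1.1) rho2.
  by exists t; split=> //; exact: ltW.
have [tt Htt] := choice Ct.
pose TQ (r : triple R) (l : R) (kp : seq (triple R) * seq (triple R)) := [/\ subdiv r (kp.1 ++ kp.2),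
   forall u, u \in kp.1 -> exists b l', u = tmap b l' (tt r) /\ `|l'| = l,
   forall u, u \in kp.2 -> diam_le u (l * M) /\ area u <= l ^+ 2 &
   (size kp.2)%:R * l ^+ 2 <= e1].
have [l l0 Hl] : exists2 l : R, 0 < l & forall r, r \in Rs -> exists kp, TQ r l kp.
  apply: common_scale => r rR; have [[t0 t1 tM] _] := Htt r.
  have [l0 l00 Hl] := tiling_by_copies (Rdet _ rR) t0 t1 tM e10.
  by exists l0 => // l /Hl[kept [part H]]; exists (kept, part).
have Ck r : exists kp, r \in Rs -> TQ r l kp.
  have [/Hl[x Hx]|_] := boolP (r \in Rs); last by exists ([::], [::]).
  by exists x.
have [kp Hkp] := choice Ck.
have l2 : 0 < l ^+ 2 by exact: exprn_gt0.
pose P := flatten (map (fun r => (kp r).1 ++ (kp r).2) Rs).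
have TP : tiling Omega P by apply: tiling_flatten => // r /Hkp[].
have [Pp _ Pdet PO] := TP.
have Co Q : exists r, Q \in P -> r \in Rs /\ Q \in (kp r).1 ++ (kp r).2.
  have [/flatten_mapP[r rR Qr]|_] := boolP (Q \in P); last by exists Q.
  by exists r.
(* [own Q] is the macro triangle containing [Q]; the coefficients are frozen at its first vertex. *)
have [own Hown] := choice Co.
pose c Q := cz (own Q).1.1.
have sub Q : Q \in P -> hull Q `<=` hull (own Q).
  by move=> /Hown[oR Qo]; have [[_ Hs _] _ _ _] := Hkp _ oR; exact: (Hs _ Qo).2.
have QD Q : Q \in P -> diam_le Q (l * M).
  move=> /Hown[oR]; have [_ H1 H2 _] := Hkp _ oR; have [[_ _ tD] _] := Htt (own Q).
  by rewrite mem_cat => /orP[/H1[b [l' [-> <-]]]|/H2[]//]; exact: diam_le_tmap.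
have cnear Q z : Q \in P -> hull Q z -> cnorm m (fun k => cz z k - c Q k) <= w.
  move=> QP Qz; have [oR _] := Hown _ QP; have [h _ _] := hullv (own Q).
  have oz := sub _ QP _ Qz; apply: Hd; try exact: (tiling_sub TR oR).
  by have [h1 h2] := Rd _ oR _ _ oz h; rewrite prod_normE /= ge_max h1 h2.
have Pf Q : Q \in P -> fits m Omega f Q (c Q) w (l * M).
  move=> QP; split.
  - exact: Pdet.
  - exact: (tiling_sub TP).
  - exact: QD.
  - exact: ltW.
  - move=> z Qz Oz; apply: le_trans (cnear _ _ QP Qz).
    by apply: ler_sum => k _; rewrite czE// -ltnS.
pose E Q := e0 Q (c Q) w (l * M).
have E0 Q : 0 <= E Q.
  rewrite /E /e0 /eQ addr0 addr_ge0 ?fine_ge0 ?nrm_ge0//.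
  by rewrite mulr_ge0 ?ap_ge0// mulr_ge0// mulr_ge0 ?(ltW w0)// exprn_ge0// mulr_ge0// mulr_ge0// ltW.
have cl Q : Q \in P -> cnorm m (c Q) <= B.
  by move=> /Hown[oR _]; apply: HB; apply: (tiling_sub TR oR); case: (hullv (own Q)).
have clw Q z : Q \in P -> hull Q z -> shapeM m p M (c Q) <= shapeM m p M (cz z) + (1 + Lam m.-1) * M ^+ m * w.
  move=> QP Qz; apply: (le_trans (shapeM_lip m2 p1 tmM (c Q) (cz z))); rewrite lerD2l -mulrA ler_wpM2l//.
  rewrite mulrC ler_wpM2l ?exprn_ge0//.
  have := cnear _ _ QP Qz; apply: le_trans; rewrite le_eqVlt; apply/orP; left; apply/eqP.
  by apply: eq_bigr => k _; rewrite distrC.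
(* For a copy the weight is written as area times a density [kk], to be compared with the integrand;
   for a boundary part it is the flat bound [vv]. *)
pose isk Q := Q \in (kp (own Q)).1.
pose kk Q := if isk Q then E Q `^ q / area Q else 0.
pose vv Q := if isk Q then 0 else l ^+ 2 * X2 `^ q.
have EB Q : Q \in P -> E Q `^ q <= area Q * kk Q + vv Q.
  move=> QP; have a0 := area_gt0 (Pdet _ QP); rewrite /kk /vv; case: ifPn => Qk.
    by rewrite addr0 mulrC divfK// gt_eqF.
  rewrite mulr0 add0r -gain_powR// ge0_ler_powR ?nnegrE ?(ltW q0)//.
    by rewrite mulr_ge0// gain_ge0// ltW.
  have [oR] := Hown _ QP; rewrite mem_cat (negbTE Qk : (Q \in (kp (own Q)).1) = false) /= => Qp.
  have [_ _ H2 _] := Hkp _ oR; have [_ QA] := H2 _ Qp.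
  apply: part_error => //; [exact: Pdet|exact: QD|exact: cl].
have sumk : \sum_(Q <- P) area Q * kk Q <= I.
  rewrite -lee_fin -IE -sumEFin; apply: (@sum_tint_le_integral _ _ id kk P Omega F) => //.
  - move=> Q QP; rewrite /kk; case: ifP => // _; rewrite divr_ge0 ?powR_ge0// ltW// area_gt0//.
    exact: Pdet.
  - by rewrite map_id.
  - by move=> Q QP z /(tint_hull (Pdet _ QP)); exact: (tiling_sub TP QP).
  - move=> Q z QP /(tint_hull (Pdet _ QP)) Qz; rewrite lee_fin /kk; case: ifPn => Qk; last exact: powR_ge0.
    have [oR _] := Hown _ QP; have [_ H1 _ _] := Hkp _ oR; have [b [l' [QE lE]]] := H1 _ Qk.
    have [tM te] := Htt (own Q); have [t0 t1 _] := tM.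
    have l'0 : l' != 0 by rewrite -normr_eq0 lE gt_eqF.
    have aQ : area Q = l ^+ 2 by rewrite QE area_tmap// t1 mulr1 -lE real_normK ?num_real.
    rewrite aQ ler_pdivrMr// mulrC -gain_powR//; last by rewrite addr_ge0 ?(ltW rho0)// (shapeM_ge0 m p tmM).
    rewrite ge0_ler_powR ?nnegrE ?(ltW q0)//.
      by rewrite mulr_ge0 ?gain_ge0 ?(ltW l0)// addr_ge0 ?(ltW rho0)// (shapeM_ge0 m p tmM).
    have := copy_error b tM l0 lE (ltW w0) te; rewrite -QE -/(c Q) -/(E Q) => /le_trans; apply.
    rewrite ler_wpM2l ?gain_ge0 ?(ltW l0)//.
    apply: (slack (clw _ _ QP Qz)); apply: le_trans kww.
    by rewrite /kw [leRHS]mulrDl !mulrA.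
have sumv : \sum_(Q <- P) vv Q <= gap / 4.
  rewrite (eq_bigr (fun Q => if ~~ isk Q then l ^+ 2 * X2 `^ q else 0)); last first.
    by move=> Q _; rewrite /vv; case: (isk Q).
  rewrite -big_mkcond /= -big_filter big_const_seq count_predT iter_addr_0 -[_ *+ size _]mulr_natl.
  set N := [seq Q <- P | _].
  have Ns : (size N <= size (flatten (map (fun r => (kp r).2) Rs)))%N.
    apply: uniq_leq_size; first by rewrite filter_uniq// psep_uniq_seq.
    move=> Q; rewrite mem_filter => /andP[Qk QP]; have [oR] := Hown _ QP.
    rewrite mem_cat (negbTE Qk : (Q \in (kp (own Q)).1) = false) /= => Qp.
    by apply/flatten_mapP; exists (own Q).
  have sz : (size (flatten (map (fun r => (kp r).2) Rs)))%:R * l ^+ 2 <= (size Rs)%:R * e1.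
    rewrite size_flatten /shape -map_comp sumnE big_map natr_sum mulr_suml.
    rewrite (_ : (size Rs)%:R * e1 = \sum_(r <- Rs) e1); last first.
      by rewrite big_const_seq count_predT iter_addr_0 mulr_natl.
    by rewrite big_seq [leRHS]big_seq; apply: ler_sum => r /Hkp[].
  rewrite mulrA; apply: (@le_trans _ _ ((size Rs)%:R * e1 * X2 `^ q)).
    rewrite ler_wpM2r// (le_trans _ sz)// ler_wpM2r ?(ltW l2)// ler_nat//.
  have N1 : 0 < (size Rs).+1%:R :> R by rewrite ltr0n.
  have X1 : 0 < X2 `^ q + 1 by rewrite ltr_wpDl.
  have N10 := lt0r_neq0 N1; have X10 := lt0r_neq0 X1.
  rewrite (_ : _ * e1 * _ = gap / 4 * (((size Rs)%:R / (size Rs).+1%:R) * (X2 `^ q / (X2 `^ q + 1)))).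
    rewrite ler_piMr ?divr_ge0 ?(ltW gap0)// mulr_ile1 ?divr_ge0 ?(ltW N1) ?(ltW X1)//.
      by rewrite ler_pdivrMr// mul1r ler_nat.
    by rewrite ler_pdivrMr// mul1r lerDl.
  rewrite /e1; move: N10 X10; move: (X2 `^ q) ((size Rs).+1%:R : R) ((size Rs)%:R : R) => a1 a2 a3 N10 X10.
  by field; rewrite X10 N10.
(* The slack per triangle: [(E + 2 sg)^q <= E^q + x] by subadditivity, and all the [x] together use
   another quarter of the gap. *)
pose x := gap / (4 * (size P).+1%:R).
have x0 : 0 < x by rewrite divr_gt0// mulr_gt0// ltr0n.
pose sg := x `^ q^-1 / 2.
have sg0 : 0 < sg by rewrite divr_gt0// powR_gt0.
have sgq : (2 * sg) `^ q = x.
  by rewrite /sg mulrC divfK// -powRrM mulVf ?gt_eqF// powRr1// ltW.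
exists P, c, (fun=> w), (fun=> l * M), sg; split=> //.
apply: (@le_lt_trans _ _ (\sum_(Q <- P) (area Q * kk Q + vv Q + x))).
  rewrite big_seq [leRHS]big_seq; apply: ler_sum => Q QP.
  have -> : ePQ m p c (fun=> w) (fun=> l * M) sg Q = E Q + 2 * sg.
    by rewrite /ePQ /E /e0 /eQ; ring.
  apply: (le_trans (powRD_le _ _ _)) => //; first by rewrite q0.
    by rewrite mulr_ge0// ltW.
  by rewrite sgq lerD2r EB.
rewrite !big_split /= [X in _ + X]big_const_seq count_predT iter_addr_0 -[_ *+ size _]mulr_natl.
have : (size P)%:R * x <= gap / 4.
  have N1 : 0 < (size P).+1%:R :> R by rewrite ltr0n.
  rewrite (_ : _ * x = gap / 4 * ((size P)%:R / (size P).+1%:R)).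
    by rewrite ler_piMr ?divr_ge0 ?(ltW gap0)// ler_pdivrMr// mul1r ler_nat.
  rewrite /x; move: (lt0r_neq0 N1); move: ((size P).+1%:R : R) ((size P)%:R : R) => a1 a2 N10.
  by field.
exact: (three_quarters gap0 sumk sumv).
Qed.

End adapted_tiling.

Lemma limn_esup_le_eventually (R : realType) (u : (\bar R)^nat) (c : \bar R) n0 :
  (forall n, (n0 <= n)%N -> (u n <= c)%E) -> (limn_esup u <= c)%E.
Proof.
move=> H; apply: (@le_trans _ _ (ereal_sup (u @` [set n | (n0 <= n)%N]))).
  by apply: ereal_inf_lbound; exists [set n | (n0 <= n)%N] => //; exists n0.
by apply: ge_ereal_sup => _ [n /H h <-].
Qed.

(** * From eventual bounds to one sequence *)

Section near_optimal_sequence.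
Context {R : realType} (T : choiceType) (x0 : T).
Variables (ok : nat -> T -> Prop) (V : nat -> T -> \bar R) (L : R).
Local Open Scope ereal_scope.

(** For each [N] the choice is made within [1 / (N + 1)] of the infimum over admissible objects,
    independently of [x]. The same sequence thus serves every [x > L], without diagonal
    extraction. *)
Lemma near_optimal_sequence : (forall N x, 0 <= V N x) ->
  (forall x : R, (L < x)%R -> exists N0, forall N, (N0 <= N)%N -> exists2 y, ok N y & V N y <= x%:E) ->
  exists N0 (Y : nat -> T), (forall N, (N0 <= N)%N -> ok N (Y N)) /\ limn_esup (fun N => V N (Y N)) <= L%:E.
Proof.
move=> V0 H; have [N0 HN0] := H (L + 1)%R ltac:(by rewrite ltrDl).
pose m N := ereal_inf [set V N y | y in ok N].
have C N : exists y, (N0 <= N)%N -> ok N y /\ V N y <= m N + (N.+1%:R^-1)%:E.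
  have [hN|hN] := leqP N0 N; last by exists x0.
  have [y oy Vy] := HN0 N hN.
  have mf : m N \is a fin_num.
    rewrite ge0_fin_numE; last by apply: le_ereal_inf_tmp => _ [z _ <-]; exact: V0.
    by apply: (@le_lt_trans _ _ (L + 1)%:E); rewrite ?ltry//; apply: le_trans Vy; apply: ereal_inf_lbound; exists y.
  have e0 : (0 < N.+1%:R^-1 :> R)%R by rewrite invr_gt0.
  have [_ [z oz <-] zm] := lb_ereal_inf_adherent e0 mf.
  by exists z => _; split=> //; exact: ltW.
have [Y HY] := choice C; exists N0, Y; split=> [N /HY[]//|].
apply/lee_addgt0Pr => e e0; have e2 : (0 < e / 2)%R by rewrite divr_gt0.
have [N1 HN1] := H (L + e / 2)%R ltac:(by rewrite ltrDl).
pose N2 := (Num.trunc (e / 2)^-1).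
apply: (@limn_esup_le_eventually _ _ _ (maxn N0 (maxn N1 N2))) => N.
rewrite !geq_max => /and3P[h0 h1 h2]; have [_ hY] := HY _ h0.
have [y oy Vy] := HN1 _ h1.
apply: (le_trans hY); rewrite (_ : L%:E + e%:E = (L + e / 2)%:E + (e / 2)%:E); last first.
  by rewrite -!EFinD -addrA -splitr.
apply: leeD.
  by apply: le_trans Vy; apply: ereal_inf_lbound; exists y.
rewrite lee_fin -[leRHS]invrK lef_pV2 ?posrE ?invr_gt0//.
have /truncn_itv/andP[_ /ltW h] : (0 <= (e / 2)^-1)%R by rewrite invr_ge0 ltW.
by apply: (le_trans h); rewrite ler_nat.
Qed.

End near_optimal_sequence.

Lemma normLp_shape_fun (R : realType) (m : nat) (p : \bar R) (q : R) (Omega : set (R * R))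
    (g h : R * R -> R * R -> R) : 0 < q -> (forall z, Omega z -> g z = h z) ->
  normLp q%:E Omega (fun z => shape_fun m p (g z)) =
  ((\int[leb2]_(z in Omega) (shape_fun m p (h z) `^ q)) `^ q^-1)%E.
Proof.
move=> q0 gh; rewrite /normLp unlock /=; congr (_ `^ _)%E.
rewrite [RHS]integral_mkcond; apply: eq_integral => z _.
rewrite /patch; case: ifPn => [|_]; last by rewrite abse0 poweR0r// gt_eqF.
rewrite inE => Oz; rewrite gh// gee0_abs//.
by apply: le_ereal_inf_tmp => _ [T _ <-]; exact: Lnorm_ge0.
Qed.

Theorem theorem1p1 (R : realType) (m : nat) (hm : (2 <= m)%N)
    (p : \bar R) (hp : (1 <= p)%E)
    (q : R) (hq : (q^-1)%:E = ((m%:R / 2)%:E + p^-1)%E)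
    (Omega : set (R * R)) (hOmega : polygonal_domain Omega)
    (f : R * R -> R) (hf : Cm m Omega f) :
  exists (N0 : nat) (TT : nat -> {fset triangle R}),
    (forall N : nat, (N0 <= N)%N ->
       conforming Omega (TT N) /\ #|` TT N| = N) /\
    (limn_esup (fun N => (N%:R `^ (m%:R / 2))%:E * err_glob m p (TT N) f) <=
       normLp q%:E Omega (fun z => shape_fun m p (dmf m Omega f z)))%E.
Proof.
have q01 := exponent_le1 hm hp hq; have /andP[q0 _] := q01.
have [cO _ clO _] := hOmega; have [cz [cc czE dE]] := coefficients clO hf.
rewrite (normLp_shape_fun m p q0 dE).
have [Ilty HI] := shape_integral_approx hm hp q01 cO cc.
set I := (\int[leb2]_(z in Omega) _)%E in Ilty HI *.
have I0 : (0 <= I)%E by apply: integral_ge0 => z _; exact: poweR_ge0.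
have IE : I = (fine I)%:E by rewrite fineK// ge0_fin_numE.
have fI0 : 0 <= fine I by exact: fine_ge0.
rewrite IE poweR_EFin.
apply: (@near_optimal_sequence _ _ fset0 (fun N TT => conforming Omega TT /\ #|` TT| = N)
  (fun N TT => (N%:R `^ (m%:R / 2))%:E * err_glob m p TT f)%E).
  move=> N TT; rewrite mule_ge0 ?lee_fin ?powR_ge0// /err_glob.
  case: p {hp hq HI I Ilty I0 IE fI0} => [r||].
  - exact: poweR_ge0.
  - by apply: bigmax_ge_id.
  - by apply: bigmax_ge_id.
move=> x Lx; have x0 : 0 < x by exact: le_lt_trans (powR_ge0 _ _) Lx.
(* Raising [x > I^(1/q)] to the power [q] leaves room above the integral, in which the partition and
   then the number of tiles are chosen. *)
have IS : (I < (x `^ q)%:E)%E.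
  rewrite IE lte_fin -[ltLHS]powRr1// -(mulVf (lt0r_neq0 q0)) powRrM.
  by rewrite gt0_ltr_powR ?nnegrE ?powR_ge0// ltW.
have [M [t [rho [tM rho0 IM]]]] := HI _ IS.
have [P0 TP0] := polygon_triangles hOmega.
have [P [c [w [D [sg [[Pp Pn Pd PO] sg0 Pf Ps]]]]]] := adapted_tiling hm hp hq cO cc czE TP0 tM rho0 IM.
have [N0 HN0] := adapted_meshes hm hf hp hq Pp Pn sg0 Pf PO Ps.
exists N0 => N /HN0[TT [cT nT eT]]; exists TT => //.
by rewrite (le_trans eT)// -powRrM divff ?lt0r_neq0// powRr1// ltW.
Qed.
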